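(* Let $\mathbb{G}=(C_0(\mathbb{G}),\Delta)$ be a discrete $C^{*}$-quantum group, and let $p\in M(C(\mathbb{B}_{\mathbb{G}})\otimes C_0(\mathbb{G}))$ be the universal admissible projection. Then there exists a unique coaction $\delta$ of $C_0(\mathbb{G})$ on $C(\mathbb{B}_{\mathbb{G}})$ such that $$(\delta\otimes\mathrm{id})(p)=(\mathrm{id}\otimes\Delta)(p).$$ This coaction is counital and restricts to a coaction on $C_0(\mathbb{B}_{\mathbb{G}}^{\times})$.
   Context: Tensor products of $C^{*}$-algebras are minimal; $M(A)$ is the multiplier algebra. A $C^{*}$-bialgebra is a $C^{*}$-algebra $A$ with a nondegenerate coassociative $*$-homomorphism $\Delta\colon A\to M(A\otimes A)$. A discrete $C^{*}$-quantum group $\mathbb{G}=(C_0(\mathbb{G}),\Delta)$ is the dual of a compact $C^{*}$-quantum group $\hat{\mathbb{G}}$ (a unital $C^{*}$-bialgebra satisfying the density/cancellation conditions); $C_0(\mathbb{G})\cong\bigoplus_\alpha I_\alpha$ is a $c_0$-direct sum of matrix algebras indexed by the equivalence classes $\alpha$ of irreducible corepresentations of $\hat{\mathbb{G}}$, and there is a counit $\varepsilon$, i.e. a character with $(\varepsilon\otimes\mathrm{id})\Delta=\mathrm{id}=(\mathrm{id}\otimes\varepsilon)\Delta$. For a $C^{*}$-algebra $C$, a projection $q\in M(C\otimes C_0(\mathbb{G}))$ is admissible if $(q\otimes 1)\cdot(\mathrm{id}\otimes\Delta)(q)=(\mathrm{id}\otimes\Delta)(q)\cdot(q\otimes 1)$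 in $M(C\otimes C_0(\mathbb{G})\otimes C_0(\mathbb{G}))$. $C(\mathbb{B}_{\mathbb{G}})$ is the (unique) unital $C^{*}$-algebra with an admissible projection $p\in M(C(\mathbb{B}_{\mathbb{G}})\otimes C_0(\mathbb{G}))$ such that for every $C^{*}$-algebra $C$ and admissible projection $q\in M(C\otimes C_0(\mathbb{G}))$ there is a unique unital $*$-homomorphism $\pi\colon C(\mathbb{B}_{\mathbb{G}})\to M(C)$ with $q=(\pi\otimes\mathrm{id})(p)$. Concretely, choosing matrix units $(e^\alpha_{ij})$ of $I_\alpha$, it is the universal unital $C^{*}$-algebra generated by $1$ and elements $p^\alpha_{ij}$ such that each $p^\alpha=\sum_{i,j}p^\alpha_{ij}\otimes e^\alpha_{ij}$ is a projection and $(p^\alpha\otimes 1)(\mathrm{id}\otimes\Delta)(p^\beta)=(\mathrm{id}\otimes\Delta)(p^\beta)(p^\alpha\otimes1)$ for all $\alpha,\beta$; then $p=\sum_\alpha p^\alpha$ (strict convergence). $C_0(\mathbb{B}_{\mathbb{G}}^{\times})\subset C(\mathbb{B}_{\mathbb{G}})$ is the (non-unital) $C^{*}$-subalgebra generated by all $p^\alpha_{ij}$. A coaction of $(A,\Delta)$ on a $C^{*}$-algebra $B$ is an injective nondegenerate $*$-homomorphism $\delta\colon B\to M(B\otimes A)$ with $\delta(B)(1_B\otimes A)\subseteq B\otimes A$ and $(\delta\otimes\mathrm{id})\delta=(\mathrm{id}\otimes\Delta)\delta$. It is counital if $(\mathrm{id}\otimes\varepsilon)\delta=\mathrm{id}$.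 *)

(* Defs.v *)
From HB Require Import structures.
From mathcomp Require Import all_boot all_order all_algebra.
From mathcomp Require Import complex.
From mathcomp Require Import all_classical all_reals all_analysis.

Set Implicit Arguments.
Unset Strict Implicit.
Unset Printing Implicit Defensive.

Import Order.TTheory GRing.Theory Num.Theory.
Import numFieldNormedType.Exports.
Local Open Scope classical_set_scope.
Local Open Scope ring_scope.
Local Open Scope complex_scope.

(** * C*-algebras *)

(* Not necessarily unital; the norm takes values in the nonnegative reals of
   R[i]. *)
Record cstar (R : realType) := Cstar {
  cstar_car :> completeNormedModType R[i];
  cmul : cstar_car -> cstar_car -> cstar_car;
  cadj : cstar_car -> cstar_car;
  cmulA : forall a b c, cmul a (cmul b c) = cmul (cmul a b) c;
  cmul_linl : forall b, linear (cmul^~ b);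
  cmul_linr : forall a, linear (cmul a);
  cadjK : forall a, cadj (cadj a) = a;
  cadjD : forall a b, cadj (a + b) = cadj a + cadj b;
  cadjZ : forall (k : R[i]) a, cadj (k *: a) = (k^*)%R *: cadj a;
  cadjM : forall a b, cadj (cmul a b) = cmul (cadj b) (cadj a);
  cnormM : forall a b, `|cmul a b| <= `|a| * `|b|;
  cnorm_cstar : forall a, `|cmul (cadj a) a| = `|a| ^+ 2
}.

Arguments cmul {R _}.
Arguments cadj {R _}.
Infix "**" := cmul (at level 40, left associativity) : ring_scope.

Section Basics.
Variable R : realType.
Implicit Types A B : cstar R.

Definition is_unit A (e : A) := forall a : A, e ** a = a /\ a ** e = a.

Definition lin_span (V : lmodType R[i]) (S : set V) : set V :=
  [set x | exists n (c : 'I_n -> R[i]) (s : 'I_n -> V),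
    (forall i, S (s i)) /\ x = \sum_i c i *: s i].

Definition dense_span A (S : set A) := closure (lin_span S) = setT.

Definition sub_cstar A (S : set A) :=
  [/\ closed S,
      S 0,
      (forall (k : R[i]) a b, S a -> S b -> S (k *: a + b)),
      (forall a b, S a -> S b -> S (a ** b)) &
      (forall a, S a -> S (cadj a))].

Definition cstar_generated A (S : set A) : set A :=
  [set x | forall S', sub_cstar S' -> S `<=` S' -> S' x].

(* [the_or d P] is the element satisfying P, when P has one; it is only used
   for objects that are determined uniquely by P. *)
Definition the_or (T : Type) (d : T) (P : T -> Prop) : T :=
  if pselect (exists x, P x) is left h then projT1 (cid h) else d.

End Basics.

(** * Multiplier algebras *)

(* Double centralizers.  Linearity and boundedness of the two maps, and the
   identities L(ab) = L(a)b, R(ab) = aR(b), are automatic. *)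
Record multiplier (R : realType) (A : cstar R) := Multiplier {
  mL : A -> A;
  mR : A -> A;
  mLR : forall a b, a ** mL b = mR a ** b
}.

Section Multiplier.
Variables (R : realType) (A : cstar R).
Implicit Types m : multiplier A.

Lemma multiplier_eq m1 m2 : mL m1 =1 mL m2 -> mR m1 =1 mR m2 -> m1 = m2.
Proof.
case: m1 m2 => [l1 r1 h1] [l2 r2 h2] /= /funext el /funext er.
by subst l2 r2; congr Multiplier; exact: Prop_irrelevance.
Qed.

Lemma cmulDl (a b c : A) : (a + b) ** c = a ** c + b ** c.
Proof. by have := cmul_linl c 1 a b; rewrite !scale1r. Qed.

Lemma cmulDr (a b c : A) : a ** (b + c) = a ** b + a ** c.
Proof. by have := cmul_linr a 1 b c; rewrite !scale1r. Qed.

Lemma cmul0l (a : A) : 0 ** a = 0.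
Proof. by apply: (addrI (0 ** a)); rewrite -cmulDl !addr0. Qed.

Lemma cmul0r (a : A) : a ** 0 = 0.
Proof. by apply: (addrI (a ** 0)); rewrite -cmulDr !addr0. Qed.

Lemma cmulNl (a b : A) : (- a) ** b = - (a ** b).
Proof. by apply: (addrI (a ** b)); rewrite -cmulDl !subrr cmul0l. Qed.

Lemma cmulNr (a b : A) : a ** (- b) = - (a ** b).
Proof. by apply: (addrI (a ** b)); rewrite -cmulDr !subrr cmul0r. Qed.

Lemma cmulZl (k : R[i]) (a b : A) : (k *: a) ** b = k *: (a ** b).
Proof. by have := cmul_linl b k a 0; rewrite !addr0 cmul0l addr0. Qed.

Lemma cmulZr (k : R[i]) (a b : A) : a ** (k *: b) = k *: (a ** b).
Proof. by have := cmul_linr a k b 0; rewrite !addr0 cmul0r addr0. Qed.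

Lemma cmul_faithl (x y : A) : (forall c, c ** x = c ** y) -> x = y.
Proof.
move=> h; apply/eqP; rewrite -subr_eq0 -normr_eq0 -sqrf_eq0 -cnorm_cstar.
by rewrite cmulDr cmulNr h subrr normr0.
Qed.

Lemma cmul_faithr (x y : A) : (forall c, x ** c = y ** c) -> x = y.
Proof.
move=> h; rewrite -[x]cadjK -[y]cadjK; congr cadj; apply: cmul_faithl => c.
by rewrite -[c]cadjK -!cadjM h.
Qed.

Lemma mL_linear m : linear (mL m).
Proof.
move=> k a b; apply: cmul_faithl => c.
by rewrite cmulDr cmulZr !mLR cmulDr cmulZr.
Qed.

Lemma mR_linear m : linear (mR m).
Proof.
move=> k a b; apply: cmul_faithr => c.
by rewrite cmulDl cmulZl -!mLR cmulDl cmulZl.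
Qed.

HB.instance Definition _ := gen_eqMixin (multiplier A).
HB.instance Definition _ := gen_choiceMixin (multiplier A).

Fact madd_subproof m1 m2 a b :
  a ** (mL m1 b + mL m2 b) = (mR m1 a + mR m2 a) ** b.
Proof. by rewrite cmulDr cmulDl !mLR. Qed.
Definition madd m1 m2 := Multiplier (madd_subproof m1 m2).

Fact mzero_subproof (a b : A) : a ** 0 = 0 ** b.
Proof. by rewrite cmul0l cmul0r. Qed.
Definition mzero := Multiplier mzero_subproof.

Fact mopp_subproof m a b : a ** (- mL m b) = (- mR m a) ** b.
Proof. by rewrite cmulNr cmulNl mLR. Qed.
Definition mopp m := Multiplier (mopp_subproof m).

Fact mone_subproof (a b : A) : a ** id b = id a ** b.
Proof. by []. Qed.
Definition mone := Multiplier mone_subproof.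

Fact mmul_subproof m1 m2 a b :
  a ** mL m1 (mL m2 b) = mR m2 (mR m1 a) ** b.
Proof. by rewrite !mLR. Qed.
Definition mmul m1 m2 := Multiplier (mmul_subproof m1 m2).

Fact mscale_subproof (k : R[i]) m a b :
  a ** (k *: mL m b) = (k *: mR m a) ** b.
Proof. by rewrite cmulZr cmulZl mLR. Qed.
Definition mscale k m := Multiplier (mscale_subproof k m).

Fact madj_subproof m a b :
  a ** cadj (mR m (cadj b)) = cadj (mL m (cadj a)) ** b.
Proof. by rewrite -[a]cadjK -[b in RHS]cadjK -!cadjM cadjK mLR. Qed.
Definition madj m := Multiplier (madj_subproof m).

Fact incl_subproof (x a b : A) : a ** (x ** b) = (a ** x) ** b.
Proof. exact: cmulA. Qed.
Definition incl (x : A) := Multiplier (incl_subproof x).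

Fact maddA : associative madd.
Proof. by move=> x y z; apply: multiplier_eq => a /=; rewrite addrA. Qed.
Fact maddC : commutative madd.
Proof. by move=> x y; apply: multiplier_eq => a /=; rewrite addrC. Qed.
Fact madd0 : left_id mzero madd.
Proof. by move=> x; apply: multiplier_eq => a /=; rewrite add0r. Qed.
Fact maddN : left_inverse mzero mopp madd.
Proof. by move=> x; apply: multiplier_eq => a /=; rewrite addNr. Qed.

HB.instance Definition _ :=
  GRing.isZmodule.Build (multiplier A) maddA maddC madd0 maddN.

Fact mmulA : associative mmul.
Proof. by move=> x y z; exact: multiplier_eq. Qed.
Fact mmul1l : left_id mone mmul.
Proof. by move=> x; exact: multiplier_eq. Qed.
Fact mmul1r : right_id mone mmul.
Proof. by move=> x; exact: multiplier_eq. Qed.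
Fact mmulDl : left_distributive mmul madd.
Proof.
move=> x y z; apply: multiplier_eq => a //=.
by have := mR_linear z 1 (mR x a) (mR y a); rewrite !scale1r.
Qed.
Fact mmulDr : right_distributive mmul madd.
Proof.
move=> x y z; apply: multiplier_eq => a //=.
by have := mL_linear x 1 (mL y a) (mL z a); rewrite !scale1r.
Qed.

HB.instance Definition _ := GRing.Zmodule_isPzRing.Build (multiplier A)
  mmulA mmul1l mmul1r mmulDl mmulDr.

Fact mscaleA a b m : mscale a (mscale b m) = mscale (a * b) m.
Proof. by apply: multiplier_eq => x /=; rewrite scalerA. Qed.
Fact mscale1 : left_id 1 mscale.
Proof. by move=> m; apply: multiplier_eq => x /=; rewrite scale1r. Qed.
Fact mscaleDr : right_distributive mscale +%R.
Proof. by move=> k m1 m2; apply: multiplier_eq => x /=; rewrite scalerDr. Qed.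
Fact mscaleDl m : {morph mscale^~ m : a b / a + b}.
Proof. by move=> a b; apply: multiplier_eq => x /=; rewrite scalerDl. Qed.

HB.instance Definition _ := GRing.Zmodule_isLmodule.Build R[i] (multiplier A)
  mscaleA mscale1 mscaleDr mscaleDl.

End Multiplier.

Arguments incl {R A}.

Section Homs.
Variable R : realType.
Implicit Types A B : cstar R.

(* *-homomorphisms A -> M(B); those with values in B are the maps of the form
   incl \o f. *)
Definition starhom A B (phi : A -> multiplier B) :=
  [/\ linear phi,
      (forall a b, phi (a ** b) = phi a * phi b) &
      (forall a, phi (cadj a) = madj (phi a))].

Definition nondegenerate A B (phi : A -> multiplier B) :=
  dense_span [set x | exists a b, x = mL (phi a) b].

(* The extension M(A) -> M(B) of a nondegenerate *-homomorphism phi,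
   determined by ext phi m * phi a = phi (m a). *)
Definition ext A B (phi : A -> multiplier B) (m : multiplier A) :
    multiplier B :=
  the_or 0 (fun n => forall a, n * phi a = phi (mL m a)).

Definition projection A (q : multiplier A) := q * q = q /\ madj q = q.

(* Nonzero *-homomorphisms A -> C. *)
Definition character A (eps : A -> R[i]) :=
  [/\ linear (eps : A -> R[i]^o),
      (forall a b, eps (a ** b) = eps a * eps b),
      (forall a, eps (cadj a) = ((eps a)^*)%R) &
      exists a, eps a != 0].

End Homs.

(** * Minimal tensor products *)

Record hilbert (R : realType) := Hilbert {
  hilbert_car :> completeNormedModType R[i];
  ip : hilbert_car -> hilbert_car -> R[i];
  ip_linl : forall y, linear (ip^~ y : hilbert_car -> R[i]^o);
  ip_conj : forall x y, ip y x = ((ip x y)^*)%R;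
  ip_norm : forall x, ip x x = `|x| ^+ 2
}.

Definition is_rep (R : realType) (A : cstar R) (H : hilbert R)
    (rho : A -> H -> H) :=
  [/\ (forall a, linear (rho a)),
      (forall x, linear (rho^~ x)),
      (forall a b x, rho (a ** b) x = rho a (rho b x)) &
      (forall a x y, ip (rho a x) y = ip x (rho (cadj a) y))].

(* The squared norm of \sum_k x_k (x) y_k in the Hilbert space tensor
   product. *)
Definition tnorm2 (R : realType) (H1 H2 : hilbert R) (I : finType)
    (x : I -> H1) (y : I -> H2) : R[i] :=
  \sum_k \sum_l ip (x k) (x l) * ip (y k) (y l).

(* [tens_norm] says that the norm of \sum_i a_i (x) b_i is the supremum, over
   all representations rho1 of X and rho2 of Y, of the operator norm of
   \sum_i rho1(a_i) (x) rho2(b_i). *)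
Record min_tensor (R : realType) (X Y : cstar R) := MinTensor {
  tensor_alg :> cstar R;
  tens : X -> Y -> tensor_alg;
  tens_linl : forall y, linear (tens^~ y);
  tens_linr : forall x, linear (tens x);
  tensM : forall x x' y y', tens (x ** x') (y ** y') = tens x y ** tens x' y';
  tens_adj : forall x y, tens (cadj x) (cadj y) = cadj (tens x y);
  tens_dense : dense_span [set t | exists x y, t = tens x y];
  tens_norm : forall n (a : 'I_n -> X) (b : 'I_n -> Y) (M : R[i]), 0 <= M ->
    (`|\sum_i tens (a i) (b i)| <= M) <->
    (forall (H1 H2 : hilbert R) (rho1 : X -> H1 -> H1) (rho2 : Y -> H2 -> H2),
      is_rep rho1 -> is_rep rho2 ->
      forall m (xi : 'I_m -> H1) (eta : 'I_m -> H2),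
        tnorm2 (fun k : 'I_n * 'I_m => rho1 (a k.1) (xi k.2))
               (fun k : 'I_n * 'I_m => rho2 (b k.1) (eta k.2))
        <= M ^+ 2 * tnorm2 xi eta)
}.

Arguments tens {R X Y _}.

Definition tensor_choice (R : realType) :=
  forall X Y : cstar R, min_tensor X Y.

Section Legs.
Variable R : realType.

(* The embeddings m |-> m (x) 1 and m |-> 1 (x) m of M(X) and M(Y) into
   M(X (x) Y). *)
Definition leg1 (X Y : cstar R) (T : min_tensor X Y) (m : multiplier X) :
    multiplier T :=
  the_or 0 (fun n => forall x y, mL n (tens x y) = tens (mL m x) y).

Definition leg2 (X Y : cstar R) (T : min_tensor X Y) (m : multiplier Y) :
    multiplier T :=
  the_or 0 (fun n => forall x y, mL n (tens x y) = tens x (mL m y)).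

(* The *-homomorphism X (x) Y -> M(V) with x (x) y |-> f(x) g(y), for
   commuting f and g. *)
Definition tprod (X Y V : cstar R) (T : min_tensor X Y)
    (f : X -> multiplier V) (g : Y -> multiplier V) : T -> multiplier V :=
  the_or (fun=> 0)
    (fun F => starhom F /\ forall x y, F (tens x y) = f x * g y).

End Legs.

Arguments leg1 {R X Y T}.
Arguments leg2 {R X Y T}.
Arguments tprod {R X Y V T}.

(** * C*-bialgebras and their coactions *)

Section Bialgebras.
Variables (R : realType) (mt : tensor_choice R).
Local Notation "X ⊗ Y" := (tensor_alg (mt X Y))
  (at level 40, left associativity).
Implicit Types A B C D : cstar R.

Definition tens_id B C A (f : B -> multiplier C) : B ⊗ A -> multiplier (C ⊗ A) :=
  tprod (fun b => leg1 (f b)) (fun a => leg2 (incl a)).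

(* Triple tensor products are bracketed to the left; [emb_ij] embeds a tensor
   product as the i-th and j-th legs. *)
Definition emb12 A1 A2 A3 : A1 ⊗ A2 -> multiplier (A1 ⊗ A2 ⊗ A3) :=
  fun t => leg1 (incl t).
Definition emb13 A1 A2 A3 : A1 ⊗ A3 -> multiplier (A1 ⊗ A2 ⊗ A3) :=
  tprod (fun a => leg1 (leg1 (incl a))) (fun a => leg2 (incl a)).
Definition emb23 A1 A2 A3 : A2 ⊗ A3 -> multiplier (A1 ⊗ A2 ⊗ A3) :=
  tprod (fun a => leg1 (leg2 (incl a))) (fun a => leg2 (incl a)).

Definition id_tens C A (Delta : A -> multiplier (A ⊗ A)) :
    C ⊗ A -> multiplier (C ⊗ A ⊗ A) :=
  tprod (fun c => leg1 (leg1 (incl c))) (fun a => ext (@emb23 C A A) (Delta a)).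

Definition cstar_bialgebra A (Delta : A -> multiplier (A ⊗ A)) :=
  [/\ starhom Delta,
      nondegenerate Delta &
      forall a, ext (tens_id Delta) (Delta a) = ext (id_tens Delta) (Delta a)].

Definition coaction A (Delta : A -> multiplier (A ⊗ A)) B
    (delta : B -> multiplier (B ⊗ A)) :=
  [/\ starhom delta,
      injective delta,
      nondegenerate delta,
      (forall b a, exists s, delta b * leg2 (incl a) = incl s) &
      (forall b, ext (tens_id delta) (delta b) =
                 ext (id_tens Delta) (delta b))].

(* eps (x) id and id (x) eps; the second is used on A (x) A and, for
   coactions, on B (x) A. *)
Definition eps_id A (eps : A -> R[i]) : A ⊗ A -> multiplier A :=
  tprod (fun a => eps a *: (1 : multiplier A)) incl.
Definition id_eps B A (eps : A -> R[i]) : B ⊗ A -> multiplier B :=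
  tprod incl (fun a => eps a *: (1 : multiplier B)).

Definition counit A (Delta : A -> multiplier (A ⊗ A)) (eps : A -> R[i]) :=
  [/\ character eps,
      (forall a, ext (eps_id eps) (Delta a) = incl a) &
      (forall a, ext (id_eps eps) (Delta a) = incl a)].

(* The counit of a discrete quantum group exists and is unique. *)
Definition counital A (Delta : A -> multiplier (A ⊗ A)) B
    (delta : B -> multiplier (B ⊗ A)) :=
  exists2 eps, counit Delta eps &
    forall b, ext (id_eps eps) (delta b) = incl b.

(* For a C*-subalgebra of B given by its inclusion j : J -> B: the elements
   delta(j x)(1 (x) a) lie in J (x) A, viewed in B (x) A via j (x) id, and the
   resulting map J -> M(J (x) A) is a coaction.  The inclusion may be
   degenerate, so M(J (x) A) need not act on B (x) A. *)
Definition restricts A (Delta : A -> multiplier (A ⊗ A)) B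
    (delta : B -> multiplier (B ⊗ A)) (J : cstar R) (j : J -> B) :=
  exists2 deltaJ : J -> multiplier (J ⊗ A), coaction Delta deltaJ &
    forall x a s, deltaJ x * leg2 (incl a) = incl s ->
      delta (j x) * leg2 (incl a) = tens_id (fun y => incl (j y)) s.

(** * Compact quantum groups and their discrete duals *)

Record compact_qg := CompactQG {
  cqg :> cstar R;
  cqg_unit : cqg;
  cqg_unitP : is_unit cqg_unit;
  cqg_unit_neq0 : cqg_unit != 0;
  cqg_comul : cqg -> multiplier (cqg ⊗ cqg);
  cqg_bialg : cstar_bialgebra cqg_comul;
  cqg_cancel1 : dense_span
    [set s | exists a b, incl s = cqg_comul a * leg1 (incl b)];
  cqg_cancel2 : dense_span
    [set s | exists a b, incl s = cqg_comul a * leg2 (incl b)]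
}.

Section Corep.
Variable K : compact_qg.

Definition unitary_corep n (u : 'M[K]_n) :=
  [/\ (forall i j, cqg_comul (u i j) = incl (\sum_k tens (u i k) (u k j))),
      (forall i j, \sum_k cadj (u k i) ** u k j =
                   if i == j then cqg_unit K else 0) &
      (forall i j, \sum_k u i k ** cadj (u j k) =
                   if i == j then cqg_unit K else 0)].

(* T u = v T *)
Definition intertwiner n m (u : 'M[K]_n) (v : 'M[K]_m) (T : 'M[R[i]]_(m, n)) :=
  forall i j, \sum_k T i k *: u k j = \sum_k T k j *: v i k.

Definition corep_equiv n m (u : 'M[K]_n) (v : 'M[K]_m) :=
  exists (T : 'M[R[i]]_(m, n)) (S : 'M[R[i]]_(n, m)),
    [/\ intertwiner u v T, T *m S = 1%:M & S *m T = 1%:M].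

Definition irreducible n (u : 'M[K]_n) :=
  (0 < n)%N /\ forall T, intertwiner u u T -> is_scalar_mx T.

End Corep.

(* The discrete quantum group dual to K: C_0(G) is the c_0-direct sum of the
   matrix algebras I_a spanned by the matrix units (mu a i j)_{i,j}, a ranging
   over the classes of irreducible corepresentations of K, represented by
   unitaries [irrep a]; the comultiplication is the one for which
   W = \sum_{a,i,j} mu a i j (x) u^a_ij in M(C_0(G) (x) K) satisfies
   (Delta (x) id)(W) = W_13 W_23. *)
Record discrete_qg := DiscreteQG {
  qg_dual : compact_qg;
  irr : Type;
  dimi : irr -> nat;
  irrep : forall a, 'M[qg_dual]_(dimi a);
  irrep_unitary : forall a, unitary_corep (irrep a);
  irrep_irr : forall a, irreducible (irrep a);
  irrep_inj : forall a b, corep_equiv (irrep a) (irrep b) -> a = b;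
  irrep_all : forall n (u : 'M[qg_dual]_n), unitary_corep u ->
    irreducible u -> exists a, corep_equiv u (irrep a);
  C0 : cstar R;
  mu : forall a, 'I_(dimi a) -> 'I_(dimi a) -> C0;
  mu_neq0 : forall a i j, mu (a := a) i j != 0;
  mu_adj : forall a i j, cadj (mu (a := a) i j) = mu j i;
  mu_mul : forall a i j k l,
    mu (a := a) i j ** mu k l = if j == k then mu i l else 0;
  mu_orth : forall a b i j k l, a <> b -> mu (a := a) i j ** mu (a := b) k l = 0;
  mu_dense : dense_span [set x | exists a i j, x = mu (a := a) i j];
  comul : C0 -> multiplier (C0 ⊗ C0);
  comul_bialg : cstar_bialgebra comul;
  Wdual : multiplier (C0 ⊗ qg_dual);
  Wdual_irrep : forall a k l, Wdual * leg1 (incl (mu (a := a) k l)) =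
    incl (\sum_i tens (mu i l) (irrep a i k));
  Wdual_comul : ext (tens_id comul) Wdual =
    ext (@emb13 C0 C0 qg_dual) Wdual * ext (@emb23 C0 C0 qg_dual) Wdual
}.

(** * Admissible projections *)

Section Admissible.
Variable G : discrete_qg.

Definition admissible C (q : multiplier (C ⊗ C0 G)) :=
  projection q /\
  (leg1 q : multiplier (C ⊗ C0 G ⊗ C0 G)) * ext (id_tens (@comul G)) q =
  ext (id_tens (@comul G)) q * leg1 q.

Definition universal_admissible B (oneB : B) (p : multiplier (B ⊗ C0 G)) :=
  [/\ is_unit oneB,
      admissible p &
      forall C (q : multiplier (C ⊗ C0 G)), admissible q ->
        exists! pi : B -> multiplier C,
          [/\ starhom pi, pi oneB = 1 & q = ext (tens_id pi) p]].

(* The elements p^a_ij of B with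
   p (1 (x) 1_{I_a}) = \sum_{i,j} p^a_ij (x) mu a i j. *)
Definition matrix_coefs B (p : multiplier (B ⊗ C0 G)) : set B :=
  [set b | exists pc : forall a : irr G, 'M[B]_(dimi a),
    (forall a k l, p * leg2 (incl (mu (a := a) k l)) =
                   incl (\sum_i tens (pc a i k) (mu i l))) /\
    exists a i j, b = pc a i j].

(* j : J -> B presents the C*-subalgebra generated by the p^a_ij. *)
Definition is_pointed_part B (p : multiplier (B ⊗ C0 G)) (J : cstar R)
    (j : J -> B) :=
  [/\ starhom (fun x => incl (j x)),
      injective j &
      range j = cstar_generated (matrix_coefs p)].

End Admissible.

End Bialgebras.

(* Main.v *)
(* By coassociativity, applying id (x) Delta (x) id to the admissibility
   relation of p shows that the projection q = (id (x) Delta)(p) is admissible,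
   so universality yields a unique unital delta with (delta (x) id)(p) = q; a
   coaction is nondegenerate, hence unital, which gives uniqueness.
   Coassociativity and counitality of delta are again equalities of maps out
   of B that agree on p.
   Counitality forces injectivity.

   The counit eps is the character of the block of the trivial
   corepresentation; the maps (eps (x) id)Delta and (id (x) eps)Delta fix the
   fundamental unitary W, and by Schur's lemma only the identity does so.

   For the subalgebra J, the elements delta(p_ij)(1 (x) a) are slices of
   q(1 (x) a (x) e_ij), hence lie in J (x) A.  Nondegeneracy of the restricted
   map uses cup vectors: for every irreducible corepresentation u there are an
   irreducible unitary v equivalent to the conjugate of u and an element s of
   I_u (x) I_v with Delta(z)s = eps(z)s for all z.  By coassociativity,
   (delta (x) id)delta(y) maps x (x) s to
   (id (x) Delta)delta(y) (x (x) s) = yx (x) s, and slicing the last leg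
   of s exhibits yx (x) e_ij as a limit of elements of delta(J)(J (x) A).

   That the conjugate of u is equivalent to a unitary corepresentation is
   proved without assuming the Haar state h to be faithful: a null vector of
   the positive matrix with entries h(sum_i u_ik u_il^* ) would give
   coefficients y_a with h(y_a^* y_a) = 0 for all a, although
   sum_a y_a^* y_a = 1. *)

From HB Require Import structures.
From mathcomp Require Import all_boot all_order all_algebra.
From mathcomp Require Import complex.
From mathcomp Require Import all_classical all_reals all_analysis.
From mathcomp Require Import ring lra.
Require Import Defs.

Set Implicit Arguments.
Unset Strict Implicit.
Unset Printing Implicit Defensive.

Import Order.TTheory GRing.Theory Num.Theory.
Import numFieldNormedType.Exports.
Local Open Scope classical_set_scope.
Local Open Scope ring_scope.
Local Open Scope complex_scope.

(** [ext], [leg1] and [tprod] choose an object if one exists and return a default otherwise, so each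
    is usable only after an existence proof, and existence rests on norm estimates. Two devices
    supply these. A bound t of a multiplier m becomes the identity m^* m + g^2 = t^2, which survives
    homomorphisms, legs and positive functionals. A map out of a minimal tensor product is bounded
    by testing it on product functionals psi ⊗ chi: they separate points because the minimal norm is
    a supremum over product representations, and their GNS spaces are tensor products, where the
    norm formula applies. The inclusion of J may be degenerate, so M(J ⊗ A) has no natural map to
    M(B ⊗ A). The restriction of delta is obtained by pulling multipliers back along the injective f
    = j ⊗ id, and its properties are compared with those of delta by the relation f(m s) = n f(s).
    Identities pass through this relation, nondegeneracy does not; there the cup vectors play the
    part of the antipode in the algebraic formula x ⊗ a = sum x_0 ⊗ x_1 S(x_2) a. *)

Local Notation Re := (@complex.Re _).
Local Notation Im := (@complex.Im _).

(** * Reflection for identities in abelian groups and noncommutative rings *)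

Inductive nexp := NV of nat | N0 | N1 | NA of nexp & nexp | NO of nexp | NM of nexp & nexp.

Definition npoly := seq (seq nat * int).

Fixpoint nnf (e : nexp) : npoly := match e with
  | NV i => [:: ([:: i], 1)]
  | N0 => [::]
  | N1 => [:: ([::], 1)]
  | NA a b => nnf a ++ nnf b
  | NO a => [seq (p.1, - p.2) | p <- nnf a]
  | NM a b => flatten [seq [seq (p.1 ++ q.1, p.2 * q.2) | q <- nnf b] | p <- nnf a]
  end.

Definition ncoef (p : npoly) (m : seq nat) : int :=
  foldr (fun q c => if q.1 == m then q.2 + c else c) 0 p.

(** A normal form is a list of words with coefficients in which words may repeat, so every word is
    tested by its total coefficient. *)
Definition nzero (p : npoly) := all (fun q => ncoef p q.1 == 0) p.

Definition neval (V : zmodType) (f : seq nat -> V) (p : npoly) : V :=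
  \sum_(q <- p) f q.1 *~ q.2.

Lemma ncoefE p m : ncoef p m = \sum_(q <- p | q.1 == m) q.2.
Proof.
by elim: p => [|q p ih] /=; rewrite ?big_nil // big_cons ih; case: ifP.
Qed.

Lemma nzeroP (V : zmodType) (f : seq nat -> V) p : nzero p -> neval f p = 0.
Proof.
move=> /allP h; rewrite /neval.
(* Group the terms by word; each group is a multiple of a single value of f. *)
have -> : \sum_(q <- p) f q.1 *~ q.2 =
    \sum_(m <- undup [seq q.1 | q <- p]) \sum_(q <- p | q.1 == m) f m *~ q.2.
  rewrite (exchange_big_dep xpredT) //=.
  rewrite [LHS]big_seq [RHS]big_seq; apply: eq_bigr => q qp.
  rewrite -big_filter (_ : [seq _ <- _ | _] = [:: q.1]) ?big_seq1 //.
  rewrite (eq_filter (a2 := pred1 q.1)) => [|m]; last by rewrite /= [RHS]eq_sym.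
  by rewrite filter_pred1_uniq ?undup_uniq // mem_undup map_f.
rewrite big_seq big1 // => m; rewrite mem_undup => /mapP[q qp ->].
rewrite -mulrz_sumr; have := h _ qp; rewrite ncoefE => /eqP ->.
by rewrite mulr0z.
Qed.

Fixpoint nden (A : pzRingType) (f : nat -> A) (e : nexp) : A := match e with
  | NV i => f i
  | N0 => 0
  | N1 => 1
  | NA a b => nden f a + nden f b
  | NO a => - nden f a
  | NM a b => nden f a * nden f b
  end.

Lemma ndenE (A : pzRingType) (f : nat -> A) e :
  nden f e = neval (fun m => \prod_(i <- m) f i) (nnf e).
Proof.
rewrite /neval; elim: e => [i|||a iha b ihb|a iha|a iha b ihb] /=.
- by rewrite !big_seq1 mulr1z.
- by rewrite big_nil.
- by rewrite big_seq1 /= big_nil mulr1z.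
- by rewrite big_cat iha ihb.
- by rewrite big_map iha -sumrN; apply: eq_bigr => q _; rewrite mulrNz.
rewrite big_flatten big_map iha ihb mulr_suml; apply: eq_bigr => p _.
rewrite mulr_sumr big_map; apply: eq_bigr => q _ /=.
by rewrite big_cat /= mulrzAl mulrzAr mulrzA mulrzAC.
Qed.

Lemma ncringP (A : pzRingType) (f : nat -> A) e1 e2 :
  nzero (nnf (NA e1 (NO e2))) -> nden f e1 = nden f e2.
Proof.
move=> h; apply/eqP; rewrite -subr_eq0; apply/eqP.
rewrite -[LHS]/(nden f (NA e1 (NO e2))) ndenE; exact: nzeroP.
Qed.

Fixpoint zden (A : zmodType) (f : nat -> A) (e : nexp) : A := match e with
  | NV i => f i
  | NA a b => zden f a + zden f b
  | NO a => - zden f a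
  | _ => 0
  end.

Fixpoint zok e := match e with
  | NV _ | N0 => true
  | NA a b => zok a && zok b
  | NO a => zok a
  | _ => false
  end.

(** The same normal form serves abelian groups: without products and 1 only words of length one
    occur, so the value 0 given to the other words is arbitrary. *)
Lemma zdenE (A : zmodType) (f : nat -> A) e : zok e ->
  zden f e = neval (fun m => if m is [:: i] then f i else 0) (nnf e).
Proof.
rewrite /neval; elim: e => [i|||a iha b ihb|a iha|a iha b ihb] //=.
- by rewrite big_seq1 mulr1z.
- by rewrite big_nil.
- by move=> /andP[/iha -> /ihb ->]; rewrite big_cat.
by move=> /iha ->; rewrite big_map -sumrN; apply: eq_bigr => q _; rewrite mulrNz.
Qed.

Lemma zmodP (A : zmodType) (f : nat -> A) e1 e2 :
  zok e1 && zok e2 && nzero (nnf (NA e1 (NO e2))) -> zden f e1 = zden f e2.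
Proof.
move=> /andP[zz h]; apply/eqP; rewrite -subr_eq0; apply/eqP.
rewrite -[LHS]/(zden f (NA e1 (NO e2))) zdenE //; exact: nzeroP.
Qed.

Ltac nc_idx x l := lazymatch l with
  | cons x _ => constr:(0%N)
  | cons _ ?l' => let n := nc_idx x l' in constr:(S n)
  end.
Ltac nc_add x l := lazymatch l with
  | context [cons x _] => l
  | _ => constr:(cons x l)
  end.
Ltac nc_vars t l := lazymatch t with
  | (?a + ?b)%R => let l := nc_vars a l in nc_vars b l
  | (- ?a)%R => nc_vars a l
  | (?a * ?b)%R => let l := nc_vars a l in nc_vars b l
  | 0%R => l
  | 1%R => l
  | _ => nc_add t l
  end.
Ltac nc_reify t l := lazymatch t with
  | (?a + ?b)%R => let x := nc_reify a l in let y := nc_reify b l in constr:(NA x y)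
  | (- ?a)%R => let x := nc_reify a l in constr:(NO x)
  | (?a * ?b)%R => let x := nc_reify a l in let y := nc_reify b l in constr:(NM x y)
  | 0%R => constr:(N0)
  | 1%R => constr:(N1)
  | _ => let n := nc_idx t l in constr:(NV n)
  end.
Ltac zm_vars t l := lazymatch t with
  | (?a + ?b)%R => let l := zm_vars a l in zm_vars b l
  | (- ?a)%R => zm_vars a l
  | 0%R => l
  | _ => nc_add t l
  end.
Ltac zm_reify t l := lazymatch t with
  | (?a + ?b)%R => let x := zm_reify a l in let y := zm_reify b l in constr:(NA x y)
  | (- ?a)%R => let x := zm_reify a l in constr:(NO x)
  | 0%R => constr:(N0)
  | _ => let n := nc_idx t l in constr:(NV n)
  end.
Ltac nc_ring := lazymatch goal with |- @eq ?T ?a ?b =>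
  let l := nc_vars a (@nil T) in let l := nc_vars b l in
  let x := nc_reify a l in let y := nc_reify b l in
  let l' := constr:(nth (0%R : T) l) in
  exact: (@ncringP _ l' x y isT) end.
Ltac zm := lazymatch goal with |- @eq ?T ?a ?b =>
  let l := zm_vars a (@nil T) in let l := zm_vars b l in
  let x := zm_reify a l in let y := zm_reify b l in
  let l' := constr:(nth (0%R : T) l) in
  exact: (@zmodP _ l' x y isT) end.

(** * Real-valued norms and limits of sequences *)

Section RealNorm.
Variable R : realType.

(** Norms here are elements of R[i]; the real part is a number to which the order of R and [lra]
    apply. *)
Definition nc (k : R[i]) : R := Re `|k|.

Lemma ncE k : `|k| = (nc k)%:C.
Proof.
have := normr_ge0 k; rewrite lecE => /andP[/eqP h _].
by rewrite /nc [LHS]complexE h mulr0 addr0.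
Qed.

Lemma nc_ge0 k : 0 <= nc k.
Proof. by have := normr_ge0 k; rewrite ncE ler0c. Qed.

Lemma ncM k l : nc (k * l) = nc k * nc l.
Proof. by apply: complexI; rewrite rmorphM /= -!ncE normrM. Qed.

Lemma ncD k l : nc (k + l) <= nc k + nc l.
Proof. by rewrite -lecR rmorphD /= -!ncE ler_normD. Qed.

Lemma nc_real (t : R) : nc t%:C = `|t|.
Proof.
apply: complexI; rewrite -ncE normc_def /=.
by rewrite expr0n /= addr0 sqrtr_sqr.
Qed.

Lemma nc_conj k : nc (k^*)%R = nc k.
Proof. by apply: complexI; rewrite -!ncE norm_conjC. Qed.

Lemma nc_eq0 k : nc k = 0 -> k = 0.
Proof. by move=> h; apply/eqP; rewrite -normr_eq0 ncE h. Qed.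

Lemma nc_sqr k : ((nc k) ^+ 2)%:C = k * (k^*)%R.
Proof. by rewrite rmorphXn /= -ncE normCK. Qed.

Lemma nc_i : nc 'i%C = 1.
Proof.
by apply: complexI; rewrite -ncE normc_def /= expr0n /= add0r expr1n sqrtr1.
Qed.

Lemma nc_Re k : `|Re k| <= nc k.
Proof. by rewrite -lecR -ncE normc_ge_Re. Qed.

Lemma conj_real (t : R) : ((t%:C)^*)%R = t%:C.
Proof. by rewrite conj_Creal //; apply/complex_realP; exists t. Qed.

Lemma conj_iE : (('i%C : R[i])^*)%R = - 'i%C.
Proof.
have h : ('i%C : R[i]) * ('i%C : R[i]) = -1 by rewrite -expr2 sqr_i.
have h2 : ('i%C : R[i]) * ('i%C^*)%R = 1.
  by rewrite -nc_sqr nc_i expr1n.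
apply: (@mulfI _ 'i%C); last by rewrite h2 mulrN h opprK.
by apply/eqP => /(congr1 nc); rewrite nc_i /nc normr0 /= => /eqP; rewrite oner_eq0.
Qed.

Lemma ge0_realE (z : R[i]) : 0 <= z -> z = (Re z)%:C /\ 0 <= Re z.
Proof.
rewrite lecE => /andP[/eqP h h2]; split=> //.
by rewrite [LHS]complexE h mulr0 addr0.
Qed.

Lemma ltc0R (e : R) : (0 < e%:C) = (0 < e).
Proof. exact: (ltcR 0 e). Qed.

Definition nr (V : normedModType R[i]) (x : V) : R := Re `|x|.

Section V.
Variable V : normedModType R[i].
Implicit Types x y z : V.

Lemma nrE x : `|x| = (nr x)%:C.
Proof.
have := normr_ge0 x; rewrite lecE => /andP[/eqP h _].
by rewrite /nr [LHS]complexE h mulr0 addr0.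
Qed.

Lemma nr_ge0 x : 0 <= nr x.
Proof. by have := normr_ge0 x; rewrite nrE ler0c. Qed.

Lemma nr0 : nr (0 : V) = 0. Proof. by rewrite /nr normr0. Qed.

Lemma nr_eq0 x : nr x = 0 -> x = 0.
Proof. by move=> h; apply/eqP; rewrite -normr_eq0 nrE h. Qed.

Lemma nrD x y : nr (x + y) <= nr x + nr y.
Proof. by rewrite -lecR rmorphD /= -!nrE ler_normD. Qed.

Lemma nrN x : nr (- x) = nr x.
Proof. by rewrite /nr normrN. Qed.

Lemma nrC x y : nr (x - y) = nr (y - x).
Proof. by rewrite -nrN opprB. Qed.

Lemma nrB x y : nr (x - y) <= nr x + nr y.
Proof. by rewrite -[nr y]nrN nrD. Qed.

Lemma nr_tri y x z : nr (x - z) <= nr (x - y) + nr (y - z).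
Proof. by rewrite -[x - z](subrKA y) nrD. Qed.

Lemma nr_le_sub x y : nr x <= nr y + nr (x - y).
Proof. by rewrite -{1}[x](subrK y) addrC nrD. Qed.

Lemma nrZ k x : nr (k *: x) = nc k * nr x.
Proof. by apply: complexI; rewrite rmorphM /= -nrE -ncE -nrE normrZ. Qed.

Lemma nrZr (t : R) x : nr (t%:C *: x) = `|t| * nr x.
Proof. by rewrite nrZ nc_real. Qed.

Lemma nr_sum (I : Type) (r : seq I) (P : pred I) (f : I -> V) :
  nr (\sum_(i <- r | P i) f i) <= \sum_(i <- r | P i) nr (f i).
Proof.
elim/big_rec2: _ => [|i y1 y2 _ h]; first by rewrite nr0.
by apply: le_trans (nrD _ _) _; rewrite lerD2l.
Qed.

Lemma nr_small x : (forall e : R, 0 < e -> nr x <= e) -> x = 0.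
Proof.
move=> h; apply: nr_eq0; apply/eqP; rewrite eq_le nr_ge0 andbT.
by apply/ler_addgt0Pr => e e0; rewrite add0r h.
Qed.

Lemma closure_nrP (S : set V) x :
  closure S x <-> forall e : R, 0 < e -> exists y, S y /\ nr (x - y) < e.
Proof.
split=> h.
  move=> e e0.
  have [|y [Sy yb]] := h (ball x e%:C); first by apply: nbhsx_ballx; rewrite ltc0R.
  exists y; split=> //; move: yb.
  by rewrite -ball_normE /ball_ /= nrE ltcR.
move=> B /nbhs_ballP[e /= e0 Be].
have e0r : 0 < Re e by move: e0; rewrite ltcE => /andP[].
have eE : e = (Re e)%:C by apply: (proj1 (ge0_realE _)); exact: ltW.
have [y [Sy yx]] := h _ e0r; exists y; split=> //; apply: Be.
by rewrite -ball_normE /ball_ /= nrE eE ltcR.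
Qed.

End V.

Definition cau (V : normedModType R[i]) (u : nat -> V) :=
  forall e : R, 0 < e -> exists N, forall m n, (N <= m)%N -> (N <= n)%N ->
    nr (u m - u n) < e.

Definition clim (V : normedModType R[i]) (u : nat -> V) (l : V) :=
  forall e : R, 0 < e -> exists N, forall n, (N <= n)%N -> nr (u n - l) < e.

Lemma cau_lim (V : completeNormedModType R[i]) (u : nat -> V) :
  cau u -> exists l, clim u l.
Proof.
move=> h.
have cvu : cvg (u @ \oo).
  apply: cauchy_cvg; apply: cauchy_exP => e e0.
  have e0r : 0 < Re e by move: e0; rewrite ltcE => /andP[].
  have eE : e = (Re e)%:C by apply: (proj1 (ge0_realE _)); exact: ltW.
  have [N hN] := h _ e0r; exists (u N); exists N => // n /= Nn.
  by rewrite -ball_normE /ball_ /= nrE eE ltcR hN.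
exists (lim (u @ \oo)) => e e0.
move/cvgrPdist_lt: cvu => /(_ e%:C); rewrite ltc0R => /(_ e0)[N _ hN].
exists N => n Nn; have := hN n Nn.
by rewrite nrE ltcR nrC.
Qed.

Lemma clim_cau (V : normedModType R[i]) (u : nat -> V) l : clim u l -> cau u.
Proof.
move=> h e e0; have [|N hN] := h (e / 2); first by rewrite divr_gt0.
exists N => m n Nm Nn; apply: le_lt_trans (nr_tri l _ _) _.
by rewrite (nrC l) [ltRHS]splitr ltrD ?hN.
Qed.

Lemma clim_uniq (V : normedModType R[i]) (u : nat -> V) l l' :
  clim u l -> clim u l' -> l = l'.
Proof.
move=> h h'; apply/eqP; rewrite -subr_eq0; apply/eqP; apply: nr_small => e e0.
have e2 : 0 < e / 2 by rewrite divr_gt0.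
have [N hN] := h _ e2; have [N' hN'] := h' _ e2.
apply: ltW; apply: le_lt_trans (nr_tri (u (maxn N N')) _ _) _.
by rewrite nrC [ltRHS]splitr ltrD ?hN ?hN' ?leq_maxl ?leq_maxr.
Qed.

Lemma clim_le (V : normedModType R[i]) (u : nat -> V) l x c N :
  clim u l -> (forall n, (N <= n)%N -> nr (u n - x) <= c) -> nr (l - x) <= c.
Proof.
move=> h hc; apply/ler_addgt0Pr => e e0; have [M hM] := h _ e0.
apply: le_trans (nr_tri (u (maxn N M)) _ _) _.
by rewrite addrC lerD ?hc ?leq_maxl // nrC ltW // hM ?leq_maxr.
Qed.

Lemma clim_lip (V W : normedModType R[i]) (f : V -> W) c (u : nat -> V) l :
  (forall x y, nr (f x - f y) <= c * nr (x - y)) -> clim u l ->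
  clim (fun n => f (u n)) (f l).
Proof.
move=> hf h e e0.
have c1 : 0 < `|c| + 1 by rewrite ltr_wpDl.
have [|N hN] := h (e / (`|c| + 1)); first by rewrite divr_gt0.
exists N => n /hN hn; apply: le_lt_trans (hf _ _) _.
apply: (@le_lt_trans _ _ ((`|c| + 1) * nr (u n - l))).
  rewrite ler_wpM2r ?nr_ge0 //; have := ler_norm c; lra.
by rewrite mulrC -ltr_pdivlMr.
Qed.

Lemma clim_ext (V : normedModType R[i]) (u v : nat -> V) l :
  u =1 v -> clim u l -> clim v l.
Proof. by move=> /funext ->. Qed.

(** The increments of u are dominated by those of r, which is therefore nondecreasing and, being
    bounded, comes close to its supremum. The second conclusion keeps the explicit rate r m - r
    n. *)
Lemma cau_tele (V : normedModType R[i]) (u : nat -> V) (r : nat -> R) (L : R) :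
  (forall n, nr (u n.+1 - u n) <= r n.+1 - r n) ->
  (forall n, r n <= L) ->
  cau u /\ forall m n, (n <= m)%N -> nr (u m - u n) <= r m - r n.
Proof.
move=> hu hr.
have tele : forall m n, (n <= m)%N -> nr (u m - u n) <= r m - r n.
  move=> m n /subnK <-; elim: (m - n)%N => [|k ih]; first by rewrite !add0n !subrr nr0.
  rewrite addSn; apply: le_trans (nr_tri (u (k + n)%N) _ _) _.
  have := hu (k + n)%N; lra.
split=> // e e0.
have rnd : {homo r : x y / (x <= y)%N >-> x <= y}.
  move=> n m /tele h; have := nr_ge0 (u m - u n); lra.
have hs : has_sup (range r).
  by split; [exists (r 0%N); exists 0%N|exists L => _ [n _ <-]].
have [_ [N _ <-] hN] := sup_adherent e0 hs.
have ub : forall n, r n <= sup (range r).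
  by move=> n; apply: (sup_upper_bound hs); exists n.
exists N => m n Nm Nn.
wlog nm : m n Nm Nn / (n <= m)%N.
  move=> h; case/orP: (leq_total n m) => /h; last rewrite nrC; exact.
apply: le_lt_trans (tele _ _ nm) _.
have := ub m; have := rnd _ _ Nn; lra.
Qed.

End RealNorm.

(** * Norms in C*-algebras *)

Section CstarNorm.
Variables (R : realType) (A : cstar R).
Implicit Types a b : A.

Lemma nrM a b : nr (a ** b) <= nr a * nr b.
Proof. by rewrite -lecR rmorphM /= -!nrE cnormM. Qed.

Lemma nr_cs a : nr (cadj a ** a) = nr a ^+ 2.
Proof. by apply: complexI; rewrite rmorphXn /= -!nrE cnorm_cstar. Qed.

Lemma nr_adj a : nr (cadj a) = nr a.
Proof.
have le : forall b : A, nr b <= nr (cadj b).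
  move=> b; have [->|b0] := eqVneq (nr b) 0; first exact: nr_ge0.
  have bp : 0 < nr b by rewrite lt_def b0 nr_ge0.
  by rewrite -(ler_pM2r bp) -expr2 -nr_cs nrM.
by apply/eqP; rewrite eq_le le andbT -{2}[a]cadjK le.
Qed.

Lemma nr_cs' a : nr (a ** cadj a) = nr a ^+ 2.
Proof. by rewrite -{1}[a]cadjK nr_cs nr_adj. Qed.

Lemma cadj0 : cadj (0 : A) = 0.
Proof. by apply: (addrI (cadj 0)); rewrite -cadjD !addr0. Qed.

Lemma cadjN a : cadj (- a) = - cadj a.
Proof. by apply: (addrI (cadj a)); rewrite -cadjD !subrr cadj0. Qed.

Lemma cadjB a b : cadj (a - b) = cadj a - cadj b.
Proof. by rewrite cadjD cadjN. Qed.

Lemma cmulBl a b (c : A) : (a - b) ** c = a ** c - b ** c.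
Proof. by rewrite cmulDl cmulNl. Qed.

Lemma cmulBr (c : A) a b : c ** (a - b) = c ** a - c ** b.
Proof. by rewrite cmulDr cmulNr. Qed.

Lemma cadj_inj a b : cadj a = cadj b -> a = b.
Proof. by move=> h; rewrite -[a]cadjK h cadjK. Qed.

Lemma cadj_sum (I : Type) (r : seq I) (P : pred I) (f : I -> A) :
  cadj (\sum_(i <- r | P i) f i) = \sum_(i <- r | P i) cadj (f i).
Proof. exact: (big_morph _ (@cadjD R A) cadj0). Qed.

Lemma cmul_suml (I : Type) (r : seq I) (P : pred I) (f : I -> A) b :
  (\sum_(i <- r | P i) f i) ** b = \sum_(i <- r | P i) (f i ** b).
Proof. by rewrite (big_morph (cmul^~ b) (fun x y => cmulDl x y b) (cmul0l b)). Qed.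

Lemma cmul_sumr (I : Type) (r : seq I) (P : pred I) (f : I -> A) b :
  b ** (\sum_(i <- r | P i) f i) = \sum_(i <- r | P i) (b ** f i).
Proof. by rewrite (big_morph (cmul b) (cmulDr b) (cmul0r b)). Qed.

Lemma cs_eq0 a : cadj a ** a = 0 -> a = 0.
Proof.
move=> h; apply: nr_eq0; apply/eqP.
by rewrite -sqrf_eq0 -nr_cs h nr0.
Qed.

Lemma clim_mulr (u : nat -> A) l b : clim u l -> clim (fun n => u n ** b) (l ** b).
Proof.
by apply: (@clim_lip _ _ _ (cmul^~ b) (nr b)) => x y; rewrite -cmulBl mulrC nrM.
Qed.

Lemma clim_mull (u : nat -> A) l b : clim u l -> clim (fun n => b ** u n) (b ** l).
Proof. by apply: (@clim_lip _ _ _ (cmul b) (nr b)) => x y; rewrite -cmulBr nrM. Qed.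

Lemma clim_adj (u : nat -> A) l : clim u l -> clim (fun n => cadj (u n)) (cadj l).
Proof.
by apply: (@clim_lip _ _ _ cadj 1) => x y; rewrite -cadjB nr_adj mul1r.
Qed.

End CstarNorm.

(** * Multipliers, their bounds and limits *)

Section MultBasics.
Variables (R : realType) (X : cstar R).
Implicit Types (m n : multiplier X) (x y v : X).

Lemma mult_eqL m n : mL m =1 mL n -> m = n.
Proof.
move=> h; apply: multiplier_eq => // a; apply: cmul_faithr => c.
by rewrite -!mLR h.
Qed.

Lemma mL_add m n v : mL (m + n) v = mL m v + mL n v. Proof. by []. Qed.
Lemma mL_sub m n v : mL (m - n) v = mL m v - mL n v. Proof. by []. Qed.
Lemma mL_mul m n v : mL (m * n) v = mL m (mL n v). Proof. by []. Qed.
Lemma mL_scale k m v : mL (k *: m) v = k *: mL m v. Proof. by []. Qed.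
Lemma mL_zero v : mL (0 : multiplier X) v = 0. Proof. by []. Qed.
Lemma mL_incl x v : mL (incl x) v = x ** v. Proof. by []. Qed.

Lemma mLD m v w : mL m (v + w) = mL m v + mL m w.
Proof. by have := mL_linear m 1 v w; rewrite !scale1r. Qed.
Lemma mL0 m : mL m 0 = 0.
Proof. by apply: (addrI (mL m 0)); rewrite -mLD !addr0. Qed.
Lemma mLN m v : mL m (- v) = - mL m v.
Proof. by apply: (addrI (mL m v)); rewrite -mLD !subrr mL0. Qed.
Lemma mLB m v w : mL m (v - w) = mL m v - mL m w.
Proof. by rewrite mLD mLN. Qed.
Lemma mLZ m k v : mL m (k *: v) = k *: mL m v.
Proof. by have := mL_linear m k v 0; rewrite !addr0 mL0 addr0. Qed.
Lemma mL_sum (I : Type) (r : seq I) (P : pred I) m (f : I -> X) :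
  mL m (\sum_(i <- r | P i) f i) = \sum_(i <- r | P i) mL m (f i).
Proof. by rewrite (big_morph (mL m) (mLD m) (mL0 m)). Qed.
Lemma msumL (I : Type) (r : seq I) (P : pred I) (f : I -> multiplier X) v :
  mL (\sum_(i <- r | P i) f i) v = \sum_(i <- r | P i) mL (f i) v.
Proof. by rewrite (big_morph (fun m => mL m v) (fun m n => mL_add m n v) (mL_zero v)). Qed.

Lemma mLM m v w : mL m (v ** w) = mL m v ** w.
Proof. by apply: cmul_faithl => c; rewrite mLR cmulA -mLR cmulA. Qed.

Lemma madj_mL m v : mL (madj m) v = cadj (mR m (cadj v)). Proof. by []. Qed.

Lemma madj_ip m v w : cadj v ** mL m w = cadj (mL (madj m) v) ** w.
Proof. by rewrite madj_mL cadjK mLR. Qed.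

Lemma madj_ip' m v w : cadj v ** mL (madj m) w = cadj (mL m v) ** w.
Proof. by apply: cadj_inj; rewrite !cadjM !cadjK mLR. Qed.

Lemma madjK : involutive (@madj R X).
Proof. by move=> m; apply: mult_eqL => v; rewrite /= !cadjK. Qed.

Lemma madjD m n : madj (m + n) = madj m + madj n.
Proof. by apply: mult_eqL => v; rewrite /= cadjD. Qed.
Lemma madj0 : madj (0 : multiplier X) = 0.
Proof. by apply: mult_eqL => v; rewrite /= cadj0. Qed.
Lemma madjN m : madj (- m) = - madj m.
Proof. by apply: mult_eqL => v; rewrite /= cadjN. Qed.
Lemma madjB m n : madj (m - n) = madj m - madj n.
Proof. by rewrite madjD madjN. Qed.
Lemma madjM m n : madj (m * n) = madj n * madj m.
Proof. by apply: mult_eqL => v; rewrite /= cadjK. Qed.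
Lemma madj1 : madj (1 : multiplier X) = 1.
Proof. by apply: mult_eqL => v; rewrite /= cadjK. Qed.
Lemma madjZ k m : madj (k *: m) = (k^*)%R *: madj m.
Proof. by apply: mult_eqL => v; rewrite /= cadjZ. Qed.
Lemma madjX m k : madj (m ^+ k) = madj m ^+ k.
Proof. by elim: k => [|k ih]; rewrite ?expr0 ?madj1 // exprS madjM ih -exprSr. Qed.

Lemma mscaleAl k m n : (k *: m) * n = k *: (m * n).
Proof. exact: mult_eqL. Qed.
Lemma mscaleAr k m n : m * (k *: n) = k *: (m * n).
Proof. by apply: mult_eqL => v; rewrite /= mLZ. Qed.

Lemma inclD x y : incl (x + y) = incl x + incl y.
Proof. by apply: mult_eqL => v; rewrite /= cmulDl. Qed.
Lemma incl0 : incl (0 : X) = 0.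
Proof. by apply: mult_eqL => v; rewrite /= cmul0l. Qed.
Lemma inclN x : incl (- x) = - incl x.
Proof. by apply: mult_eqL => v; rewrite /= cmulNl. Qed.
Lemma inclB x y : incl (x - y) = incl x - incl y.
Proof. by rewrite inclD inclN. Qed.
Lemma inclZ k x : incl (k *: x) = k *: incl x.
Proof. by apply: mult_eqL => v; rewrite /= cmulZl. Qed.
Lemma inclM x y : incl (x ** y) = incl x * incl y.
Proof. by apply: mult_eqL => v; rewrite /= cmulA. Qed.
Lemma incl_adj x : incl (cadj x) = madj (incl x).
Proof. by apply: mult_eqL => v; rewrite /= cadjM cadjK. Qed.
Lemma incl_inj : injective (@incl R X).
Proof. by move=> x y h; apply: cmul_faithr => c; rewrite -!mL_incl h. Qed.
Lemma incl_sum (I : Type) (r : seq I) (P : pred I) (f : I -> X) :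
  incl (\sum_(i <- r | P i) f i) = \sum_(i <- r | P i) incl (f i).
Proof. by rewrite (big_morph _ inclD incl0). Qed.
Lemma mul_incl m x : m * incl x = incl (mL m x).
Proof. by apply: mult_eqL => v; rewrite /= mLM. Qed.
(** The operator norm of a multiplier is never formed; upper bounds suffice, and carrying 0 <= t
    lets them be multiplied. *)
Definition bnd m (t : R) := 0 <= t /\ forall v, nr (mL m v) <= t * nr v.

Lemma bndD m n s t : bnd m s -> bnd n t -> bnd (m + n) (s + t).
Proof.
move=> [s0 hs] [t0 ht]; split; first exact: addr_ge0.
by move=> v; apply: le_trans (nrD _ _) _; rewrite mulrDl lerD.
Qed.
Lemma bndN m t : bnd m t -> bnd (- m) t.
Proof. by move=> [t0 h]; split=> // v; rewrite /= nrN. Qed.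
Lemma bndB m n s t : bnd m s -> bnd n t -> bnd (m - n) (s + t).
Proof. by move=> ? /bndN; exact: bndD. Qed.
Lemma bndM m n s t : bnd m s -> bnd n t -> bnd (m * n) (s * t).
Proof.
move=> [s0 hs] [t0 ht]; split; first exact: mulr_ge0.
by move=> v; apply: le_trans (hs _) _; rewrite -mulrA ler_wpM2l.
Qed.
Lemma bndZ k m t : bnd m t -> bnd (k *: m) (nc k * t).
Proof.
move=> [t0 h]; split; first by rewrite mulr_ge0 ?nc_ge0.
by move=> v; rewrite /= nrZ -mulrA ler_wpM2l ?nc_ge0.
Qed.
Lemma bnd1 : bnd 1 1.
Proof. by split=> // v; rewrite mul1r. Qed.
Lemma bnd0 : bnd 0 0.
Proof. by split=> // v; rewrite mul0r nr0. Qed.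
Lemma bnd_le m s t : bnd m s -> s <= t -> bnd m t.
Proof.
move=> [s0 h] st; split; first exact: le_trans st.
by move=> v; apply: le_trans (h v) _; rewrite ler_wpM2r ?nr_ge0.
Qed.
Lemma bnd_incl x : bnd (incl x) (nr x).
Proof. by split; [exact: nr_ge0|move=> v; exact: nrM]. Qed.
(** The C*-identity for multipliers, read off from |m v|^2 = |v^* m^* m v|. *)
Lemma bnd_cs m t : 0 <= t -> bnd (madj m * m) (t ^+ 2) -> bnd m t.
Proof.
move=> t0 [_ h]; split=> // v.
rewrite -(@ler_pXn2r _ 2) ?nnegrE ?nr_ge0 ?mulr_ge0 ?nr_ge0 //.
rewrite -nr_cs -madj_ip' -mL_mul; apply: le_trans (nrM _ _) _.
by rewrite nr_adj exprMn [nr v ^+ 2]expr2 mulrA [leLHS]mulrC ler_wpM2r ?nr_ge0.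
Qed.
Lemma bnd_incl_le x t : bnd (incl x) t -> nr x <= t.
Proof.
move=> [t0 h]; have [->//|x0] := eqVneq (nr x) 0.
have xp : 0 < nr x by rewrite lt_def x0 nr_ge0.
by rewrite -(ler_pM2r xp) -expr2 -nr_cs'; apply: le_trans (h _) _; rewrite nr_adj.
Qed.
Lemma bnd_adj m t : bnd m t -> bnd (madj m) t.
Proof.
move=> [t0 h]; split=> // v; have [->|x0] := eqVneq (nr (mL (madj m) v)) 0.
  by rewrite mulr_ge0 ?nr_ge0.
have xp : 0 < nr (mL (madj m) v) by rewrite lt_def x0 nr_ge0.
rewrite -(ler_pM2r xp) -expr2 -nr_cs -madj_ip; apply: le_trans (nrM _ _) _.
by rewrite nr_adj mulrAC [leLHS]mulrC ler_wpM2r ?nr_ge0.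
Qed.
Lemma bnd_eq0 m : bnd m 0 -> m = 0.
Proof.
move=> [_ h]; apply: mult_eqL => v; apply: nr_eq0; apply/eqP.
by rewrite eq_le nr_ge0 andbT -[leRHS](mul0r (nr v)) h.
Qed.
Lemma bnd_eqM m s t : bnd m s -> s = t -> bnd m t. Proof. by move=> h <-. Qed.

Lemma madj_cs0 m : madj m * m = 0 -> m = 0.
Proof.
move=> h; apply: bnd_eq0; apply: bnd_cs => //.
by rewrite h expr0n /=; exact: bnd0.
Qed.

(** The limit is taken pointwise, once for the left action of u and once for that of its adjoints,
    which yields the right action; the double centralizer identity passes to the limit. The
    telescoping bound makes the rate L - r n uniform in the vector. *)
Lemma bnd_limM (u : nat -> multiplier X) (r : nat -> R) L :
  (forall n : nat, bnd (u n.+1 - u n) (r n.+1 - r n)) ->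
  (forall n : nat, r n <= L) ->
  exists m, forall n : nat, bnd (m - u n) (L - r n).
Proof.
move=> hu hr.
have lim : forall w : nat -> multiplier X,
    (forall n : nat, bnd (w n.+1 - w n) (r n.+1 - r n)) ->
    forall v, exists l, clim (fun n : nat => mL (w n) v) l.
  move=> w hw v; apply: cau_lim.
  have [||//] := @cau_tele _ _ (fun n : nat => mL (w n) v)
    (fun n : nat => r n * nr v) (L * nr v).
    by move=> k; rewrite -mL_sub -mulrBl; exact: (proj2 (hw k)).
  by move=> k; rewrite ler_wpM2r ?nr_ge0.
have hu' : forall n : nat, bnd (madj (u n.+1) - madj (u n)) (r n.+1 - r n).
  by move=> n; rewrite -madjB; exact: bnd_adj.
have [l hl] := choice (lim _ hu).
have [l' hl'] := choice (lim (fun n : nat => madj (u n)) hu').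
have E a b : a ** l b = cadj (l' (cadj a)) ** b.
  apply: clim_uniq (clim_mull a (hl b)) _.
  apply: clim_ext (clim_mulr b (clim_adj (hl' (cadj a)))) => n.
  by rewrite -madj_ip cadjK.
exists (Multiplier E) => n; split; first by rewrite subr_ge0.
move=> v; rewrite mL_sub /= [leRHS]mulrBl.
apply: (clim_le (N := n) (hl v)) => k nk.
have [||_ /(_ _ _ nk) h] := @cau_tele _ _ (fun n : nat => mL (u n) v)
  (fun n : nat => r n * nr v) (L * nr v).
- by move=> j; rewrite -mL_sub -mulrBl; exact: (proj2 (hu j)).
- by move=> j; rewrite ler_wpM2r ?nr_ge0.
apply: le_trans h _.
by rewrite lerB // ler_wpM2r ?nr_ge0.
Qed.

(** [incl] is isometric, so approximants of m in X form a Cauchy sequence, whose limit then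
    represents m. *)
Lemma incl_closed m :
  (forall e : R, 0 < e -> exists x, bnd (m - incl x) e) -> exists x, m = incl x.
Proof.
move=> h.
have /choice[u hu] : forall n : nat, exists x, bnd (m - incl x) (n.+1%:R^-1).
  by move=> n; apply: h; rewrite invr_gt0 ltr0Sn.
have small : forall e : R, 0 < e -> exists N, forall n : nat, (N <= n)%N -> n.+1%:R^-1 < e.
  move=> e e0; exists (Num.truncn e^-1) => n hn.
  rewrite invf_plt ?posrE ?ltr0Sn // (lt_le_trans (truncnS_gt _)) //.
  by rewrite ler_nat.
have cu : cau u.
  move=> e e0; have [|N hN] := small (e / 2); first by rewrite divr_gt0.
  exists N => i j Ni Nj.
  have hij : bnd (incl (u i - u j)) (i.+1%:R^-1 + j.+1%:R^-1).
    rewrite (_ : incl _ = (m - incl (u j)) - (m - incl (u i))).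
      by rewrite [_^-1 + _]addrC; apply: bndB.
    by rewrite inclB opprB [RHS]addrC subrKA.
  apply: le_lt_trans (bnd_incl_le hij) _.
  by rewrite [ltRHS]splitr ltrD ?hN.
have [l hl] := cau_lim cu; exists l.
apply/eqP; rewrite -subr_eq0; apply/eqP/mult_eqL => v.
apply: nr_small => e e0; rewrite mL_sub /= -/(nr _).
have e2 : 0 < e / 2 / (nr v + 1) by rewrite !divr_gt0 // ltr_wpDl ?nr_ge0.
have [N hN] := small _ e2; have [M hM] := hl _ e2.
pose k := maxn N M.
apply: le_trans (nr_tri (u k ** v) _ _) _; rewrite -cmulBl.
have h1 : nr (mL m v - u k ** v) <= e / 2 / (nr v + 1) * nr v.
  apply: le_trans (proj2 (hu k) v) _; rewrite ler_wpM2r ?nr_ge0 // ltW //.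
  by rewrite hN ?leq_maxl.
have h2 : nr ((u k - l) ** v) <= e / 2 / (nr v + 1) * nr v.
  apply: le_trans (nrM _ _) _; rewrite ler_wpM2r ?nr_ge0 // ltW //.
  by rewrite hM ?leq_maxr.
have h3 : e / 2 / (nr v + 1) * nr v <= e / 2.
  rewrite -mulrA ler_piMr ?divr_ge0 ?ltW // mulrC.
  by rewrite ltr_pdivrMr ?ltr_wpDl ?nr_ge0 // mul1r ltrDl.
lra.
Qed.

End MultBasics.

Section MultBounded.
Variables (R : realType) (X : cstar R).

(* Uniform boundedness, by Sokal's gliding-hump argument. *)
Lemma mult_bounded (m : multiplier X) : exists t, bnd m t.
Proof.
apply: contrapT => nb.
have unb (t : R) : 0 <= t -> exists c : X, nr c <= 1 /\ t < nr (mR m c).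
  move=> t0; have [v hv] : exists v, t * nr v < nr (mL m v).
    apply: contrapT => h; apply: nb; exists t; split=> // v.
    by rewrite leNgt; apply/negP => hv; apply: h; exists v.
  have mv0 : 0 < nr (mL m v) by apply: le_lt_trans hv; rewrite mulr_ge0 ?nr_ge0.
  have v0 : 0 < nr v.
    rewrite lt_def nr_ge0 andbT; apply/eqP => /nr_eq0 v0.
    by move: mv0; rewrite v0 mL0 nr0 ltxx.
  pose c := ((nr (mL m v))^-1)%:C *: cadj (mL m v).
  exists c; split; first by rewrite nrZr nr_adj ger0_norm ?invr_ge0 ?nr_ge0 // mulVf ?gt_eqF.
  rewrite -(ltr_pM2r v0); apply: lt_le_trans (nrM _ _).
  rewrite -mLR cmulZl nrZr nr_cs ger0_norm ?invr_ge0 ?nr_ge0 //.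
  by rewrite expr2 mulKf ?gt_eqF.
have /choice[c hc] : forall n : nat, exists c : X,
    nr c <= 1 /\ 4 * n%:R * 5 ^+ n < nr (mR m c).
  by move=> n; apply: unb; rewrite !mulr_ge0 // exprn_ge0.
pose a n := mR m (c n).
have a0 n : 0 < nr (a n).
  by apply: le_lt_trans (proj2 (hc n)); rewrite !mulr_ge0 // exprn_ge0.
pose b n := ((5 ^- n) * (nr (a n))^-1)%:C *: cadj (a n).
have p5 n : (0 : R) < 5 ^- n by rewrite invr_gt0 exprn_gt0.
have nb' n : nr (b n) = 5 ^- n.
  rewrite nrZr nr_adj ger0_norm; last by rewrite ltW // mulr_gt0 ?invr_gt0.
  by rewrite mulfVK ?gt_eqF.
have nab n : nr (a n ** b n) = 5 ^- n * nr (a n).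
  rewrite cmulZr nrZr nr_cs' ger0_norm; last by rewrite ltW // mulr_gt0 ?invr_gt0.
  by rewrite expr2 mulrA mulfVK ?gt_eqF.
(* The hump b n, of norm 5^-n, is added only if x is not yet large on a n. Later humps change x by
   at most 5^-n / 4, half of what is secured at stage n, so |a n l| is at least |a n| 5^-n / 4,
   which exceeds n by the choice of c n. Since a n l = c n (m l) with |c n| <= 1, this bounds |m l|
   below by every n. *)
pose fix x n := if n is k.+1 then
  (if 2^-1 * (5 ^- k * nr (a k)) <= nr (a k ** x k) then x k else x k + b k)
  else 0 : X.
have x1 n : 2^-1 * (5 ^- n * nr (a n)) <= nr (a n ** x n.+1).
  rewrite /=; case: ifP => // /negbT; rewrite -ltNge => h.
  have : nr (a n ** b n) <= nr (a n ** (x n + b n)) + nr (a n ** x n).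
    by apply: le_trans (nrB _ _); rewrite -cmulBr [x n + _]addrC addrK.
  rewrite nab; lra.
have x2 n : nr (x n.+1 - x n) <= 5 ^- n.
  by rewrite /=; case: ifP => _; [rewrite subrr nr0 ltW|rewrite addrAC subrr add0r nb'].
pose r n : R := - (5 / 4) * 5 ^- n.
have rE n : r n.+1 - r n = 5 ^- n.
  by rewrite /r exprS invfM; lra.
have [||cx tx] := @cau_tele _ _ x r 0.
- by move=> n; rewrite rE.
- by move=> n; rewrite /r mulNr oppr_le0 mulr_ge0 // ltW.
have [l hl] := cau_lim cx.
have dl n : nr (l - x n.+1) <= 4^-1 * 5 ^- n.
  apply: (clim_le (N := n.+1) hl) => k nk; apply: le_trans (tx _ _ nk) _.
  have : r k <= 0 by rewrite /r mulNr oppr_le0 mulr_ge0 // ltW.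
  have : - r n.+1 = 4^-1 * 5 ^- n by rewrite /r exprS invfM; lra.
  lra.
have big n : n%:R <= nr (mL m l).
  have h1 : nr (a n ** l) <= nr (mL m l).
    rewrite -mLR; apply: le_trans (nrM _ _) _.
    by rewrite ler_piMl ?nr_ge0 //; case: (hc n).
  have h2 : nr (a n ** x n.+1) <= nr (a n ** l) + nr (a n) * (4^-1 * 5 ^- n).
    rewrite -lerBlDl; apply: le_trans (le_trans (nrM (a n) (l - x n.+1)) _).
      by rewrite cmulBr nrC lerBlDl nr_le_sub.
    by rewrite ler_wpM2l ?nr_ge0.
  have h3 := x1 n.
  have h4 : n%:R <= 4^-1 * (5 ^- n * nr (a n)).
    have [_ /ltW] := hc n; rewrite -/(a n) => h.
    have := ler_wpM2l (ltW (p5 n)) h.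
    rewrite mulrC mulfK; last by rewrite gt_eqF ?exprn_gt0.
    lra.
  lra.
have := big (Num.truncn (nr (mL m l))).+1.
by rewrite leNgt truncnS_gt.
Qed.

End MultBounded.

(** * Square roots and positivity without spectra *)

Section Positivity.
Variables (R : realType) (X : cstar R).
Implicit Types (m h d w a : multiplier X).

Definition rsc (t : R) : multiplier X := t%:C *: (1 : multiplier X).

Lemma rscl t m : rsc t * m = t%:C *: m.
Proof. by rewrite mscaleAl mul1r. Qed.
Lemma rscr t m : m * rsc t = t%:C *: m.
Proof. by rewrite mscaleAr mulr1. Qed.
Lemma rsc_comm t m : GRing.comm m (rsc t).
Proof. by rewrite /GRing.comm rscl rscr. Qed.
Lemma rscD s t : rsc (s + t) = rsc s + rsc t.
Proof. by rewrite /rsc rmorphD scalerDl. Qed.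
Lemma rscM s t : rsc (s * t) = rsc s * rsc t.
Proof. by rewrite rscl scalerA /rsc rmorphM. Qed.
Lemma rscN t : rsc (- t) = - rsc t.
Proof. by rewrite /rsc rmorphN scaleNr. Qed.
Lemma rscB s t : rsc (s - t) = rsc s - rsc t.
Proof. by rewrite rscD rscN. Qed.
Lemma rsc0 : rsc 0 = 0.
Proof. by rewrite /rsc rmorph0 scale0r. Qed.
Lemma rsc1 : rsc 1 = 1.
Proof. by rewrite /rsc rmorph1 scale1r. Qed.
Lemma madj_rsc t : madj (rsc t) = rsc t.
Proof. by rewrite /rsc madjZ madj1 conj_real. Qed.
Lemma bnd_rsc t : bnd (rsc t) `|t|.
Proof. by rewrite -[`|t|]mulr1 -nc_real; apply: bndZ (@bnd1 _ _). Qed.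
Lemma bnd_rscM t m s : bnd m s -> bnd (rsc t * m) (`|t| * s).
Proof. by move=> h; apply: bndM h; exact: bnd_rsc. Qed.
Lemma madj_rscM t m : madj (rsc t * m) = rsc t * madj m.
Proof. by rewrite madjM madj_rsc rsc_comm. Qed.
Lemma mL_rsc t v : mL (rsc t) v = t%:C *: v.
Proof. by []. Qed.

Lemma bnd_small m : (forall e : R, 0 < e -> bnd m e) -> m = 0.
Proof.
move=> h; apply: mult_eqL => v; apply: nr_small => e e0.
have v1 : 0 < nr v + 1 by rewrite ltr_wpDl ?nr_ge0.
have [_ /(_ v) hv] := h _ (divr_gt0 e0 v1); apply: le_trans hv _.
rewrite -mulrA ler_piMr ?ltW // mulrC ltr_pdivrMr // mul1r.
by rewrite ltrDl.
Qed.

(** The iteration d -> (w + d^2) / 2, whose fixed point satisfies (1 - d)^2 = 1 - w. [sqr_] is the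
    same iteration in R at w = 1; the coefficients being nonnegative, it bounds the iterates and
    their increments whenever |w| <= 1. *)
Fixpoint sqit w n : multiplier X :=
  if n is k.+1 then rsc 2^-1 * (w + sqit w k * sqit w k) else 0.
Fixpoint sqr_ n : R := if n is k.+1 then 2^-1 * (1 + sqr_ k * sqr_ k) else 0.

Lemma sqr_01 n : 0 <= sqr_ n <= 1.
Proof. by elim: n => [|n /andP[h1 h2]] /=; rewrite ?lexx ?ler01 //; nra. Qed.

(** One step takes the gap g = 1 - [sqr_ n] to g - g^2 / 2. A gap that stayed above e would shrink
    by e^2 / 2 each time and finally become negative. *)
Lemma sqr_lim (e : R) : 0 < e -> exists n, 1 - sqr_ n < e.
Proof.
move=> e0; apply: contrapT => h.
have he n : e <= 1 - sqr_ n.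
  by rewrite leNgt; apply/negP => hn; apply: h; exists n.
have hn n : 1 - sqr_ n <= 1 - n%:R * (e ^+ 2 / 2).
  elim: n => [|n ih]; first by rewrite mul0r.
  have -> : 1 - sqr_ n.+1 = (1 - sqr_ n) - (1 - sqr_ n) ^+ 2 / 2.
    by rewrite /=; lra.
  have : e ^+ 2 <= (1 - sqr_ n) ^+ 2 by have := he n; nra.
  rewrite [n.+1%:R](_ : _ = n%:R + 1); last by rewrite -natr1.
  rewrite mulrDl mul1r; move: ih.
  by set p := n%:R * _; set q := (1 - sqr_ n) ^+ 2; set e2 := e ^+ 2 => ih h1; lra.
pose n := (Num.truncn (2 / e ^+ 2)).+1.
have := hn n; have := he n.
have : 2 / e ^+ 2 < n%:R by exact: truncnS_gt.
have e2 : 0 < e ^+ 2 by rewrite exprn_gt0.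
rewrite ltr_pdivrMr // => h1 h2 h3.
by have : 0 < n%:R * (e ^+ 2 / 2) - 1; lra.
Qed.

Lemma comm_rsc2 y t m : GRing.comm y m -> GRing.comm y (rsc t * m).
Proof. by move=> h; apply: commrM => //; exact: rsc_comm. Qed.

Lemma sqit_comm y w n : GRing.comm y w -> GRing.comm y (sqit w n).
Proof.
move=> h; elim: n => [|n ih] /=; first exact: commr0.
by apply: comm_rsc2; apply: commrD => //; exact: commrM.
Qed.

Lemma diff_sq m (n : multiplier X) : m * m - n * n = m * (m - n) + (m - n) * n.
Proof. by rewrite mulrBr mulrBl addrA subrK. Qed.

Lemma half_ge0 : 0 <= 2^-1 :> R. Proof. by rewrite invr_ge0. Qed.

(** The witness is d = 1 - sqrt (1 - w), the limit of [sqit]. The iterates are polynomials in w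
    without constant term, hence commute with whatever commutes with w and stay in X when w does;
    both properties are closed under limits. *)
Lemma sqrt1 w : madj w = w -> bnd w 1 -> exists d,
  [/\ madj d = d, bnd d 1, w + d * d = d + d,
      (forall y, GRing.comm y w -> GRing.comm y d) &
      (exists x, w = incl x) -> exists y, d = incl y].
Proof.
move=> wa w1.
have sa n : madj (sqit w n) = sqit w n.
  elim: n => [|n ih] /=; first exact: madj0.
  by rewrite madj_rscM madjD wa madjM ih.
have sb n : bnd (sqit w n) (sqr_ n).
  elim: n => [|n ih]; first exact: bnd0.
  rewrite /= -{2}(ger0_norm half_ge0); apply: bnd_rscM.
  by apply: bndD => //; apply: bndM.
have sd n : bnd (sqit w n.+1 - sqit w n) (sqr_ n.+1 - sqr_ n).
  elim: n => [|n ih].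
    rewrite [sqit w 0]/= [sqr_ 0]/= !subr0; exact: (sb 1%N).
  have -> : sqit w n.+2 - sqit w n.+1 =
      rsc 2^-1 * (sqit w n.+1 * sqit w n.+1 - sqit w n * sqit w n).
    by rewrite [LHS]/= -mulrBr; congr (_ * _); rewrite opprD addrACA subrr add0r.
  rewrite diff_sq.
  have -> : sqr_ n.+2 - sqr_ n.+1 = `|2^-1 : R| *
     (sqr_ n.+1 * (sqr_ n.+1 - sqr_ n) + (sqr_ n.+1 - sqr_ n) * sqr_ n).
    have E : sqr_ n.+1 = 2^-1 * (1 + sqr_ n * sqr_ n) by [].
    rewrite (ger0_norm half_ge0) -[sqr_ n.+2]/(2^-1 * (1 + sqr_ n.+1 * sqr_ n.+1)).
    by move: E; set s := sqr_ n.+1; set r := sqr_ n => E; lra.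
  by apply: bnd_rscM; apply: bndD; apply: bndM.
have [d hd] : exists d, forall n : nat, bnd (d - sqit w n) (1 - sqr_ n).
  by apply: bnd_limM sd _ => n; case/andP: (sqr_01 n).
have small c m : 0 <= c ->
    (forall n : nat, bnd m (c * (1 - sqr_ n))) -> m = 0.
  move=> c0 hm; apply: bnd_small => e e0.
  have c1 : 0 < c + 1 by rewrite ltr_wpDl.
  have [n hn] := sqr_lim (divr_gt0 e0 c1).
  apply: bnd_le (hm n) _; apply: (@le_trans _ _ (c * (e / (c + 1)))).
    by rewrite ler_wpM2l // ltW.
  by rewrite mulrCA ler_piMr ?ltW // ltr_pdivrMr // mul1r ltrDl.
have d1 : bnd d 1 by have := hd 0%N; rewrite /= !subr0.
have q0 n : 0 <= 1 - sqr_ n by rewrite subr_ge0; case/andP: (sqr_01 n).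
exists d; split=> //.
- apply/eqP; rewrite -subr_eq0; apply/eqP; apply: (small 2) => // n.
  rewrite (_ : _ - d = madj (d - sqit w n) - (d - sqit w n)).
    by apply: bnd_eqM; [apply: bndB; [apply: bnd_adj|]; exact: hd|lra].
  by rewrite madjB sa; zm.
- apply/eqP; rewrite -subr_eq0; apply/eqP; apply: (small 4) => // n.
  rewrite (_ : _ - (d + d) = (d * (d - sqit w n) + (d - sqit w n) * sqit w n)
     - rsc 2 * (d - sqit w n.+1)).
    apply: (@bnd_le _ _ _ ((1 * (1 - sqr_ n) + (1 - sqr_ n) * 1) + `|2| * (1 - sqr_ n.+1))).
      apply: bndB; last exact: bnd_rscM.
      apply: bndD; apply: bndM => //; apply: bnd_le (sb n) _.
      by case/andP: (sqr_01 n).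
    rewrite ger0_norm //= ; have := sqr_01 n => /andP[]; nra.
  rewrite -diff_sq /= mulrBr mulrA -rscM divff ?pnatr_eq0 // rsc1 mul1r.
  rewrite [rsc 2](_ : _ = 1 + 1); last by rewrite -rsc1 -rscD.
  by nc_ring.
- move=> y yw; have [t yt] := mult_bounded y.
  apply/eqP; rewrite -subr_eq0; apply/eqP; apply: (small (2 * t)).
    by case: yt => t0 _; rewrite mulr_ge0.
  move=> n; rewrite (_ : _ - _ = y * (d - sqit w n) - (d - sqit w n) * y).
    apply: bnd_eqM; first by apply: bndB; [apply: (bndM yt (hd n))|apply: (bndM (hd n) yt)].
    lra.
  have c : y * sqit w n = sqit w n * y by exact: sqit_comm.
  by rewrite mulrBr mulrBl c; nc_ring.
case=> w0 wE; apply: incl_closed => e e0.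
have [n hn] := sqr_lim e0.
have [s hs] : exists s, sqit w n = incl s.
  elim: (n) => [|k [s hs]] /=; first by exists 0; rewrite incl0.
  exists ((2^-1)%:C *: (w0 + s ** s)).
  by rewrite rscl inclZ inclD inclM -hs wE.
by exists s; rewrite -hs; apply: bnd_le (hd n) _; exact: ltW.
Qed.

(** The inequality |t - m| <= t says that the spectrum lies in [0, 2t]. In this form closure under
    sums is the triangle inequality. *)
Definition pos m := madj m = m /\ exists t, bnd (rsc t - m) t.

Lemma rscMA (s t : R) m : rsc s * (rsc t * m) = rsc (s * t) * m.
Proof. by rewrite mulrA rscM. Qed.

Lemma rsc_swap t m h : m * (rsc t * h) = rsc t * (m * h).
Proof. by rewrite !mulrA rsc_comm. Qed.

Lemma madj_sqr m : madj m = m -> madj (m * m) = m * m.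
Proof. by move=> h; rewrite madjM h. Qed.

Lemma sq_sqrt1 d w : w + d * d = d + d -> (1 - d) * (1 - d) = 1 - w.
Proof. by move=> h; rewrite -(addrK (d * d) w) h; nc_ring. Qed.

Lemma comm_1B y d : GRing.comm y d -> GRing.comm y (1 - d).
Proof. by move=> h; apply: commrB => //; exact: commr1. Qed.

Lemma pos0 : pos 0.
Proof. by split; [exact: madj0|exists 0; rewrite rsc0 subr0; exact: bnd0]. Qed.

(** For t > 0 the element w = 1 - m / t has norm at most 1, and the root is sqrt t (1 - d) with the
    d of [sqrt1]; for t = 0 the bound gives m = 0. *)
Lemma pos_sqrt m : pos m -> exists k,
  [/\ madj k = k, k * k = m, pos k & forall y, GRing.comm y m -> GRing.comm y k].
Proof.
move=> [ma [t mt]]; have t0 : 0 <= t by case: mt.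
have [tz|tn] := eqVneq t 0.
  have -> : m = 0.
    have : rsc t - m = 0 by apply: bnd_eq0; move: mt; rewrite tz.
    by rewrite tz rsc0 sub0r => /eqP; rewrite oppr_eq0 => /eqP.
  by exists 0; split; rewrite ?madj0 ?mulr0 //; exact: pos0.
have tp : 0 < t by rewrite lt_def tn.
pose w := 1 - rsc t^-1 * m.
have wE : w = rsc t^-1 * (rsc t - m) by rewrite mulrBr -rscM mulVf // rsc1.
have [||d [da d1 dd dc _]] := @sqrt1 w.
- by rewrite /w madjB madj1 madj_rscM ma.
- rewrite wE; apply: bnd_eqM; first by apply: bnd_rscM; exact: mt.
  by rewrite ger0_norm ?invr_ge0 // mulVf.
have rt := sqrtr_ge0 t; have rt2 : Num.sqrt t * Num.sqrt t = t by rewrite -expr2 sqr_sqrtr.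
exists (rsc (Num.sqrt t) * (1 - d)); split.
- by rewrite madj_rscM madjB madj1 da.
- rewrite -mulrA rsc_swap mulrA -rscM rt2 (sq_sqrt1 dd) /w opprB addrC subrK.
  by rewrite mulrA -rscM divff // rsc1 mul1r.
- split; first by rewrite madj_rscM madjB madj1 da.
  exists (Num.sqrt t); rewrite (_ : _ - _ = rsc (Num.sqrt t) * d).
    by apply: bnd_eqM; [apply: bnd_rscM; exact: d1|rewrite mulr1 ger0_norm].
  by nc_ring.
move=> y ym; apply: comm_rsc2; apply: comm_1B; apply: dc; apply: commrB.
  exact: commr1.
exact: comm_rsc2.
Qed.

Lemma half2 m : rsc 2^-1 * (m + m) = m.
Proof.
rewrite (_ : m + m = rsc 2 * m); last first.
  by rewrite -[2]/(1 + 1) rscD rsc1 mulrDl mul1r.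
by rewrite rscMA mulVf ?pnatr_eq0 // rsc1 mul1r.
Qed.

Lemma bnd_re m t : bnd m t -> bnd (rsc 2^-1 * (m + madj m)) t.
Proof.
move=> h; apply: bnd_eqM; first by apply: bnd_rscM; apply: bndD h (bnd_adj h).
by rewrite ger0_norm ?half_ge0 //; lra.
Qed.

Let I_ : multiplier X := 'i%C *: (1 : multiplier X).
Let I_M m : I_ * m = 'i%C *: m. Proof. by rewrite mscaleAl mul1r. Qed.
Let I_C m : m * I_ = I_ * m. Proof. by rewrite I_M mscaleAr mulr1. Qed.
Let I_adj : madj I_ = - I_.
Proof. by rewrite madjZ madj1 conj_iE scaleNr. Qed.
Let I_sq : I_ * I_ = - 1.
Proof. by rewrite I_M scalerA -expr2 sqr_i scaleN1r. Qed.

(* h + i k is unitary up to the scale t when h^2 + k^2 = t *)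
Lemma bnd_circle h k t : madj h = h -> madj k = k -> h * k = k * h ->
  0 <= t -> h * h + k * k = rsc t -> bnd h (Num.sqrt t).
Proof.
move=> ha ka hk t0 e; pose u := h + I_ * k.
have ua : madj u = h - I_ * k by rewrite madjD ha madjM ka I_adj mulrN I_C.
have u1 : bnd u (Num.sqrt t).
  apply: bnd_cs; rewrite ?sqrtr_ge0 // sqr_sqrtr //.
  rewrite ua mulrBl !mulrDr (_ : I_ * k * (I_ * k) = - (k * k)); last first.
    by rewrite mulrA -[I_ * k * I_]mulrA I_C mulrA I_sq mulN1r mulNr.
  rewrite (_ : h * (I_ * k) = I_ * (k * h)); last first.
    by rewrite mulrA I_C -mulrA hk.
  rewrite (_ : _ - _ = h * h + k * k); last by nc_ring.
  by rewrite e; apply: bnd_eqM (bnd_rsc _) _; rewrite ger0_norm.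
have -> : h = rsc 2^-1 * (u + madj u).
  by rewrite ua /u -[LHS]half2; congr (_ * _); nc_ring.
exact: bnd_re.
Qed.

(** [sqrt1] writes 1 - h^2 as a square k^2 with k commuting with h; then h^2 + k^2 = 1 bounds k by
    [bnd_circle]. *)
Lemma contr_1Bsq h : madj h = h -> bnd h 1 -> bnd (1 - h * h) 1.
Proof.
move=> ha h1.
have [||d [da d1 dd dc _]] := @sqrt1 (h * h).
- exact: madj_sqr.
- by apply: bnd_eqM; [apply: (bndM h1 h1)|rewrite mulr1].
have e := sq_sqrt1 dd; rewrite -e.
have hd : h * d = d * h by apply: dc; apply: commrM.
have ka : madj (1 - d) = 1 - d by rewrite madjB madj1 da.
suff k1 : bnd (1 - d) 1 by have := bndM k1 k1; rewrite mulr1.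
rewrite -(sqrtr1 R); apply: (@bnd_circle _ h) => //.
  by rewrite mulrBr mulrBl mulr1 mul1r hd.
by rewrite e rsc1 subrK.
Qed.

Lemma bnd_sub_sq h t : madj h = h -> bnd h t -> bnd (rsc (t * t) - h * h) (t * t).
Proof.
move=> ha ht; have t0 : 0 <= t by case: ht.
have [tz|tn] := eqVneq t 0.
  have -> : h = 0 by apply: bnd_eq0; rewrite tz in ht.
  rewrite mulr0 subr0; apply: bnd_eqM (bnd_rsc _) _.
  by rewrite ger0_norm ?mulr_ge0.
have : bnd (1 - (rsc t^-1 * h) * (rsc t^-1 * h)) 1.
  apply: contr_1Bsq; first by rewrite madj_rscM ha.
  apply: bnd_eqM; first by apply: bnd_rscM; exact: ht.
  by rewrite ger0_norm ?invr_ge0 // mulVf.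
move=> /(bnd_rscM (t * t)); rewrite mulr1 ger0_norm ?mulr_ge0 //.
rewrite mulrBr mulr1 -mulrA rsc_swap !rscMA.
by rewrite (_ : t * t * (t^-1 / t) = 1) ?rsc1 ?mul1r // mulrA mulfK // divff.
Qed.

Lemma pos_sq h : madj h = h -> pos (h * h).
Proof.
move=> ha; split; first exact: madj_sqr.
by have [t ht] := mult_bounded h; exists (t * t); exact: bnd_sub_sq.
Qed.

Lemma posD m h : pos m -> pos h -> pos (m + h).
Proof.
move=> [ma [t mt]] [ha [s hs]]; split; first by rewrite madjD ma ha.
exists (t + s); rewrite (_ : _ - _ = (rsc t - m) + (rsc s - h)); first exact: bndD.
by rewrite rscD; nc_ring.
Qed.

Lemma posZ t m : 0 <= t -> pos m -> pos (rsc t * m).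
Proof.
move=> t0 [ma [s ms]]; split; first by rewrite madj_rscM ma.
exists (t * s); rewrite rscM -mulrBr.
by apply: bnd_eqM; [apply: bnd_rscM; exact: ms|rewrite ger0_norm].
Qed.

Lemma pos_rsc t : 0 <= t -> pos (rsc t).
Proof.
move=> t0; split; first exact: madj_rsc.
by exists t; rewrite subrr; exact: bnd_le (@bnd0 _ _) _.
Qed.

Lemma pos_bndB m t : madj m = m -> bnd m t -> pos (rsc t - m).
Proof.
move=> ma mt; split; first by rewrite madjB madj_rsc ma.
by exists t; rewrite opprB addrC subrK.
Qed.

(** With m = k^2 and t - m = l^2 for commuting k and l, the pair lies on the circle of radius sqrt
    t, so |k| <= sqrt t and |m| <= t. *)
Lemma pos_le_bnd m t : 0 <= t -> pos m -> pos (rsc t - m) -> bnd m t.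
Proof.
move=> t0 /pos_sqrt[k [ka kk _ kc]] /pos_sqrt[l [la ll _ lc]].
have kl : k * l = l * k.
  apply: lc; apply: commrB; first exact: rsc_comm.
  by rewrite -kk; apply: commrM.
have : bnd k (Num.sqrt t).
  by apply: (@bnd_circle k l) => //; rewrite kk ll addrC subrK.
move=> b; rewrite -kk; apply: bnd_eqM; first exact: (bndM b b).
by rewrite -expr2 sqr_sqrtr.
Qed.

Lemma pos_mono m h t : pos m -> pos (h - m) -> bnd h t -> pos h -> bnd m t.
Proof.
move=> pm phm ht ph; apply: pos_le_bnd => //; first by case: ht.
rewrite -(subrK h (rsc t)) -addrA; apply: posD => //.
by apply: pos_bndB => //; case: ph.
Qed.

Lemma pos_anti m : pos m -> pos (- m) -> m = 0.
Proof.
by move=> pm nm; apply: bnd_eq0; apply: pos_le_bnd; rewrite ?rsc0 ?sub0r.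
Qed.

Lemma sq_eq0 h : madj h = h -> h * h = 0 -> h = 0.
Proof. by move=> ha hh; apply: madj_cs0; rewrite ha. Qed.

(** Twice the sum is x^2 + y^2, where x and y are the self-adjoint elements c + c^* and i c - i
    c^*. *)
Lemma pos_re_im c : pos (madj c * c + c * madj c).
Proof.
pose x := c + madj c; pose y := I_ * (c - madj c).
have xa : madj x = x by rewrite madjD madjK addrC.
have ya : madj y = y.
  by rewrite madjM I_adj madjB madjK mulrN I_C -mulrN opprB.
have yy : y * y = - ((c - madj c) * (c - madj c)).
  by rewrite /y mulrA -[I_ * _ * I_]mulrA I_C mulrA I_sq mulN1r mulNr.
have -> : madj c * c + c * madj c = rsc 2^-1 * (x * x + y * y).
  by rewrite yy -[LHS]half2; congr (_ * _); rewrite /x; nc_ring.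
by apply: posZ; [exact: half_ge0|apply: posD; exact: pos_sq].
Qed.

(** For c' = c h both c'^* c' and c' c'^* are negatives of squares of self-adjoint elements, while
    their sum is positive by [pos_re_im]. So both squares vanish, and the second is the square of c
    c^*. *)
Lemma neg_cs_eq0 c h : madj h = h -> madj c * c = - (h * h) -> c = 0.
Proof.
move=> ha e; pose c' := c * h; pose g := c * madj c.
have ga : madj g = g by rewrite madjM madjK.
have e1 : madj c' * c' = - ((h * h) * (h * h)).
  rewrite /c' madjM ha (_ : _ * _ = h * (madj c * c) * h); last by nc_ring.
  by rewrite e; nc_ring.
have e2 : c' * madj c' = - (g * g).
  rewrite madjM ha /c' /g (_ : _ * _ * _ = c * (h * h) * madj c); last by nc_ring.
  by rewrite -[h * h]opprK -e; nc_ring.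
have hh : madj (h * h) = h * h by exact: madj_sqr.
have := pos_re_im c'; rewrite e1 e2 => p.
have p1 := pos_sq hh; have p2 := pos_sq ga.
have z : (h * h) * (h * h) + g * g = 0.
  by apply: pos_anti; [exact: posD|rewrite opprD].
have gz : g * g = 0.
  apply: pos_anti => //; rewrite (_ : - _ = (h * h) * (h * h)) //.
  by apply/eqP; rewrite eq_sym -addr_eq0; apply/eqP.
have := sq_eq0 ga gz; rewrite /g -{1}[c]madjK => /madj_cs0 h0.
by rewrite -[c]madjK h0 madj0.
Qed.

(* Kelley-Vaught *)
Lemma pos_cs a : pos (madj a * a).
Proof.
pose x := madj a * a.
have xa : madj x = x by rewrite madjM madjK.
have [v [va vv pv vc]] := pos_sqrt (pos_sq xa).
have [k [ka kk _ kc]] := pos_sqrt pv.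
have xv : x * v = v * x by apply: vc; apply: commrM.
(* Here v = |x|, so u is twice the negative part of x. As u (v + x) = 0, the element u x u, which is
   the square of a u, equals - (k u)^2; [neg_cs_eq0] kills a u, and then u vanishes. *)
pose u := v - x.
have ua : madj u = u by rewrite madjB va xa.
have ku : k * u = u * k.
  apply/commr_sym/kc; rewrite /GRing.comm /u mulrBl mulrBr xv //.
have uvx : u * (v + x) = 0.
  by rewrite /u mulrBl !mulrDr vv xv; nc_ring.
have uxu : madj (a * u) * (a * u) = - ((k * u) * (k * u)).
  rewrite madjM ua {1}ku (_ : _ * _ = u * x * u); last first.
    by rewrite /x; nc_ring.
  apply/eqP; rewrite -addr_eq0; apply/eqP.
  transitivity (u * (v + x) * u); first by rewrite -kk; nc_ring.
  by rewrite uvx mul0r.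
have kua : madj (k * u) = k * u by rewrite madjM ua ka ku.
have au : a * u = 0 := neg_cs_eq0 kua uxu.
have ku0 : k * u = 0.
  apply: sq_eq0 => //; apply/eqP; rewrite -oppr_eq0 -uxu au.
  by rewrite mulr0.
have u0 : u = 0.
  apply: sq_eq0 => //; rewrite {1}/u mulrBl -kk -mulrA ku0 /x -mulrA au.
  by rewrite !mulr0 subrr.
by rewrite -/x (_ : x = v) //; apply/eqP; rewrite eq_sym -subr_eq0 -/u u0.
Qed.

(** Turns a norm bound into an algebraic identity. Whatever preserves the identity, such as a
    homomorphism or a positive functional, carries the bound along. *)
Lemma bnd_compl m t : bnd m t -> exists2 g, madj g = g &
  madj m * m + g * g = rsc (t * t).
Proof.
move=> mt; have mm : bnd (madj m * m) (t * t) by apply: bndM => //; exact: bnd_adj.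
have p : pos (rsc (t * t) - madj m * m).
  by apply: pos_bndB => //; rewrite madjM madjK.
by have [g [ga gg _ _]] := pos_sqrt p; exists g => //; rewrite gg addrC subrK.
Qed.

End Positivity.

Section PositivityAlg.
Variables (R : realType) (X : cstar R).
Implicit Types (x y z : X).

Definition cpos x := pos (incl x).

Lemma cposD x y : cpos x -> cpos y -> cpos (x + y).
Proof. by rewrite /cpos inclD; exact: posD. Qed.

Lemma cpos_cs x : cpos (cadj x ** x).
Proof. by rewrite /cpos inclM incl_adj; exact: pos_cs. Qed.

Lemma cpos_mono x y : cpos x -> cpos y -> cpos (y - x) -> nr x <= nr y.
Proof.
move=> px py pxy; apply: bnd_incl_le; apply: pos_mono py => //.
  by rewrite -inclB.
exact: bnd_incl.
Qed.

(* The hypothesis is the operator inequality x^*x <= t^2 z^*z *)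
Lemma nr_dom x y z (t : R) : 0 <= t ->
  cadj x ** x + cadj y ** y = (t ^+ 2)%:C *: (cadj z ** z) -> nr x <= t * nr z.
Proof.
move=> t0 e.
rewrite -(@ler_pXn2r _ 2) ?nnegrE ?nr_ge0 ?mulr_ge0 ?nr_ge0 // exprMn -!nr_cs.
rewrite -[t ^+ 2]ger0_norm ?exprn_ge0 // -nrZr -e; apply: cpos_mono.
- exact: cpos_cs.
- by apply: cposD; exact: cpos_cs.
by rewrite addrC addKr; exact: cpos_cs.
Qed.

End PositivityAlg.

(** * Completeness of R and R[i] *)

Section ComplexComplete.
Variable R : realType.

Lemma cau_limR (u : nat -> R) :
  (forall e, 0 < e -> exists N, forall m n, (N <= m)%N -> (N <= n)%N ->
    `|u m - u n| < e) ->
  exists l, forall e, 0 < e -> exists N, forall n, (N <= n)%N -> `|u n - l| < e.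
Proof.
move=> h.
have cvu : cvg ((u : nat -> R^o) @ \oo).
  apply: cauchy_cvg; apply: cauchy_exP => e e0.
  have [N hN] := h _ e0; exists (u N); exists N => // n /= Nn.
  by rewrite -ball_normE /ball_ /= hN.
exists (lim ((u : nat -> R^o) @ \oo)) => e e0.
move/cvgrPdist_lt: cvu => /(_ e e0)[N _ hN].
by exists N => n Nn; have := hN n Nn; rewrite distrC.
Qed.

Lemma nc_le_ReIm (z : R[i]) : nc z <= `|Re z| + `|Im z|.
Proof.
rewrite {1}[z]complexE; apply: le_trans (ncD _ _) _.
by rewrite ncM nc_i mul1r !nc_real.
Qed.

Lemma nc_Im (z : R[i]) : `|Im z| <= nc z.
Proof.
have := nc_Re ('i%C * z); rewrite ncM nc_i mul1r mulrC ReiNIm.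
by rewrite normrN.
Qed.

Lemma ncN (z : R[i]) : nc (- z) = nc z.
Proof. by rewrite /nc normrN. Qed.

Lemma nc0 : nc (0 : R[i]) = 0.
Proof. by rewrite /nc normr0. Qed.

Lemma ncC (z w : R[i]) : nc (z - w) = nc (w - z).
Proof. by rewrite -ncN opprB. Qed.

Lemma nc_tri (y x z : R[i]) : nc (x - z) <= nc (x - y) + nc (y - z).
Proof. by rewrite -[x - z](subrKA y) ncD. Qed.

Lemma nc_small (z : R[i]) : (forall e, 0 < e -> nc z <= e) -> z = 0.
Proof.
move=> h; apply: nc_eq0; apply/eqP; rewrite eq_le nc_ge0 andbT.
by apply/ler_addgt0Pr => e e0; rewrite add0r h.
Qed.

Lemma cau_limC (u : nat -> R[i]) :
  (forall e, 0 < e -> exists N, forall m n, (N <= m)%N -> (N <= n)%N ->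
    nc (u m - u n) < e) ->
  exists l, forall e, 0 < e -> exists N, forall n, (N <= n)%N -> nc (u n - l) < e.
Proof.
move=> h.
have [|a ha] := @cau_limR (fun n => Re (u n)).
  move=> e /h[N hN]; exists N => m n Nm Nn; apply: le_lt_trans (hN _ _ Nm Nn).
  by apply: le_trans (nc_Re _); rewrite raddfB.
have [|b hb] := @cau_limR (fun n => Im (u n)).
  move=> e /h[N hN]; exists N => m n Nm Nn; apply: le_lt_trans (hN _ _ Nm Nn).
  by apply: le_trans (nc_Im _); rewrite raddfB.
exists (a +i* b) => e e0; have e2 : 0 < e / 2 by rewrite divr_gt0.
have [N hN] := ha _ e2; have [M hM] := hb _ e2.
exists (maxn N M) => n; rewrite geq_max => /andP[/hN h1 /hM h2].
apply: le_lt_trans (nc_le_ReIm _) _; rewrite !raddfB /=; lra.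
Qed.

Lemma inv_small (e : R) : 0 < e -> exists N, forall n, (N <= n)%N -> n.+1%:R^-1 < e.
Proof.
move=> e0; exists (Num.truncn e^-1) => n hn.
rewrite invf_plt ?posrE ?ltr0Sn // (lt_le_trans (truncnS_gt _)) //.
by rewrite ler_nat.
Qed.

End ComplexComplete.

(** * Completion of pre-Hilbert spaces *)

Record prehilb (R : realType) := Prehilb {
  pv :> lmodType R[i];
  ps : pv -> pv -> R[i];
  ps_lin : forall y, linear (ps^~ y : pv -> R[i]^o);
  ps_conj : forall x y, ps y x = ((ps x y)^*)%R;
  ps_ge0 : forall x, 0 <= ps x x
}.

Section Prehilb.
Variables (R : realType) (P : prehilb R).
Implicit Types (x y z : P) (k : R[i]).
Local Notation s := (@ps R P).

Lemma psD x y z : s (x + y) z = s x z + s y z.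
Proof. by have := ps_lin z 1 x y; rewrite !scale1r. Qed.
Lemma ps0l z : s 0 z = 0.
Proof. by apply: (addrI (s 0 z)); rewrite -psD !addr0. Qed.
Lemma psZ k x z : s (k *: x) z = k * s x z.
Proof. by have := ps_lin z k x 0; rewrite !addr0 ps0l addr0. Qed.
Lemma psDr x y z : s x (y + z) = s x y + s x z.
Proof. by rewrite ps_conj psD rmorphD /= -!ps_conj. Qed.
Lemma psZr k x y : s x (k *: y) = (k^*)%R * s x y.
Proof. by rewrite ps_conj psZ rmorphM /= -ps_conj. Qed.
Lemma psN x z : s (- x) z = - s x z.
Proof. by rewrite -scaleN1r psZ mulN1r. Qed.
Lemma psNr x z : s x (- z) = - s x z.
Proof. by rewrite -scaleN1r psZr rmorphN rmorph1 mulN1r. Qed.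
Lemma psB x y z : s (x - y) z = s x z - s y z.
Proof. by rewrite psD psN. Qed.
Lemma psBr x y z : s x (y - z) = s x y - s x z.
Proof. by rewrite psDr psNr. Qed.

Definition q2 x : R := Re (s x x).
Definition q x : R := Num.sqrt (q2 x).

Lemma q2E x : s x x = (q2 x)%:C. Proof. by case: (ge0_realE (ps_ge0 x)). Qed.
Lemma q2_ge0 x : 0 <= q2 x. Proof. by case: (ge0_realE (ps_ge0 x)). Qed.
Lemma q_ge0 x : 0 <= q x. Proof. exact: sqrtr_ge0. Qed.
Lemma q_sqr x : q x ^+ 2 = q2 x. Proof. by rewrite sqr_sqrtr ?q2_ge0. Qed.

Lemma cauchy_schwarz x y : nc (s x y) <= q x * q y.
Proof.
rewrite -(@ler_pXn2r _ 2) ?nnegrE ?nc_ge0 ?mulr_ge0 ?q_ge0 // exprMn !q_sqr.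
set m := nc (s x y) ^+ 2.
have m0 : 0 <= m by rewrite exprn_ge0 ?nc_ge0.
(* The squared length of x - t <x, y> y. Below, t is the optimal value or, when y is null, a value
   that makes the expression negative. *)
have key (t : R) : 0 <= q2 x - 2 * t * m + t ^+ 2 * m * q2 y.
  pose c := t%:C * s x y.
  have := ps_ge0 (x - c *: y).
  rewrite psB psZ !psBr !psZr !q2E (ps_conj x y) rmorphM /= conj_real.
  have -> : (q2 x)%:C - t%:C * ((s x y)^*)%R * s x y -
      t%:C * s x y * (((s x y)^*)%R - t%:C * ((s x y)^*)%R * (q2 y)%:C) =
      (q2 x)%:C - 2 * t%:C * (s x y * ((s x y)^*)%R)
      + t%:C ^+ 2 * (s x y * ((s x y)^*)%R) * (q2 y)%:C by ring.
  rewrite -nc_sqr -/m -[2](rmorph_nat (real_complex R)).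
  by rewrite -!rmorphXn -!rmorphM -rmorphB -rmorphD /= ler0c.
have [y0|yn] := eqVneq (q2 y) 0.
  rewrite y0 mulr0; have [->//|mn] := eqVneq m 0.
  have := key ((q2 x + 1) / (2 * m)); rewrite y0 mulr0 addr0.
  rewrite (_ : 2 * _ * m = q2 x + 1); first by lra.
  by field.
have yp : 0 < q2 y by rewrite lt_def yn q2_ge0.
have := key (q2 y)^-1.
rewrite (_ : _ + _ = q2 x - m / q2 y); last by field.
by rewrite subr_ge0 ler_pdivrMr.
Qed.

Lemma q0 : q 0 = 0.
Proof. by rewrite /q /q2 ps0l sqrtr0. Qed.

Lemma qZ k x : q (k *: x) = nc k * q x.
Proof.
have h : q2 (k *: x) = nc k ^+ 2 * q2 x.
  apply: complexI; rewrite -q2E psZ psZr q2E rmorphM /= nc_sqr; ring.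
by rewrite /q h sqrtrM ?exprn_ge0 ?nc_ge0 // sqrtr_sqr ger0_norm ?nc_ge0.
Qed.

(* The completion consists of the conjugate-linear functionals y |-> <f, y>
   which are norm limits of the functionals s x. *)
Definition hset (f : P -> R[i]) :=
  (forall k y z, f (k *: y + z) = (k^*)%R * f y + f z) /\
  (forall e, 0 < e -> exists x, forall y, nc (f y - s x y) <= e * q y).

Record hcomp := Hcomp { hf :> P -> R[i]; hfP : hset hf }.

HB.instance Definition _ := gen_eqMixin hcomp.
HB.instance Definition _ := gen_choiceMixin hcomp.

Lemma hcomp_eq (f g : hcomp) : f =1 g -> f = g.
Proof.
case: f g => [f hf] [g hg] /= /funext e; subst g; congr Hcomp.
exact: Prop_irrelevance.
Qed.

Lemma hset_lin k f g : hset f -> hset g -> hset (fun y => k * f y + g y).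
Proof.
move=> [fl fa] [gl ga]; split=> [l y z|e e0]; first by rewrite fl gl; ring.
have k1 : 0 < nc k + 1 by rewrite ltr_wpDl ?nc_ge0.
have [x hx] := fa (e / 2 / (nc k + 1)) ltac:(by rewrite !divr_gt0).
have [x' hx'] := ga (e / 2) ltac:(by rewrite divr_gt0).
exists (k *: x + x') => y; rewrite psD psZ.
rewrite (_ : _ - _ = k * (f y - s x y) + (g y - s x' y)); last by ring.
apply: le_trans (ncD _ _) _; rewrite ncM.
have h1 : nc k * nc (f y - s x y) <= e / 2 * q y.
  apply: le_trans (ler_wpM2l (nc_ge0 k) (hx y)) _.
  rewrite mulrA ler_wpM2r ?q_ge0 // mulrCA ler_piMr ?divr_ge0 ?ltW //.
  by rewrite ltr_pdivrMr // mul1r ltrDl.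
have := hx' y; lra.
Qed.

Lemma hset_iota x : hset (s x).
Proof.
split=> [k y z|e e0]; first by rewrite psDr psZr.
by exists x => y; rewrite subrr nc0 mulr_ge0 ?q_ge0 // ltW.
Qed.

Lemma hset0 : hset (fun=> 0).
Proof.
split=> [k y z|e e0]; first by rewrite mulr0 addr0.
by exists 0 => y; rewrite ps0l subrr nc0 mulr_ge0 ?q_ge0 // ltW.
Qed.

Fact hadd_subproof (f g : hcomp) : hset (fun y => f y + g y).
Proof.
have := @hset_lin 1 f g (hfP f) (hfP g).
by rewrite (_ : (fun y => 1 * f y + g y) = fun y => f y + g y) //; apply/funext => y; rewrite mul1r.
Qed.
Fact hscale_subproof k (f : hcomp) : hset (fun y => k * f y).
Proof.
have := @hset_lin k f (fun=> 0) (hfP f) hset0.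
by rewrite (_ : (fun y => k * f y + 0) = fun y => k * f y) //; apply/funext => y; rewrite addr0.
Qed.

Definition hadd f g := Hcomp (hadd_subproof f g).
Definition hscale k f := Hcomp (hscale_subproof k f).
Definition hzero := Hcomp hset0.
Definition hopp f := hscale (-1) f.

Fact haddA : associative hadd.
Proof. by move=> f g h; apply: hcomp_eq => y /=; rewrite addrA. Qed.
Fact haddC : commutative hadd.
Proof. by move=> f g; apply: hcomp_eq => y /=; rewrite addrC. Qed.
Fact hadd0 : left_id hzero hadd.
Proof. by move=> f; apply: hcomp_eq => y /=; rewrite add0r. Qed.
Fact haddN : left_inverse hzero hopp hadd.
Proof. by move=> f; apply: hcomp_eq => y /=; rewrite mulN1r addNr. Qed.

HB.instance Definition _ := GRing.isZmodule.Build hcomp haddA haddC hadd0 haddN.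

Fact hscaleA a b f : hscale a (hscale b f) = hscale (a * b) f.
Proof. by apply: hcomp_eq => y /=; rewrite mulrA. Qed.
Fact hscale1 : left_id 1 hscale.
Proof. by move=> f; apply: hcomp_eq => y /=; rewrite mul1r. Qed.
Fact hscaleDr : right_distributive hscale +%R.
Proof. by move=> k f g; apply: hcomp_eq => y /=; rewrite mulrDr. Qed.
Fact hscaleDl f : {morph hscale^~ f : a b / a + b}.
Proof. by move=> a b; apply: hcomp_eq => y /=; rewrite mulrDl. Qed.

HB.instance Definition _ := GRing.Zmodule_isLmodule.Build R[i] hcomp
  hscaleA hscale1 hscaleDr hscaleDl.

Lemma hfD (f g : hcomp) y : (f + g) y = f y + g y. Proof. by []. Qed.
Lemma hfZ k (f : hcomp) y : (k *: f) y = k * f y. Proof. by []. Qed.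
Lemma hfN (f : hcomp) y : (- f) y = - f y. Proof. by rewrite /= mulN1r. Qed.
Lemma hfB (f g : hcomp) y : (f - g) y = f y - g y. Proof. by rewrite hfD hfN. Qed.

Definition iota x : hcomp := Hcomp (hset_iota x).

Definition hbnds (f : hcomp) : set R :=
  [set M | 0 <= M /\ forall y, nc (f y) <= M * q y].
Definition hN (f : hcomp) : R := inf (hbnds f).

Lemma hbnds_inf f : has_inf (hbnds f).
Proof.
split; last by exists 0 => M [].
have [x hx] := proj2 (hfP f) 1 ltr01.
exists (1 + q x); split; first by rewrite addr_ge0 ?q_ge0.
move=> y; rewrite -[f y](subrK (s x y)); apply: le_trans (ncD _ _) _.
by rewrite mulrDl lerD ?cauchy_schwarz.
Qed.

Lemma hN_ge0 f : 0 <= hN f.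
Proof. by apply: lb_le_inf; [exact: (proj1 (hbnds_inf f))|move=> M []]. Qed.

Lemma hN_le (f : hcomp) y : nc (f y) <= hN f * q y.
Proof.
have [y0|yn] := eqVneq (q y) 0.
  have [M [_ hM]] := proj1 (hbnds_inf f); apply: le_trans (hM y) _.
  by rewrite y0 !mulr0.
have yp : 0 < q y by rewrite lt_def yn q_ge0.
rewrite -ler_pdivrMr //; apply: lb_le_inf; first exact: (proj1 (hbnds_inf f)).
by move=> M [_ hM]; rewrite ler_pdivrMr.
Qed.

Lemma hN_lub (f : hcomp) M : 0 <= M -> (forall y, nc (f y) <= M * q y) -> hN f <= M.
Proof. by move=> M0 h; apply: inf_lbound; [exact: (proj2 (hbnds_inf f))|split]. Qed.

Lemma hND f g : hN (f + g) <= hN f + hN g.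
Proof.
apply: hN_lub; first by rewrite addr_ge0 ?hN_ge0.
by move=> y; apply: le_trans (ncD _ _) _; rewrite mulrDl lerD ?hN_le.
Qed.

Lemma hNZ k f : hN (k *: f) = nc k * hN f.
Proof.
have le l g : hN (l *: g) <= nc l * hN g.
  apply: hN_lub; first by rewrite mulr_ge0 ?hN_ge0 ?nc_ge0.
  by move=> y; rewrite hfZ ncM -mulrA ler_wpM2l ?nc_ge0 ?hN_le.
apply/eqP; rewrite eq_le le /=.
have [->|k0] := eqVneq k 0; first by rewrite nc0 mul0r hN_ge0.
have := le k^-1 (k *: f); rewrite scalerA mulVf // scale1r => h.
have kp : 0 < nc k.
  by rewrite lt_def nc_ge0 andbT; apply/eqP => /nc_eq0 /eqP; rewrite (negbTE k0).
apply: le_trans (ler_wpM2l (ltW kp) h) _.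
by rewrite mulrA -ncM divff // /nc normr1 mul1r.
Qed.

Lemma hN_eq0 f : hN f = 0 -> f = 0.
Proof.
move=> h; apply: hcomp_eq => y /=; apply: nc_eq0; apply/eqP.
by rewrite eq_le nc_ge0 andbT -[leRHS](mul0r (q y)) -h hN_le.
Qed.

Lemma hN_iota x : hN (iota x) = q x.
Proof.
apply/eqP; rewrite eq_le; apply/andP; split.
  by apply: hN_lub; [exact: q_ge0|move=> y; exact: cauchy_schwarz].
have [->|xn] := eqVneq (q x) 0; first exact: hN_ge0.
have xp : 0 < q x by rewrite lt_def xn q_ge0.
have := hN_le (iota x) x; rewrite /= q2E nc_real ger0_norm ?q2_ge0 //.
by rewrite -q_sqr expr2 ler_pM2r.
Qed.

Definition hnorm (f : hcomp) : R[i] := (hN f)%:C.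

Fact hnormD f g : hnorm (f + g) <= hnorm f + hnorm g.
Proof. by rewrite /hnorm -rmorphD /= lecR hND. Qed.
Fact hnormZ k f : hnorm (k *: f) = `|k| * hnorm f.
Proof. by rewrite /hnorm hNZ rmorphM /= ncE. Qed.
Fact hnorm_eq0 f : hnorm f = 0 -> f = 0.
Proof. by move=> /complexI; exact: hN_eq0. Qed.

HB.instance Definition _ := Lmodule_isNormed.Build R[i] hcomp hnormD hnormZ hnorm_eq0.

Lemma hnrE (f : hcomp) : nr f = hN f.
Proof. by []. Qed.

Lemma hcomp_seq (u : nat -> hcomp) : cau u -> exists l, clim u l.
Proof.
move=> cu.
have /choice[f hfl] : forall y, exists l, forall e, 0 < e -> exists N, forall n,
    (N <= n)%N -> nc (u n y - l) < e.
  move=> y; apply: cau_limC => e e0.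
  have q1 : 0 < q y + 1 by rewrite ltr_wpDl ?q_ge0.
  have [N hN_] := cu _ (divr_gt0 e0 q1); exists N => m n Nm Nn.
  rewrite -hfB; apply: le_lt_trans (hN_le _ _) _.
  have := hN_ _ _ Nm Nn; rewrite hnrE => h.
  apply: (@le_lt_trans _ _ (hN (u m - u n) * (q y + 1))).
    by rewrite ler_wpM2l ?hN_ge0 // lerDl.
  by rewrite -ltr_pdivlMr.
have close e : 0 < e -> exists N, forall n, (N <= n)%N -> forall y,
    nc (u n y - f y) <= e * q y.
  move=> e0; have [N hN_] := cu _ e0; exists N => n Nn y.
  apply/ler_addgt0Pr => d d0; have [M hM] := hfl y _ d0.
  apply: le_trans (nc_tri (u (maxn N M) y) _ _) _; apply: lerD.
    rewrite -hfB; apply: le_trans (hN_le _ _) _.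
    by rewrite ler_wpM2r ?q_ge0 // -hnrE ltW // hN_ ?leq_maxl.
  by rewrite ltW // hM ?leq_maxr.
have hs : hset f.
  split=> [k y z|e e0].
    apply/eqP; rewrite -subr_eq0; apply/eqP; apply: nc_small => e e0.
    set w := k *: y + z.
    pose c := q w + nc k * q y + q z.
    have c0 : 0 <= c by rewrite !addr_ge0 ?mulr_ge0 ?q_ge0 ?nc_ge0.
    have c1 : 0 < c + 1 by rewrite ltr_wpDl.
    have [N hN_] := close _ (divr_gt0 e0 c1); have {}hN_ := hN_ N (leqnn N).
    have E := proj1 (hfP (u N)) k y z.
    rewrite (_ : _ - _ = - (u N w - f w) + (k^*)%R * (u N y - f y) + (u N z - f z)); last first.
      by rewrite /w E; ring.
    apply: le_trans (ncD _ _) _; apply: (@le_trans _ _ (e / (c + 1) * c)).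
      have -> : e / (c + 1) * c = e / (c + 1) * q w + e / (c + 1) * (nc k * q y)
          + e / (c + 1) * q z by rewrite -!mulrDr.
      apply: lerD => //; apply: le_trans (ncD _ _) _.
      apply: lerD; first by rewrite ncN.
      by rewrite ncM nc_conj mulrCA ler_wpM2l ?nc_ge0.
    rewrite -mulrA ler_piMr ?ltW // mulrC ltr_pdivrMr // mul1r.
    by rewrite ltrDl.
  have e2 : 0 < e / 2 by rewrite divr_gt0.
  have [N hN_] := close _ e2; have [x hx] := proj2 (hfP (u N)) _ e2.
  exists x => y; apply: le_trans (nc_tri (u N y) _ _) _.
  have := hx y; have := hN_ N (leqnn N) y; rewrite ncC; lra.
exists (Hcomp hs) => e e0; have e2 : 0 < e / 2 by rewrite divr_gt0.
have [N hN_] := close _ e2; exists N => n Nn; rewrite hnrE.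
apply: (@le_lt_trans _ _ (e / 2)); last lra.
by apply: hN_lub; [exact: ltW|move=> y; rewrite hfB; exact: hN_].
Qed.

(** Reduction to sequences: centres of balls of radius 1 / (n + 1) belonging to F form a Cauchy
    sequence, and F converges to its limit. *)
Fact hcomp_complete (F : set_system hcomp) : ProperFilter F -> cauchy F -> cvg F.
Proof.
move=> FF /cauchyP cF.
have e0 n : (0 : R[i]) < (n.+1%:R^-1 : R)%:C by rewrite ltc0R invr_gt0 ltr0Sn.
have /choice[u hu] : forall n : nat, exists x : hcomp, F (ball x ((n.+1%:R^-1 : R)%:C)).
  by move=> n; exact: cF.
have near m n : nr (u m - u n) < m.+1%:R^-1 + n.+1%:R^-1.
  have [z [zm zn]] := filter_ex (filterI (hu m) (hu n)).
  apply: le_lt_trans (nr_tri z _ _) _; apply: ltrD.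
    by move: zm; rewrite -ball_normE /ball_ /= nrE ltcR.
  by move: zn; rewrite -ball_normE /ball_ /= nrE ltcR nrC.
have [|l hl] := @hcomp_seq u.
  move=> e e1; have [|N hN_] := @inv_small _ (e / 2); first by rewrite divr_gt0.
  exists N => m n Nm Nn; apply: lt_trans (near _ _) _.
  by rewrite [ltRHS]splitr ltrD ?hN_.
apply/cvg_ex; exists l; apply/cvgrPdist_lt => e e1.
have e0r : 0 < Re e by move: e1; rewrite ltcE => /andP[].
have eE : e = (Re e)%:C by apply: (proj1 (ge0_realE _)); exact: ltW.
have e2 : 0 < Re e / 2 by rewrite divr_gt0.
have [N hN_] := @inv_small _ _ e2; have [M hM] := hl _ e2.
pose n := maxn N M.
apply: filterS (hu n) => z; rewrite -ball_normE /ball_ /= !nrE eE !ltcR => zn.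
apply: le_lt_trans (nr_tri (u n) _ _) _; rewrite [ltRHS]splitr ltrD //.
  by rewrite nrC hM ?leq_maxr.
by apply: lt_trans zn _; rewrite hN_ ?leq_maxl.
Qed.

HB.instance Definition _ := Uniform_isComplete.Build hcomp hcomp_complete.

Lemma iota_dense (f : hcomp) e : 0 < e -> exists x, hN (f - iota x) <= e.
Proof.
move=> e0; have [x hx] := proj2 (hfP f) _ e0; exists x.
by apply: hN_lub; [exact: ltW|move=> y; rewrite hfB; exact: hx].
Qed.

Lemma iotaB x y : iota x - iota y = iota (x - y).
Proof. by apply: hcomp_eq => z; rewrite hfB /= psB. Qed.

Lemma hf_sub (f : hcomp) x y : f (x - y) = f x - f y.
Proof.
have := proj1 (hfP f) (-1) y x; rewrite rmorphN rmorph1 !mulN1r scaleN1r.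
by rewrite addrC => ->; rewrite addrC.
Qed.

(** f y is the product of f with [iota y], and it has a limit as [iota y] tends to g. The estimate
    is Cauchy-Schwarz for f and g - [iota y]; it determines the limit. *)
Lemma ip_ex (f g : hcomp) : exists c, forall y, nc (c - f y) <= hN f * hN (g - iota y).
Proof.
have /choice[y hy] : forall n : nat, exists y, hN (g - iota y) <= n.+1%:R^-1.
  by move=> n; apply: iota_dense; rewrite invr_gt0 ltr0Sn.
have tri a b : q (a - b) <= hN (g - iota a) + hN (g - iota b).
  rewrite -hN_iota -iotaB (_ : _ - _ = (g - iota b) - (g - iota a)); last by zm.
  by rewrite -!hnrE [leRHS]addrC; exact: nrB.
have [|c hc] := @cau_limC _ (fun n => f (y n)).
  move=> e e0; have f1 : 0 < hN f + 1 by rewrite ltr_wpDl ?hN_ge0.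
  have [N hN_] := @inv_small _ (e / (hN f + 1) / 2) ltac:(by rewrite !divr_gt0).
  exists N => m n Nm Nn; rewrite -hf_sub; apply: le_lt_trans (hN_le _ _) _.
  have qs : q (y m - y n) < e / (hN f + 1).
    apply: le_lt_trans (tri _ _) _; rewrite [ltRHS]splitr.
    by apply: ltrD; apply: le_lt_trans (hy _) (hN_ _ _).
  apply: (@le_lt_trans _ _ ((hN f + 1) * q (y m - y n))).
    by rewrite ler_wpM2r ?q_ge0 // lerDl.
  by rewrite mulrC -ltr_pdivlMr.
exists c => z; apply/ler_addgt0Pr => e e0.
have f1 : 0 < hN f + 1 by rewrite ltr_wpDl ?hN_ge0.
have e2 : 0 < e / 2 by rewrite divr_gt0.
have [N hN_] := @inv_small _ (e / 2 / (hN f + 1)) ltac:(by rewrite !divr_gt0).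
have [M hM] := hc _ e2; pose n := maxn N M.
apply: le_trans (nc_tri (f (y n)) _ _) _.
have h1 : nc (c - f (y n)) <= e / 2 by rewrite ncC ltW // hM ?leq_maxr.
have h2 : nc (f (y n) - f z) <= hN f * (n.+1%:R^-1 + hN (g - iota z)).
  rewrite -hf_sub; apply: le_trans (hN_le _ _) _; rewrite ler_wpM2l ?hN_ge0 //.
  by apply: le_trans (tri _ _) _; rewrite lerD2r.
have h3 : hN f * n.+1%:R^-1 <= e / 2.
  apply: (@le_trans _ _ ((hN f + 1) * n.+1%:R^-1)).
    by rewrite ler_wpM2r ?invr_ge0 // lerDl.
  by rewrite mulrC -ler_pdivlMr // ltW // hN_ ?leq_maxl.
apply: le_trans (lerD h1 h2) _; rewrite mulrDr addrA [leRHS]addrC lerD2r [leRHS]splitr.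
by apply: lerD.
Qed.

Definition hip (f g : hcomp) : R[i] := projT1 (cid (ip_ex f g)).

Lemma hipP f g y : nc (hip f g - f y) <= hN f * hN (g - iota y).
Proof. by rewrite /hip; case: cid => c /=. Qed.

Lemma hN0 : hN 0 = 0.
Proof. by rewrite -hnrE nr0. Qed.

Lemma hip_iota f x : hip f (iota x) = f x.
Proof.
apply/eqP; rewrite -subr_eq0; apply/eqP; apply: nc_small => e e0.
by apply: le_trans (hipP _ _ x) _; rewrite subrr hN0 mulr0 ltW.
Qed.

Fact hip_lin g : linear (hip^~ g : hcomp -> R[i]^o).
Proof.
move=> k f f'; apply/eqP; rewrite -subr_eq0; apply/eqP; apply: nc_small => e e0.
rewrite /GRing.scale /=; set w := k *: f + f'.
pose c := hN w + nc k * hN f + hN f'.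
have c0 : 0 <= c by rewrite !addr_ge0 ?mulr_ge0 ?hN_ge0 ?nc_ge0.
have c1 : 0 < c + 1 by rewrite ltr_wpDl.
have [y hy] := iota_dense g (divr_gt0 e0 c1).
rewrite (_ : _ - _ = (hip w g - w y) - k * (hip f g - f y) - (hip f' g - f' y)); last first.
  by rewrite /w hfD hfZ; ring.
apply: le_trans (ncD _ _) _; rewrite ncN.
apply: (@le_trans _ _ (c * hN (g - iota y))).
  rewrite /c !mulrDl; apply: lerD; last exact: hipP.
  apply: le_trans (ncD _ _) _; rewrite ncN ncM -mulrA lerD ?hipP //.
  by rewrite ler_wpM2l ?nc_ge0 ?hipP.
apply: le_trans (ler_wpM2l c0 hy) _.
by rewrite mulrCA ler_piMr ?ltW // ltr_pdivrMr // mul1r ltrDl.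
Qed.

Fact hip_conj f g : hip g f = ((hip f g)^*)%R.
Proof.
apply/eqP; rewrite -subr_eq0; apply/eqP; apply: nc_small => e e0.
pose c := hN g + hN f + 1.
have c1 : 0 < c by rewrite ltr_wpDl ?addr_ge0 ?hN_ge0.
pose d := Num.min 1 (e / 4 / (c + 1)).
have d0 : 0 < d by rewrite lt_min ltr01 !divr_gt0 // addr_gt0.
have d1 : d <= 1 by rewrite ge_min lexx.
have dc : d * (c + 1) <= e / 4.
  have dle : d <= e / 4 / (c + 1) by rewrite /d ge_min lexx orbT.
  have c2 : 0 < c + 1 by rewrite addr_gt0.
  by rewrite -(ler_pdivlMr _ _ c2).
have [x hx] := iota_dense f d0; have [y hy] := iota_dense g d0.
have h1 : nc (hip g f - g x) <= c * d.
  apply: le_trans (hipP g f x) _; apply: ler_pM => //; rewrite ?hN_ge0 // /c.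
  by have := hN_ge0 f; lra.
have h2 : nc (hip f g - f y) <= c * d.
  apply: le_trans (hipP f g y) _; apply: ler_pM => //; rewrite ?hN_ge0 // /c.
  by have := hN_ge0 g; lra.
have qx : q x <= hN f + d.
  rewrite -hN_iota -!hnrE; apply: le_trans (nr_le_sub _ f) _.
  by rewrite lerD2l nrC hnrE.
have qy : q y <= hN g + d.
  rewrite -hN_iota -!hnrE; apply: le_trans (nr_le_sub _ g) _.
  by rewrite lerD2l nrC hnrE.
have h3 : nc (g x - s y x) <= d * c.
  rewrite -[s y x]/(iota y x) -hfB; apply: le_trans (hN_le _ _) _.
  apply: ler_pM; rewrite ?hN_ge0 ?q_ge0 //.
  by rewrite /c; have := hN_ge0 g; lra.
have h4 : nc (f y - s x y) <= d * c.
  rewrite -[s x y]/(iota x y) -hfB; apply: le_trans (hN_le _ _) _.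
  apply: ler_pM; rewrite ?hN_ge0 ?q_ge0 //.
  by rewrite /c; have := hN_ge0 f; lra.
rewrite (_ : _ - _ = (hip g f - g x) + (g x - s y x)
   - ((hip f g - f y)^*)%R - ((f y - s x y)^*)%R); last first.
  by rewrite !rmorphB /= -(ps_conj x y); ring.
apply: le_trans (ncD _ _) _; rewrite ncN nc_conj.
apply: le_trans (lerD (ncD _ _) (lexx _)) _; rewrite ncN nc_conj.
apply: le_trans (lerD (lerD (ncD _ _) (lexx _)) (lexx _)) _.
nra.
Qed.

Fact hip_norm f : hip f f = `|f| ^+ 2.
Proof.
rewrite nrE hnrE.
apply/eqP; rewrite -subr_eq0; apply/eqP; apply: nc_small => e e0.
have c0 := hN_ge0 f.
pose d := Num.min 1 (e / (4 * hN f + 4)).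
have d4 : 0 < 4 * hN f + 4 by lra.
have d0 : 0 < d by rewrite lt_min ltr01 divr_gt0.
have d1 : d <= 1 by rewrite ge_min lexx.
have dc : d * (4 * hN f + 4) <= e by rewrite -ler_pdivlMr // ge_min lexx orbT.
have [x hx] := iota_dense f d0.
have qx : q x <= hN f + d.
  rewrite -hN_iota -!hnrE; apply: le_trans (nr_le_sub _ f) _.
  by rewrite lerD2l nrC hnrE.
have qx' : hN f <= q x + d.
  rewrite -hN_iota -!hnrE; apply: le_trans (nr_le_sub _ (iota x)) _.
  by rewrite lerD2l hnrE.
have h1 : nc (hip f f - f x) <= hN f * d.
  by apply: le_trans (hipP f f x) _; rewrite ler_wpM2l.
have h3 : nc (f x - s x x) <= d * q x.
  rewrite -[s x x]/(iota x x) -hfB; apply: le_trans (hN_le _ _) _.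
  by rewrite ler_wpM2r ?q_ge0.
have h4 : nc (s x x - (hN f)%:C ^+ 2) <= d * (q x + hN f).
  rewrite q2E -q_sqr -rmorphXn -rmorphB nc_real /= subr_sqr normrM.
  rewrite [X in _ * X]ger0_norm ?addr_ge0 ?q_ge0 // ler_wpM2r ?addr_ge0 ?q_ge0 //.
  by rewrite ler_norml; lra.
rewrite (_ : _ - _ = (hip f f - f x) + (f x - s x x) + (s x x - (hN f)%:C ^+ 2)); last by ring.
apply: le_trans (ncD _ _) _; apply: le_trans (lerD (ncD _ _) (lexx _)) _.
have := q_ge0 x; nra.
Qed.

Definition hilb_comp : hilbert R := Hilbert hip_lin hip_conj hip_norm.

End Prehilb.

Section PrehilbRep.
Variables (R : realType) (X : cstar R) (P : prehilb R) (act : X -> P -> P).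
Hypothesis act_lin : forall a, linear (act a).
Hypothesis act_linl : forall x, linear (act^~ x).
Hypothesis act_mul : forall a b x, act (a ** b) x = act a (act b x).
Hypothesis act_adj : forall a x y, ps (act a x) y = ps x (act (cadj a) y).
Hypothesis act_bnd : forall a, exists c, 0 <= c /\ forall x, q (act a x) <= c * q x.

(** On functionals a acts by precomposition with the action of a^*; for the functional of x the
    result is that of [act a x]. The action thus extends to the completion by a formula. *)
Fact hact_subproof a (f : hcomp P) : hset (fun y => f (act (cadj a) y)).
Proof.
split=> [k y z|e e0]; first by rewrite act_lin (proj1 (hfP f)).
have [c [c0 hc]] := act_bnd (cadj a).
have c1 : 0 < c + 1 by rewrite ltr_wpDl.
have [x hx] := proj2 (hfP f) _ (divr_gt0 e0 c1).
exists (act a x) => y; rewrite act_adj; apply: le_trans (hx _) _.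
rewrite mulrAC ler_pdivrMr // -mulrA; apply: ler_wpM2l; first exact: ltW.
by apply: le_trans (hc y) _; rewrite mulrC ler_wpM2l ?q_ge0 // lerDl.
Qed.

Definition hact a (f : hilb_comp P) : hilb_comp P := Hcomp (hact_subproof a f).

Lemma hact_iota a x : hact a (iota x) = iota (act a x).
Proof. by apply: hcomp_eq => y /=; rewrite act_adj. Qed.

Lemma hact_rep : is_rep hact.
Proof.
have lin a : linear (hact a) by move=> k f g; exact: hcomp_eq.
have bd a : exists c, 0 <= c /\ forall f : hcomp P, hN (hact a f : hcomp P) <= c * hN f.
  have [c [c0 hc]] := act_bnd (cadj a); exists c; split=> // f.
  apply: hN_lub; first by rewrite mulr_ge0 ?hN_ge0.
  move=> y /=; apply: le_trans (hN_le f _) _.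
  by rewrite -mulrA mulrCA ler_wpM2l ?hN_ge0.
have lin2 (f : hcomp P) k y z : f (k *: y + z) = (k^*)%R * f y + f z by exact: (proj1 (hfP f)).
split=> //.
- move=> f k a b; apply: hcomp_eq => y /=.
  by rewrite cadjD cadjZ act_linl lin2 conjCK.
- by move=> a b f; apply: hcomp_eq => y /=; rewrite cadjM act_mul.
move=> a f g; apply/eqP; rewrite -subr_eq0; apply/eqP; apply: nc_small => e e0.
have [c [c0 hc]] := bd (cadj a).
have [c' [c0' hc']] := bd a.
pose d := hN f * (c' + c) + 1.
have d0 : 0 < d by rewrite ltr_wpDl // mulr_ge0 ?hN_ge0 ?addr_ge0.
have [y hy] := iota_dense g (divr_gt0 e0 d0).
have h1 := hipP (hact a f : hcomp P) g y.
have h2 := hipP f (hact (cadj a) g : hcomp P) (act (cadj a) y).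
rewrite (_ : _ - _ = (hip (hact a f : hcomp P) g - (hact a f : hcomp P) y)
   - (hip f (hact (cadj a) g : hcomp P) - f (act (cadj a) y))); last first.
  by rewrite [(hact a f : hcomp P) y]/= /=; ring.
apply: le_trans (ncD _ _) _; rewrite ncN.
have h3 : hN ((hact (cadj a) g : hcomp P) - iota (act (cadj a) y)) <= c * hN (g - iota y).
  rewrite -hact_iota (_ : _ - _ = (hact (cadj a) (g - iota y) : hcomp P)) //.
  by have := lin (cadj a) (-1) (iota y) g; rewrite !scaleN1r addrC => <-; rewrite [g + _]addrC.
have N0 := hN_ge0 (g - iota y); have F0 := hN_ge0 f.
apply: le_trans (lerD h1 h2) _.
apply: (@le_trans _ _ (d * hN (g - iota y))); last first.
  by rewrite mulrC -ler_pdivlMr.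
have h4 := hc' f.
apply: (@le_trans _ _ (c' * hN f * hN (g - iota y) + hN f * (c * hN (g - iota y)))).
  by apply: lerD; [apply: ler_wpM2r|apply: ler_wpM2l].
rewrite /d; nra.
Qed.

Lemma prehilb_rep : exists rho : X -> hilb_comp P -> hilb_comp P,
  is_rep rho /\ forall a x, rho a (iota x) = iota (act a x).
Proof. by exists hact; split; [exact: hact_rep|exact: hact_iota]. Qed.

End PrehilbRep.

(** * States *)

Section State.
Variables (R : realType) (X : cstar R) (h : multiplier X).
Hypotheses (hpos : pos h) (hbig : forall t, 0 <= t -> bnd h t -> 1 <= t).
Implicit Types (m n : multiplier X) (t : R) (Q : set (multiplier X)).

(** The role of Hahn-Banach is played by a maximal cone Q of self-adjoint multipliers: the order
    defined by Q becomes total, and a state is read off as a cut. Having h - 1 in Q forces the value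
    at h to be at least 1; the last clause is properness. *)
Definition cone Q :=
  [/\ (forall m, Q m -> madj m = m), (forall m n, Q m -> Q n -> Q (m + n)),
      (forall t m, 0 <= t -> Q m -> Q (rsc X t * m)), (forall m, pos m -> Q m) &
      Q (h - 1) /\ forall t, Q (rsc X t) -> 0 <= t].

Lemma rsc_inj0 t : rsc X t = 0 -> t = 0.
Proof.
move=> e; apply: contrapT => /eqP tn.
have h0 : h = 0 by rewrite -[h]mul1r -rsc1 -(mulVf tn) rscM e mulr0 mul0r.
have : bnd h 0 by rewrite h0; exact: bnd0.
by move/(hbig (lexx 0)); rewrite ler10.
Qed.

Lemma pos_rsc_ge0 t : pos (rsc X t) -> 0 <= t.
Proof.
move=> p; rewrite leNgt; apply/negP => t0.
have : pos (- rsc X t) by rewrite -rscN; apply: pos_rsc; rewrite oppr_ge0 ltW.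
by move=> /(pos_anti p)/rsc_inj0 tz; move: t0; rewrite tz ltxx.
Qed.

Lemma cone0 : cone [set m | exists p t, [/\ pos p, 0 <= t & m = p + rsc X t * (h - 1)]].
Proof.
split.
- move=> m [p [t [pp t0 ->]]]; rewrite madjD madj_rscM madjB madj1.
  by rewrite (proj1 hpos) (proj1 pp).
- move=> m n [p [t [pp t0 ->]]] [p' [t' [pp' t0' ->]]].
  exists (p + p'), (t + t'); split; [exact: posD|exact: addr_ge0|].
  by rewrite rscD; nc_ring.
- move=> s m s0 [p [t [pp t0 ->]]]; exists (rsc X s * p), (s * t).
  split; [exact: posZ|exact: mulr_ge0|].
  by rewrite rscM; nc_ring.
- by move=> m pm; exists m, 0; split=> //; rewrite rsc0 mul0r addr0.
split; first by exists 0, 1; split=> //; [exact: pos0|rewrite rsc1 mul1r add0r].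
move=> s [p [t [pp t0 e]]].
(* So t h <= s + t, and the lower bound [hbig] on the norm of h gives t <= s + t. *)
have e2 : rsc X (s + t) = p + rsc X t * h by rewrite rscD e; nc_ring.
have st0 : 0 <= s + t.
  by apply: pos_rsc_ge0; rewrite e2; apply: posD => //; apply: posZ.
have [tz|tn] := eqVneq t 0; first by rewrite tz addr0 in st0.
have tp : 0 < t by rewrite lt_def tn.
have : bnd (rsc X t * h) (s + t).
  by apply: pos_le_bnd => //; [exact: posZ|rewrite e2 addrK].
move=> /(bnd_rscM t^-1); rewrite rscMA mulVf // rsc1 mul1r ger0_norm ?invr_ge0 //.
move=> /hbig H; have := H ltac:(by rewrite mulr_ge0 ?invr_ge0).
by rewrite mulrC ler_pdivlMr // mul1r lerDr.
Qed.

Lemma max_cone : exists2 Q, cone Q &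
  forall m, madj m = m -> Q m \/ Q (- m).
Proof.
have [|Q [[Q0|cQ] maxQ]] := @Zorn_bigcup (multiplier X) (fun Q => Q = set0 \/ cone Q).
- move=> F FP tot.
  have [[A [FA An0]]|none] := pselect (exists A, F A /\ A <> set0); last first.
    left; rewrite -subset0 => m [A FA Am]; apply: none; exists A; split=> //.
    by move=> A0; rewrite A0 in Am.
  right; have cA : cone A by case: (FP _ FA).
  have cone_of B m : F B -> B m -> cone B.
    by move=> /FP[->//|].
  split.
  + by move=> m [B FB Bm]; case: (cone_of _ _ FB Bm) => + _ _ _ _; exact.
  + move=> m n [B FB Bm] [D FD Dn].
    case: (tot _ _ FB FD) => sub.
      by exists D => //; case: (cone_of _ _ FD Dn) => _ + _ _ _; apply=> //; exact: sub.
    by exists B => //; case: (cone_of _ _ FB Bm) => _ + _ _ _; apply=> //; exact: sub.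
  + move=> t m t0 [B FB Bm]; exists B => //.
    by case: (cone_of _ _ FB Bm) => _ _ + _ _; apply.
  + by move=> m pm; exists A => //; case: cA => _ _ _ + _; apply.
  split; first by exists A => //; case: cA => _ _ _ _ [].
  by move=> t [B FB Bt]; case: (cone_of _ _ FB Bt) => _ _ _ _ [_]; apply.
- exfalso; apply: (maxQ _ _ (or_intror cone0)); rewrite Q0; split=> // /(_ (h - 1)); apply.
  by case: cone0 => _ _ _ _ [].
exists Q => //; case: (cQ) => Qsa QD QZ Qpos [Qh Qprop].
(* By maximality, adjoining an n outside Q must create a negative scalar t. *)
have ext n : madj n = n -> ~ Q n -> exists q l t, [/\ Q q, 0 <= l, t < 0 & q + rsc X l * n = rsc X t].
  move=> na nQ; apply: contrapT => hno.
  pose B := [set m | exists q l, [/\ Q q, 0 <= l & m = q + rsc X l * n]].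
  have Q00 : Q 0 by apply: Qpos; exact: pos0.
  apply: (maxQ B); last first.
    right; split.
    + by move=> m [q [l [/Qsa qa l0 ->]]]; rewrite madjD madj_rscM qa na.
    + move=> m m' [q [l [qq l0 ->]]] [q' [l' [qq' l0' ->]]].
      exists (q + q'), (l + l'); split; [exact: QD|exact: addr_ge0|].
      by rewrite rscD; nc_ring.
    + move=> t m t0 [q [l [qq l0 ->]]]; exists (rsc X t * q), (t * l).
      split; [exact: QZ|exact: mulr_ge0|by rewrite rscM; nc_ring].
    + by move=> m pm; exists m, 0; split; rewrite ?rsc0 ?mul0r ?addr0 //; exact: Qpos.
    split; first by exists (h - 1), 0; split=> //; rewrite rsc0 mul0r addr0.
    move=> t [q [l [qq l0 e]]]; rewrite leNgt; apply/negP => t0.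
    by apply: hno; exists q, l, t.
  split.
    by move=> m Qm; exists m, 0; split=> //; rewrite rsc0 mul0r addr0.
  by move=> /(_ n) bq; apply/nQ/bq; exists 0, 1; split=> //; rewrite rsc1 mul1r add0r.
move=> m ma; apply: contrapT => /not_orP[n1 n2].
have [q [l [t [Qq l0 t0 e]]]] := ext _ ma n1.
have [|q' [l' [t' [Qq' l0' t0' e']]]] := ext (- m) _ n2; first by rewrite madjN ma.
(* The combination with weights l' and l cancels m. It leaves a scalar of Q that is at most 0, hence
   0; this forces l = 0 and puts the negative scalar t into Q. *)
have Qc : Q (rsc X (l' * t + l * t')).
  rewrite rscD !rscM -e -e'.
  rewrite (_ : _ + _ = rsc X l' * q + rsc X l * q' + (rsc X (l' * l) - rsc X (l * l')) * m).
    by rewrite [l * l']mulrC subrr mul0r addr0; apply: QD; exact: QZ.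
  by rewrite !rscM; nc_ring.
have := Qprop _ Qc; move=> ge.
have z1 : l' * t <= 0 by apply: mulr_ge0_le0 => //; exact: ltW.
have z2 : l * t' <= 0 by apply: mulr_ge0_le0 => //; exact: ltW.
have lz : l = 0.
  apply/eqP; have : l * t' == 0 by rewrite eq_le z2 /=; lra.
  by rewrite mulf_eq0 (lt_eqF t0') orbF.
move: e; rewrite lz rsc0 mul0r addr0 => e.
by have := Qprop t; rewrite -e => /(_ Qq); rewrite leNgt t0.
Qed.

(** phi m is the supremum of the t with m - t in Q. Since m - t or t - m always lies in Q, numbers
    below phi m give elements m - t of Q and numbers above it elements t - m of Q; adding these
    yields additivity in both directions. *)
Lemma real_state : exists phi : multiplier X -> R,
  [/\ (forall m n, madj m = m -> madj n = n -> phi (m + n) = phi m + phi n),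
      (forall t m, madj m = m -> phi (rsc X t * m) = t * phi m),
      (forall m, pos m -> 0 <= phi m),
      phi 1 = 1 & 1 <= phi h].
Proof.
have [Q [Qsa QD QZ Qpos [Qh Qprop]] dich] := max_cone.
pose phi m := sup [set t | Q (m - rsc X t)].
have up m t0 : Q (rsc X t0 - m) -> ubound [set t | Q (m - rsc X t)] t0.
  move=> qt t /= qt'; rewrite -subr_ge0; apply: Qprop.
  rewrite (_ : rsc X _ = (rsc X t0 - m) + (m - rsc X t)); first exact: QD.
  by rewrite rscB; nc_ring.
have hs m : madj m = m -> has_sup [set t | Q (m - rsc X t)].
  move=> ma; have [t0 mt] := mult_bounded m; split.
    exists (- t0) => /=; apply: Qpos; rewrite rscN opprK addrC -[m]opprK.
    by apply: pos_bndB; [rewrite madjN ma|exact: bndN].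
  by exists t0; apply: up; apply: Qpos; exact: pos_bndB.
have le1 m t : madj m = m -> Q (m - rsc X t) -> t <= phi m.
  by move=> ma qt; apply: (sup_upper_bound (hs _ ma)).
have le2 m t : madj m = m -> Q (rsc X t - m) -> phi m <= t.
  by move=> ma qt; apply: ge_sup; [case: (hs _ ma)|exact: up].
have gt2 m t : madj m = m -> phi m < t -> Q (rsc X t - m).
  move=> ma lt; have : madj (m - rsc X t) = m - rsc X t by rewrite madjB ma madj_rsc.
  case/dich; last by rewrite opprB.
  by move=> /(le1 _ _ ma); rewrite leNgt lt.
have gt1 m t : madj m = m -> t < phi m -> Q (m - rsc X t).
  move=> ma lt; have : madj (m - rsc X t) = m - rsc X t by rewrite madjB ma madj_rsc.
  case/dich => //; rewrite opprB.
  by move=> /(le2 _ _ ma); rewrite leNgt lt.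
have add m n : madj m = m -> madj n = n -> phi (m + n) = phi m + phi n.
  move=> ma na; have mna : madj (m + n) = m + n by rewrite madjD ma na.
  apply/eqP; rewrite eq_le; apply/andP; split; apply/ler_addgt0Pr => e e0.
    apply: le2 => //.
    rewrite (_ : rsc X _ - _ = (rsc X (phi m + e / 2) - m) + (rsc X (phi n + e / 2) - n)).
      by apply: QD; apply: gt2; rewrite // ltrDl divr_gt0.
    rewrite (_ : phi m + phi n + e = (phi m + e / 2) + (phi n + e / 2)); last by lra.
    by rewrite rscD; nc_ring.
  rewrite -lerBlDr; apply: le1 => //.
  rewrite (_ : _ - rsc X _ = (m - rsc X (phi m - e / 2)) + (n - rsc X (phi n - e / 2))).
    by apply: QD; apply: gt1; rewrite // ltrBlDr ltrDl divr_gt0.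
  rewrite (_ : phi m + phi n - e = (phi m - e / 2) + (phi n - e / 2)); last by lra.
  by rewrite [rsc X (_ + _)]rscD; nc_ring.
have p0 : phi 0 = 0.
  by have := add 0 0 (@madj0 _ _) (@madj0 _ _); rewrite addr0 -[X in X = _]addr0 => /addrI.
have neg m : madj m = m -> phi (- m) = - phi m.
  move=> ma; apply/eqP; rewrite -addr_eq0 -add ?madjN ?ma // addNr p0 //.
have scp t m : 0 < t -> madj m = m -> phi (rsc X t * m) = t * phi m.
  move=> t0 ma; have tma : madj (rsc X t * m) = rsc X t * m by rewrite madj_rscM ma.
  have tz : t != 0 by rewrite gt_eqF.
  apply/eqP; rewrite eq_le; apply/andP; split; apply/ler_addgt0Pr => e e0.
    apply: le2 => //.
    rewrite (_ : rsc X _ - _ = rsc X t * (rsc X (phi m + e / t) - m)).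
      by apply: QZ; [exact: ltW|apply: gt2; rewrite // ltrDl divr_gt0].
    by rewrite mulrBr -rscM mulrDr mulrCA divff // mulr1.
  rewrite -lerBlDr; apply: le1 => //.
  rewrite (_ : _ - rsc X _ = rsc X t * (m - rsc X (phi m - e / t))).
    by apply: QZ; [exact: ltW|apply: gt1; rewrite // ltrBlDr ltrDl divr_gt0].
  by rewrite mulrBr -rscM mulrBr mulrCA divff // mulr1.
exists phi; split=> //.
- move=> t m ma; have [t0|t0|->] := ltgtP t 0.
  + have := scp (- t) m; rewrite oppr_gt0 => /(_ t0 ma).
    rewrite rscN mulNr neg ?madj_rscM ?ma // => /eqP.
    by rewrite mulNr eqr_opp => /eqP.
  + exact: scp.
  by rewrite rsc0 !mul0r p0.
- by move=> m pm; apply: le1; [case: pm|rewrite rsc0 subr0; exact: Qpos].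
- have Q00 : Q 0 by apply: Qpos; exact: pos0.
  apply/eqP; rewrite eq_le; apply/andP; split.
    by apply: le2; rewrite ?madj1 // rsc1 subrr.
  by apply: le1; rewrite ?madj1 // rsc1 subrr.
by apply: le1; [case: hpos|rewrite rsc1].
Qed.

End State.

Section ComplexState.
Variables (R : realType) (X : cstar R).
Implicit Types m n : multiplier X.

Lemma mscaleRI (k : R[i]) m :
  k *: m = rsc X (Re k) * m + rsc X (Im k) * ('i%C *: m).
Proof. by rewrite !rscl scalerA -scalerDl {1}[k]complexE [_ * 'i%C]mulrC. Qed.

(** With r the real state evaluated on self-adjoint parts, Phi m = r m - i r (i m) is the complex
    linear functional with real part r. *)
Lemma complex_state (h : multiplier X) : pos h ->
  (forall t, 0 <= t -> bnd h t -> 1 <= t) ->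
  exists Phi : multiplier X -> R[i],
  [/\ linear (Phi : multiplier X -> R[i]^o), (forall m, 0 <= Phi (madj m * m)),
      Phi 1 = 1 & 1 <= Phi h].
Proof.
move=> hp hb; have [phi [pD pZ p0 p1 ph]] := real_state hp hb.
pose re m := rsc X 2^-1 * (m + madj m).
have re_sa m : madj (re m) = re m by rewrite madj_rscM madjD madjK addrC.
have re_id m : madj m = m -> re m = m by move=> ma; rewrite /re ma half2.
have reD m n : re (m + n) = re m + re n by rewrite /re madjD; nc_ring.
have reZ t m : re (rsc X t * m) = rsc X t * re m.
  by rewrite /re madj_rscM -mulrDr rscMA [2^-1 * t]mulrC -rscMA.
pose r m := phi (re m).
have rD m n : r (m + n) = r m + r n by rewrite /r reD pD.
have rZ t m : r (rsc X t * m) = t * r m by rewrite /r reZ pZ.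
have rN m : r (- m) = - r m.
  by have := rZ (-1) m; rewrite rscN rsc1 !mulN1r.
pose Phi m : R[i] := (r m)%:C - 'i%C * (r ('i%C *: m))%:C.
have Phi_sa m : madj m = m -> Phi m = (phi m)%:C.
  move=> ma; rewrite /Phi /r re_id // (_ : re ('i%C *: m) = 0); last first.
    by rewrite /re madjZ ma conj_iE scaleNr subrr mulr0.
  by have := pD 0 0 (@madj0 _ _) (@madj0 _ _); rewrite addr0 => e; rewrite (_ : phi 0 = 0) ?mulr0 ?subr0 //; lra.
exists Phi; split.
- have PD m n : Phi (m + n) = Phi m + Phi n.
    by rewrite /Phi scalerDr !rD !rmorphD /=; ring.
  have PZ t m : Phi (rsc X t * m) = t%:C * Phi m.
    rewrite /Phi -mscaleAr !rZ !rmorphM /=; ring.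
  have Pi m : Phi ('i%C *: m) = 'i%C * Phi m.
    have i2 : 'i%C * 'i%C = -1 :> R[i] by rewrite -expr2 sqr_i.
    by rewrite /Phi scalerA i2 scaleN1r rN rmorphN /= mulrBr mulrA i2; ring.
  move=> k m n; rewrite PD mscaleRI PD !PZ Pi mulrA -mulrDl [X in _ = X *: _ + _]complexE.
  by rewrite /GRing.scale /= ; congr (_ * _ + _); rewrite [_ * 'i%C]mulrC.
- move=> m; rewrite Phi_sa ?madjM ?madjK // lecR.
  by apply: p0; exact: pos_cs.
- by rewrite Phi_sa ?madj1 // p1.
have ha : madj h = h by case: hp.
by rewrite (Phi_sa _ ha) lecR.
Qed.

End ComplexState.

(** * Representations: contractivity, GNS and Gelfand-Naimark *)

Section Hermitian.
Variables (R : realType) (V : lmodType R[i]) (s : V -> V -> R[i]).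
Hypotheses (sl : forall y, linear (s^~ y : V -> R[i]^o))
  (sr : forall x k y z, s x (k *: y + z) = (k^*)%R * s x y + s x z)
  (sp : forall x, 0 <= s x x).

(** Symmetry follows from positivity by polarization: the form is real on y + x and on i y + x. *)
Fact herm_conj x y : s y x = ((s x y)^*)%R.
Proof.
have sl' k a b c : s (k *: a + b) c = k * s a c + s b c by rewrite (sl c k a b).
have re a : ((s a a)^*)%R = s a a by apply: conj_Creal; rewrite ger0_real.
have cD a b : ((a + b)^*)%R = (a^*)%R + (b^*)%R :> R[i] by exact: rmorphD.
have cM a b : ((a * b)^*)%R = (a^*)%R * (b^*)%R :> R[i] by exact: rmorphM.
have cN a : ((- a)^*)%R = - (a^*)%R :> R[i] by exact: rmorphN.
have c1 : ((1 : R[i])^*)%R = 1 by exact: rmorph1.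
have h1 := re (1 *: y + x).
have h2 := re ('i%C *: y + x).
rewrite !sl' !sr !c1 !mul1r !cD !re in h1.
rewrite !sl' !sr !(cD, cM, conj_iE, cN) opprK !re in h2.
set a := s x y in h1 h2 *; set b := s y x in h1 h2 *.
have i2 : 'i%C * 'i%C = -1 :> R[i] by rewrite -expr2 sqr_i.
have e1 : (a^*)%R + (b^*)%R = a + b by apply: (addrI (s y y + s x x)); move: h1; move: (s y y) (s x x) => u v h1; rewrite (_ : u + v + _ = u + (b^*)%R + ((a^*)%R + v)); [rewrite h1; ring|ring].
have e2 : 'i%C * (a^*)%R - 'i%C * (b^*)%R = 'i%C * b - 'i%C * a.
  apply: (addrI (s y y + s x x)).
  transitivity (- 'i%C * ('i%C * s y y + (b^*)%R) + ('i%C * (a^*)%R + s x x)).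
    by rewrite mulrDr mulrA mulNr i2 opprK; ring.
  by rewrite h2 mulrDr mulrA mulrN i2 opprK; ring.
have e3 : (a^*)%R - (b^*)%R = b - a.
  by apply: (@mulfI _ 'i%C); [apply/eqP => z; move: i2; rewrite z mul0r => /eqP; rewrite eq_sym oppr_eq0 oner_eq0|rewrite !mulrBr].
apply: (@mulfI _ 2%:R); first by rewrite pnatr_eq0.
transitivity ((a + b) + (b - a)); first by ring.
by rewrite -e1 -e3; ring.
Qed.

Definition herm_prehilb : prehilb R := Prehilb sl herm_conj sp.

End Hermitian.

Section HilbertBasics.
Variables (R : realType) (H : hilbert R).
Implicit Types (x y z : H) (k : R[i]).

Fact hilb_ge0 x : 0 <= ip x x.
Proof. by rewrite ip_norm exprn_ge0. Qed.

Definition hilb_pre : prehilb R := Prehilb (@ip_linl R H) (@ip_conj R H) hilb_ge0.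

Lemma ipD x y z : ip (x + y) z = ip x z + ip y z.
Proof. exact: (@psD _ hilb_pre). Qed.
Lemma ipDr x y z : ip x (y + z) = ip x y + ip x z.
Proof. exact: (@psDr _ hilb_pre). Qed.
Lemma ipZ k x y : ip (k *: x) y = k * ip x y.
Proof. exact: (@psZ _ hilb_pre). Qed.
Lemma ipZr k x y : ip x (k *: y) = (k^*)%R * ip x y.
Proof. exact: (@psZr _ hilb_pre). Qed.
Lemma ipB x y z : ip (x - y) z = ip x z - ip y z.
Proof. exact: (@psB _ hilb_pre). Qed.
Lemma ip_suml (I : Type) (r : seq I) (P : pred I) (f : I -> H) y :
  ip (\sum_(i <- r | P i) f i) y = \sum_(i <- r | P i) ip (f i) y.
Proof.
apply: (big_morph (fun x => ip x y)) => [a b|]; first exact: ipD.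
exact: (@ps0l _ hilb_pre).
Qed.
Lemma ip_sumr (I : Type) (r : seq I) (P : pred I) (f : I -> H) y :
  ip y (\sum_(i <- r | P i) f i) = \sum_(i <- r | P i) ip y (f i).
Proof.
rewrite ip_conj ip_suml rmorph_sum; apply: eq_bigr => i _.
by rewrite [in RHS]ip_conj.
Qed.

Lemma ip_nr x : ip x x = (nr x ^+ 2)%:C.
Proof. by rewrite ip_norm nrE rmorphXn. Qed.

Lemma q_nr x : @q _ hilb_pre x = nr x.
Proof. by rewrite /q /q2 /= ip_nr /= sqrtr_sqr ger0_norm ?nr_ge0. Qed.

Lemma ip_le x y : nc (ip x y) <= nr x * nr y.
Proof. by rewrite -!q_nr; exact: (@cauchy_schwarz _ hilb_pre). Qed.

End HilbertBasics.

Section Contraction.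
Variables (R : realType) (X : cstar R).

(* a^*a/|a|^2 = 1 - (1 - d)^2 *)
Lemma cs_sqrt (a : X) : a != 0 -> exists d : X, [/\ cadj d = d &
  ((nr a ^- 2)%:C *: (cadj a ** a)) + d ** d = d + d].
Proof.
move=> a0; have na : 0 < nr a by rewrite lt_def nr_ge0 andbT; apply: contra a0 => /eqP/nr_eq0->.
pose w := (nr a ^- 2)%:C *: (cadj a ** a).
have wa : madj (incl w) = incl w by rewrite -incl_adj cadjZ conj_real cadjM cadjK.
have w1 : bnd (incl w) 1.
  apply: bnd_eqM (bnd_incl _) _; rewrite nrZr nr_cs ger0_norm ?invr_ge0 ?exprn_ge0 ?nr_ge0 //.
  by rewrite mulVf // expf_neq0 // gt_eqF.
have [d [da _ de _ dx]] := sqrt1 wa w1.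
have [y dy] := dx ltac:(by exists w); exists y; split; apply: incl_inj.
  by rewrite incl_adj -dy da.
by rewrite !inclD inclM -dy de.
Qed.

(** The identity of [cs_sqrt] involves only elements of X, so phi can be applied to it, and phi(a)^*
    phi(a) / |a|^2 = 1 - (1 - phi d)^2 <= 1. *)
Lemma starhom_bnd (B : cstar R) (phi : X -> multiplier B) a :
  starhom phi -> bnd (phi a) (nr a).
Proof.
move=> [plin pM padj]; have pD x y : phi (x + y) = phi x + phi y.
  by have := plin 1 x y; rewrite !scale1r.
have p0 : phi 0 = 0 by apply: (addrI (phi 0)); rewrite -pD !addr0.
have pZ k x : phi (k *: x) = k *: phi x by have := plin k x 0; rewrite p0 !addr0.
have [->|a0] := eqVneq a 0; first by rewrite p0 nr0; exact: bnd0.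
have na : 0 < nr a by rewrite lt_def nr_ge0 andbT; apply: contra a0 => /eqP/nr_eq0->.
have [d [da de]] := cs_sqrt a0.
have pe := congr1 phi de; rewrite !pD pZ !pM padj in pe.
apply: bnd_cs; first exact: nr_ge0.
have pd : madj (phi d) = phi d by rewrite -padj da.
have h1 : bnd (rsc B (nr a ^- 2) * (madj (phi a) * phi a)) 1.
  apply: pos_le_bnd => //.
    by apply: posZ; [rewrite invr_ge0 exprn_ge0 ?nr_ge0|exact: pos_cs].
  rewrite rsc1 rscl -(sq_sqrt1 pe); apply: pos_sq.
  by rewrite madjB madj1 pd.
have := bnd_rscM (nr a ^+ 2) h1; rewrite rscMA mulfV ?expf_neq0 ?gt_eqF //.
by rewrite rsc1 mul1r mulr1 ger0_norm ?exprn_ge0 ?nr_ge0.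
Qed.

Variables (H : hilbert R) (rho : X -> H -> H).
Hypothesis hrho : is_rep rho.

Lemma repD a x y : rho a (x + y) = rho a x + rho a y.
Proof. by case: hrho => l _ _ _; have := l a 1 x y; rewrite !scale1r. Qed.
Lemma repZ a k x : rho a (k *: x) = k *: rho a x.
Proof.
case: hrho => l _ _ _; have z : rho a 0 = 0 by apply: (addrI (rho a 0)); rewrite -repD !addr0.
by have := l a k x 0; rewrite z !addr0.
Qed.
Lemma repDl a b x : rho (a + b) x = rho a x + rho b x.
Proof. by case: hrho => _ l _ _; have := l x 1 a b; rewrite !scale1r. Qed.
Lemma rep0l x : rho 0 x = 0.
Proof. by apply: (addrI (rho 0 x)); rewrite -repDl !addr0. Qed.
Lemma repZl k a x : rho (k *: a) x = k *: rho a x.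
Proof. by case: hrho => _ l _ _; have := l x k a 0; rewrite rep0l !addr0. Qed.
Lemma rep_suml (I : Type) (r : seq I) (P : pred I) (f : I -> X) x :
  rho (\sum_(i <- r | P i) f i) x = \sum_(i <- r | P i) rho (f i) x.
Proof. by apply: (big_morph (rho^~ x)) => [a b|]; [exact: repDl|exact: rep0l]. Qed.

(** The identity of [cs_sqrt] evaluated at the vector x: it yields |x|^2 - |rho a x|^2 / |a|^2 = |x
    - rho d x|^2 >= 0. *)
Lemma rep_bnd a x : nr (rho a x) <= nr a * nr x.
Proof.
case: hrho => _ _ rM radj.
have [->|a0] := eqVneq a 0; first by rewrite rep0l !nr0 mul0r.
have na : 0 < nr a by rewrite lt_def nr_ge0 andbT; apply: contra a0 => /eqP/nr_eq0->.
have [d [da de]] := cs_sqrt a0.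
have e := congr1 (fun z => ip (rho z x) x) de.
rewrite /= !repDl repZl !rM !ipD ipZ (radj (cadj a)) cadjK (radj d) da !ip_nr in e.
have n2 : nr (x - rho d x) ^+ 2 = nr x ^+ 2 - Re (ip (rho d x) x) *+ 2 + nr (rho d x) ^+ 2.
  apply: complexI; rewrite -ip_nr ipB.

  have -> : ip x (x - rho d x) = ip x x - ip x (rho d x).
    exact: (@psBr _ (hilb_pre H)).
  have -> : ip (rho d x) (x - rho d x) = ip (rho d x) x - ip (rho d x) (rho d x).
    exact: (@psBr _ (hilb_pre H)).
  have r : ip (rho d x) x = (Re (ip (rho d x) x))%:C.
    have s : ip x (rho d x) = ip (rho d x) x by rewrite radj da.
    have := ip_conj x (rho d x); rewrite s; case: (ip _ _) => u v /= [/eqP].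
    by rewrite -addr_eq0 -mulr2n mulrn_eq0 /= => /eqP ->.
  have -> : ip x (rho d x) = ip (rho d x) x by rewrite radj da.
  rewrite !ip_nr {1 2}r !rmorphD !rmorphN !rmorphMn /=; ring.
have e' : nr a ^- 2 * nr (rho a x) ^+ 2 + nr (rho d x) ^+ 2 = Re (ip (rho d x) x) *+ 2.
  by move: (congr1 (@complex.Re _) e); case: (ip _ _) => u v /=; rewrite !(mul0r, subr0, mulr2n).
have : nr a ^- 2 * nr (rho a x) ^+ 2 <= nr x ^+ 2.
  have := sqr_ge0 (nr (x - rho d x)); rewrite n2; lra.
rewrite mulrC ler_pdivrMr ?exprn_gt0 // -exprMn mulrC.
by rewrite ler_pXn2r ?nnegrE ?mulr_ge0 ?nr_ge0 // [nr x * _]mulrC.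
Qed.

End Contraction.

Section GNS.
Variables (R : realType) (V : cstar R) (phi : V -> R[i]).
Hypotheses (phi_lin : linear (phi : V -> R[i]^o))
  (phi_pos : forall x, 0 <= phi (cadj x ** x)).

Fact gns_sl (y : V) : linear ((fun x => phi (cadj y ** x)) : V -> R[i]^o).
Proof. by move=> k a b; rewrite cmulDr cmulZr phi_lin. Qed.

Fact gns_sr (x : V) k y z :
  phi (cadj (k *: y + z) ** x) = (k^*)%R * phi (cadj y ** x) + phi (cadj z ** x).
Proof. by rewrite cadjD cadjZ cmulDl cmulZl (phi_lin _ _ _). Qed.

Definition gns_pre : prehilb R := herm_prehilb gns_sl gns_sr phi_pos.

(* The GNS space of phi, acted upon through multipliers *)
Lemma gns_act (X : cstar R) (f : X -> multiplier V) : starhom f ->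
  exists (H : hilbert R) (rho : X -> H -> H) (v : V -> H),
  [/\ is_rep rho, linear v, (forall x y, ip (v x) (v y) = phi (cadj y ** x)) &
      forall a x, rho a (v x) = v (mL (f a) x)].
Proof.
move=> [fl fM fa]; pose act (a : X) (x : gns_pre) : gns_pre := mL (f a) x.
have [|||||rho [hrho ract]] := @prehilb_rep _ X gns_pre act.
- by move=> a k x y; exact: mL_linear.
- by move=> x k a b; rewrite /act fl mL_add mL_scale.
- by move=> a b x; rewrite /act fM.
- by move=> a x y; rewrite /act fa; congr phi; exact: madj_ip.
- move=> a; have [t bt] := mult_bounded (f a); exists t; split; first by case: bt.
  move=> x; have t0 := proj1 bt.
  have [g ga ge] := bnd_compl bt.
  rewrite -(@ler_pXn2r _ 2) ?nnegrE ?mulr_ge0 ?q_ge0 // exprMn !q_sqr.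
  have q2x (z : gns_pre) : (q2 z)%:C = phi (cadj (z : V) ** (z : V)) by rewrite -q2E.
  rewrite -lecR rmorphM /= !q2x /act.
  rewrite -[X in X <= _]addr0 (_ : (t ^+ 2)%:C * phi (cadj x ** x) =
     phi (cadj (mL (f a) x) ** mL (f a) x) + phi (cadj (mL g x) ** mL g x)).
    by rewrite lerD2l.
  have phiD u v : phi (u + v) = phi u + phi v by have := phi_lin 1 u v; rewrite !scale1r.
  have phi0 : phi 0 = 0 by apply: (addrI (phi 0)); rewrite -phiD !addr0.
  have phiZ k u : phi (k *: u) = k * phi u by have := phi_lin k u 0; rewrite phi0 !addr0.
  rewrite -phiD -!madj_ip' ga -cmulDr -!mL_mul -mL_add ge mL_rsc cmulZr phiZ.
  by rewrite expr2.
exists (hilb_comp gns_pre), rho, (@iota _ gns_pre); split=> //.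
- by move=> k x y; apply: hcomp_eq => z /=; rewrite -gns_sl.
- by move=> x y; rewrite /= hip_iota.
Qed.

End GNS.

Section GelfandNaimark.
Variables (R : realType) (X : cstar R).

Lemma starhom_incl : starhom (@incl R X).
Proof.
split; [by move=> k a b; rewrite inclD inclZ|exact: inclM|exact: incl_adj].
Qed.

(** The GNS space is built over M(X) rather than X, so that 1 is available as the vector xi. The
    state is chosen with value at least 1 at b^* b / |b|^2; for b = 0 the zero functional serves,
    whence only |xi| <= 1. *)
Lemma gelfand_naimark (b : X) :
  exists (H : hilbert R) (rho : X -> H -> H) (xi : H),
  [/\ is_rep rho, nr xi <= 1 & nr b <= nr (rho b xi)].
Proof.
have [Phi [Pl Pp P1 Pb]] : exists Phi : multiplier X -> R[i],
  [/\ linear (Phi : multiplier X -> R[i]^o), (forall m, 0 <= Phi (madj m * m)),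
      Phi 1 <= 1 & (nr b ^+ 2)%:C <= Phi (incl (cadj b ** b))].
  have [->|b0] := eqVneq b 0.
    exists (fun=> 0); split=> //.
    - by move=> k x y; rewrite scaler0 addr0.
    by rewrite nr0 expr0n.
  have nb : 0 < nr b by rewrite lt_def nr_ge0 andbT; apply: contra b0 => /eqP/nr_eq0->.
  pose h := rsc X (nr b ^- 2) * incl (cadj b ** b).
  have n0 : 0 <= nr b ^- 2 by rewrite invr_ge0 exprn_ge0 // ltW.
  have [||Phi [Pl Pp P1 Pb]] := @complex_state _ _ h.
  - by apply: posZ => //; exact: cpos_cs.
  - move=> t t0; rewrite /h rscl -inclZ => /bnd_incl_le.
    by rewrite nrZr nr_cs ger0_norm // mulVf // expf_neq0 // gt_eqF.
  exists Phi; split=> //; first by rewrite P1.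
  have P0 : Phi 0 = 0.
    by have := Pl 1 0 0; rewrite scaler0 addr0 scale1r -[LHS]addr0 => /addrI.
  move: Pb; rewrite /h rscl; have := Pl (nr b ^- 2)%:C (incl (cadj b ** b)) 0.
  rewrite !addr0 P0 addr0 => ->; rewrite /GRing.scale /=.
  rewrite -(ler_pM2l (_ : 0 < (nr b ^+ 2)%:C)) ?ltc0R ?exprn_gt0 //.
  by rewrite mulr1 mulrA -rmorphM /= mulfV ?mul1r // expf_neq0 // gt_eqF.
pose s (m n : multiplier X) := Phi (madj n * m).
have sl y : linear (s^~ y : multiplier X -> R[i]^o).
  by move=> k m n; rewrite /s mulrDr mscaleAr Pl.
have sr x k y z : s x (k *: y + z) = (k^*)%R * s x y + s x z.
  by rewrite /s madjD madjZ mulrDl mscaleAl (Pl _ _ _).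
pose P := @herm_prehilb R (multiplier X) s sl sr Pp.
pose act (a : X) (m : P) : P := incl a * m.
have [|||||rho [hrho ract]] := @prehilb_rep _ X P act.
- by move=> a k x y; rewrite /act mulrDr mscaleAr.
- by move=> x k a c; rewrite /act inclD inclZ mulrDl mscaleAl.
- by move=> a c x; rewrite /act inclM mulrA.
- move=> a x y; rewrite -[LHS]/(Phi (madj y * (incl a * x))).
  rewrite -[RHS]/(Phi (madj (incl (cadj a) * y) * x)).
  by rewrite madjM incl_adj madjK mulrA.
- move=> a; have bt := bnd_incl a; exists (nr a); split; first exact: nr_ge0.
  move=> x; have [g ga ge] := bnd_compl bt.
  rewrite -(@ler_pXn2r _ 2) ?nnegrE ?mulr_ge0 ?q_ge0 ?nr_ge0 // exprMn !q_sqr.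
  have q2x (z : P) : (q2 z)%:C = Phi (madj z * z) by rewrite -q2E.
  rewrite -lecR rmorphM /= !q2x /act.
  rewrite -[X in X <= _]addr0 (_ : (nr a ^+ 2)%:C * Phi (madj x * x) =
     Phi (madj (incl a * x) * (incl a * x)) + Phi (madj (g * x) * (g * x))).
    by rewrite lerD2l.
  have PhiD u v : Phi (u + v) = Phi u + Phi v by have := Pl 1 u v; rewrite !scale1r.
  have Phi0 : Phi 0 = 0 by apply: (addrI (Phi 0)); rewrite -PhiD !addr0.
  have PhiZ k u : Phi (k *: u) = k * Phi u by have := Pl k u 0; rewrite Phi0 !addr0.
  rewrite -PhiD !madjM ga.
  rewrite (_ : madj x * madj (incl a) * (incl a * x) + madj x * g * (g * x) =
    madj x * (madj (incl a) * incl a + g * g) * x); last by nc_ring.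
  by rewrite ge rscr mscaleAl PhiZ expr2.
exists (hilb_comp P), rho, (@iota _ P 1); split=> //.
  rewrite hnrE hN_iota /q -sqrtr1 ler_wsqrtr // -lecR -q2E /= /s madj1 mul1r.
  exact: P1.
rewrite ract hnrE hN_iota /q -[nr b]ger0_norm ?nr_ge0 // -sqrtr_sqr ler_wsqrtr //.
by rewrite -lecR -q2E /= /s /act mulr1 -incl_adj -inclM.
Qed.

End GelfandNaimark.

Lemma cs_mL (R : realType) (X : cstar R) (m : multiplier X) v :
  cadj (mL m v) ** mL m v = cadj v ** mL (madj m * m) v.
Proof. by rewrite mL_mul madj_ip'. Qed.

Section Isometry.
Variables (R : realType) (V : cstar R) (F : set (V -> R[i])).
Hypotheses (F_lin : forall phi, F phi -> linear (phi : V -> R[i]^o))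
  (F_pos : forall phi, F phi -> forall z, 0 <= phi (cadj z ** z))
  (F_sep : forall y, (forall phi, F phi -> phi (cadj y ** y) = 0) -> y = 0).

(* With y = m^*m/s^2, the element e = y - 1 + |1 - y| is twice the positive
   part of y - 1 and satisfies e y e = e^2 + e|1 - y|e. *)
Lemma norm_by_states (m : multiplier V) (M : R) : 0 <= M ->
  (forall phi, F phi -> forall y, phi (cadj (mL m y) ** mL m y) <=
     (M ^+ 2)%:C * phi (cadj y ** y)) -> bnd m M.
Proof.
move=> M0 hm.
suff H s : M < s -> bnd m s.
  split=> // v; apply/ler_addgt0Pr => e e0.
  have n1 : 0 < nr v + 1 by rewrite ltr_wpDl ?nr_ge0.
  have [|_ /(_ v) h] := H (M + e / (nr v + 1)); first by rewrite ltrDl divr_gt0.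
  apply: le_trans h _; rewrite mulrDl lerD2l mulrAC ler_pdivrMr //.
  by rewrite ler_wpM2l ?(ltW e0) // lerDl.
move=> Ms; have s0 : 0 < s by apply: le_lt_trans Ms.
have s2 : s ^+ 2 != 0 by rewrite expf_neq0 // gt_eqF.
have s20 : 0 < s ^- 2 by rewrite invr_gt0 exprn_gt0.
pose y := rsc V (s ^- 2) * (madj m * m).
have py : pos y by apply: posZ; [exact: ltW|exact: pos_cs].
have ya : madj y = y by case: py.
have ya1 : madj (1 - y) = 1 - y by rewrite madjB madj1 ya.
have [k [ka kk pk kc]] := pos_sqrt (pos_sq ya1).
have cyk : y * k = k * y by apply: kc; rewrite /GRing.comm; nc_ring.
have [g [ga gg _ _]] := pos_sqrt pk.
pose e := y - 1 + k.
have ea : madj e = e by rewrite madjD madjB madj1 ya ka.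
have eye : e * y = e + e * k.
  apply/eqP; rewrite -subr_eq0; apply/eqP.
  rewrite (_ : _ - _ = (1 - y) * (1 - y) - k * k + (k * y - y * k)); last by rewrite /e; nc_ring.
  by rewrite kk cyk !subrr addr0.
have e0 : e = 0.
  apply: mult_eqL => z; apply: F_sep => phi Fphi.
  have phiD u v : phi (u + v) = phi u + phi v by have := F_lin Fphi 1 u v; rewrite !scale1r.
  have phi0 : phi 0 = 0 by apply: (addrI (phi 0)); rewrite -phiD !addr0.
  have phiZ c u : phi (c *: u) = c * phi u by have := F_lin Fphi c u 0; rewrite phi0 !addr0.
  set w := mL e z.
  have hw : cadj (mL m w) ** mL m w =
      (s ^+ 2)%:C *: (cadj w ** w + cadj (mL g w) ** mL g w).
    rewrite (cs_mL m w) (cs_mL g w) ga gg.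
    have -> : madj m * m = rsc V (s ^+ 2) * y.
      by rewrite /y rscMA mulfV // rsc1 mul1r.
    rewrite mL_mul mL_rsc cmulZr -cmulDr; congr (_ *: _).
    rewrite /w -!madj_ip' ea -[RHS]/(cadj z ** mL (e * (e + k * e)) z).
    rewrite -[LHS]/(cadj z ** mL (e * (y * e)) z); congr (_ ** mL _ z).
    by rewrite mulrA eye; nc_ring.
  have := hm _ Fphi w; rewrite hw phiZ phiD.
  have := F_pos Fphi w; have := F_pos Fphi (mL g w).
  move: (phi (cadj (mL g w) ** _)) (phi (cadj w ** w)) => p q p0 q0.
  have [-> p0'] := ge0_realE p0; have [-> q0'] := ge0_realE q0.
  rewrite -rmorphD -!rmorphM lecR /= => le.
  have lt : M ^+ 2 < s ^+ 2 by rewrite ltr_pXn2r ?nnegrE // ltW.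
  have q00 : Re q = 0.
    apply/eqP; rewrite eq_le q0' andbT.
    have h : (s ^+ 2 - M ^+ 2) * Re q <= 0.
      have := mulr_ge0 (ltW (exprn_gt0 2 s0)) p0'; rewrite mulrDr in le; lra.
    by rewrite -(pmulr_rle0 _ (_ : 0 < s ^+ 2 - M ^+ 2)) ?subr_gt0.
  by rewrite q00.
have y1 : bnd y 1.
  apply: pos_le_bnd => //; rewrite rsc1 (_ : 1 - y = k) //.
  by rewrite -[k]add0r -[X in X + k](subrr (y - 1)) -[LHS]addr0 -e0 /e; nc_ring.
apply: bnd_cs (ltW s0) _.
have := bnd_rscM (s ^+ 2) y1; rewrite rscMA mulfV // rsc1 mul1r mulr1.
by rewrite ger0_norm // exprn_ge0 // ltW.
Qed.

End Isometry.

(** * Extension by density *)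

Section Density.
Variables (R : realType).

Lemma the_orP (T : Type) (d : T) (P : T -> Prop) :
  (exists x, P x) -> P (the_or d P).
Proof. by rewrite /the_or; case: pselect => // h _; exact: (projT2 (cid h)). Qed.

(** Linear combinations are lists of pairs, so that sums are concatenations and two families can
    share one list; in this way a map prescribed on generators is compared with its argument. *)
Definition comb (V : lmodType R[i]) (I : Type) (s : I -> V) (l : seq (R[i] * I)) : V :=
  \sum_(p <- l) p.1 *: s p.2.

Lemma lin_sub (V : lmodType R[i]) (k : R[i]) (x y x' y' : V) :
  (k *: x + x') - (k *: y + y') = k *: (x - y) + (x' - y').
Proof. by rewrite scalerBr opprD addrACA. Qed.

Lemma comb_cat (V : lmodType R[i]) (I : Type) (s : I -> V) l l' :
  comb s (l ++ l') = comb s l + comb s l'.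
Proof. by rewrite /comb big_cat. Qed.

Lemma comb_scale (V : lmodType R[i]) (I : Type) (s : I -> V) k l :
  comb s [seq (k * p.1, p.2) | p <- l] = k *: comb s l.
Proof.
by rewrite /comb big_map scaler_sumr; apply: eq_bigr => p _; rewrite scalerA.
Qed.

Lemma comb1 (V : lmodType R[i]) (I : Type) (s : I -> V) i : comb s [:: (1, i)] = s i.
Proof. by rewrite /comb big_seq1 scale1r. Qed.

Lemma comb_cons (V : lmodType R[i]) (I : Type) (s : I -> V) p l :
  comb s (p :: l) = p.1 *: s p.2 + comb s l.
Proof. by rewrite /comb big_cons. Qed.

Definition dense_by (V : normedModType R[i]) (I : Type) (s : I -> V) :=
  forall v (e : R), 0 < e -> exists l, nr (v - comb s l) < e.

Lemma dense_spanP (X : cstar R) (S : set X) : dense_span S ->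
  dense_by (fun i : {x | S x} => projT1 i).
Proof.
move=> hS v e e0; have : closure (lin_span S) v by rewrite hS.
move=> /closure_nrP/(_ _ e0)[y [[n [c [s [Ss ->]]]] h]].
exists [seq (c i, exist _ (s i) (Ss i)) | i <- enum 'I_n].
by rewrite /comb big_map big_enum.
Qed.

Lemma dense_by_img (V : normedModType R[i]) (I J : Type) (s : I -> V) (t : J -> V) :
  dense_by s -> (forall i, exists j, t j = s i) -> dense_by t.
Proof.
move=> h /choice[f hf] v e /(h v)[l hl]; exists [seq (p.1, f p.2) | p <- l].
by rewrite /comb big_map; under eq_bigr do rewrite hf.
Qed.

Lemma dense_by_span (X : cstar R) (I : Type) (s : I -> X) (S : set X) :
  dense_by s -> (forall i, S (s i)) -> dense_span S.
Proof.
move=> h hS; apply/seteqP; split=> // v _; apply/closure_nrP => e /(h v)[l hl].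
exists (comb s l); split=> //.
exists (size l), (fun i => (tnth (in_tuple l) i).1), (fun i => s (tnth (in_tuple l) i).2).
by split=> //; rewrite /comb big_tnth.
Qed.

Lemma dense_by_trans (V : normedModType R[i]) (I J : Type) (s : I -> V) (t : J -> V) :
  dense_by s -> (forall i (e : R), 0 < e -> exists l, nr (s i - comb t l) < e) -> dense_by t.
Proof.
move=> h ht v e e0; have e2 : 0 < e / 2 by rewrite divr_gt0.
have [l hl] := h v _ e2.
suff [l' hl'] : exists l', nr (comb s l - comb t l') < e / 2.
  by exists l'; apply: le_lt_trans (nr_tri (comb s l) _ _) _; rewrite [ltRHS]splitr ltrD.
elim: l {hl} (e / 2) e2 => [|[k i] l IH] d d0.
  by exists [::]; rewrite /comb !big_nil subr0 nr0.
have d2 : 0 < d / 2 by rewrite divr_gt0.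
have k0 : 0 < nc k + 1 by rewrite ltr_wpDl ?nc_ge0.
have [l1 h1] := IH _ d2; have [l2 h2] := ht i _ (divr_gt0 d2 k0).
exists ([seq (k * p.1, p.2) | p <- l2] ++ l1).
rewrite comb_cat comb_scale comb_cons /=.
rewrite lin_sub; apply: le_lt_trans (nrD _ _) _; rewrite [ltRHS]splitr; apply: ler_ltD => //.
rewrite nrZ; apply: (@le_trans _ _ ((nc k + 1) * nr (s i - comb t l2))).
  by rewrite ler_wpM2r ?nr_ge0 // lerDl.
by rewrite mulrC -ler_pdivlMr // ltW.
Qed.

Section Maps.
Variables (V W : completeNormedModType R[i]) (I : Type) (s : I -> V).
Hypothesis sd : dense_by s.

Lemma linear_comb (V' W' : lmodType R[i]) (J : Type) (t : J -> V') (f : V' -> W') l :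
  linear f -> f (comb t l) = comb (f \o t) l.
Proof.
move=> lf; have fD a b : f (a + b) = f a + f b by have := lf 1 a b; rewrite !scale1r.
have f0 : f 0 = 0 by apply: (addrI (f 0)); rewrite -fD !addr0.
have fZ k a : f (k *: a) = k *: f a by have := lf k a 0; rewrite f0 !addr0.
by rewrite /comb (big_morph f fD f0); apply: eq_bigr => p _; rewrite fZ.
Qed.

Lemma dense_eq (f f' : V -> W) (c c' : R) : linear f -> linear f' ->
  (forall v, nr (f v) <= c * nr v) -> (forall v, nr (f' v) <= c' * nr v) ->
  (forall i, f (s i) = f' (s i)) -> f =1 f'.
Proof.
move=> lf lf' bf bf' e v; apply/eqP; rewrite -subr_eq0; apply/eqP.
have fB (g : V -> W) x y : linear g -> g (x - y) = g x - g y.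
  by move=> lg; have := lg (-1) y x; rewrite !scaleN1r [- y + x]addrC => ->; rewrite addrC.
apply: nr_small => d d0.
have c0 : 0 < `|c| + `|c'| + 1 by rewrite ltr_wpDl // addr_ge0.
have [l hl] := sd v (divr_gt0 d0 c0).
have el : f (comb s l) = f' (comb s l).
  by rewrite !linear_comb //; apply: eq_bigr => p _ /=; rewrite e.
rewrite (_ : f v - f' v = f (v - comb s l) - f' (v - comb s l)); last first.
  by rewrite !fB // el; zm.
apply: le_trans (nrB _ _) _; apply: le_trans (lerD (bf _) (bf' _)) _.
rewrite -mulrDl; apply: (@le_trans _ _ ((`|c| + `|c'| + 1) * nr (v - comb s l))).
  rewrite ler_wpM2r ?nr_ge0 //; have := ler_norm c; have := ler_norm c'; lra.
by rewrite mulrC -ler_pdivlMr // ltW.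
Qed.

Variables (g : I -> W) (c : R).
Hypotheses (c0 : 0 <= c) (gb : forall l, nr (comb g l) <= c * nr (comb s l)).

Lemma dense_ext : exists G : V -> W, [/\ linear G, (forall i, G (s i) = g i) &
  forall v, nr (G v) <= c * nr v].
Proof.
(* P is the closure of the graph of comb s l -> comb g l; the bound [gb] makes it the graph of a
   function. *)
pose P v w := forall e : R, 0 < e -> exists l, nr (v - comb s l) < e /\ nr (w - comb g l) < e.
have Pex v : exists w, P v w.
  have /choice[l hl] : forall n : nat, exists l, nr (v - comb s l) < n.+1%:R^-1.
    by move=> n; apply: sd; rewrite invr_gt0 ltr0Sn.
  have gB l1 l2 : nr (comb g l1 - comb g l2) <= c * nr (comb s l1 - comb s l2).
    have := gb (l1 ++ [seq (-1 * p.1, p.2) | p <- l2]).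
    by rewrite !comb_cat !comb_scale !scaleN1r.
  have c1 : 0 < c + 1 by rewrite ltr_wpDl.
  have [|w hw] := @cau_lim _ _ (fun n => comb g (l n)).
    move=> e e0; have [N hN] := @inv_small _ (e / (c + 1) / 2) ltac:(by rewrite !divr_gt0).
    exists N => m n Nm Nn; apply: le_lt_trans (gB _ _) _.
    have d : nr (comb s (l m) - comb s (l n)) < e / (c + 1).
      apply: le_lt_trans (nr_tri v _ _) _; rewrite [ltRHS]splitr nrC.
      by apply: ltrD; apply: lt_trans (hl _) (hN _ _).
    apply: (@le_lt_trans _ _ ((c + 1) * nr (comb s (l m) - comb s (l n)))).
      by rewrite ler_wpM2r ?nr_ge0 // lerDl.
    by rewrite mulrC -ltr_pdivlMr.
  exists w => e e0; have [N hN] := hw _ e0; have [M hM] := inv_small e0.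
  exists (l (maxn N M)); split.
    by apply: lt_trans (hl _) (hM _ _); exact: leq_maxr.
  by rewrite nrC; apply: hN; exact: leq_maxl.
have Plin k v w v' w' : P v w -> P v' w' -> P (k *: v + v') (k *: w + w').
  move=> h h' e e0; have e2 : 0 < e / 2 by rewrite divr_gt0.
  have k0 : 0 < nc k + 1 by rewrite ltr_wpDl ?nc_ge0.
  have [l [l1 l2]] := h _ (divr_gt0 e2 k0); have [l' [l1' l2']] := h' _ e2.
  have aux (U : completeNormedModType R[i]) (x y x' y' : U) : nr (x - y) < e / 2 / (nc k + 1) ->
      nr (x' - y') < e / 2 -> nr (k *: x + x' - (k *: y + y')) < e.
    move=> hx hy; rewrite lin_sub.
    apply: le_lt_trans (nrD _ _) _; rewrite [ltRHS]splitr; apply: ler_ltD => //.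
    rewrite nrZ; apply: (@le_trans _ _ ((nc k + 1) * nr (x - y))).
      by rewrite ler_wpM2r ?nr_ge0 // lerDl.
    by rewrite mulrC -ler_pdivlMr // ltW.
  exists ([seq (k * p.1, p.2) | p <- l] ++ l'); rewrite !comb_cat !comb_scale.
  by split; apply: aux.
have Pb v w : P v w -> nr w <= c * nr v.
  move=> h; apply/ler_addgt0Pr => e e0.
  have c1 : 0 < c + 1 by rewrite ltr_wpDl.
  have [l [h1 h2]] := h _ (divr_gt0 e0 c1).
  have n1 := nr_le_sub w (comb g l); have n2 := nr_le_sub (comb s l) v.
  rewrite nrC in n2.
  have n3 : nr w <= c * (nr v + e / (c + 1)) + e / (c + 1).
    apply: le_trans n1 _; apply: lerD; last exact: ltW.
    apply: le_trans (gb l) _; rewrite ler_wpM2l //; apply: le_trans n2 _.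
    by rewrite lerD2l ltW.
  apply: le_trans n3 _; rewrite mulrDr -addrA lerD2l -[X in _ + X]mul1r -mulrDl.
  by rewrite mulrC divfK // gt_eqF.
have [G hG] := choice Pex.
have Puniq v w w' : P v w -> P v w' -> w = w'.
  move=> h h'; apply/eqP; rewrite -subr_eq0; apply/eqP; apply: nr_eq0.
  apply/eqP; rewrite eq_le nr_ge0 andbT.
  have := Pb _ _ (Plin (-1) _ _ _ _ h' h).
  by rewrite !scaleN1r addNr nr0 mulr0 addrC.
exists G; split=> [k v v'|i|v]; last exact: Pb.
  by apply: Puniq (hG _) _; exact: Plin.
apply: Puniq (hG _) _ => e e0; exists [:: (1, i)].
by rewrite !comb1 !subrr !nr0.
Qed.

End Maps.

Section MultExt.
Variables (X : cstar R) (I : Type) (s : I -> X).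
Hypothesis sd : dense_by s.

(** g prescribes the left action on the dense family and g' that of the adjoint; the last hypothesis
    is the double centralizer identity on generators. *)
Lemma mult_ext (g g' : I -> X) (c c' : R) : 0 <= c -> 0 <= c' ->
  (forall l, nr (comb g l) <= c * nr (comb s l)) ->
  (forall l, nr (comb g' l) <= c' * nr (comb s l)) ->
  (forall i j, cadj (s i) ** g j = cadj (g' i) ** s j) ->
  exists n : multiplier X, forall i, mL n (s i) = g i.
Proof.
move=> c0 c0' gb gb' cr.
have [G [Gl Gs Gb]] := dense_ext sd c0 gb.
have [G' [Gl' Gs' Gb']] := dense_ext sd c0' gb'.
have h1 i b : cadj (s i) ** G b = cadj (G' (s i)) ** b.
  apply: (dense_eq sd (f := fun b => cadj (s i) ** G b) (f' := fun b => cadj (G' (s i)) ** b)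
    (c := nr (s i) * c) (c' := nr (G' (s i)))).
  - by move=> k x y; rewrite Gl cmulDr cmulZr.
  - by move=> k x y; rewrite cmulDr cmulZr.
  - move=> v; apply: le_trans (nrM _ _) _; rewrite nr_adj -mulrA.
    by rewrite ler_wpM2l ?nr_ge0.
  - by move=> v; apply: le_trans (nrM _ _) _; rewrite nr_adj.
  by move=> j; rewrite Gs Gs'.
have h2 a b : cadj (G b) ** a = cadj b ** G' a.
  apply: (dense_eq sd (f := fun a => cadj (G b) ** a) (f' := fun a => cadj b ** G' a)
    (c := nr (G b)) (c' := nr b * c')).
  - by move=> k x y; rewrite cmulDr cmulZr.
  - by move=> k x y; rewrite Gl' cmulDr cmulZr.
  - by move=> v; apply: le_trans (nrM _ _) _; rewrite nr_adj.
  - move=> v; apply: le_trans (nrM _ _) _; rewrite nr_adj -mulrA.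
    by rewrite ler_wpM2l ?nr_ge0.
  by move=> i; apply: cadj_inj; rewrite !cadjM !cadjK h1.
have E a b : a ** G b = cadj (G' (cadj a)) ** b.
  by apply: cadj_inj; rewrite !cadjM !cadjK h2.
by exists (Multiplier E).
Qed.

Lemma mult_eq_dense (m n : multiplier X) :
  (forall i, mL m (s i) = mL n (s i)) -> m = n.
Proof.
move=> h; apply: mult_eqL; have [t [_ bt]] := mult_bounded m.
have [t' [_ bt']] := mult_bounded n.
by apply: (dense_eq sd (c := t) (c' := t')) => //; exact: mL_linear.
Qed.

Variable (V : cstar R).

Lemma starhomD (f : X -> multiplier V) a b : starhom f -> f (a + b) = f a + f b.
Proof. by case=> l _ _; have := l 1 a b; rewrite !scale1r. Qed.

Lemma starhom0 (f : X -> multiplier V) : starhom f -> f 0 = 0.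
Proof. by move=> h; apply: (addrI (f 0)); rewrite -starhomD // !addr0. Qed.

Lemma starhomZ (f : X -> multiplier V) k a : starhom f -> f (k *: a) = k *: f a.
Proof. by move=> h; case: (h) => l _ _; have := l k a 0; rewrite starhom0 // !addr0. Qed.

Lemma starhom_sum (f : X -> multiplier V) (J : Type) (r : seq J) (P : pred J) (F : J -> X) :
  starhom f -> f (\sum_(i <- r | P i) F i) = \sum_(i <- r | P i) f (F i).
Proof.
by move=> h; apply: (big_morph f) => [a b|]; [exact: starhomD|exact: starhom0].
Qed.

Lemma starhom_le (f : X -> multiplier V) a v : starhom f ->
  nr (mL (f a) v) <= nr v * nr a.
Proof. by move=> /(starhom_bnd a)[_ /(_ v)]; rewrite mulrC. Qed.

Lemma starhom_eq_dense (f f' : X -> multiplier V) : starhom f -> starhom f' ->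
  (forall i, f (s i) = f' (s i)) -> f = f'.
Proof.
move=> hf hf' e; apply/funext => a; apply: mult_eqL => v.
apply: (dense_eq sd (f := fun a => mL (f a) v) (f' := fun a => mL (f' a) v)
  (c := nr v) (c' := nr v)).
- by move=> k x y; case: hf => -> _ _.
- by move=> k x y; case: hf' => -> _ _.
- by move=> x; exact: starhom_le.
- by move=> x; exact: starhom_le.
by move=> i; rewrite e.
Qed.

(** For each v the map t -> F(t) v is extended by density, and the adjoint relation on generators
    shows that these maps form multipliers. Multiplicativity is extended one variable at a time. *)
Lemma hom_ext (g : I -> multiplier V) :
  (forall l, bnd (comb g l) (nr (comb s l))) ->
  (forall i, exists i', s i' = cadj (s i) /\ g i' = madj (g i)) ->
  (forall i j, exists k, s k = s i ** s j /\ g k = g i * g j) ->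
  exists F : X -> multiplier V, starhom F /\ forall i, F (s i) = g i.
Proof.
move=> gb gadj gmul.
have mcomb l v : mL (comb g l) v = comb (fun i => mL (g i) v) l.
  by rewrite /comb msumL.
have /choice[G hG] : forall v, exists G : X -> V, [/\ linear G,
    (forall i, G (s i) = mL (g i) v) & forall t, nr (G t) <= nr v * nr t].
  move=> v; apply: dense_ext => //; first exact: nr_ge0.
  by move=> l; rewrite -mcomb mulrC; exact: (proj2 (gb l)).
have GL v : linear (G v) by case: (hG v).
have Gs v i : G v (s i) = mL (g i) v by case: (hG v).
have Gb v t : nr (G v t) <= nr v * nr t by case: (hG v).
have h a b t : cadj a ** G b t = cadj (G a (cadj t)) ** b.
  apply: (dense_eq sd (f := fun t => cadj a ** G b t)
    (f' := fun t => cadj (G a (cadj t)) ** b) (c := nr a * nr b) (c' := nr a * nr b)).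
  - by move=> k x y; rewrite GL cmulDr cmulZr.
  - by move=> k x y; rewrite cadjD cadjZ GL cadjD cadjZ conjCK cmulDl cmulZl.
  - move=> v; apply: le_trans (nrM _ _) _; rewrite nr_adj -mulrA.
    by rewrite ler_wpM2l ?nr_ge0.
  - move=> v; apply: le_trans (nrM _ _) _; rewrite nr_adj mulrAC.
    by rewrite ler_wpM2r ?nr_ge0 // -[nr v]nr_adj.
  move=> i; have [i' [si gi]] := gadj i.
  by rewrite -si !Gs gi madj_ip.
have E t a b : a ** G b t = cadj (G (cadj a) (cadj t)) ** b.
  by rewrite -h cadjK.
pose F t := Multiplier (E t).
have FL : linear F.
  move=> k x y; apply: mult_eqL => v.
  by rewrite mL_add mL_scale /= GL.
have Fs i : F (s i) = g i by apply: mult_eqL => v /=; rewrite Gs.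
exists F; split=> //; split=> //.
- move=> a b; apply: mult_eqL => v.
  have h1 i c : G v (s i ** c) = G (G v c) (s i).
    rewrite Gs.
    apply: (dense_eq sd (f := fun c => G v (s i ** c)) (f' := fun c => mL (g i) (G v c))
      (c := nr v * nr (s i)) (c' := nr (s i) * nr v)).
    + by move=> k x y; rewrite cmulDr cmulZr GL.
    + by move=> k x y; rewrite GL mLD mLZ.
    + move=> x; apply: le_trans (Gb _ _) _; rewrite -mulrA.
      by rewrite ler_wpM2l ?nr_ge0 ?nrM.
    + move=> x; rewrite -mulrA; have := gb [:: (1, i)]; rewrite !comb1 => -[_ bi].
      by apply: le_trans (bi _) _; rewrite ler_wpM2l ?nr_ge0.
    by move=> j; have [k [sk gk]] := gmul i j; rewrite -sk !Gs gk.
  apply: (dense_eq sd (f := fun a => G v (a ** b)) (f' := fun a => G (G v b) a)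
      (c := nr v * nr b) (c' := nr (G v b))).
  + by move=> k x y; rewrite cmulDl cmulZl GL.
  + by move=> k x y; rewrite GL.
  + move=> x; apply: le_trans (Gb _ _) _; rewrite -mulrA.
    by rewrite ler_wpM2l ?nr_ge0 // mulrC nrM.
  + by [].
  by move=> i; rewrite h1.
by move=> a; apply: mult_eqL => v /=; rewrite !cadjK.
Qed.

End MultExt.

Section Ext.
Variables (A B : cstar R) (phi : A -> multiplier B).
Hypotheses (hp : starhom phi) (nd : nondegenerate phi).

Lemma nondeg_dense : dense_by (fun p : A * B => mL (phi p.1) p.2).
Proof.
apply: dense_by_img (dense_spanP nd) _ => -[x [a [b e]]] /=.
by exists (a, b).
Qed.

(** The left action must send phi(a) b to phi(m a) b. With m^* m + g^2 = t^2, the squares of the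
    images under m and under g add up to t^2 times the square of the argument, and [nr_dom] gives
    the bound t. *)
Lemma extP (m : multiplier A) a : ext phi m * phi a = phi (mL m a).
Proof.
move: a; apply: (@the_orP _ 0 (fun n => forall a, n * phi a = phi (mL m a))).
case: (hp) => pl pM pa.
have cl (n : multiplier A) l : comb (fun p : A * B => mL (phi (mL n p.1)) p.2) l =
    \sum_(p <- l) p.1 *: mL (phi (mL n p.2.1)) p.2.2 by [].
have gb (n : multiplier A) : exists2 t, 0 <= t & forall l,
    nr (comb (fun p : A * B => mL (phi (mL n p.1)) p.2) l) <=
    t * nr (comb (fun p : A * B => mL (phi p.1) p.2) l).
  have [t bt] := mult_bounded n; exists t; first by case: bt.
  have [g ga ge] := bnd_compl bt.
  move=> l; apply: (@nr_dom _ _ _ (comb (fun p : A * B => mL (phi (mL g p.1)) p.2) l)).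
    by case: bt.
  have E (u v : multiplier A) : cadj (comb (fun p : A * B => mL (phi (mL u p.1)) p.2) l) **
      comb (fun p : A * B => mL (phi (mL v p.1)) p.2) l =
      \sum_(p <- l) \sum_(p' <- l) ((p.1^*)%R * p'.1) *:
        (cadj p.2.2 ** mL (phi (cadj p.2.1 ** mL (madj u * v) p'.2.1)) p'.2.2).
    rewrite /comb cadj_sum cmul_suml; apply: eq_bigr => p _.
    rewrite cmul_sumr; apply: eq_bigr => p' _.
    rewrite cadjZ cmulZl cmulZr scalerA; congr (_ *: _).
    rewrite -madj_ip' -pa -mL_mul -pM; congr (_ ** mL (phi _) _).
    by rewrite mL_mul madj_ip'.
  have := E n n; have := E g g; have := E 1 1; rewrite !madj1 !mul1r ga.
  rewrite -[comb (fun p => mL (phi (mL 1 p.1)) p.2) l]/(comb (fun p => mL (phi p.1) p.2) l).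
  move=> -> -> ->; rewrite -big_split scaler_sumr; apply: eq_bigr => p _ /=.
  rewrite -big_split scaler_sumr; apply: eq_bigr => p' _ /=.
  rewrite [RHS]scalerA [X in _ = X *: _]mulrC -[RHS]scalerA -scalerDr; congr (_ *: _).
  rewrite -cmulDr -mL_add -(starhomD _ _ hp) -cmulDr.
  rewrite -[X in phi (_ ** X)]/(mL (madj n * n + g * g) _) ge mL_rsc cmulZr.
  by rewrite (starhomZ _ _ hp) mL_scale cmulZr expr2.
have [t t0 bt] := gb m; have [t' t0' bt'] := gb (madj m).
have [|n hn] := mult_ext nondeg_dense t0 t0' bt bt'.
  move=> [a b] [a' b'].
  rewrite -[LHS]/(cadj (mL (phi a) b) ** mL (phi (mL m a')) b').
  rewrite -[RHS]/(cadj (mL (phi (mL (madj m) a)) b) ** mL (phi a') b').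
  by rewrite -!madj_ip' -!pa -!mL_mul -!pM (madj_ip m a a').
by exists n => a; apply: mult_eqL => b; have := hn (a, b).
Qed.

Lemma ext_uniq m n : (forall a, n * phi a = phi (mL m a)) -> n = ext phi m.
Proof.
move=> h; apply: (mult_eq_dense nondeg_dense) => -[a b] /=.
by rewrite -!mL_mul h extP.
Qed.

Lemma ext_incl a : ext phi (incl a) = phi a.
Proof. by symmetry; apply: ext_uniq => b; case: hp => _ pM _; rewrite -pM. Qed.

Lemma ext1 : ext phi 1 = 1.
Proof. by symmetry; apply: ext_uniq => b; rewrite mul1r. Qed.

Lemma extD m n : ext phi (m + n) = ext phi m + ext phi n.
Proof.
by symmetry; apply: ext_uniq => b; rewrite mulrDl !extP mL_add starhomD.
Qed.

Lemma extZ k m : ext phi (k *: m) = k *: ext phi m.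
Proof.
by symmetry; apply: ext_uniq => b; rewrite mscaleAl !extP mL_scale starhomZ.
Qed.

Lemma extM m n : ext phi (m * n) = ext phi m * ext phi n.
Proof. by symmetry; apply: ext_uniq => b; rewrite -mulrA !extP. Qed.

Lemma nondeg_eq m n : (forall a, m * phi a = n * phi a) -> m = n.
Proof.
move=> h; apply: (mult_eq_dense nondeg_dense) => -[a b] /=.
by rewrite -!mL_mul h.
Qed.

Lemma nondeg_eql m n : (forall a, phi a * m = phi a * n) -> m = n.
Proof.
move=> h; rewrite -[m]madjK -[n]madjK; congr madj; apply: nondeg_eq => a.
by case: hp => _ _ pa; rewrite -[a]cadjK pa -!madjM h.
Qed.

Lemma ext_adj m : ext phi (madj m) = madj (ext phi m).
Proof.
symmetry; apply: ext_uniq => a; apply: nondeg_eql => c.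
case: (hp) => pl pM pa; rewrite -pM.
rewrite -[c]cadjK pa mulrA -madjM extP -!pa -pM.
by rewrite madj_ip madjK.
Qed.

End Ext.

End Density.

Section Conj.
Variable R : realType.
Implicit Types a b : R[i].
Lemma cjM a b : ((a * b)^*)%R = (a^*)%R * (b^*)%R. Proof. exact: rmorphM. Qed.
Lemma cjN a : ((- a)^*)%R = - (a^*)%R. Proof. exact: rmorphN. Qed.
Lemma cj1 : ((1 : R[i])^*)%R = 1. Proof. exact: rmorph1. Qed.
End Conj.

(** * Minimal tensor products and their legs *)

Section TensorNorm.
Variables (R : realType) (H1 H2 : hilbert R).
Implicit Types z : seq (H1 * H2).

(* The inner product of \sum_{(x,y) in z} x (x) y and its analogue for z' *)
Definition tip z z' : R[i] :=
  \sum_(p <- z) \sum_(p' <- z') ip p.1 p'.1 * ip p.2 p'.2.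

Lemma tip_catl z1 z2 z : tip (z1 ++ z2) z = tip z1 z + tip z2 z.
Proof. by rewrite /tip big_cat. Qed.

Lemma tip_catr z1 z2 z : tip z (z1 ++ z2) = tip z z1 + tip z z2.
Proof. by rewrite /tip -big_split; apply: eq_bigr => p _; rewrite big_cat. Qed.

Definition tscale (k : R[i]) z := [seq (k *: p.1, p.2) | p <- z].

Lemma tip_scalel k z z' : tip (tscale k z) z' = k * tip z z'.
Proof.
rewrite /tip big_map mulr_sumr; apply: eq_bigr => p _.
by rewrite mulr_sumr; apply: eq_bigr => p' _; rewrite ipZ mulrA.
Qed.

Lemma tip_scaler k z z' : tip z (tscale k z') = (k^*)%R * tip z z'.
Proof.
rewrite /tip mulr_sumr; apply: eq_bigr => p _.
rewrite big_map mulr_sumr; apply: eq_bigr => p' _.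
by rewrite ipZr mulrA.
Qed.

Lemma ip0r (H : hilbert R) (x : H) : ip x 0 = 0.
Proof. by rewrite -[X in ip _ X](scale0r (0 : H)) ipZr rmorph0 mul0r. Qed.
Lemma ip0l (H : hilbert R) (x : H) : ip 0 x = 0.
Proof. by rewrite ip_conj ip0r rmorph0. Qed.

(** Gram-Schmidt in the second factor: splitting every second component along y0 separates a
    nonnegative multiple of <y0, y0> from a sum whose first term has become x0 ⊗ 0, so the number of
    terms drops. *)
Lemma tip_ge0 z : 0 <= tip z z.
Proof.
have [n] := ubnP (size z); elim: n z => // n IH [|[x0 y0] z] /=.
  by rewrite /tip big_nil.
rewrite ltnS => hz; have [->|y00] := eqVneq y0 0.
  rewrite (_ : tip _ _ = tip z z) ?IH // -cat1s tip_catl !tip_catr.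
  rewrite {1 2 3}/tip !big_seq1 /= ip0l mulr0 !(addr0, add0r).
  rewrite [X in X + (_ + _)]big1 ?add0r; last by move=> p _ /=; rewrite ip0l mulr0.
  by rewrite big1 ?add0r // => p _; rewrite big_seq1 /= ip0r mulr0.
have n0 : ip y0 y0 != 0.
  rewrite ip_nr; apply: contra y00 => /eqP h; apply/eqP/nr_eq0.
  by apply/eqP; rewrite -sqrf_eq0; apply/eqP; move: h => [].
pose c (y : H2) := ip y y0 / ip y0 y0.
pose qq (p : H1 * H2) := (p.1, p.2 - c p.2 *: y0).
have cc y : c y * ip y0 y0 = ip y y0 by rewrite divfK.
have E y y' : ip y y' = c y * ((c y')^*)%R * ip y0 y0 + ip (y - c y *: y0) (y' - c y' *: y0).
  have er : ip (y - c y *: y0) y0 = 0 by rewrite ipB ipZ cc subrr.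
  have -> : ip (y - c y *: y0) (y' - c y' *: y0) = ip (y - c y *: y0) y'.
    have := (@psBr _ (hilb_pre H2)) (y - c y *: y0) y' (c y' *: y0).
    by rewrite /= ipZr er mulr0 subr0.
  rewrite ipB ipZ [ip y0 y']ip_conj -[ip y' y0]cc cjM.
  have -> : ((ip y0 y0)^*)%R = ip y0 y0 by rewrite -ip_conj.
  by rewrite mulrA addrC subrK.
have gen l : tip l l = ip (\sum_(p <- l) c p.2 *: p.1) (\sum_(p <- l) c p.2 *: p.1) * ip y0 y0
    + tip [seq qq p | p <- l] [seq qq p | p <- l].
  rewrite ip_suml mulr_suml /tip big_map -big_split; apply: eq_bigr => p _ /=.
  rewrite ip_sumr mulr_suml big_map -big_split; apply: eq_bigr => p' _ /=.
  rewrite ipZ ipZr [ip p.2 p'.2]E; ring.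
rewrite gen; set l := (x0, y0) :: z.
have q0 : qq (x0, y0) = (x0, 0) by rewrite /qq /c /= divff // scale1r subrr.
apply: addr_ge0; first by rewrite mulr_ge0 // hilb_ge0.
rewrite /l /= q0; set z' := [seq _ | _ <- z].
rewrite (_ : tip _ _ = tip z' z'); first by apply: IH; rewrite size_map.
rewrite -cat1s tip_catl !tip_catr.
rewrite {1 2 3}/tip !big_seq1 /= ip0l mulr0 !(addr0, add0r).
rewrite [X in X + (_ + _)]big1 ?add0r; last by move=> p _ /=; rewrite ip0l mulr0.
by rewrite big1 ?add0r // => p _; rewrite big_seq1 /= ip0r mulr0.
Qed.

Definition tn z : R := Num.sqrt (Re (tip z z)).

Lemma tn_sqr z : ((tn z) ^+ 2)%:C = tip z z.
Proof. by have [e h] := ge0_realE (tip_ge0 z); rewrite sqr_sqrtr // -e. Qed.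

Lemma tn_ge0 z : 0 <= tn z. Proof. exact: sqrtr_ge0. Qed.

(** Combinations of z and z' are parametrized by R[i]^2, on which [tip] induces a positive form;
    Cauchy-Schwarz is applied to the two coordinate vectors. *)
Lemma tip_le z z' : nc (tip z z') <= tn z * tn z'.
Proof.
pose V : lmodType R[i] := (R[i]^o * R[i]^o)%type.
pose s (a b : V) : R[i] := tip (tscale a.1 z ++ tscale a.2 z') (tscale b.1 z ++ tscale b.2 z').
have sE a b : s a b = a.1 * ((b.1^*)%R * tip z z + (b.2^*)%R * tip z z')
   + a.2 * ((b.1^*)%R * tip z' z + (b.2^*)%R * tip z' z').
  by rewrite /s tip_catl !tip_catr !tip_scalel !tip_scaler -!mulrDr.
have sl y : linear (s^~ y : V -> R[i]^o).
  move=> k a b; rewrite !sE /= /GRing.scale /=; ring.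
have sr x k y y' : s x (k *: y + y') = (k^*)%R * s x y + s x y'.
  have E (u v : R[i]) : ((k * u + v)^*)%R = (k^*)%R * (u^*)%R + (v^*)%R.
    by rewrite rmorphD rmorphM.
  rewrite !sE /= [((k * y.1 + _)^*)%R]E [((k * y.2 + _)^*)%R]E; ring.
have sp a : 0 <= s a a by exact: tip_ge0.
have := @cauchy_schwarz _ (herm_prehilb sl sr sp) (1, 0) (0, 1).
rewrite /q /q2 /= !sE /= !rmorph0 !rmorph1.
by rewrite !(mul0r, mul1r, add0r, addr0).
Qed.

End TensorNorm.

Section Tensor.
Variables (R : realType) (X Y : cstar R) (T : min_tensor X Y).
Implicit Types (x : X) (y : Y) (t : T).
Local Notation tns := (fun p : X * Y => tens p.1 p.2 : T).

Lemma tensDl x x' y : tens (x + x') y = tens x y + tens x' y :> T.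
Proof. by have := tens_linl T y 1 x x'; rewrite !scale1r. Qed.
Lemma tensDr x y y' : tens x (y + y') = tens x y + tens x y' :> T.
Proof. by have := tens_linr T x 1 y y'; rewrite !scale1r. Qed.
Lemma tens0l y : tens 0 y = 0 :> T.
Proof. by apply: (addrI (tens 0 y)); rewrite -tensDl !addr0. Qed.
Lemma tens0r x : tens x 0 = 0 :> T.
Proof. by apply: (addrI (tens x 0)); rewrite -tensDr !addr0. Qed.
Lemma tensZl k x y : tens (k *: x) y = k *: tens x y :> T.
Proof. by have := tens_linl T y k x 0; rewrite tens0l !addr0. Qed.
Lemma tensZr k x y : tens x (k *: y) = k *: tens x y :> T.
Proof. by have := tens_linr T x k y 0; rewrite tens0r !addr0. Qed.
Lemma tens_suml (I : Type) (r : seq I) (P : pred I) (f : I -> X) y :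
  tens (\sum_(i <- r | P i) f i) y = \sum_(i <- r | P i) tens (f i) y :> T.
Proof. by apply: (big_morph (fun x => tens x y : T)) => [a b|]; [exact: tensDl|exact: tens0l]. Qed.
Lemma tens_sumr (I : Type) (r : seq I) (P : pred I) x (f : I -> Y) :
  tens x (\sum_(i <- r | P i) f i) = \sum_(i <- r | P i) tens x (f i) :> T.
Proof. by apply: (big_morph (fun y => tens x y : T)) => [a b|]; [exact: tensDr|exact: tens0r]. Qed.

Lemma tens_dense_by : dense_by tns.
Proof.
apply: dense_by_img (dense_spanP (tens_dense T)) _ => -[t [x [y e]]] /=.
by exists (x, y).
Qed.

(* The action of \sum k x (x) y on \sum v (x) w *)
Definition tact (H1 H2 : hilbert R) (rho1 : X -> H1 -> H1) (rho2 : Y -> H2 -> H2)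
    (l : seq (R[i] * (X * Y))) (z : seq (H1 * H2)) :=
  [seq (rho1 (p.1 *: p.2.1) v.1, rho2 p.2.2 v.2) | p <- l, v <- z].

(** The coefficients are moved into the first factor, which turns the indexed norm formula of
    [min_tensor] into one on lists. *)
Lemma tens_norm_seq l (M : R) : 0 <= M ->
  nr (comb tns l) <= M <->
  (forall (H1 H2 : hilbert R) (rho1 : X -> H1 -> H1) (rho2 : Y -> H2 -> H2),
      is_rep rho1 -> is_rep rho2 -> forall z,
      tn (tact rho1 rho2 l z) <= M * tn z).
Proof.
move=> M0.
have M0' : 0 <= M%:C by rewrite lecR.
pose a (i : 'I_(size l)) := (tnth (in_tuple l) i).1 *: (tnth (in_tuple l) i).2.1.
pose b (i : 'I_(size l)) := (tnth (in_tuple l) i).2.2.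
have := @tens_norm _ _ _ T (size l) a b M%:C M0'.
have -> : \sum_i tens (a i) (b i) = comb tns l.
  by rewrite /comb [RHS]big_tnth; apply: eq_bigr => i _; rewrite tensZl.
rewrite nrE lecR => ->.
have E1 (H1 H2 : hilbert R) (rho1 : X -> H1 -> H1) (rho2 : Y -> H2 -> H2) m
   (xi : 'I_m -> H1) (eta : 'I_m -> H2) z : z = [seq (xi i, eta i) | i <- enum 'I_m] ->
   tnorm2 (fun k : 'I_(size l) * 'I_m => rho1 (a k.1) (xi k.2))
               (fun k => rho2 (b k.1) (eta k.2)) =
   tip (tact rho1 rho2 l z) (tact rho1 rho2 l z) /\ tnorm2 xi eta = tip z z.
  move=> ->.
  have G (F : H1 * H2 -> R[i]) : \sum_(p <- tact rho1 rho2 l [seq (xi i, eta i) | i <- enum 'I_m]) F p =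
      \sum_(k : 'I_(size l) * 'I_m) F (rho1 (a k.1) (xi k.2), rho2 (b k.1) (eta k.2)).
    rewrite /tact big_allpairs_dep big_tnth -(pair_big predT predT
      (fun i j => F (rho1 (a i) (xi j), rho2 (b i) (eta j)))) /=.
    by apply: eq_bigr => i _; rewrite big_map big_enum.
  split.
    by rewrite /tip G; apply: eq_bigr => k _; rewrite G.
  rewrite /tip big_map big_enum; apply: eq_bigr => k _.
  by rewrite big_map big_enum.
have E2 (u v : R[i]) : 0 <= u -> 0 <= v -> (u <= M%:C ^+ 2 * v) =
    (Num.sqrt (Re u) <= M * Num.sqrt (Re v)).
  move=> /ge0_realE[-> hu] /ge0_realE[-> hv].
  rewrite -rmorphXn -rmorphM lecR /= -[M in RHS]ger0_norm // -[`|M|]sqrtr_sqr.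
  by rewrite -sqrtrM ?sqr_ge0 // ler_psqrt // ?nnegrE ?mulr_ge0 ?sqr_ge0.
split=> h H1 H2 rho1 rho2 r1 r2.
  move=> z; have := h _ _ _ _ r1 r2 _ (fun i => (tnth (in_tuple z) i).1) (fun i => (tnth (in_tuple z) i).2).
  have [|-> ->] := E1 _ _ rho1 rho2 _ (fun i => (tnth (in_tuple z) i).1) (fun i => (tnth (in_tuple z) i).2) z.
    rewrite -[LHS](map_tnth_enum (in_tuple z)); apply: eq_map => i.
    by case: (tnth _ _).
  by rewrite E2 ?tip_ge0.
move=> m xi eta.
have [|-> ->] := E1 _ _ rho1 rho2 _ xi eta [seq (xi i, eta i) | i <- enum 'I_m]; first by [].
by rewrite E2 ?tip_ge0 //; exact: h.
Qed.

Lemma tens_norm_rep (H1 H2 : hilbert R) (rho1 : X -> H1 -> H1) (rho2 : Y -> H2 -> H2) l z :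
  is_rep rho1 -> is_rep rho2 -> tn (tact rho1 rho2 l z) <= nr (comb tns l) * tn z.
Proof. by move=> r1 r2; apply: (proj1 (tens_norm_seq l (nr_ge0 _))). Qed.

End Tensor.

Section Flip.
Variables (R : realType) (X Y : cstar R) (T : min_tensor X Y).

Fact flip_dense : @dense_span R T [set t | exists y x, t = tens x y].
Proof.
suff -> : [set t | exists y x, t = tens x y] = [set t | exists x y, t = tens x y :> T].
  exact: tens_dense.
by apply/seteqP; split=> t [a [b ->]]; exists b, a.
Qed.

Fact flip_norm n (a : 'I_n -> Y) (b : 'I_n -> X) (M : R[i]) : 0 <= M ->
    (`|\sum_i (tens (b i) (a i) : T)| <= M) <->
    (forall (H1 H2 : hilbert R) (rho1 : Y -> H1 -> H1) (rho2 : X -> H2 -> H2),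
      is_rep rho1 -> is_rep rho2 ->
      forall m (xi : 'I_m -> H1) (eta : 'I_m -> H2),
        tnorm2 (fun k : 'I_n * 'I_m => rho1 (a k.1) (xi k.2))
               (fun k : 'I_n * 'I_m => rho2 (b k.1) (eta k.2))
        <= M ^+ 2 * tnorm2 xi eta).
Proof.
have sw (H1 H2 : hilbert R) (I : finType) (x : I -> H1) (y : I -> H2) : tnorm2 x y = tnorm2 y x.
  by apply: eq_bigr => k _; apply: eq_bigr => l _; rewrite mulrC.
move=> M0; rewrite (tens_norm T b a M0); split=> h H1 H2 r1 r2 h1 h2 m xi eta.
  by rewrite !(sw H1 H2); exact: h.
by rewrite !(sw H1 H2); exact: h.
Qed.

(** The same algebra viewed as a tensor product of Y and X; facts about the second leg become facts
    about the first. *)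
Definition flip : min_tensor Y X := @MinTensor R Y X T (fun y x => tens x y)
  (fun y => @tens_linr _ _ _ T y) (fun x => @tens_linl _ _ _ T x)
  (fun y y' x x' => @tensM _ _ _ T x x' y y') (fun y x => @tens_adj _ _ _ T x y)
  flip_dense flip_norm.

End Flip.

Lemma madj_dense (R : realType) (X : cstar R) (I : Type) (s : I -> X) (n : multiplier X) g :
  dense_by s -> (forall i j, cadj (s i) ** mL n (s j) = cadj (g i) ** s j) ->
  forall i, mL (madj n) (s i) = g i.
Proof.
move=> sd h i; apply/eqP; rewrite -subr_eq0; apply/eqP/cs_eq0.
set D := _ - _.
apply: (dense_eq sd (f := fun c => cadj D ** c) (f' := fun=> 0) (c := nr D) (c' := 0)).
- by move=> k x y; rewrite cmulDr cmulZr.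
- by move=> k x y; rewrite scaler0 addr0.
- by move=> v; apply: le_trans (nrM _ _) _; rewrite nr_adj.
- by move=> v; rewrite nr0 mul0r.
by move=> j; rewrite /D cadjB cmulBl -madj_ip h subrr.
Qed.

Section Leg1.
Variables (R : realType) (X Y : cstar R) (T : min_tensor X Y).
Implicit Types (m n : multiplier X).

(** Existence of m ⊗ 1 rests on the C*-identity of T: as for [extP], a complement g of m makes the
    square of the image at most t^2 times that of the argument. *)
Lemma leg1P m x y : mL (leg1 m) (tens x y) = tens (mL m x) y :> T.
Proof.
move: x y; rewrite /leg1; set P := fun _ => _; apply: (@the_orP _ _ P); rewrite {}/P.
have gb n : exists2 t, 0 <= t & forall l,
    nr (comb (fun p : X * Y => tens (mL n p.1) p.2 : T) l) <=
    t * nr (comb (fun p : X * Y => tens p.1 p.2 : T) l).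
  have [t bt] := mult_bounded n; exists t; first by case: bt.
  have [g ga ge] := bnd_compl bt.
  move=> l; apply: (@nr_dom _ _ _ (comb (fun p : X * Y => tens (mL g p.1) p.2 : T) l)).
    by case: bt.
  have E (u v : multiplier X) : cadj (comb (fun p : X * Y => tens (mL u p.1) p.2 : T) l) **
      comb (fun p : X * Y => tens (mL v p.1) p.2 : T) l =
      \sum_(p <- l) \sum_(p' <- l) ((p.1^*)%R * p'.1) *:
        (tens (cadj p.2.1 ** mL (madj u * v) p'.2.1) (cadj p.2.2 ** p'.2.2) : T).
    rewrite /comb cadj_sum cmul_suml; apply: eq_bigr => p _.
    rewrite cmul_sumr; apply: eq_bigr => p' _.
    by rewrite cadjZ cmulZl cmulZr scalerA -tens_adj -tensM -madj_ip'.
  have := E n n; have := E g g; have := E 1 1; rewrite !madj1 !mul1r ga.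
  rewrite -[comb (fun p => tens (mL 1 p.1) p.2) l]/(comb (fun p => tens p.1 p.2 : T) l).
  move=> -> -> ->; rewrite -big_split scaler_sumr; apply: eq_bigr => p _ /=.
  rewrite -big_split scaler_sumr; apply: eq_bigr => p' _ /=.
  rewrite [RHS]scalerA [X in _ = X *: _]mulrC -[RHS]scalerA -scalerDr; congr (_ *: _).
  rewrite -tensDl -cmulDr.
  rewrite -[X in cadj p.2.1 ** X]/(mL (madj n * n + g * g) _) ge mL_rsc cmulZr.
  by rewrite tensZl expr2.
have [t t0 bt] := gb m; have [t' t0' bt'] := gb (madj m).
have [|n hn] := mult_ext (@tens_dense_by _ _ _ T) t0 t0' bt bt'.
  by move=> [a b] [a' b']; rewrite -!tens_adj -!tensM (madj_ip m a a').
by exists n => x y; exact: (hn (x, y)).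
Qed.

Lemma tens_eq (m n : multiplier T) :
  (forall x y, mL m (tens x y) = mL n (tens x y)) -> m = n.
Proof. by move=> h; apply: (mult_eq_dense (@tens_dense_by _ _ _ T)) => -[x y]; exact: h. Qed.

Lemma leg1_uniq m (n : multiplier T) :
  (forall x y, mL n (tens x y) = tens (mL m x) y) -> n = leg1 m.
Proof. by move=> h; apply: tens_eq => x y; rewrite h leg1P. Qed.

Lemma leg1D m n : leg1 (m + n) = leg1 m + leg1 n :> multiplier T.
Proof. by symmetry; apply: leg1_uniq => x y; rewrite !mL_add !leg1P tensDl. Qed.
Lemma leg1Z k m : leg1 (k *: m) = k *: leg1 m :> multiplier T.
Proof. by symmetry; apply: leg1_uniq => x y; rewrite !mL_scale !leg1P tensZl. Qed.
Lemma leg1M m n : leg1 (m * n) = leg1 m * leg1 n :> multiplier T.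
Proof. by symmetry; apply: leg1_uniq => x y; rewrite !mL_mul !leg1P. Qed.
Lemma leg1_1 : leg1 1 = 1 :> multiplier T.
Proof. by symmetry; apply: leg1_uniq. Qed.
Lemma leg1_0 : leg1 0 = 0 :> multiplier T.
Proof. by symmetry; apply: leg1_uniq => x y; rewrite tens0l. Qed.
Lemma leg1_adj m : leg1 (madj m) = madj (leg1 m) :> multiplier T.
Proof.
symmetry; apply: leg1_uniq => x y.
apply: (madj_dense (@tens_dense_by _ _ _ T) (g := fun p => tens (mL (madj m) p.1) p.2) _ (x, y)).
move=> [a b] [a' b'] /=; rewrite leg1P -!tens_adj -!tensM.
by rewrite (madj_ip m a a').
Qed.
(** The identity m^* m + g^2 = t^2 is preserved by the homomorphism [leg1]. *)
Lemma leg1_bnd m t : bnd m t -> bnd (leg1 m : multiplier T) t.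
Proof.
move=> bt; apply: bnd_cs; first by case: bt.
have [g ga ge] := bnd_compl bt.
have e : madj (leg1 m) * leg1 m + leg1 g * leg1 g = rsc T (t * t).
  by rewrite -leg1_adj -!leg1M -leg1D ge /rsc leg1Z leg1_1.
apply: (@pos_le_bnd _ _ _ (t ^+ 2)); [exact: sqr_ge0|exact: pos_cs|].
rewrite expr2 -e addrAC subrr add0r; apply: pos_sq.
by rewrite -leg1_adj ga.
Qed.
Lemma leg1_incl_bnd x : bnd (leg1 (incl x) : multiplier T) (nr x).
Proof. exact/leg1_bnd/bnd_incl. Qed.

End Leg1.

Section Leg2.
Variables (R : realType) (X Y : cstar R) (T : min_tensor X Y).
Implicit Types (m n : multiplier Y).

Lemma leg2E m : leg2 m = leg1 (T := flip T) m :> multiplier T.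
Proof.
rewrite /leg2 /leg1; congr the_or; apply/funext => n; apply/propext.
by split=> h x y; exact: h.
Qed.

Lemma leg2P m x y : mL (leg2 m) (tens x y) = tens x (mL m y) :> T.
Proof. by rewrite leg2E; exact: (@leg1P _ _ _ (flip T) m y x). Qed.
Lemma leg2D m n : leg2 (m + n) = leg2 m + leg2 n :> multiplier T.
Proof. by rewrite !leg2E; exact: (@leg1D _ _ _ (flip T)). Qed.
Lemma leg2Z k m : leg2 (k *: m) = k *: leg2 m :> multiplier T.
Proof. by rewrite !leg2E; exact: (@leg1Z _ _ _ (flip T)). Qed.
Lemma leg2M m n : leg2 (m * n) = leg2 m * leg2 n :> multiplier T.
Proof. by rewrite !leg2E; exact: (@leg1M _ _ _ (flip T)). Qed.
Lemma leg2_1 : leg2 1 = 1 :> multiplier T.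
Proof. by rewrite leg2E; exact: (@leg1_1 _ _ _ (flip T)). Qed.
Lemma leg2_0 : leg2 0 = 0 :> multiplier T.
Proof. by rewrite leg2E; exact: (@leg1_0 _ _ _ (flip T)). Qed.
Lemma leg2_adj m : leg2 (madj m) = madj (leg2 m) :> multiplier T.
Proof. by rewrite !leg2E; exact: (@leg1_adj _ _ _ (flip T)). Qed.
Lemma leg2_bnd m t : bnd m t -> bnd (leg2 m : multiplier T) t.
Proof. by rewrite leg2E; exact: (@leg1_bnd _ _ _ (flip T)). Qed.

Lemma legC (a : multiplier X) m : leg1 a * leg2 m = leg2 m * leg1 a :> multiplier T.
Proof. by apply: tens_eq => x y; rewrite !mL_mul leg1P !leg2P leg1P. Qed.

Lemma leg_tens x y : leg1 (incl x) * leg2 (incl y) = incl (tens x y) :> multiplier T.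
Proof. by apply: tens_eq => a b; rewrite mL_mul leg2P leg1P !mL_incl tensM. Qed.

Lemma starhom_leg1 (V : cstar R) (f : V -> multiplier X) : starhom f ->
  starhom (fun v => leg1 (f v) : multiplier T).
Proof.
case=> fl fM fa; split.
- by move=> k a b; rewrite fl leg1D leg1Z.
- by move=> a b; rewrite fM leg1M.
by move=> a; rewrite fa leg1_adj.
Qed.

Lemma starhom_leg2 (V : cstar R) (f : V -> multiplier Y) : starhom f ->
  starhom (fun v => leg2 (f v) : multiplier T).
Proof.
case=> fl fM fa; split.
- by move=> k a b; rewrite fl leg2D leg2Z.
- by move=> a b; rewrite fM leg2M.
by move=> a; rewrite fa leg2_adj.
Qed.

Lemma nr_tens x y : nr (tens x y : T) <= nr x * nr y.
Proof.
apply: bnd_incl_le; rewrite -leg_tens; apply: bndM.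
  exact: leg1_incl_bnd.
exact/leg2_bnd/bnd_incl.
Qed.

End Leg2.

(** * Slices *)

Section VectorFunctionals.
Variables (R : realType) (Y : cstar R).

(** Vector functionals play the part of the dual space: they are stable under multiplication by
    elements of Y, and slicing with them is bounded for the minimal norm. *)
Definition vecf (chi : Y -> R[i]) := exists (H : hilbert R) (rho : Y -> H -> H) (xi eta : H),
  is_rep rho /\ chi = fun y => ip (rho y xi) eta.

Definition pvec (chi : Y -> R[i]) := exists (H : hilbert R) (rho : Y -> H -> H) (xi : H),
  is_rep rho /\ chi = fun y => ip (rho y xi) xi.

Lemma pvec_vecf chi : pvec chi -> vecf chi.
Proof. by move=> [H [rho [xi [r e]]]]; exists H, rho, xi, xi. Qed.

Lemma vecf_lin chi : vecf chi -> linear (chi : Y -> R[i]^o).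
Proof. by move=> [H [rho [xi [eta [r ->]]]]] k a b; rewrite (repDl r) (repZl r) ipD ipZ. Qed.

Lemma vecf_bnd chi : vecf chi -> exists2 c, 0 <= c & forall y, nc (chi y) <= c * nr y.
Proof.
move=> [H [rho [xi [eta [r ->]]]]]; exists (nr xi * nr eta).
  by rewrite mulr_ge0 ?nr_ge0.
move=> y; apply: le_trans (ip_le _ _) _; rewrite mulrAC ler_wpM2r ?nr_ge0 //.
by rewrite mulrC; exact: (rep_bnd r).
Qed.

Lemma pvec_pos chi y : pvec chi -> 0 <= chi (cadj y ** y).
Proof.
move=> [H [rho [xi [[l1 l2 rM ra] ->]]]]; rewrite rM ra cadjK.
exact: hilb_ge0.
Qed.

Lemma vecf_mulr chi a : vecf chi -> vecf (fun y => chi (y ** a)).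
Proof.
move=> [H [rho [xi [eta [r ->]]]]]; exists H, rho, (rho a xi), eta; split=> //.
by apply/funext => y; case: r => _ _ -> _.
Qed.

Lemma vecf_mull chi a : vecf chi -> vecf (fun y => chi (a ** y)).
Proof.
move=> [H [rho [xi [eta [r ->]]]]]; exists H, rho, xi, (rho (cadj a) eta); split=> //.
by apply/funext => y; case: r => _ _ rM ra; rewrite rM ra.
Qed.

Lemma vecf_polar chi : vecf chi -> exists f : 'I_4 -> (Y -> R[i]), exists k : 'I_4 -> R[i],
  (forall i, pvec (f i)) /\ forall y, chi y = \sum_i k i * f i y.
Proof.
move=> [H [rho [xi [eta [r ->]]]]].
pose u (i : 'I_4) : R[i] := nth 0 [:: 1; 'i%C; -1; - 'i%C] i.
exists (fun i y => ip (rho y (xi + u i *: eta)) (xi + u i *: eta)).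
exists (fun i => 4^-1 * u i); split.
  by move=> i; exists H, rho, (xi + u i *: eta).
move=> y.
have i2 : 'i%C * 'i%C = -1 :> R[i] by rewrite -expr2 sqr_i.
have E (w : R[i]) : ip (rho y (xi + w *: eta)) (xi + w *: eta) =
   ip (rho y xi) xi + (w^*)%R * ip (rho y xi) eta + w * ip (rho y eta) xi + w * (w^*)%R * ip (rho y eta) eta.
  rewrite (repD r) (repZ r) ipD !ipDr !ipZ !ipZr; ring.
under eq_bigr do rewrite E.
move: (ip (rho y xi) xi) (ip (rho y xi) eta) (ip (rho y eta) xi) (ip (rho y eta) eta) => a b c d.
have e4 : (4^-1 : R[i]) * 4 = 1 by rewrite mulVf // pnatr_eq0.
have F k q : k * (k^*)%R = 1 -> k * k = q -> 4^-1 * k *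
    (a + (k^*)%R * b + k * c + k * (k^*)%R * d) = 4^-1 * (k * a + b + q * c + k * d).
  move=> kk <-; rewrite -mulrA kk mul1r; congr (_ * _).
  by rewrite !mulrDr !mulrA kk mul1r.
rewrite !big_ord_recl big_ord0 /u /=.
rewrite (F 1 1) ?(F 'i%C (-1)) ?(F (-1) 1) ?(F (- 'i%C) (-1)) ?cjN ?cj1 ?conj_iE
  ?mulrNN ?mulr1 ?mulrN ?i2 ?opprK //.
transitivity (4^-1 * 4 * b); first by rewrite e4 mul1r.
move: (4^-1 : R[i]) => f; ring.
Qed.

(** The vector functional at xi and rho(y) xi takes at y the value |rho(y) xi|^2 >= |y|^2;
    polarization expresses it by positive ones. *)
Lemma pos_sep y : (forall chi, pvec chi -> chi y = 0) -> y = 0.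
Proof.
move=> h; have [H [rho [xi [r x1 le]]]] := gelfand_naimark y.
have [f [k [pf e]]] := vecf_polar (ex_intro _ H (ex_intro _ rho (ex_intro _ xi
  (ex_intro _ (rho y xi) (conj r erefl))))).
have : ip (rho y xi) (rho y xi) = 0.
  by rewrite e big1 // => i _; rewrite h // mulr0.
rewrite ip_nr => -[/eqP]; rewrite sqrf_eq0 => /eqP z.
by apply: nr_eq0; apply/eqP; rewrite eq_le nr_ge0 andbT -z.
Qed.

End VectorFunctionals.

Section Slice.
Variables (R : realType) (X Y : cstar R) (T : min_tensor X Y).

Lemma tn_seq1 (H1 H2 : hilbert R) (x : H1) (y : H2) : tn [:: (x, y)] = nr x * nr y.
Proof.
rewrite /tn /tip !big_seq1 /= !ip_nr -rmorphM /= -exprMn sqrtr_sqr ger0_norm //.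
by rewrite mulr_ge0 ?nr_ge0.
Qed.

(** Let b be the prospective image and z = rho1(b) x1 with |z| >= |b|. Then |z|^2 is the coefficient
    of rho1 ⊗ rho between x1 ⊗ xi and z ⊗ eta, so the minimal norm bounds it, with constant |xi|
    |eta|. *)
Lemma slice_ex (chi : Y -> R[i]) : vecf chi -> exists S : T -> X,
  [/\ linear S, (forall x y, S (tens x y) = chi y *: x) &
      exists c, forall t, nr (S t) <= c * nr t].
Proof.
move=> vc; have cl := vecf_lin vc; case: vc => [H [rho [xi [eta [r ce]]]]].
have [||S [Sl St Sb]] := @dense_ext _ T X _ _ (@tens_dense_by _ _ _ T)
  (fun p => chi p.2 *: p.1) (nr xi * nr eta).
- by rewrite mulr_ge0 ?nr_ge0.
- move=> l; set b := comb _ l.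
  have [H1 [rho1 [x1 [r1 n1 le]]]] := gelfand_naimark b.
  set z := rho1 b x1 in le.
  have [z0|z0] := eqVneq (nr z) 0.
    by apply: le_trans le _; rewrite z0 !mulr_ge0 ?nr_ge0.
  have zp : 0 < nr z by rewrite lt_def z0 nr_ge0.
  have E : ip z z = tip (tact rho1 rho l [:: (x1, xi)]) [:: (z, eta)].
    rewrite {1}/z /b /comb (rep_suml r1) ip_suml /tip /tact big_allpairs_dep.
    apply: eq_bigr => p _; rewrite !big_seq1 /= scalerA (repZl r1) ipZ (repZl r1) ipZ ce.
    by rewrite mulrAC.
  have := tip_le (tact rho1 rho l [:: (x1, xi)]) [:: (z, eta)].
  rewrite -E ip_nr nc_real ger0_norm ?sqr_ge0 // tn_seq1 => h.
  have h2 := tens_norm_rep T l [:: (x1, xi)] r1 r.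
  rewrite tn_seq1 in h2.
  set N := nr (comb _ l) in h2 *.
  have h3 : nr z * nr z <= (nr xi * nr eta * N) * nr z.
    rewrite -expr2; apply: le_trans h _.
    apply: le_trans (ler_wpM2r _ h2) _; first by rewrite mulr_ge0 ?nr_ge0.
    have -> : N * (nr x1 * nr xi) * (nr z * nr eta) = nr x1 * (nr xi * nr eta * N * nr z) by ring.
    by rewrite -[leRHS]mul1r ler_wpM2r // !mulr_ge0 ?nr_ge0.
  by apply: le_trans le _; rewrite -(ler_pM2r zp).
exists S; split=> //; first by move=> x y; exact: (St (x, y)).
by exists (nr xi * nr eta).
Qed.

Definition slice (chi : Y -> R[i]) : T -> X := the_or (fun=> 0) (fun S : T -> X =>
  [/\ linear S, (forall x y, S (tens x y) = chi y *: x) &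
      exists c, forall t, nr (S t) <= c * nr t]).

Section SliceFacts.
Variable chi : Y -> R[i].
Hypothesis vc : vecf chi.

Lemma sliceP : [/\ linear (slice chi), (forall x y, slice chi (tens x y) = chi y *: x) &
      exists c, forall t, nr (slice chi t) <= c * nr t].
Proof. exact: (the_orP _ (slice_ex vc)). Qed.

Lemma slice_lin : linear (slice chi). Proof. by case: sliceP. Qed.
Lemma slice_tens x y : slice chi (tens x y) = chi y *: x. Proof. by case: sliceP. Qed.
Lemma slice_bnd : exists c, forall t, nr (slice chi t) <= c * nr t. Proof. by case: sliceP. Qed.
Lemma sliceD t t' : slice chi (t + t') = slice chi t + slice chi t'.
Proof. by have := slice_lin 1 t t'; rewrite !scale1r. Qed.
Lemma slice0 : slice chi 0 = 0.
Proof. by apply: (addrI (slice chi 0)); rewrite -sliceD !addr0. Qed.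
Lemma sliceZ k t : slice chi (k *: t) = k *: slice chi t.
Proof. by have := slice_lin k t 0; rewrite slice0 !addr0. Qed.
Lemma slice_sum (I : Type) (r : seq I) (P : pred I) (f : I -> T) :
  slice chi (\sum_(i <- r | P i) f i) = \sum_(i <- r | P i) slice chi (f i).
Proof. by apply: (big_morph (slice chi)) => [a b|]; [exact: sliceD|exact: slice0]. Qed.

Lemma slice_leg1 m t : slice chi (mL (leg1 m) t) = mL m (slice chi t).
Proof.
have [c hc] := slice_bnd; have [b [b0 hb]] := mult_bounded m.
have [b' [b0' hb']] := mult_bounded (leg1 m : multiplier T).
apply: (dense_eq (@tens_dense_by _ _ _ T) (f := fun t => slice chi (mL (leg1 m) t))
   (f' := fun t => mL m (slice chi t)) (c := `|c| * b') (c' := b * `|c|)).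
- by move=> k x y; rewrite mLD mLZ slice_lin.
- by move=> k x y; rewrite slice_lin mLD mLZ.
- move=> v; apply: le_trans (hc _) _; rewrite -mulrA.
  apply: (@le_trans _ _ (`|c| * nr (mL (leg1 m) v))); first by rewrite ler_wpM2r ?nr_ge0 ?ler_norm.
  by rewrite ler_wpM2l.
- move=> v; apply: le_trans (hb _) _; rewrite -mulrA ler_wpM2l //.
  by apply: le_trans (hc _) _; rewrite ler_wpM2r ?nr_ge0 ?ler_norm.
by move=> -[x y]; rewrite leg1P !slice_tens mLZ.
Qed.

Lemma slice_uniq (W : completeNormedModType R[i]) (f f' : T -> W) c c' :
  linear f -> linear f' -> (forall v, nr (f v) <= c * nr v) ->
  (forall v, nr (f' v) <= c' * nr v) ->
  (forall x y, f (tens x y) = f' (tens x y)) -> f =1 f'.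
Proof.
move=> l l' b b' e; apply: (dense_eq (@tens_dense_by _ _ _ T) l l' b b') => -[x y].
exact: e.
Qed.

End SliceFacts.

Lemma slice_polar chi t : (forall f, pvec f -> slice f t = 0) -> vecf chi -> slice chi t = 0.
Proof.
move=> h vc; have [f [k [pf e]]] := vecf_polar vc.
have vf i : vecf (f i) := pvec_vecf (pf i).
suff -> : slice chi t = \sum_i k i *: slice (f i) t.
  by rewrite big1 // => i _; rewrite h // scaler0.
have [c hc] := slice_bnd vc.
have /choice[d hd] : forall i, exists d, forall t, nr (slice (f i) t) <= d * nr t.
  by move=> i; exact: slice_bnd.
apply: (slice_uniq (f' := fun t => \sum_i k i *: slice (f i) t) (c := c)
   (c' := \sum_i nc (k i) * d i)) => //.
- exact: slice_lin.
- move=> a x y; rewrite scaler_sumr -big_split; apply: eq_bigr => i _ /=.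
  by rewrite slice_lin // scalerDr !scalerA mulrC.
- move=> v; apply: le_trans (nr_sum _ _ _) _; rewrite mulr_suml.
  by apply: ler_sum => i _; rewrite nrZ -mulrA ler_wpM2l ?nc_ge0.
move=> x y; rewrite slice_tens // e scaler_suml; apply: eq_bigr => i _.
by rewrite slice_tens // scalerA.
Qed.

(** Every coefficient of a product representation rho1 ⊗ rho2 is computed by slicing, so it vanishes
    at t, and the norm formula gives t = 0. This is where minimality of the tensor product
    enters. *)
Lemma slice_sep t : (forall chi, pvec chi -> slice chi t = 0) -> t = 0.
Proof.
move=> h0; have h chi : vecf chi -> slice chi t = 0 by exact: slice_polar.
apply: nr_small => e e0.
have e2 : 0 < e / 2 by rewrite divr_gt0.
have [l hl] := @tens_dense_by _ _ _ T t _ e2.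
suff le : nr (comb (fun p : X * Y => tens p.1 p.2 : T) l) <= e / 2.
  apply: le_trans (nr_le_sub _ (comb (fun p : X * Y => tens p.1 p.2) l)) _.
  by rewrite [leRHS]splitr lerD // ltW.
apply/tens_norm_seq; first exact: ltW.
move=> H1 H2 rho1 rho2 r1 r2 z; set w := tact _ _ _ _.
pose chi (v w : H1 * H2) y := ip (rho2 y v.2) w.2.
have vchi u v : vecf (chi u v) by exists H2, rho2, u.2, v.2.
(* The coefficient of (rho1 ⊗ rho2)(u) between z and w, written with slices so as to be defined on
   all of T. *)
pose L (u : T) := \sum_(v <- z) \sum_(p <- w) ip (rho1 (slice (chi v p) u) v.1) p.1.
have LE l' : L (comb (fun p : X * Y => tens p.1 p.2 : T) l') = tip (tact rho1 rho2 l' z) w.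
  rewrite /L /tip /tact big_allpairs_dep exchange_big /=.
  under [RHS]eq_bigr do rewrite exchange_big /=.
  rewrite [RHS]exchange_big; apply: eq_bigr => p _; rewrite exchange_big; apply: eq_bigr => v _ /=.
  rewrite /comb slice_sum // (rep_suml r1) ip_suml; apply: eq_bigr => q _.
  by rewrite sliceZ // slice_tens // !(repZl r1) !ipZ /chi -!mulrA [ip _ _ * ip _ _]mulrC.
have LB u u' : L (u - u') = L u - L u'.
  rewrite /L -sumrB; apply: eq_bigr => v _; rewrite -sumrB; apply: eq_bigr => p _.
  rewrite -scaleN1r sliceD // sliceZ // (repDl r1) (repZl r1) ipD ipZ mulN1r //.
have [C [C0 hC]] : exists C, 0 <= C /\ forall u, nc (L u) <= C * nr u.
  have /choice[c hc] : forall q : (H1 * H2) * (H1 * H2), exists c, forall t, nr (slice (chi q.1 q.2) t) <= c * nr t.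
    by move=> q; exact: slice_bnd.
  exists (\sum_(v <- z) \sum_(p <- w) `|c (v, p)| * nr v.1 * nr p.1); split.
    by apply: sumr_ge0 => v _; apply: sumr_ge0 => p _; rewrite !mulr_ge0 ?nr_ge0.
  have nc_sum (I : Type) (s : seq I) (f : I -> R[i]) : nc (\sum_(i <- s) f i) <= \sum_(i <- s) nc (f i).
    exact: (@nr_sum _ (R[i]^o) I s predT f).
  move=> u; apply: le_trans (nc_sum _ _ _) _; rewrite mulr_suml; apply: ler_sum => v _.
  apply: le_trans (nc_sum _ _ _) _; rewrite mulr_suml; apply: ler_sum => p _.
  apply: le_trans (ip_le _ _) _; rewrite [leRHS]mulrAC ler_wpM2r ?nr_ge0 //.
  apply: le_trans (rep_bnd r1 _ _) _; rewrite [leRHS]mulrAC ler_wpM2r ?nr_ge0 //.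
  by apply: le_trans (hc (v, p) _) _; rewrite ler_wpM2r ?nr_ge0 ?ler_norm.
have Lt : L t = 0.
  rewrite /L big1 // => v _; rewrite big1 // => p _; rewrite h // (rep0l r1).
  by rewrite -(scale0r (0 : H1)) ipZ mul0r.
set y := comb _ l in hl *.
have hb : nc (L y) <= e / 2 * tn z * tn w.
  apply/ler_addgt0Pr => d d0.
  have c1 : 0 < tn z * tn w + C + 1 by rewrite ltr_wpDl // addr_ge0 // mulr_ge0 ?tn_ge0.
  have [l' hl'] := @tens_dense_by _ _ _ T t _ (divr_gt0 d0 c1).
  set y' := comb _ l' in hl'.
  have -> : L y = L (y - y') - L (t - y') by rewrite !LB Lt; ring.
  apply: le_trans (ncD _ _) _; rewrite ncN.
  have h1 : nc (L (y - y')) <= (e / 2 + nr (t - y')) * tn z * tn w.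
    have -> : y - y' = comb (fun p : X * Y => tens p.1 p.2 : T) (l ++ [seq (-1 * p.1, p.2) | p <- l']).
      by rewrite comb_cat comb_scale scaleN1r.
    rewrite LE; apply: le_trans (tip_le _ _) _; rewrite ler_wpM2r ?tn_ge0 //.
    apply: le_trans (tens_norm_rep T _ _ r1 r2) _; rewrite ler_wpM2r ?tn_ge0 //.
    rewrite comb_cat comb_scale scaleN1r; apply: le_trans (nr_tri t _ _) _.
    by rewrite lerD2r nrC ltW.
  have h2 := hC (t - y').
  apply: le_trans (lerD h1 h2) _; rewrite 2!mulrDl -addrA lerD2l.
  apply: (@le_trans _ _ ((tn z * tn w + C + 1) * nr (t - y'))).
    have := nr_ge0 (t - y'); have := tn_ge0 z; have := tn_ge0 w; nra.
  by rewrite mulrC -ler_pdivlMr // ltW.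
move: hb; rewrite LE -/w -tn_sqr nc_real ger0_norm ?sqr_ge0 //.
have [->|w0] := eqVneq (tn w) 0; first by rewrite mulr_ge0 ?tn_ge0 // ltW.
by rewrite expr2 ler_pM2r // lt_def w0 tn_ge0.
Qed.

End Slice.

(** * Homomorphisms out of minimal tensor products *)

Section Forms.
Variables (R : realType) (V : cstar R) (phi : V -> R[i]) (C : R).
Hypotheses (phi_lin : linear (phi : V -> R[i]^o)) (C0 : 0 <= C)
  (phi_bnd : forall v, nc (phi v) <= C * nr v).

Lemma ge0_near (z : R[i]) :
  (forall e : R, 0 < e -> exists w, 0 <= w /\ nc (z - w) <= e) -> 0 <= z.
Proof.
move=> h; have im : Im z = 0.
  apply/eqP; rewrite -normr_le0; apply/ler_addgt0Pr => e e0; rewrite add0r.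
  have [w [/ge0_realE[we w0] hw]] := h e e0.
  apply: le_trans hw; apply: le_trans (nc_Im _).
  by rewrite we; case: (z) => a b /=; rewrite oppr0 addr0.
have re : 0 <= Re z.
  rewrite -oppr_le0; apply/ler_addgt0Pr => e e0; rewrite add0r.
  have [w [/ge0_realE[we w0] hw]] := h e e0.
  apply: le_trans hw; have := nc_Re (z - w).
  rewrite we; move: w0; case: (z) => a b /= w0 h2.
  apply: le_trans h2; rewrite -normrN; apply: le_trans (ler_norm _); lra.
by rewrite lecE im eqxx.
Qed.

Lemma functionalB u v : phi (u - v) = phi u - phi v.
Proof. by rewrite [u - v]addrC -[- v]scaleN1r (phi_lin _ _ _) scaleN1r addrC. Qed.

(** The distance 1 / (t + 1) keeps |m y'| within 1 of |m y|, whence the factor N = 2 |m y| + 1 for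
    the difference of the two squares. *)
Lemma form_near (m : multiplier V) y (e : R) : 0 < e -> exists2 d : R, 0 < d &
  forall y', nr (y - y') < d ->
    nc (phi (cadj (mL m y) ** mL m y) - phi (cadj (mL m y') ** mL m y')) <= e.
Proof.
move=> e0; have [t [t0 bt]] := mult_bounded m.
pose N := 2 * nr (mL m y) + 1.
have N0 : 0 < N by rewrite ltr_wpDl // mulr_ge0 ?nr_ge0.
have D0 : 0 < (C + 1) * N * (t + 1) by rewrite !mulr_gt0 // ltr_wpDl.
pose d := Num.min (e / ((C + 1) * N * (t + 1))) (t + 1)^-1.
have t1 : 0 < t + 1 by rewrite ltr_wpDl.
exists d; first by rewrite lt_min !divr_gt0 ?invr_gt0.
move=> y' hy; set a := mL m y; set b := mL m y'.
have hab : nr (a - b) <= (t + 1) * nr (y - y').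
  rewrite /a /b -mLB; apply: le_trans (bt _) _.
  by rewrite ler_wpM2r ?nr_ge0 // lerDl.
have h1 : nr (a - b) <= 1.
  apply: le_trans hab _; rewrite mulrC -ler_pdivlMr // div1r ltW //.
  by apply: lt_le_trans hy _; rewrite ge_min lexx orbT.
rewrite -functionalB; apply: le_trans (phi_bnd _) _.
have -> : cadj a ** a - cadj b ** b = cadj a ** (a - b) + cadj (a - b) ** b.
  by rewrite cmulBr cadjB cmulBl addrA subrK.
have h2 : nr (cadj a ** (a - b) + cadj (a - b) ** b) <= N * nr (a - b).
  apply: le_trans (nrD _ _) _; apply: le_trans (lerD (nrM _ _) (nrM _ _)) _.
  have := nr_le_sub b a; rewrite [nr (b - a)]nrC !nr_adj /N; have := nr_ge0 (a - b); rewrite -/a; nra.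
apply: (@le_trans _ _ ((C + 1) * N * (t + 1) * nr (y - y'))).
  rewrite -!mulrA; apply: (@le_trans _ _ (C * (N * ((t + 1) * nr (y - y'))))).
    by rewrite ler_wpM2l //; apply: le_trans h2 _; rewrite ler_wpM2l // ltW.
  by rewrite ler_wpM2r ?lerDl // !mulr_ge0 ?nr_ge0 ?ltW.
rewrite mulrC -ler_pdivlMr // ltW //; apply: lt_le_trans hy _.
by rewrite ge_min lexx.
Qed.

Variables (I : Type) (s : I -> V).
Hypothesis sd : dense_by s.
Hypothesis pos_comb : forall l, 0 <= phi (cadj (comb s l) ** comb s l).

Lemma form_pos_dense y : 0 <= phi (cadj y ** y).
Proof.
apply: ge0_near => e /(form_near 1 y)[d d0 hd].
have [l hl] := sd y d0; exists (phi (cadj (comb s l) ** comb s l)); split=> //.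
exact: (hd _ hl).
Qed.

Lemma form_le_dense (m : multiplier V) (M : R) :
  (forall l, phi (cadj (mL m (comb s l)) ** mL m (comb s l)) <=
     (M ^+ 2)%:C * phi (cadj (comb s l) ** comb s l)) ->
  forall y, phi (cadj (mL m y) ** mL m y) <= (M ^+ 2)%:C * phi (cadj y ** y).
Proof.
move=> h y; rewrite -subr_ge0; apply: ge0_near => e e0.
have e2 : 0 < e / 2 by rewrite divr_gt0.
have M1 : 0 < M ^+ 2 + 1 by rewrite ltr_wpDl // sqr_ge0.
have [d d0 hd] := form_near m y e2.
have [d' d0' hd'] := form_near 1 y (divr_gt0 e2 M1).
have dd : 0 < Num.min d d' by rewrite lt_min d0.
have [l hl] := sd y dd.
exists ((M ^+ 2)%:C * phi (cadj (comb s l) ** comb s l) -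
   phi (cadj (mL m (comb s l)) ** mL m (comb s l))); rewrite subr_ge0; split=> //.
have h1 := hd (comb s l) ltac:(by apply: lt_le_trans hl _; rewrite ge_min lexx).
have h2 := hd' (comb s l) ltac:(by apply: lt_le_trans hl _; rewrite ge_min lexx orbT).
rewrite (_ : _ - _ = (M ^+ 2)%:C * (phi (cadj y ** y) - phi (cadj (comb s l) ** comb s l)) -
  (phi (cadj (mL m y) ** mL m y) - phi (cadj (mL m (comb s l)) ** mL m (comb s l)))); last by ring.
apply: le_trans (ncD _ _) _; rewrite ncN [leRHS]splitr; apply: lerD => //.
rewrite ncM nc_real ger0_norm ?sqr_ge0 //.
apply: (@le_trans _ _ ((M ^+ 2 + 1) * (e / 2 / (M ^+ 2 + 1)))).
  apply: le_trans (ler_wpM2l (sqr_ge0 _) h2) _.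
  by rewrite ler_wpM2r ?lerDl // !divr_ge0 ?ltW.
by rewrite mulrC divfK // gt_eqF.
Qed.

End Forms.

Section TensBound.
Variables (R : realType) (X Y V : cstar R) (T : min_tensor X Y).
Variables (f : X -> multiplier V) (g : Y -> multiplier V).
Hypotheses (hf : starhom f) (hg : starhom g) (fg : forall x y, f x * g y = g y * f x).

Definition tens_dom := forall l, bnd (comb (fun p : X * Y => f p.1 * g p.2) l)
  (nr (comb (fun p : X * Y => tens p.1 p.2 : T) l)).

(* f and g are weakly contained in representations of tensor product form *)
Lemma tens_bound (I : Type) (s : I -> V) (F : set (V -> R[i])) : dense_by s ->
  (forall phi, F phi -> linear (phi : V -> R[i]^o) /\ exists2 C, 0 <= C & forall v, nc (phi v) <= C * nr v) ->
  (forall y, (forall phi, F phi -> phi (cadj y ** y) = 0) -> y = 0) ->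
  (forall phi, F phi -> exists (H1 H2 : hilbert R) (rho1 : X -> H1 -> H1)
     (rho2 : Y -> H2 -> H2) (v1 : I -> H1) (v2 : I -> H2),
     [/\ is_rep rho1, is_rep rho2,
       (forall i j, phi (cadj (s j) ** s i) = ip (v1 i) (v1 j) * ip (v2 i) (v2 j)) &
       (forall x y x' y' i j, phi (cadj (mL (f x' * g y') (s j)) ** mL (f x * g y) (s i)) =
          ip (rho1 x (v1 i)) (rho1 x' (v1 j)) * ip (rho2 y (v2 i)) (rho2 y' (v2 j)))]) ->
  tens_dom.
Proof.
move=> sd Fl Fs Fr l'; set m := comb _ l'; set M := nr _.
(* On combinations of s the form of phi is the inner product of the vectors v1 i ⊗ v2 i, and m acts
   there as rho1 ⊗ rho2 does for the list l'. The norm formula gives the inequality, which density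
   and [norm_by_states] turn into a bound of m. *)
have main phi : F phi -> (forall l, 0 <= phi (cadj (comb s l) ** comb s l)) /\
  (forall l, phi (cadj (mL m (comb s l)) ** mL m (comb s l)) <=
     (M ^+ 2)%:C * phi (cadj (comb s l) ** comb s l)).
  move=> Fphi; have [pl _] := Fl _ Fphi.
  have [H1 [H2 [rho1 [rho2 [v1 [v2 [r1 r2 e1 e2]]]]]]] := Fr _ Fphi.
  have pD u v : phi (u + v) = phi u + phi v by have := pl 1 u v; rewrite !scale1r.
  have p0 : phi 0 = 0 by apply: (addrI (phi 0)); rewrite -pD !addr0.
  have pZ k u : phi (k *: u) = k * phi u by have := pl k u 0; rewrite p0 !addr0.
  have psum (J : Type) (r : seq J) (h : J -> V) : phi (\sum_(i <- r) h i) = \sum_(i <- r) phi (h i).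
    exact: (big_morph phi pD p0).
  pose z (l : seq (R[i] * I)) := [seq (p.1 *: v1 p.2, v2 p.2) | p <- l].
  have E1 l : phi (cadj (comb s l) ** comb s l) = tip (z l) (z l).
    rewrite /comb cmul_sumr psum /tip /z big_map; apply: eq_bigr => p _.
    rewrite cadj_sum cmul_suml psum big_map; apply: eq_bigr => p' _ /=.
    by rewrite cadjZ cmulZl cmulZr !pZ e1 ipZ ipZr !mulrA [_ * p.1]mulrC.
  have E2 l : phi (cadj (mL m (comb s l)) ** mL m (comb s l)) =
      tip (tact rho1 rho2 l' (z l)) (tact rho1 rho2 l' (z l)).
    have ml : mL m (comb s l) = \sum_(q <- l') \sum_(p <- l) (q.1 * p.1) *:
        mL (f q.2.1 * g q.2.2) (s p.2).
      rewrite /m /comb msumL; apply: eq_bigr => q _.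
      rewrite mL_scale mL_sum scaler_sumr; apply: eq_bigr => p _.
      by rewrite mLZ scalerA.
    rewrite ml cmul_sumr psum /tip /tact big_allpairs_dep; apply: eq_bigr => q _.
    rewrite cmul_sumr psum /z big_map; apply: eq_bigr => p _.
    rewrite cadj_sum cmul_suml psum big_allpairs_dep; apply: eq_bigr => q' _.
    rewrite cadj_sum cmul_suml psum big_map; apply: eq_bigr => p' _ /=.
    rewrite cadjZ cmulZl cmulZr !pZ e2 !(repZl r1) !(repZ r1) !ipZ !ipZr cjM; ring.
  split=> l; first by rewrite E1; exact: tip_ge0.
  rewrite E1 E2 -!tn_sqr -rmorphM lecR /= -exprMn ler_pXn2r ?nnegrE ?mulr_ge0 ?tn_ge0 ?nr_ge0 //.
  exact: tens_norm_rep.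
apply: (norm_by_states _ _ Fs (nr_ge0 _)) => [phi /Fl[]//|phi Fphi|phi Fphi].
  have [pl [C C0 pC]] := Fl _ Fphi.
  by apply: (form_pos_dense pl C0 pC sd); case: (main _ Fphi).
have [pl [C C0 pC]] := Fl _ Fphi.
by apply: (form_le_dense pl C0 pC sd); case: (main _ Fphi).
Qed.

Lemma tprod_ex : (exists F : T -> multiplier V,
    starhom F /\ forall x y, F (tens x y) = f x * g y) ->
  starhom (tprod f g : T -> multiplier V) /\
  forall x y, tprod f g (tens x y : T) = f x * g y.
Proof.
by move=> h; exact: (@the_orP _ (fun=> 0)
  (fun F : T -> multiplier V => starhom F /\ forall x y, F (tens x y) = f x * g y) h).
Qed.

Lemma tprodP : tens_dom -> starhom (tprod f g : T -> multiplier V) /\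
  forall x y, tprod f g (tens x y : T) = f x * g y.
Proof.
move=> td; apply: tprod_ex; case: (hf) (hg) => [_ fM fa] [_ gM ga].
have [|||F [hF e]] := hom_ext (@tens_dense_by _ _ _ T) (g := fun p : X * Y => f p.1 * g p.2).
- exact: td.
- move=> [x y]; exists (cadj x, cadj y); rewrite /= tens_adj; split=> //.
  by rewrite fa ga madjM -fa -ga fg.
- move=> [x y] [x' y']; exists (x ** x', y ** y'); rewrite /= tensM; split=> //.
  by rewrite fM gM mulrA -[f x * f x' * g y]mulrA [f x' * _]fg !mulrA.
by exists F; split=> // x y; exact: (e (x, y)).
Qed.

End TensBound.

Section HomTens.
Variables (R : realType) (X Y : cstar R) (T : min_tensor X Y).

Lemma starhom_eq_tens (V : cstar R) (F F' : T -> multiplier V) : starhom F -> starhom F' ->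
  (forall x y, F (tens x y) = F' (tens x y)) -> F = F'.
Proof.
by move=> h h' e; apply: (starhom_eq_dense (@tens_dense_by _ _ _ T) h h') => -[x y]; exact: e.
Qed.

(** These are the functionals psi ⊗ chi with positive psi and chi. *)
Definition prodf : set (T -> R[i]) := [set phi | exists psi chi,
  [/\ pvec psi, pvec chi & phi = fun t => psi (slice chi t)]].

Lemma prodf_lin phi : prodf phi -> linear (phi : T -> R[i]^o) /\
  exists2 C, 0 <= C & forall v, nc (phi v) <= C * nr v.
Proof.
move=> [psi [chi [pp pc ->]]]; split.
  by move=> k a b; rewrite slice_lin; [exact: vecf_lin (pvec_vecf pp) _ _ _|exact: pvec_vecf].
have [c c0 hc] := vecf_bnd (pvec_vecf pp); have [d hd] := slice_bnd T (pvec_vecf pc).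
exists (c * `|d|); first by rewrite mulr_ge0.
move=> v; apply: le_trans (hc _) _; rewrite -mulrA ler_wpM2l //.
by apply: le_trans (hd _) _; rewrite ler_wpM2r ?nr_ge0 ?ler_norm.
Qed.

Lemma prodf_sep y : (forall phi, prodf phi -> phi (cadj y ** y) = 0) -> y = 0.
Proof.
move=> h; apply: cs_eq0; apply: slice_sep => chi pc; apply: pos_sep => psi pp.
by apply: (h (fun t => psi (slice chi t))); exists psi, chi.
Qed.

Variables (X' Y' : cstar R) (f : X' -> multiplier X) (g : Y' -> multiplier Y).
Variable T' : min_tensor X' Y'.
Hypotheses (hf : starhom f) (hg : starhom g).

Definition hom_tens : T' -> multiplier T :=
  tprod (fun x => leg1 (f x)) (fun y => leg2 (g y)).

(** The GNS representation of psi ⊗ chi splits: X' acts through f on the space of psi and Y' through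
    g on that of chi. *)
Lemma hom_tens_dom : tens_dom T' (fun x => leg1 (f x) : multiplier T) (fun y => leg2 (g y)).
Proof.
apply: (@tens_bound _ _ _ _ _ _ _ (X * Y)%type (fun p => tens p.1 p.2 : T) prodf).
- exact: tens_dense_by.
- exact: prodf_lin.
- exact: prodf_sep.
move=> phi [psi [chi [pp pc ->]]].
have vp := pvec_vecf pp; have vc := pvec_vecf pc.
have [H1 [rho1 [v1 [r1 _ i1 a1]]]] := gns_act (vecf_lin vp) (fun x => pvec_pos x pp) hf.
have [H2 [rho2 [v2 [r2 _ i2 a2]]]] := gns_act (vecf_lin vc) (fun x => pvec_pos x pc) hg.
exists H1, H2, rho1, rho2, (fun p => v1 p.1), (fun p => v2 p.2).
have pl := vecf_lin vp.
have pZ k u : psi (k *: u) = k * psi u.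
  have p0 : psi 0 = 0 by have := pl 1 0 0; rewrite scaler0 addr0 scale1r -[LHS]addr0 => /addrI.
  by have := pl k u 0; rewrite p0 !addr0.
split=> //.
- by move=> i j; rewrite -tens_adj -tensM slice_tens // pZ i1 i2 mulrC.
move=> x y x' y' i j; rewrite !mL_mul !leg2P !leg1P -tens_adj -tensM slice_tens // pZ.
by rewrite a1 a1 a2 a2 i1 i2 mulrC.
Qed.

Lemma hom_tensP : starhom hom_tens /\
  forall x y, hom_tens (tens x y) = leg1 (f x) * leg2 (g y).
Proof.
apply: tprodP; [exact: starhom_leg1|exact: starhom_leg2|by move=> *; exact: legC|].
exact: hom_tens_dom.
Qed.

End HomTens.

(** * Approximate units and density of products *)

Section ProductsDense.
Variables (R : realType) (A : cstar R).

(** With p = 1 - w the terms w p^k decrease in k, and the first n + 1 of them add up to 1 - p^(n+1)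
    <= 1; so the last one is at most 1 / (n + 1). *)
Lemma approx_unit_bnd (w : multiplier A) n : pos w -> pos (1 - w) ->
  bnd (w * (1 - w) ^+ n) n.+1%:R^-1.
Proof.
move=> pw pp; set p := 1 - w in pp *.
have [h [ha hh _ hc]] := pos_sqrt pw.
have [g [ga gg _ gc]] := pos_sqrt pp.
have cwp : w * p = p * w by rewrite /p; nc_ring.
have chp : GRing.comm p h by apply: hc; rewrite /GRing.comm cwp.
have chg : GRing.comm h g by apply: gc; rewrite /GRing.comm chp.
have ck k : GRing.comm h (g ^+ k) by apply: commrX.
have pk k : p ^+ k = g ^+ k * g ^+ k by rewrite -gg exprMn_comm //.
have pos_wp k : pos (w * p ^+ k).
  rewrite (_ : _ * _ = (h * g ^+ k) * (h * g ^+ k)); last first.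
    by rewrite pk -hh -!mulrA; congr (_ * _); rewrite !mulrA ck.
  by apply: pos_sq; rewrite madjM madjX ga ha -ck.
have pos_wwp k : pos (w * (w * p ^+ k)).
  have cwg : GRing.comm w (g ^+ k) by rewrite /GRing.comm -hh -mulrA ck !mulrA ck.
  rewrite (_ : _ * _ = (w * g ^+ k) * (w * g ^+ k)); last first.
    by rewrite pk -!mulrA; congr (_ * _); rewrite !mulrA cwg.
  by apply: pos_sq; rewrite madjM madjX ga (proj1 pw) -cwg.
have pos_sum (I : Type) (r : seq I) (F : I -> multiplier A) : (forall i, pos (F i)) -> pos (\sum_(i <- r) F i).
  by move=> hF; elim/big_ind: _ => //; [exact: pos0|exact: posD].
have tele k : 1 - p ^+ k = \sum_(i < k) w * p ^+ i.
  elim: k => [|k IH]; first by rewrite big_ord0 expr0 subrr.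
  have wE : w = 1 - p by rewrite /p; nc_ring.
  rewrite big_ord_recr /= -IH exprS [X in _ = _ + X * _]wE.
  by move: (p ^+ k) => q; nc_ring.
have diff k : (k <= n)%N -> pos (w * p ^+ k - w * p ^+ n).
  move=> /subnK <-; rewrite (_ : _ - _ = \sum_(i < (n - k)) w * (w * p ^+ (i + k))).
    by apply: pos_sum.
  rewrite -mulr_sumr -mulrBr; congr (_ * _).
  under eq_bigr do rewrite exprD mulrA.
  by rewrite -mulr_suml -tele mulrBl mul1r -exprD.
have bd : bnd (rsc A n.+1%:R * (w * p ^+ n)) 1.
  apply: pos_le_bnd => //; first by apply: posZ.
  rewrite rsc1 (_ : _ - _ = p ^+ n.+1 + \sum_(i < n.+1) (w * p ^+ i - w * p ^+ n)).
    apply: posD; first by rewrite pk; apply: pos_sq; rewrite madjX ga.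
    have ps (I : finType) (F : I -> multiplier A) : (forall i, pos (F i)) -> pos (\sum_i F i).
      by move=> hF; exact: pos_sum.
    by apply: ps => i; apply: diff; rewrite -ltnS.
  rewrite sumrB -tele sumr_const card_ord rscl.
  rewrite (_ : (n.+1%:R)%:C = n.+1%:R :> R[i]) ?rmorph_nat // scaler_nat.
  by rewrite addrA [p ^+ _ + _]addrC subrK.
have := bnd_rscM n.+1%:R^-1 bd; rewrite rscMA mulVf // rsc1 mul1r mulr1.
by rewrite ger0_norm // invr_ge0.
Qed.

(** The right factor u is given by 1 - u = (1 - w)^k with w = a^* a / |a|^2. The error satisfies |a
    - a u|^2 <= |a|^2 |w (1 - w)^k| <= |a|^2 / (k + 1). *)
Lemma prod_dense : dense_by (fun p : A * A => p.1 ** p.2).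
Proof.
move=> a e e0; have [->|a0] := eqVneq a 0.
  by exists [::]; rewrite /comb big_nil subr0 nr0.
have na : 0 < nr a by rewrite lt_def nr_ge0 andbT; apply: contra a0 => /eqP/nr_eq0->.
pose w := (nr a ^- 2)%:C *: (cadj a ** a).
have n0 : 0 <= nr a ^- 2 by rewrite invr_ge0 exprn_ge0 // ltW.
have pw : pos (incl w).
  by rewrite inclZ -rscl; apply: posZ => //; exact: cpos_cs.
have pw1 : pos (1 - incl w).
  rewrite -[1](rsc1 A); apply: pos_bndB; first by case: pw.
  apply: bnd_eqM (bnd_incl _) _; rewrite nrZr nr_cs ger0_norm //.
  by rewrite mulVf // expf_neq0 // gt_eqF.
have [N hN] := @inv_small _ ((e / nr a) ^+ 2) ltac:(by rewrite exprn_gt0 // divr_gt0).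
pose k := N.
have [u hu] : exists u, 1 - (1 - incl w) ^+ k = incl u.
  elim: k => [|k [u hu]]; first by exists 0; rewrite expr0 subrr incl0.
  exists (u + w - w ** u); rewrite inclB inclD inclM -hu exprS.
  by move: ((1 - incl w) ^+ k) => q; nc_ring.
exists [:: (1, (a, u))]; rewrite comb1 /=.
have E : incl (a - a ** u) = incl a * (1 - incl w) ^+ k.
  by rewrite inclB inclM -hu mulrBr mulr1 opprB addrC subrK.
rewrite -(@ltr_pXn2r _ 2) ?nnegrE ?nr_ge0 ?(ltW e0) // -nr_cs.
have q1 : bnd ((1 - incl w) ^+ k) 1.
  have b1 : bnd (1 - incl w) 1.
    apply: pos_le_bnd => //; rewrite rsc1 opprB addrC subrK //.
  elim: k {hu E} => [|k IH]; first by rewrite expr0; exact: bnd1.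
  by rewrite exprS; apply: bnd_eqM (bndM b1 IH) _; rewrite mulr1.
have sa : madj ((1 - incl w) ^+ k) = (1 - incl w) ^+ k by rewrite madjX (proj1 pw1).
have bE : bnd (incl (cadj (a - a ** u) ** (a - a ** u))) (nr a ^+ 2 * k.+1%:R^-1).
  rewrite inclM incl_adj E madjM sa.
  have -> : (1 - incl w) ^+ k * madj (incl a) * (incl a * (1 - incl w) ^+ k) =
    rsc A (nr a ^+ 2) * ((1 - incl w) ^+ k * (incl w * (1 - incl w) ^+ k)).
    have wE : rsc A (nr a ^+ 2) * incl w = madj (incl a) * incl a.
      rewrite -incl_adj -inclM rscl -inclZ scalerA -rmorphM /= mulfV ?expf_neq0 ?gt_eqF //.
      by rewrite scale1r.
    by rewrite -rsc_swap [rsc _ _ * _]mulrA wE !mulrA.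
  apply: bnd_eqM (bnd_rscM _ (bndM q1 (approx_unit_bnd k pw pw1))) _.
  by rewrite mul1r ger0_norm // exprn_ge0 // ltW.
apply: le_lt_trans (bnd_incl_le bE) _.
have := hN k (leqnn _); rewrite expr_div_n ltr_pdivlMr ?exprn_gt0 //.
by rewrite mulrC.
Qed.

Lemma nondeg_incl : nondegenerate (@incl R A).
Proof. by apply: dense_by_span prod_dense _ => -[a b]; exists a, b. Qed.

End ProductsDense.

(** * Calculus of nondegenerate homomorphisms *)

Lemma dense_comb_map (R : realType) (V W : completeNormedModType R[i]) (I : Type) (s : I -> V)
  (f : V -> W) c v e : dense_by s -> linear f -> (forall v, nr (f v) <= c * nr v) ->
  0 < e -> exists l, nr (f v - comb (f \o s) l) < e.
Proof.
move=> sd fl fb e0; have c1 : 0 < `|c| + 1 by rewrite ltr_wpDl.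
have [l hl] := sd v _ (divr_gt0 e0 c1); exists l.
rewrite -(linear_comb _ _ fl).
have -> : f v - f (comb s l) = f (v - comb s l).
  by rewrite [v - comb s l]addrC -[- comb s l]scaleN1r fl scaleN1r addrC.
apply: le_lt_trans (fb _) _.
apply: (@le_lt_trans _ _ ((`|c| + 1) * nr (v - comb s l))).
  by rewrite ler_wpM2r ?nr_ge0 //; have := ler_norm c; lra.
by rewrite mulrC -ltr_pdivlMr.
Qed.

Lemma id_dense (R : realType) (V : normedModType R[i]) : dense_by (fun v : V => v).
Proof. by move=> v e e0; exists [:: (1, v)]; rewrite comb1 subrr nr0. Qed.

Section Composition.
Variables (R : realType) (A B C : cstar R).
Variables (phi : A -> multiplier B) (psi : B -> multiplier C).
Hypotheses (hp : starhom phi) (np : nondegenerate phi)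
  (hq : starhom psi) (nq : nondegenerate psi).

Lemma starhom_ext (D : cstar R) (f : D -> multiplier B) :
  starhom f -> starhom (fun d => ext psi (f d)).
Proof.
case=> fl fM fa; split.
- by move=> k a b; rewrite fl extD // extZ.
- by move=> a b; rewrite fM extM.
by move=> a; rewrite fa ext_adj.
Qed.

Lemma nondeg_comp : nondegenerate (fun a => ext psi (phi a)).
Proof.
apply: (dense_by_span (s := fun p : A * C => mL (ext psi (phi p.1)) p.2)); last first.
  by move=> [a c]; exists a, c.
apply: dense_by_trans (nondeg_dense nq) _ => -[b c] e e0 /=.
have [||l hl] := @dense_comb_map _ _ _ _ _ (fun b => mL (psi b) c) (nr c) b e (nondeg_dense np) _ _ e0.
- by move=> k x y; case: hq => -> _ _.
- by move=> v; exact: starhom_le.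
exists [seq (p.1, (p.2.1, mL (psi p.2.2) c)) | p <- l].
rewrite {1}/comb big_map; move: hl; rewrite /comb /=.
by under eq_bigr do rewrite -extP //.
Qed.

Lemma ext_comp m : ext (fun a => ext psi (phi a)) m = ext psi (ext phi m).
Proof.
symmetry; apply: ext_uniq; [exact: starhom_ext|exact: nondeg_comp|].
by move=> a; rewrite -extM // extP.
Qed.

Lemma ext_uniq_dense (I : Type) (s : I -> A) m n : dense_by s ->
  (forall i, n * phi (s i) = phi (mL m (s i))) -> n = ext phi m.
Proof.
move=> sd h; apply: ext_uniq => // a; apply: mult_eqL => v.
have [b [b0 hb]] := mult_bounded n; have [c [c0 hc]] := mult_bounded m.
apply: (dense_eq sd (f := fun a => mL (n * phi a) v) (f' := fun a => mL (phi (mL m a)) v)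
  (c := b * nr v) (c' := nr v * c)).
- by move=> k x y; rewrite !mL_mul; case: hp => -> _ _; rewrite mL_add mL_scale mLD mLZ.
- by move=> k x y; rewrite mLD mLZ; case: hp => -> _ _.
- move=> x; rewrite mL_mul; apply: le_trans (hb _) _; rewrite -mulrA ler_wpM2l //.
  exact: starhom_le.
- move=> x; apply: le_trans (starhom_le _ _ hp) _.
  by rewrite -mulrA ler_wpM2l ?nr_ge0.
by move=> i; rewrite h.
Qed.

End Composition.

Section HomTensExt.
Variables (R : realType) (X Y X' Y' : cstar R) (T : min_tensor X Y) (T' : min_tensor X' Y').
Variables (f : X' -> multiplier X) (g : Y' -> multiplier Y).
Hypotheses (hf : starhom f) (hg : starhom g).

Lemma tens_dense2 (I J : Type) (s : I -> X) (t : J -> Y) : dense_by s -> dense_by t ->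
  dense_by (fun p : I * J => tens (s p.1) (t p.2) : T).
Proof.
move=> sd td.
have d1 : dense_by (fun p : I * Y => tens (s p.1) p.2 : T).
  apply: dense_by_trans (@tens_dense_by _ _ _ T) _ => -[x y] e e0 /=.
  have [||l hl] := @dense_comb_map _ _ T _ _ (fun x => tens x y : T) (nr y) x e sd _ _ e0.
  - by move=> k a b; rewrite tensDl tensZl.
  - by move=> v; rewrite mulrC nr_tens.
  by exists [seq (p.1, (p.2, y)) | p <- l]; rewrite /comb big_map.
apply: dense_by_trans d1 _ => -[i y] e e0 /=.
have [||l hl] := @dense_comb_map _ _ T _ _ (fun y => tens (s i) y : T) (nr (s i)) y e td _ _ e0.
- by move=> k a b; rewrite tensDr tensZr.
- by move=> v; rewrite nr_tens.
by exists [seq (p.1, (i, p.2)) | p <- l]; rewrite /comb big_map.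
Qed.

Hypotheses (nf : nondegenerate f) (ng : nondegenerate g).
Local Notation F := (@hom_tens _ _ _ T _ _ f g T').

Lemma hom_tens_nondeg : nondegenerate F.
Proof.
apply: dense_by_span (tens_dense2 (nondeg_dense nf) (nondeg_dense ng)) _ => -[[x a] [y b]] /=.
exists (tens x y), (tens a b); case: (hom_tensP T T' hf hg) => _ ->.
by rewrite mL_mul leg2P leg1P.
Qed.

Lemma ext_hom_tens_leg1 m : ext F (leg1 m) = leg1 (ext f m).
Proof.
case: (hom_tensP T T' hf hg) => hF FE; symmetry.
apply: (ext_uniq_dense hF hom_tens_nondeg (@tens_dense_by _ _ _ T')) => -[x y] /=.
by rewrite leg1P !FE mulrA -leg1M extP.
Qed.

Lemma ext_hom_tens_leg2 m : ext F (leg2 m) = leg2 (ext g m).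
Proof.
case: (hom_tensP T T' hf hg) => hF FE; symmetry.
apply: (ext_uniq_dense hF hom_tens_nondeg (@tens_dense_by _ _ _ T')) => -[x y] /=.
by rewrite leg2P !FE legC mulrA -leg2M extP // -legC.
Qed.

End HomTensExt.

Arguments tens_dense2 {R X Y} T {I J s t} _ _ v e _.

Section NondegLegs.
Variables (R : realType) (X Y : cstar R) (T : min_tensor X Y).

Lemma starhom_l1 : starhom (fun x : X => leg1 (incl x) : multiplier T).
Proof. exact/starhom_leg1/starhom_incl. Qed.
Lemma starhom_l2 : starhom (fun y : Y => leg2 (incl y) : multiplier T).
Proof. exact/starhom_leg2/starhom_incl. Qed.

Lemma nondeg_l1 : nondegenerate (fun x : X => leg1 (incl x) : multiplier T).
Proof.
apply: (dense_by_span (s := fun p : (X * X) * Y => tens (p.1.1 ** p.1.2) p.2 : T)).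
  exact: (tens_dense2 T (@prod_dense _ X) (@id_dense _ Y)).
by move=> [[a b] y]; exists a, (tens b y); rewrite /= leg1P.
Qed.

Lemma nondeg_l2 : nondegenerate (fun y : Y => leg2 (incl y) : multiplier T).
Proof.
apply: dense_by_span (tens_dense2 T (@id_dense _ X) (@prod_dense _ Y)) _.
by move=> [x [a b]]; exists a, (tens x b); rewrite /= leg2P.
Qed.

Lemma ext_l1 m : ext (fun x : X => leg1 (incl x) : multiplier T) m = leg1 m.
Proof.
symmetry; apply: ext_uniq; [exact: starhom_l1|exact: nondeg_l1|].
by move=> a; rewrite -leg1M mul_incl.
Qed.
Lemma ext_l2 m : ext (fun y : Y => leg2 (incl y) : multiplier T) m = leg2 m.
Proof.
symmetry; apply: ext_uniq; [exact: starhom_l2|exact: nondeg_l2|].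
by move=> a; rewrite -leg2M mul_incl.
Qed.
Lemma ext_id (m : multiplier X) : ext incl m = m.
Proof.
symmetry; apply: ext_uniq; [exact: starhom_incl|exact: nondeg_incl|].
by move=> a; rewrite mul_incl.
Qed.

End NondegLegs.

Lemma vecfZ (R : realType) (Y : cstar R) (chi : Y -> R[i]) k y : vecf chi ->
  chi (k *: y) = k * chi y.
Proof. by move=> [H [rho [xi [eta [r ->]]]]]; rewrite (repZl r) ipZ. Qed.

(** On the algebraic tensor product the value at w^* w is the squared length of a vector in the
    tensor product of the two representation spaces. *)
Lemma prodf_pos (R : realType) (X Y : cstar R) (T : min_tensor X Y) (om : T -> R[i]) w :
  prodf om -> 0 <= om (cadj w ** w).
Proof.
move=> po; have [oml [C C0 omb]] := prodf_lin po; move: po => [chi2 [chi3 [p2 p3 oE]]].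
have v2 := pvec_vecf p2; have v3 := pvec_vecf p3.
apply: (form_pos_dense oml C0 omb (@tens_dense_by _ _ _ T)) => l.
have [H1 [rho1 [x1 [r1 e1]]]] := p2; have [H2 [rho2 [x2 [r2 e2]]]] := p3.
suff -> : om (cadj (comb (fun p => tens p.1 p.2) l) ** comb (fun p => tens p.1 p.2) l) =
  tip (tact rho1 rho2 l [:: (x1, x2)]) (tact rho1 rho2 l [:: (x1, x2)]) by exact: tip_ge0.
have o0 : om 0 = 0 by have := oml 1 0 0; rewrite scaler0 addr0 scale1r -[X in X = _]addr0 => /addrI.
have oD u v : om (u + v) = om u + om v by have := oml 1 u v; rewrite !scale1r.
have oZ k u : om (k *: u) = k * om u by have := oml k u 0; rewrite o0 !addr0.
have osum (J : Type) (r : seq J) (h : J -> T) : om (\sum_(i <- r) h i) = \sum_(i <- r) om (h i).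
  exact: (big_morph om oD o0).
rewrite /comb cmul_sumr osum /tip /tact big_allpairs_dep; apply: eq_bigr => p _.
rewrite big_seq1 cadj_sum cmul_suml osum big_allpairs_dep; apply: eq_bigr => p' _.
rewrite big_seq1 cadjZ cmulZl cmulZr !oZ /= -tens_adj -tensM oE slice_tens //.
rewrite (vecfZ _ _ v2) e1 e2 !(repZl r1) ipZ ipZr.
case: r1 => _ _ -> a1; case: r2 => _ _ -> a2; rewrite a1 a2 !cadjK; ring.
Qed.

(** * Associativity of the tensor product, and characters *)

Section Assoc.
Variables (R : realType) (A1 A2 A3 : cstar R).
Variables (T12 : min_tensor A1 A2) (T : min_tensor T12 A3)
  (T23 : min_tensor A2 A3) (T' : min_tensor A1 T23).

Definition e23 : T23 -> multiplier T :=
  hom_tens T (fun a => leg2 (incl a) : multiplier T12) incl (T' := T23).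

Lemma e23P : starhom e23 /\ forall a b, e23 (tens a b) = leg1 (leg2 (incl a)) * leg2 (incl b).
Proof. exact: (hom_tensP T T23 (starhom_l2 T12) (@starhom_incl _ A3)). Qed.
Lemma e23_hom : starhom e23. Proof. by case: e23P. Qed.
Lemma e23_nondeg : nondegenerate e23.
Proof.
exact: (hom_tens_nondeg T T23 (starhom_l2 T12) (@starhom_incl _ A3) (nondeg_l2 T12) (@nondeg_incl _ A3)).
Qed.

Lemma e23_comm (m : multiplier A1) w : leg1 (leg1 m) * e23 w = e23 w * leg1 (leg1 m).
Proof.
apply: mult_eqL => v; rewrite !mL_mul.
have [b [b0 hb]] := mult_bounded (leg1 (leg1 m) : multiplier T).
apply: (dense_eq (@tens_dense_by _ _ _ T23) (f := fun w => mL (leg1 (leg1 m)) (mL (e23 w) v))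
  (f' := fun w => mL (e23 w) (mL (leg1 (leg1 m)) v)) (c := b * nr v)
  (c' := nr (mL (leg1 (leg1 m)) v))).
- by move=> k x y; case: e23_hom => -> _ _; rewrite mL_add mL_scale mLD mLZ.
- by move=> k x y; case: e23_hom => -> _ _.
- move=> x; apply: le_trans (hb _) _; rewrite -mulrA ler_wpM2l //.
  exact: starhom_le e23_hom.
- by move=> x; exact: starhom_le e23_hom.
move=> [a c] /=; case: e23P => _ ->; rewrite -!mL_mul; congr (mL _ v).
by rewrite mulrA -leg1M (legC T12 m (incl a)) leg1M -!mulrA (legC T (leg1 m) (incl c)).
Qed.

(** Threefold products are bracketed to the left, so reassociation is a homomorphism that has to be
    constructed; it lets id ⊗ Delta be formed on two factors first. *)
Definition assoc : T' -> multiplier T := tprod (fun c => leg1 (leg1 (incl c))) e23.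

(* psi (x) chi2 (x) chi3 factors as psi (x) (chi2 (x) chi3) *)
Lemma triple_slice chi2 chi3 (y : multiplier A1) (u : T23) c c' a a' b b' :
  vecf chi2 -> vecf chi3 ->
  slice chi2 (slice chi3 (cadj (tens (tens c' a') b' : T) **
     mL (leg1 (leg1 y) * e23 u) (tens (tens c a) b : T))) =
  chi2 (slice chi3 (cadj (tens a' b') ** (u ** tens a b))) *: (cadj c' ** mL y c).
Proof.
move=> v2 v3; have [d2 hd2] := slice_bnd T12 v2; have [d3 hd3] := slice_bnd T v3.
have [d3' hd3'] := slice_bnd T23 v3; have [d4 d40 hd4] := vecf_bnd v2.
have [k [k0 hk]] := mult_bounded (leg1 (leg1 y) : multiplier T).
set t' := tens _ b'; set t := tens _ b.
apply: (dense_eq (@tens_dense_by _ _ _ T23)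
  (f := fun u => slice chi2 (slice chi3 (cadj t' ** mL (leg1 (leg1 y) * e23 u) t)))
  (f' := fun u => chi2 (slice chi3 (cadj (tens a' b') ** (u ** tens a b))) *: (cadj c' ** mL y c))
  (c := `|d2| * (`|d3| * (nr t' * (k * nr t))))
  (c' := d4 * (`|d3'| * (nr (tens a' b' : T23) * nr (tens a b : T23))) * nr (cadj c' ** mL y c))).
- move=> q v w; case: e23_hom => -> _ _.
  rewrite !mL_mul mL_add mL_scale mLD mLZ cmulDr cmulZr.
  by rewrite !slice_lin.
- move=> q v w; rewrite cmulDl cmulZl cmulDr cmulZr slice_lin // (vecf_lin v2 _ _ _).
  by rewrite scalerDl -[X in X *: _ + _]/(q * _) scalerA.
- move=> v; apply: le_trans (hd2 _) _; apply: le_trans (ler_wpM2r (nr_ge0 _) (ler_norm d2)) _.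
  rewrite -mulrA ler_wpM2l //; apply: le_trans (hd3 _) _.
  apply: le_trans (ler_wpM2r (nr_ge0 _) (ler_norm d3)) _.
  rewrite -mulrA ler_wpM2l //; apply: le_trans (nrM _ _) _.
  rewrite nr_adj -mulrA ler_wpM2l ?nr_ge0 // mL_mul; apply: le_trans (hk _) _.
  by rewrite -mulrA ler_wpM2l //; exact: starhom_le e23_hom.
- move=> v; rewrite nrZ [leRHS]mulrAC ler_wpM2r ?nr_ge0 //; apply: le_trans (hd4 _) _.
  rewrite -mulrA ler_wpM2l //; apply: le_trans (hd3' _) _.
  apply: le_trans (ler_wpM2r (nr_ge0 _) (ler_norm d3')) _.
  rewrite -mulrA ler_wpM2l //; apply: le_trans (nrM _ _) _.
  rewrite nr_adj -mulrA ler_wpM2l ?nr_ge0 //; apply: le_trans (nrM _ _) _.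
  by rewrite mulrC.
move=> [p q] /=; case: e23P => _ ->.
rewrite !mL_mul leg2P !leg1P leg2P leg1P /t' -!tens_adj -!tensM !slice_tens //.
rewrite sliceZ // slice_tens // scalerA; congr (_ *: _).
by rewrite (vecfZ _ _ v2).
Qed.

(** psi ⊗ chi2 ⊗ chi3 is regrouped as psi ⊗ om with om = chi2 ⊗ chi3 on T23, which [triple_slice]
    justifies; the GNS spaces of psi and om then fit [tens_bound]. *)
Lemma assoc_dom : tens_dom T' (fun c => leg1 (leg1 (incl c)) : multiplier T) e23.
Proof.
apply: (@tens_bound _ _ _ _ _ _ _ (A1 * A2 * A3)%type (fun p => tens (tens p.1.1 p.1.2) p.2 : T)
  [set phi | exists psi chi2 chi3, [/\ pvec psi, pvec chi2, pvec chi3 &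
     phi = fun t => psi (slice chi2 (slice chi3 t))]]).
- exact: (tens_dense2 T (@tens_dense_by _ _ _ T12) (@id_dense _ A3)).
- move=> phi [psi [chi2 [chi3 [pp p2 p3 ->]]]]; have v2 := pvec_vecf p2; have v3 := pvec_vecf p3.
  split; first by move=> k a b; rewrite slice_lin // slice_lin // (vecf_lin (pvec_vecf pp)).
  have [c c0 hc] := vecf_bnd (pvec_vecf pp); have [d2 hd2] := slice_bnd T12 v2.
  have [d3 hd3] := slice_bnd T v3.
  exists (c * (`|d2| * `|d3|)); first by rewrite !mulr_ge0.
  move=> v; apply: le_trans (hc _) _; rewrite -mulrA ler_wpM2l //.
  apply: le_trans (hd2 _) _; apply: le_trans (ler_wpM2r (nr_ge0 _) (ler_norm d2)) _.
  rewrite -mulrA ler_wpM2l //; apply: le_trans (hd3 _) _.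
  exact: (ler_wpM2r (nr_ge0 _) (ler_norm d3)).
- move=> y h; apply: cs_eq0; apply: slice_sep => chi3 p3; apply: slice_sep => chi2 p2.
  apply: pos_sep => psi pp.
  by apply: (h (fun t => psi (slice chi2 (slice chi3 t)))); exists psi, chi2, chi3.
move=> phi [psi [chi2 [chi3 [pp p2 p3 ->]]]].
have vp := pvec_vecf pp; have v2 := pvec_vecf p2; have v3 := pvec_vecf p3.
pose om (w : T23) := chi2 (slice chi3 w).
have [oml [C C0 omb]] : linear (om : T23 -> R[i]^o) /\ exists2 C, 0 <= C & forall v, nc (om v) <= C * nr v.
  by apply: prodf_lin; exists chi2, chi3.
have ompos w : 0 <= om (cadj w ** w) by apply: prodf_pos; exists chi2, chi3.
have [H1 [rho1 [w1 [r1 _ i1 a1]]]] := gns_act (vecf_lin vp) (fun x => pvec_pos x pp) (@starhom_incl _ A1).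
have [H2 [rho2 [w2 [r2 _ i2 a2]]]] := gns_act oml ompos (@starhom_incl _ T23).
exists H1, H2, rho1, rho2, (fun p => w1 p.1.1), (fun p => w2 (tens p.1.2 p.2)).
have pZ k u : psi (k *: u) = k * psi u.
  have pl := vecf_lin vp.
  have p0 : psi 0 = 0 by have := pl 1 0 0; rewrite scaler0 addr0 scale1r -[LHS]addr0 => /addrI.
  by have := pl k u 0; rewrite p0 !addr0.
have main x x' y y' (i j : A1 * A2 * A3) : psi (slice chi2 (slice chi3
     (cadj (mL (leg1 (leg1 (incl x')) * e23 y') (tens (tens j.1.1 j.1.2) j.2 : T)) **
      mL (leg1 (leg1 (incl x)) * e23 y) (tens (tens i.1.1 i.1.2) i.2 : T)))) =
   psi (cadj (x' ** j.1.1) ** (x ** i.1.1)) *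
   om (cadj (y' ** tens j.1.2 j.2) ** (y ** tens i.1.2 i.2)).
  rewrite -madj_ip' -mL_mul.
  have -> : madj (leg1 (leg1 (incl x')) * e23 y') * (leg1 (leg1 (incl x)) * e23 y) =
     leg1 (leg1 (incl (cadj x' ** x))) * e23 (cadj y' ** y) :> multiplier T.
    rewrite madjM -!leg1_adj -incl_adj; case: (e23_hom) => _ eM ea.
    rewrite -ea eM inclM !leg1M !mulrA -[e23 (cadj y') * _ * _]mulrA.
    by rewrite -!leg1M -e23_comm.
  rewrite triple_slice // pZ mulrC; congr (psi _ * om _).
    by rewrite mL_incl cadjM -!cmulA.
  by rewrite cadjM -!cmulA.
split=> // [i j|x y x' y' i j].
  rewrite i1 i2 /om -!tens_adj -!tensM !slice_tens // sliceZ // slice_tens //.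
  by rewrite !pZ (vecfZ _ _ v2) mulrA mulrC.
by rewrite a1 a2 a1 a2 i1 i2 -main.
Qed.

Lemma assocP : starhom assoc /\ forall c w, assoc (tens c w) = leg1 (leg1 (incl c)) * e23 w.
Proof.
apply: tprodP; [exact/starhom_leg1/starhom_l1|exact: e23_hom|by move=> *; exact: e23_comm|].
exact: assoc_dom.
Qed.

Lemma assoc_nondeg : nondegenerate assoc.
Proof.
apply: (dense_by_span (s := fun p : (A1 * A1) * (A2 * A2) * (A3 * A3) =>
  tens (tens (p.1.1.1 ** p.1.1.2) (p.1.2.1 ** p.1.2.2)) (p.2.1 ** p.2.2) : T)).
  exact: (tens_dense2 T (tens_dense2 T12 (@prod_dense _ A1) (@prod_dense _ A2)) (@prod_dense _ A3)).
move=> [[[c c'] [a a']] [b b']]; exists (tens c (tens a b)), (tens (tens c' a') b') => /=.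
case: assocP => _ ->; case: e23P => _ ->.
by rewrite !mL_mul leg2P !leg1P leg2P leg1P.
Qed.

Lemma ext_assoc_leg1 m : ext assoc (leg1 m) = leg1 (leg1 m).
Proof.
case: assocP => hF FE; symmetry.
apply: (ext_uniq_dense hF assoc_nondeg (@tens_dense_by _ _ _ T')) => -[c w] /=.
by rewrite leg1P !FE mulrA -!leg1M mul_incl.
Qed.

Lemma ext_assoc_leg2 m : ext assoc (leg2 m) = ext e23 m.
Proof.
case: assocP => hF FE; symmetry.
apply: (ext_uniq_dense hF assoc_nondeg (@tens_dense_by _ _ _ T')) => -[c w] /=.
rewrite leg2P !FE e23_comm mulrA extP; [|exact: e23_hom|exact: e23_nondeg].
by rewrite e23_comm.
Qed.

End Assoc.

Section CharLegs.
Variables (R : realType) (X Y : cstar R) (T : min_tensor X Y) (eps : X -> R[i]).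
Hypothesis he : character eps.

Lemma char_lin : linear (eps : X -> R[i]^o). Proof. by case: he. Qed.
Lemma char_norm1 : exists x, eps x = 1.
Proof.
case: he => l _ _ [x x0]; exists ((eps x)^-1 *: x).
have z : eps 0 = 0 by have := l 1 0 0; rewrite scaler0 addr0 scale1r -[X in X = _]addr0 => /addrI.
by have := l (eps x)^-1 x 0; rewrite !addr0 z addr0 => ->; rewrite -[LHS]/(_ * _) mulVf.
Qed.
Lemma charM x y : eps (x ** y) = eps x * eps y. Proof. by case: he. Qed.
Lemma char_adj x : eps (cadj x) = ((eps x)^*)%R. Proof. by case: he. Qed.

Lemma starhom_char (V : cstar R) : starhom (fun x => eps x *: (1 : multiplier V)).
Proof.
split.
- by move=> k a b; rewrite char_lin scalerDl -scalerA.
- by move=> a b; rewrite charM mscaleAl mul1r scalerA.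
by move=> a; rewrite char_adj madjZ madj1.
Qed.

(** The first representation is the GNS representation of eps, and every generator uses the same
    vector w1 x0 of it, with eps x0 = 1: the first factor contributes a scalar only. *)
Lemma char_dom : tens_dom T (fun x => eps x *: (1 : multiplier Y)) incl.
Proof.
apply: (@tens_bound _ _ _ _ _ _ _ Y (fun y => y) [set phi | pvec phi]).
- exact: id_dense.
- move=> phi pp; split; first exact: vecf_lin (pvec_vecf pp).
  exact: vecf_bnd (pvec_vecf pp).
- by move=> y h; apply: cs_eq0; apply: pos_sep => chi pc; exact: h.
move=> phi pp; have vp := pvec_vecf pp.
have epos x : 0 <= eps (cadj x ** x) by rewrite charM char_adj mulrC; exact: mul_conjC_ge0.
have [H1 [rho1 [w1 [r1 _ i1 a1]]]] := gns_act char_lin epos (@starhom_incl _ X).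
have [H2 [rho2 [w2 [r2 _ i2 a2]]]] := gns_act (vecf_lin vp) (fun x => pvec_pos x pp) (@starhom_incl _ Y).
have [x0 x01] := char_norm1.
exists H1, H2, rho1, rho2, (fun=> w1 x0), w2; split=> // [i j|x y x' y' i j].
  by rewrite i1 i2 charM char_adj x01 cj1 !mul1r.
rewrite a1 a1 i1 a2 a2 i2 !mL_incl !charM char_adj charM x01 !mulr1.
rewrite !mscaleAl !mul1r !mL_scale cadjZ cmulZl cmulZr !(vecfZ _ _ vp).
by rewrite mulrA.
Qed.

Definition char_tens : T -> multiplier Y :=
  tprod (fun x => eps x *: (1 : multiplier Y)) incl.

Lemma char_comm (x : X) (m : multiplier Y) :
  (eps x *: (1 : multiplier Y)) * m = m * (eps x *: (1 : multiplier Y)).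
Proof. by rewrite mscaleAl mscaleAr mul1r mulr1. Qed.

Lemma char_tensP : starhom char_tens /\
  forall x y, char_tens (tens x y) = (eps x *: (1 : multiplier Y)) * incl y.
Proof.
apply: tprodP; [exact: starhom_char|exact: starhom_incl|by move=> *; exact: char_comm|].
exact: char_dom.
Qed.

Lemma char_tensE x y : char_tens (tens x y) = eps x *: incl y.
Proof. by case: char_tensP => _ ->; rewrite mscaleAl mul1r. Qed.

Lemma char_tens_nondeg : nondegenerate char_tens.
Proof.
apply: dense_by_span (@prod_dense _ Y) _ => -[y y'] /=.
have [x0 x01] := char_norm1.
by exists (tens x0 y), y'; rewrite char_tensE x01 scale1r.
Qed.

Lemma ext_char_leg2 m : ext char_tens (leg2 m) = m.
Proof.
case: char_tensP => hF _; symmetry.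
apply: (ext_uniq_dense hF char_tens_nondeg (@tens_dense_by _ _ _ T)) => -[x y] /=.
by rewrite leg2P !char_tensE mscaleAr mul_incl.
Qed.

Lemma ext_char_leg1 x : ext char_tens (leg1 (incl x)) = eps x *: (1 : multiplier Y).
Proof.
case: char_tensP => hF _; symmetry.
apply: (ext_uniq_dense hF char_tens_nondeg (@tens_dense_by _ _ _ T)) => -[a b] /=.
by rewrite leg1P !char_tensE mscaleAl mul1r scalerA charM.
Qed.

End CharLegs.

Lemma starhom_eqt (R : realType) (X Y V : cstar R) (T : min_tensor X Y)
  (F F' : T -> multiplier V) t : starhom F -> starhom F' ->
  (forall x y, F (tens x y) = F' (tens x y)) -> F t = F' t.
Proof. by move=> h h' /(starhom_eq_tens h h')->. Qed.

(** * Leg calculus for comultiplications and counits *)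

Section Bialgebra.
Variables (R : realType) (mt : tensor_choice R).
Local Notation "X ⊗ Y" := (tensor_alg (mt X Y)) (at level 40, left associativity).
Implicit Types A B C D : cstar R.

Section TensId.
Variables (B C A : cstar R) (f : B -> multiplier C).
Hypothesis hf : starhom f.
Local Notation tf := (@tens_id R mt B C A f).

Lemma tens_id_hom : starhom tf.
Proof. by case: (hom_tensP (mt C A) (mt B A) hf (@starhom_incl _ A)). Qed.
Lemma tens_idE b a : tf (tens b a) = leg1 (f b) * leg2 (incl a).
Proof. by case: (hom_tensP (mt C A) (mt B A) hf (@starhom_incl _ A)) => _ h; exact: h. Qed.

Hypothesis nf : nondegenerate f.
Lemma tens_id_nondeg : nondegenerate tf.
Proof. exact: (hom_tens_nondeg (mt C A) (mt B A) hf (@starhom_incl _ A) nf (@nondeg_incl _ A)). Qed.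
Lemma ext_tens_id_leg1 m : ext tf (leg1 m) = leg1 (ext f m).
Proof. exact: (ext_hom_tens_leg1 (mt C A) (mt B A) hf (@starhom_incl _ A) nf (@nondeg_incl _ A)). Qed.
Lemma ext_tens_id_leg2 m : ext tf (leg2 m) = leg2 m.
Proof.
rewrite -[in RHS](ext_id m).
exact: (ext_hom_tens_leg2 (mt C A) (mt B A) hf (@starhom_incl _ A) nf (@nondeg_incl _ A)).
Qed.
End TensId.

Section Emb23.
Variables (C A1 A2 : cstar R).
Local Notation E := (@emb23 R mt C A1 A2).
Lemma emb23_hom : starhom E. Proof. exact: e23_hom. Qed.
Lemma emb23_nondeg : nondegenerate E. Proof. exact: e23_nondeg. Qed.
Lemma emb23E a b : E (tens a b) = leg1 (leg2 (incl a)) * leg2 (incl b).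
Proof. by case: (e23P (mt (C ⊗ A1) A2) (mt A1 A2)) => _ h; exact: h. Qed.
Lemma ext_emb23_leg1 m : ext E (leg1 m) = leg1 (leg2 m).
Proof.
rewrite -(ext_l2 (mt C A1)).
exact: (ext_tens_id_leg1 (f := fun a : A1 => leg2 (incl a) : multiplier (C ⊗ A1)) A2 (starhom_l2 _) (@nondeg_l2 _ _ _ _)).
Qed.
Lemma ext_emb23_leg2 m : ext E (leg2 m) = leg2 m.
Proof.
exact: (ext_tens_id_leg2 (f := fun a : A1 => leg2 (incl a) : multiplier (C ⊗ A1)) (starhom_l2 _) (@nondeg_l2 _ _ _ _)).
Qed.
End Emb23.

Section IdTens.
Variables (A C : cstar R) (Delta : A -> multiplier (A ⊗ A)).
Hypotheses (hD : starhom Delta) (nD : nondegenerate Delta).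
Local Notation tD := (@id_tens R mt C A Delta).
Let al := @assoc R C A A (mt C A) (mt (C ⊗ A) A) (mt A A) (mt C (A ⊗ A)).
Let iD := hom_tens (mt C (A ⊗ A)) (@incl R C) Delta (T' := mt C A).

Let iD_hom : starhom iD.
Proof. by case: (hom_tensP (mt C (A ⊗ A)) (mt C A) (@starhom_incl _ C) hD). Qed.
Let iD_nondeg : nondegenerate iD.
Proof. exact: (hom_tens_nondeg _ _ (@starhom_incl _ C) hD (@nondeg_incl _ C) nD). Qed.
Let al_hom : starhom al. Proof. by case: (@assocP R C A A (mt C A) (mt (C ⊗ A) A) (mt A A) (mt C (A ⊗ A))). Qed.
Let al_nondeg : nondegenerate al. Proof. exact: assoc_nondeg. Qed.

(** The composite of id ⊗ Delta : C ⊗ A -> M(C ⊗ (A ⊗ A)) with reassociation has the required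
    values, so [tprod] does not fall back on its default. *)
Let tDP : starhom tD /\ forall c a, tD (tens c a) =
  leg1 (leg1 (incl c)) * ext (@emb23 R mt C A A) (Delta a).
Proof.
apply: tprod_ex; exists (fun t => ext al (iD t)); split.
  exact: starhom_ext.
move=> c a; case: (hom_tensP (mt C (A ⊗ A)) (mt C A) (@starhom_incl _ C) hD) => _ iDE.
by rewrite /iD iDE extM // ext_assoc_leg1 ext_assoc_leg2.
Qed.

Lemma id_tens_hom : starhom tD. Proof. by case: tDP. Qed.
Lemma id_tensE c a : tD (tens c a) = leg1 (leg1 (incl c)) * ext (@emb23 R mt C A A) (Delta a).
Proof. by case: tDP. Qed.

Let tD_comp : tD = fun t => ext al (iD t).
Proof.
apply: starhom_eq_tens; [exact: id_tens_hom|exact: starhom_ext|] => c a.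
case: (hom_tensP (mt C (A ⊗ A)) (mt C A) (@starhom_incl _ C) hD) => _ iDE.
by rewrite id_tensE /iD iDE extM // ext_assoc_leg1 ext_assoc_leg2.
Qed.

Lemma id_tens_nondeg : nondegenerate tD.
Proof. by rewrite tD_comp; apply: nondeg_comp. Qed.

Lemma ext_id_tens_leg1 m : ext tD (leg1 m) = leg1 (leg1 m).
Proof.
rewrite tD_comp ext_comp // /iD ext_hom_tens_leg1 //; try exact: starhom_incl; try exact: nondeg_incl.
by rewrite ext_id ext_assoc_leg1.
Qed.

Lemma ext_id_tens_leg2 m : ext tD (leg2 m) = ext (@emb23 R mt C A A) (ext Delta m).
Proof.
rewrite tD_comp ext_comp // /iD ext_hom_tens_leg2 //; try exact: starhom_incl; try exact: nondeg_incl.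
by rewrite ext_assoc_leg2.
Qed.

End IdTens.

Section Relations.
Variables (A : cstar R) (Delta : A -> multiplier (A ⊗ A)).
Hypothesis bA : cstar_bialgebra Delta.
Let hD : starhom Delta. Proof. by case: bA. Qed.
Let nD : nondegenerate Delta. Proof. by case: bA. Qed.

Lemma tens_id_comp B C D (phi : B -> multiplier C) (psi : C -> multiplier D) :
  starhom phi -> starhom psi -> nondegenerate psi ->
  @tens_id R mt B D A (fun b => ext psi (phi b)) = fun t => ext (@tens_id R mt C D A psi) (tens_id phi t).
Proof.
move=> hp hq nq; have hc := starhom_ext hq nq hp.
apply: starhom_eq_tens; first exact: tens_id_hom.
  by apply: starhom_ext; [exact: tens_id_hom|exact: tens_id_nondeg|exact: tens_id_hom].
move=> b a; rewrite !tens_idE // extM; [|exact: tens_id_hom|exact: tens_id_nondeg].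
by rewrite ext_tens_id_leg1 // ext_tens_id_leg2.
Qed.

(* (delta (x) id (x) id)(id (x) Delta) = (id (x) Delta)(delta (x) id) *)
Lemma id_tens_swap B C (delta : B -> multiplier C) t : starhom delta -> nondegenerate delta ->
  ext (@tens_id R mt (B ⊗ A) (C ⊗ A) A (tens_id delta)) (id_tens Delta t) =
  ext (@id_tens R mt C A Delta) (tens_id delta t).
Proof.
move=> hd nd; have ht := @tens_id_hom B C A delta hd; have nt := @tens_id_nondeg B C A delta hd nd.
have htt := @tens_id_hom _ _ A _ ht; have ntt := @tens_id_nondeg _ _ A _ ht nt.
have hi := id_tens_hom C hD; have ni := id_tens_nondeg C hD nD.
have hiB := id_tens_hom B hD; have niB := id_tens_nondeg B hD nD.
have h1 := starhom_ext htt ntt hiB.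
have h2 := starhom_ext hi ni ht.
have eE : (fun w => ext (@tens_id R mt (B ⊗ A) (C ⊗ A) A (tens_id delta)) (emb23 B w)) = @emb23 R mt C A A.
  have hE := emb23_hom B A A.
  apply: starhom_eq_tens; [exact: starhom_ext|exact: emb23_hom|] => x y.
  by rewrite !emb23E extM // ext_tens_id_leg1 // !ext_tens_id_leg2.
apply: (starhom_eqt t h1 h2) => b a.
rewrite id_tensE // extM // !ext_tens_id_leg1 // ext_incl //.
rewrite -ext_comp ?eE //; [|exact: emb23_hom|exact: emb23_nondeg].
by rewrite tens_idE // extM // ext_id_tens_leg1 // ext_id_tens_leg2 // ext_incl.
Qed.

(* (id (x) Delta (x) id)(id (x) Delta) = (id (x) id (x) Delta)(id (x) Delta) *)
Lemma id_tens_coassoc B t :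
  ext (@tens_id R mt (B ⊗ A) (B ⊗ A ⊗ A) A (id_tens Delta)) (id_tens Delta t) =
  ext (@id_tens R mt (B ⊗ A) A Delta) (id_tens Delta t).
Proof.
have hi := id_tens_hom B hD; have ni := id_tens_nondeg B hD nD.
have hiA := id_tens_hom A hD; have niA := id_tens_nondeg A hD nD.
have hiB := id_tens_hom (B ⊗ A) hD; have niB := id_tens_nondeg (B ⊗ A) hD nD.
have ht := @tens_id_hom _ _ A _ hi; have nt := @tens_id_nondeg _ _ A _ hi ni.
have hE := emb23_hom B A A; have nE := emb23_nondeg B A A.
pose E3 := @tens_id R mt (A ⊗ A) (B ⊗ A ⊗ A) A (@emb23 R mt B A A).
have hE3 : starhom E3 by exact: tens_id_hom.
have nE3 : nondegenerate E3 by exact: tens_id_nondeg.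
have hDA := @tens_id_hom _ _ A _ hD; have nDA := @tens_id_nondeg _ _ A _ hD nD.
have f1 : (fun w => ext (@tens_id R mt (B ⊗ A) (B ⊗ A ⊗ A) A (id_tens Delta)) (emb23 B w)) =
   (fun w => ext E3 (tens_id Delta w)).
  apply: starhom_eq_tens; [exact: starhom_ext|exact: starhom_ext|] => x y.
  rewrite emb23E tens_idE // !extM // !ext_tens_id_leg1 // !ext_tens_id_leg2 //.
  by rewrite ext_id_tens_leg2 // ext_incl.
have f3 : (fun w => ext E3 (emb23 A w)) = @emb23 R mt (B ⊗ A) A A.
  have hEA := emb23_hom A A A; have hEBA := emb23_hom (B ⊗ A) A A.
  apply: starhom_eq_tens => //; first exact: starhom_ext.
  move=> x y; rewrite !emb23E extM // /E3 (ext_tens_id_leg1 A hE nE) (ext_tens_id_leg2 hE nE).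
  by rewrite ext_emb23_leg2.
have f2 : (fun w => ext (@id_tens R mt (B ⊗ A) A Delta) (emb23 B w)) =
   (fun w => ext E3 (id_tens Delta w)).
  apply: starhom_eq_tens; [exact: starhom_ext|exact: starhom_ext|] => x y.
  rewrite emb23E id_tensE // !extM // ext_id_tens_leg1 // ext_id_tens_leg2 // ext_incl //.
  rewrite ext_tens_id_leg1 // ext_emb23_leg1; congr (_ * _).
  by rewrite -f3 ext_comp //; [exact: emb23_hom|exact: emb23_nondeg].
apply: (starhom_eqt t (starhom_ext ht nt hi) (starhom_ext hiB niB hi)) => b a.
rewrite id_tensE // !extM // ext_tens_id_leg1 // !ext_id_tens_leg1 //.
congr (_ * _); rewrite -!ext_comp // f1 f2 !ext_comp //.
by case: bA => _ _ ->.
Qed.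

End Relations.

Section Counit.
Variables (A : cstar R) (Delta : A -> multiplier (A ⊗ A)) (eps : A -> R[i]).
Hypotheses (bA : cstar_bialgebra Delta) (he : character eps).
Let hD : starhom Delta. Proof. by case: bA. Qed.
Let nD : nondegenerate Delta. Proof. by case: bA. Qed.

Lemma eps_idP : starhom (@eps_id R mt A eps) /\ nondegenerate (@eps_id R mt A eps).
Proof. by split; [case: (char_tensP (mt A A) he)|exact: char_tens_nondeg]. Qed.

Lemma eps_idE x y : @eps_id R mt A eps (tens x y) = eps x *: incl y.
Proof. exact: (char_tensE (mt A A) he). Qed.

Let id_epsE' B : starhom (@id_eps R mt B A eps) /\
  forall x y, @id_eps R mt B A eps (tens x y) = incl x * (eps y *: (1 : multiplier B)).
Proof.
apply: tprod_ex; exists (@char_tens _ _ _ (flip (mt B A)) eps).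
case: (char_tensP (flip (mt B A)) he) => h e; split=> // x y.
by rewrite -char_comm; exact: e.
Qed.

Lemma id_eps_hom B : starhom (@id_eps R mt B A eps). Proof. by case: (id_epsE' B). Qed.
Lemma id_epsE B x y : @id_eps R mt B A eps (tens x y) = eps y *: incl x.
Proof. by case: (id_epsE' B) => _ ->; rewrite mscaleAr mulr1. Qed.

Lemma id_eps_nondeg B : nondegenerate (@id_eps R mt B A eps).
Proof.
apply: dense_by_span (@prod_dense _ B) _ => -[y y'] /=.
have [x0 x01] := char_norm1 he.
by exists (tens y x0), y'; rewrite id_epsE x01 scale1r.
Qed.

Lemma ext_id_eps_leg1 B m : ext (@id_eps R mt B A eps) (leg1 m) = m.
Proof.
symmetry; apply: (ext_uniq_dense (id_eps_hom B) (id_eps_nondeg B) (@tens_dense_by _ _ _ (mt B A))) => -[x y] /=.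
by rewrite leg1P !id_epsE mscaleAr mul_incl.
Qed.

Lemma ext_id_eps_leg2 B x : ext (@id_eps R mt B A eps) (leg2 (incl x)) = eps x *: (1 : multiplier B).
Proof.
symmetry; apply: (ext_uniq_dense (id_eps_hom B) (id_eps_nondeg B) (@tens_dense_by _ _ _ (mt B A))) => -[a b] /=.
by rewrite leg2P !id_epsE mscaleAl mul1r scalerA (charM he).
Qed.

(* (id (x) eps (x) id)(id (x) Delta) = id *)
Lemma eps_id_tens B t : (forall a, ext (@eps_id R mt A eps) (Delta a) = incl a) ->
  ext (@tens_id R mt (B ⊗ A) B A (id_eps eps)) (id_tens Delta t) = incl t.
Proof.
move=> hc; have [he1 ne1] := eps_idP.
have h1 := id_eps_hom B; have n1 := id_eps_nondeg B.
have ht := @tens_id_hom _ _ A _ h1; have nt := @tens_id_nondeg _ _ A _ h1 n1.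
have hi := id_tens_hom B hD; have ni := id_tens_nondeg B hD nD.
have hE := emb23_hom B A A; have nE := emb23_nondeg B A A.
have h2 := starhom_l2 (mt B A); have n2 := nondeg_l2 (mt B A).
have f : (fun w => ext (@tens_id R mt (B ⊗ A) B A (id_eps eps)) (emb23 B w)) =
    (fun w => ext (fun a => leg2 (incl a) : multiplier (B ⊗ A)) (eps_id eps w)).
  apply: starhom_eq_tens; [exact: starhom_ext|exact: starhom_ext|] => x y.
  rewrite emb23E extM // ext_tens_id_leg1 // ext_tens_id_leg2 // ext_id_eps_leg2.
  by rewrite eps_idE extZ // ext_incl // leg1Z leg1_1 mscaleAl mul1r.
apply: (starhom_eqt t (starhom_ext ht nt hi) (@starhom_incl _ _)) => b a.
rewrite id_tensE // extM // ext_tens_id_leg1 // ext_id_eps_leg1 -ext_comp // f ext_comp //.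
by rewrite hc ext_incl // leg_tens.
Qed.

End Counit.

End Bialgebra.

Lemma dense_eqC (R : realType) (V : completeNormedModType R[i]) (I : Type) (s : I -> V)
  (f f' : V -> R[i]) (c c' : R) : dense_by s ->
  linear (f : V -> R[i]^o) -> linear (f' : V -> R[i]^o) ->
  (forall v, nc (f v) <= c * nr v) -> (forall v, nc (f' v) <= c' * nr v) ->
  (forall i, f (s i) = f' (s i)) -> f =1 f'.
Proof.
move=> sd lf lf' bf bf' e v; apply/eqP; rewrite -subr_eq0; apply/eqP.
apply: nc_small => d d0.
have c0 : 0 < `|c| + `|c'| + 1 by rewrite ltr_wpDl // addr_ge0.
have [l hl] := sd v _ (divr_gt0 d0 c0).
have el : f (comb s l) = f' (comb s l).
  rewrite (@linear_comb _ V (R[i]^o) _ s f) // (@linear_comb _ V (R[i]^o) _ s f') //.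
  by apply: eq_bigr => p _ /=; rewrite e.
have fB (g : V -> R[i]) a b : linear (g : V -> R[i]^o) -> g (a - b) = g a - g b.
  by move=> lg; rewrite [a - b]addrC -[- b]scaleN1r (lg _ _ _) scaleN1r addrC.
rewrite (_ : f v - f' v = f (v - comb s l) - f' (v - comb s l)); last first.
  by rewrite !fB // el; ring.
apply: le_trans (ncD _ _) _; rewrite ncN; apply: le_trans (lerD (bf _) (bf' _)) _.
rewrite -mulrDl; apply: (@le_trans _ _ ((`|c| + `|c'| + 1) * nr (v - comb s l))).
  rewrite ler_wpM2r ?nr_ge0 //; have := ler_norm c; have := ler_norm c'; lra.
by rewrite mulrC -ler_pdivlMr // ltW.
Qed.

(** * Slices over the first leg *)

Section Slice2.
Variables (R : realType) (X Y : cstar R) (T : min_tensor X Y).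

Definition slice2 (chi : X -> R[i]) (t : T) : Y := slice (T := flip T) chi t.

Lemma slice2_tens chi x y : vecf chi -> slice2 chi (tens x y) = chi x *: y.
Proof. by move=> vc; exact: (@slice_tens _ _ _ (flip T) chi vc y x). Qed.
Lemma slice2_lin chi : vecf chi -> linear (slice2 chi).
Proof. by move=> vc; exact: (@slice_lin _ _ _ (flip T) chi vc). Qed.
Lemma slice2_bnd chi : vecf chi -> exists c, forall t, nr (slice2 chi t) <= c * nr t.
Proof. by move=> vc; exact: (@slice_bnd _ _ _ (flip T) chi vc). Qed.
Lemma pvec_adj (Z : cstar R) (chi : Z -> R[i]) x : pvec chi -> chi (cadj x) = ((chi x)^*)%R.
Proof. by move=> [H [rho [xi [[_ _ _ ra] ->]]]]; rewrite ra cadjK -ip_conj. Qed.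

Lemma slice_adj chi t : pvec chi -> slice chi (cadj t : T) = cadj (slice chi t).
Proof.
move=> pc; have vc := pvec_vecf pc; have [c hc] := slice_bnd T vc.
rewrite -[LHS]cadjK; congr cadj.
apply: (slice_uniq (f := fun t => cadj (slice chi (cadj t))) (c := c) (c' := c)).
- by move=> k a b; rewrite cadjD cadjZ slice_lin // cadjD cadjZ conjCK.
- exact: slice_lin.
- by move=> v; rewrite nr_adj; apply: le_trans (hc _) _; rewrite nr_adj.
- by [].
move=> x y; rewrite -tens_adj !slice_tens // cadjZ cadjK pvec_adj // conjCK //.
Qed.

Lemma vecf_lin_bnd (V W : cstar R) (psi : W -> R[i]) (S : V -> W) : vecf psi ->
  linear S -> (exists c, forall t, nr (S t) <= c * nr t) ->
  linear ((fun t => psi (S t)) : V -> R[i]^o) /\ exists c, forall t, nc (psi (S t)) <= c * nr t.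
Proof.
move=> vp Sl [c hc]; split; first by move=> k a b; rewrite Sl (vecf_lin vp).
have [d d0 hd] := vecf_bnd vp; exists (d * c) => t.
by apply: le_trans (hd _) _; rewrite -mulrA ler_wpM2l.
Qed.

(** Both sides are psi ⊗ chi: they agree on elementary tensors and, being bounded, everywhere. *)
Lemma slice_slice2 psi chi t : vecf psi -> vecf chi -> psi (slice chi t) = chi (slice2 psi t).
Proof.
move=> vp vc.
have [l1 [c1 b1]] := vecf_lin_bnd vp (@slice_lin _ _ _ T _ vc) (slice_bnd T vc).
have [l2 [c2 b2]] := vecf_lin_bnd vc (slice2_lin vp) (slice2_bnd vp).
apply: (dense_eqC (@tens_dense_by _ _ _ T) l1 l2 b1 b2) => -[x y].
by rewrite slice_tens // slice2_tens // !vecfZ // mulrC.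
Qed.

Lemma vecf0 (Z : cstar R) (chi : Z -> R[i]) : vecf chi -> chi 0 = 0.
Proof. by move=> vc; rewrite -(scale0r (0 : Z)) vecfZ // mul0r. Qed.
Lemma vecfD (Z : cstar R) (chi : Z -> R[i]) x y : vecf chi -> chi (x + y) = chi x + chi y.
Proof. by move=> vc; have := vecf_lin vc 1 x y; rewrite !scale1r. Qed.
Lemma vecfB (Z : cstar R) (chi : Z -> R[i]) x y : vecf chi -> chi (x - y) = chi x - chi y.
Proof. by move=> vc; apply: functionalB; exact: vecf_lin. Qed.
Lemma vecf_sum (Z : cstar R) (chi : Z -> R[i]) (I : Type) (r : seq I) (P : pred I) (f : I -> Z) :
  vecf chi -> chi (\sum_(i <- r | P i) f i) = \sum_(i <- r | P i) chi (f i).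
Proof. by move=> vc; apply: (big_morph chi) => [a b|]; [exact: vecfD|exact: vecf0]. Qed.

End Slice2.

(** * Limits along ultrafilters *)

Section UltraLimit.
Variables (R : realType) (I : Type) (U : set_system I).
Hypothesis hU : UltraFilter U.

Definition uconv (f : I -> R[i]) (l : R[i]) :=
  forall e : R, 0 < e -> U [set i | nc (f i - l) < e].

Let PU : ProperFilter U := ultra_proper.

Lemma U_mono (A B : set I) : A `<=` B -> U A -> U B.
Proof. exact: filterS. Qed.
Lemma U_ex (A : set I) : U A -> exists i, A i.
Proof. by move=> /filter_ex. Qed.

Lemma uconv_uniq f l l' : uconv f l -> uconv f l' -> l = l'.
Proof.
move=> h h'; apply/eqP; rewrite -subr_eq0; apply/eqP; apply: nc_small => e e0.
have e2 : 0 < e / 2 by rewrite divr_gt0.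
have [i [/= h1 h2]] := U_ex (filterI (h _ e2) (h' _ e2)).
apply: le_trans (nc_tri (f i) _ _) _; rewrite [leRHS]splitr ncC.
by apply: lerD; exact: ltW.
Qed.

Lemma uconv_eq f g l : U [set i | f i = g i] -> uconv f l -> uconv g l.
Proof.
move=> h hf e e0; apply: U_mono (filterI h (hf _ e0)) => i [/= <-]; exact.
Qed.

Lemma uconv_cst l : uconv (fun=> l) l.
Proof.
move=> e e0; apply: U_mono (@filterT _ U _) => i _ /=.
by rewrite subrr nc0.
Qed.

Lemma uconvD f g l l' : uconv f l -> uconv g l' -> uconv (fun i => f i + g i) (l + l').
Proof.
move=> h h' e e0; have e2 : 0 < e / 2 by rewrite divr_gt0.
apply: U_mono (filterI (h _ e2) (h' _ e2)) => i [/= h1 h2].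
rewrite (_ : _ - _ = (f i - l) + (g i - l')); last by ring.
by apply: le_lt_trans (ncD _ _) _; rewrite [ltRHS]splitr ltrD.
Qed.

Lemma uconvZ k f l : uconv f l -> uconv (fun i => k * f i) (k * l).
Proof.
move=> h e e0; have k0 : 0 < nc k + 1 by rewrite ltr_wpDl ?nc_ge0.
apply: U_mono (h _ (divr_gt0 e0 k0)) => i /= hi.
rewrite -mulrBr ncM; apply: (@le_lt_trans _ _ ((nc k + 1) * nc (f i - l))).
  by rewrite ler_wpM2r ?nc_ge0 // lerDl.
by rewrite mulrC -ltr_pdivlMr.
Qed.

Lemma uconv_ge0 f l : (forall i, 0 <= f i) -> uconv f l -> 0 <= l.
Proof.
move=> h hf; apply: ge0_near => e e0; have [i /= hi] := U_ex (hf _ e0).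
by exists (f i); split=> //; rewrite ncC ltW.
Qed.

(** The limit is the supremum of the t with t <= f i for U-almost all i; just above it the
    complementary set belongs to U because U is an ultrafilter. *)
Lemma uconv_real (f : I -> R) M : (forall i, `|f i| <= M) ->
  exists l, forall e : R, 0 < e -> U [set i | `|f i - l| < e].
Proof.
move=> h; pose S := [set t | U [set i | t <= f i]].
have hs : has_sup S.
  split; first by exists (- M); apply: U_mono (@filterT _ U _) => i _ /=; have := h i; rewrite ler_norml => /andP[].
  exists M => t St; have [i /= hi] := U_ex St; apply: le_trans hi _.
  by have := h i; rewrite ler_norml => /andP[].
exists (sup S) => e e0.
have [t St ht] := sup_adherent e0 hs.
have nS : ~ S (sup S + e / 2).
  move=> Ss; have := sup_upper_bound hs Ss; rewrite gerDl leNgt divr_gt0 //.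
have [//|Uc] := in_ultra_setVsetC [set i | sup S + e / 2 <= f i] hU.
apply: U_mono (filterI St Uc) => i [/= h1 /negP]; rewrite -ltNge => h2.
by rewrite ltr_norml; lra.
Qed.

Lemma uconv_ex (f : I -> R[i]) M : (forall i, nc (f i) <= M) -> exists l, uconv f l.
Proof.
move=> h; have [|a ha] := @uconv_real (fun i => Re (f i)) M.
  by move=> i; apply: le_trans (nc_Re _) (h i).
have [|b hb] := @uconv_real (fun i => Im (f i)) M.
  by move=> i; apply: le_trans (nc_Im _) (h i).
exists (a +i* b) => e e0; have e2 : 0 < e / 2 by rewrite divr_gt0.
apply: U_mono (filterI (ha _ e2) (hb _ e2)) => i [/= h1 h2].
apply: le_lt_trans (nc_le_ReIm _) _; rewrite [ltRHS]splitr.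
by move: h1 h2; case: (f i) => x y /= h1 h2; apply: ltrD.
Qed.

End UltraLimit.

(** * Invariant states *)

Section States.
Variables (R : realType) (K : cstar R) (e : K).
Hypotheses (eU : is_unit e) (e0 : e != 0).

Definition state (chi : K -> R[i]) :=
  [/\ linear (chi : K -> R[i]^o), (forall x, 0 <= chi (cadj x ** x)) & chi e = 1].

Lemma mule x : e ** x = x. Proof. by case: (eU x). Qed.
Lemma emul x : x ** e = x. Proof. by case: (eU x). Qed.
Lemma adje : cadj e = e.
Proof. by rewrite -[LHS]emul -[in RHS](cadjK e) -[in RHS](emul (cadj e)) cadjM cadjK emul. Qed.
Lemma nre : nr e = 1.
Proof.
have n0 : nr e != 0 by apply: contra e0 => /eqP/nr_eq0->.
by apply: (mulfI n0); rewrite mulr1 -expr2 -nr_cs adje mule.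
Qed.

(** The vector is the class of the unit in the GNS space. *)
Lemma pos_pvec (chi : K -> R[i]) : linear (chi : K -> R[i]^o) ->
  (forall x, 0 <= chi (cadj x ** x)) -> pvec chi.
Proof.
move=> cl cp; have [H [rho [v [r _ i a]]]] := gns_act cl cp (@starhom_incl _ K).
exists H, rho, (v e); split=> //; apply/funext => x.
by rewrite a i /= adje mule emul.
Qed.

Lemma state_pvec chi : state chi -> pvec chi.
Proof. by case=> cl cp _; exact: pos_pvec. Qed.
Lemma state_vecf chi : state chi -> vecf chi.
Proof. by move=> /state_pvec/pvec_vecf. Qed.

Lemma state_le chi x : state chi -> nc (chi x) <= nr x.
Proof.
case=> cl cp ce; have [H [rho [v [r _ i a]]]] := gns_act cl cp (@starhom_incl _ K).
have -> : chi x = ip (rho x (v e)) (v e) by rewrite a i /= adje mule emul.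
have n1 : nr (v e) = 1.
  apply/eqP; rewrite -(@eqrXn2 _ 2) ?nr_ge0 // expr1n; apply/eqP/complexI.
  by rewrite -ip_nr i adje mule ce.
apply: le_trans (ip_le _ _) _; rewrite n1 mulr1; apply: le_trans (rep_bnd r _ _) _.
by rewrite n1 mulr1.
Qed.

Lemma state_conj chi x : state chi -> chi (cadj x) = ((chi x)^*)%R.
Proof.
case=> cl cp ce.
have := @herm_conj _ K (fun x y => chi (cadj y ** x)) (gns_sl cl) (gns_sr cl) cp e x.
by rewrite /= adje mule emul => ->; rewrite conjCK.
Qed.

Lemma state_cs chi x y : state chi -> chi (cadj x ** x) = 0 -> chi (cadj y ** x) = 0.
Proof.
case=> cl cp _ h.
have := @cauchy_schwarz _ (gns_pre cl cp) x y; rewrite /= {1}/q /q2 /= h /= sqrtr0 mul0r => l.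
by apply/nc_eq0/eqP; rewrite eq_le nc_ge0 andbT.
Qed.

Lemma state_ex : exists chi, state chi.
Proof.
have [H [rho [xi [r n1 le]]]] := gelfand_naimark e.
pose v := rho e xi; have v0 : 0 < nr v by apply: lt_le_trans le; rewrite nre.
have rv : rho e v = v by case: r => _ _ rM _; rewrite /v -rM mule.
exists (fun x => (nr v ^- 2)%:C * ip (rho x v) v).
split.
- move=> k a b; rewrite (repDl r) (repZl r) ipD ipZ mulrDr mulrCA //.
- move=> x; apply: mulr_ge0; first by rewrite lecR invr_ge0 exprn_ge0 // ltW.
  by case: r => _ _ rM ra; rewrite rM ra cadjK hilb_ge0.
by rewrite rv ip_nr -rmorphM /= mulVf // expf_neq0 // gt_eqF.
Qed.

End States.

Section Haar.
Variables (R : realType) (K : cstar R) (e : K) (T : min_tensor K K) (D : K -> T).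
Hypotheses (eU : is_unit e) (e0 : e != 0).

(** [Lc chi] is (id ⊗ chi) D and [Rc chi] is (chi ⊗ id) D: the convolution operators, dual to
    convolution of functionals. *)
Definition Lc chi x := slice chi (D x).
Definition Rc chi x := slice2 chi (D x).

(* The comultiplication of a compact quantum group, with coassociativity in
   the form: left and right convolutions commute. *)
Definition comult :=
  [/\ linear D, (forall a b, D (a ** b) = D a ** D b),
      (forall a, D (cadj a) = cadj (D a)), D e = tens e e &
      forall chi om x, vecf chi -> vecf om -> Lc chi (Rc om x) = Rc om (Lc chi x)].
Hypothesis hD : comult.

Let Dl : linear D. Proof. by case: hD. Qed.
Let DM a b : D (a ** b) = D a ** D b. Proof. by case: hD. Qed.
Let Da a : D (cadj a) = cadj (D a). Proof. by case: hD. Qed.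
Let De : D e = tens e e. Proof. by case: hD. Qed.
Let Dcomm chi om x : vecf chi -> vecf om -> Lc chi (Rc om x) = Rc om (Lc chi x).
Proof. by case: hD => _ _ _ _; exact. Qed.

Lemma Rc_lin chi : vecf chi -> linear (Rc chi).
Proof. by move=> vc k a b; rewrite /Rc Dl slice2_lin. Qed.
Lemma Rc_e chi : vecf chi -> Rc chi e = chi e *: e.
Proof. by move=> vc; rewrite /Rc De slice2_tens. Qed.
Lemma LR psi chi x : vecf psi -> vecf chi -> psi (Lc chi x) = chi (Rc psi x).
Proof. by move=> vp vc; exact: slice_slice2. Qed.

Lemma state_Rc psi chi : state e psi -> state e chi -> state e (fun x => psi (Rc chi x)).
Proof.
move=> sp sc; have vp := state_vecf eU sp; have vc := state_vecf eU sc; split.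
- by move=> k a b; rewrite Rc_lin // (vecf_lin vp).
- move=> x; rewrite -LR // /Lc DM Da.
  by apply: (@prodf_pos _ _ _ T (fun t => chi (slice psi t))); exists chi, psi; split=> //; exact: (state_pvec eU).
by rewrite Rc_e // vecfZ //; case: sp => _ _ ->; case: sc => _ _ ->; rewrite mulr1.
Qed.

(** The values at x are bounded by |x|, so pointwise limits along U exist and are states again:
    weak-star compactness of the state space. *)
Lemma ulim_state (I : Type) (U : set_system I) (hU : UltraFilter U) (f : I -> K -> R[i]) :
  (forall i, state e (f i)) -> exists h, state e h /\ forall x, uconv U (fun i => f i x) (h x).
Proof.
move=> sf; have /choice[h hh] : forall x, exists l, uconv U (fun i => f i x) l.
  by move=> x; apply: (uconv_ex hU (M := nr x)) => i; exact: (state_le eU).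
exists h; split=> //; split.
- move=> k a b; apply: (uconv_uniq hU (hh _)).
  apply: (@uconv_eq _ _ _ hU (fun i => k * f i a + f i b)); last exact: uconvD (uconvZ hU k (hh a)) (hh b).
  by apply: U_mono (@filterT _ U (@ultra_proper _ _ hU)) => i _ /=; case: (sf i) => -> _ _.
- by move=> x; apply: (uconv_ge0 hU _ (hh _)) => i; case: (sf i).
apply: (uconv_uniq hU (hh e)); apply: (@uconv_eq _ _ _ hU (fun=> 1)); last exact: uconv_cst.
by apply: U_mono (@filterT _ U (@ultra_proper _ _ hU)) => i _ /=; case: (sf i).
Qed.

(** h is a limit of Cesaro means of the convolution powers of om, along an ultrafilter on nat
    containing the tails. Convolving a mean with om changes its value at x by at most 2 |x| / (n +
    1). *)
Lemma cesaro om : state e om -> exists h, [/\ state e h,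
  (forall x, h (Rc om x) = h x) & (forall x, h (Lc om x) = h x)].
Proof.
move=> so; have vo := state_vecf eU so.
(* f n is the (n + 1)-fold convolution power of om; as left and right convolutions commute, a factor
   om can be split off on either side. *)
pose f := fix f n := if n is k.+1 then (fun x => f k (Rc om x)) else om.
have sf n : state e (f n) by elim: n => //= n IH; exact: state_Rc.
have fL n x : f n (Lc om x) = f n.+1 x.
  by elim: n x => [|n IH] x /=; [rewrite LR|rewrite -Dcomm // IH].
pose c (N : nat) x := (N.+1%:R^-1)%:C * \sum_(n < N.+1) f n x.
have sc N : state e (c N).
  split.
  - move=> k a b; rewrite /c.
    under eq_bigr do rewrite (vecf_lin (state_vecf eU (sf _))).
    rewrite big_split mulrDr -mulr_sumr /= mulrCA //.
  - move=> x; apply: mulr_ge0; first by rewrite lecR invr_ge0.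
    by apply: sumr_ge0 => n _; case: (sf n).
  rewrite /c (eq_bigr (fun=> 1)); last by move=> n _; case: (sf n).
  rewrite sumr_const card_ord (_ : N.+1%:R = (N.+1%:R)%:C :> R[i]) ?rmorph_nat //.
  by rewrite -(rmorph_nat (real_complex R)) -rmorphM /= mulVf.
have [U [hU Uoo]] := ultraFilterLemma (@eventually_filter).
have [h [sh hh]] := ulim_state hU sc.
have key g : (forall n x, f n (g x) = f n.+1 x) -> forall x, h (g x) = h x.
  move=> fg x; apply/eqP; rewrite -subr_eq0; apply/eqP; apply: nc_small => d d0.
  have d3 : 0 < d / 3 by rewrite divr_gt0.
  have x1 : 0 < 2 * nr x + 1 by rewrite ltr_wpDl // mulr_ge0 ?nr_ge0.
  have [N hN] := inv_small (divr_gt0 d3 x1).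
  have UN : U [set n | (N <= n)%N] by apply: Uoo; exists N.
  have [n [[/= h1 h2] h3]] := U_ex hU (filterI (filterI (hh (g x) _ d3) (hh x _ d3)) UN).
  have e1 : nc (c n (g x) - c n x) <= d / 3.
    rewrite /c -mulrBr ncM nc_real ger0_norm ?invr_ge0 //.
    rewrite (eq_bigr (fun i : 'I_n.+1 => f i.+1 x)) // -sumrB.
    rewrite (eq_bigr (fun i : 'I_n.+1 => f i.+1 x - f i x)) //.
    rewrite -(big_mkord predT (fun i => f i.+1 x - f i x)) telescope_sumr //.
    have : nc (f n.+1 x - f 0%N x) <= 2 * nr x + 1.
      apply: le_trans (ncD _ _) _; rewrite ncN.
      have := state_le eU x (sf n.+1); have := state_le eU x (sf 0%N); lra.
    move=> le; apply: le_trans (ler_wpM2l _ le) _; first by rewrite invr_ge0.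
    by rewrite -ler_pdivlMr // ltW // hN.
  apply: le_trans (nc_tri (c n (g x)) _ _) _; apply: le_trans (lerD (lexx _) (nc_tri (c n x) _ _)) _.
  rewrite ncC; lra.
exists h; split=> //; apply: key => n x //=; exact: fL.
Qed.

Hypothesis dl : dense_by (fun p : K * K => D p.1 ** tens p.2 e).

Let tl b t : tens b e ** t = mL (leg1 (incl b)) t :> T.
Proof.
rewrite -mL_incl -leg_tens (_ : incl e = 1) ?leg2_1 ?mulr1 //.
by apply: mult_eqL => v; rewrite mL_incl mule.
Qed.

Lemma slice_tl chi b t : vecf chi -> slice chi (tens b e ** t : T) = b ** slice chi t.
Proof. by move=> vc; rewrite tl slice_leg1. Qed.

Lemma slice_tr chi b t : pvec chi -> slice chi (t ** tens b e : T) = slice chi t ** b.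
Proof.
move=> pc; apply: cadj_inj; rewrite -slice_adj // cadjM -tens_adj (adje eU).
by rewrite slice_tl ?slice_adj ?cadjM //; exact: pvec_vecf.
Qed.

Lemma Lc_adj chi x : pvec chi -> Lc chi (cadj x) = cadj (Lc chi x).
Proof. by move=> pc; rewrite /Lc Da slice_adj. Qed.

(* Testing against psi reduces L_om L_h = L_{om * h} to coassociativity *)
Lemma Lc_comp om h h' x : vecf om -> vecf h -> vecf h' -> (forall y, h' y = h (Rc om y)) ->
  Lc om (Lc h x) = Lc h' x.
Proof.
move=> vo vh vh' e1; apply/eqP; rewrite -subr_eq0; apply/eqP; apply: pos_sep => psi pp.
have vp := pvec_vecf pp.
by rewrite vecfB // LR // -Dcomm // LR // LR // e1 subrr.
Qed.

Lemma dense_adj : dense_by (fun p : K * K => tens p.2 e ** D p.1 : T).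
Proof.
move=> v d d0; have [l hl] := dl (cadj v) d0.
exists [seq ((p.1^*)%R, (cadj p.2.1, cadj p.2.2)) | p <- l].
rewrite -nr_adj cadjB; congr (nr (_ - _) < d): hl.
rewrite /comb cadj_sum big_map; apply: eq_bigr => p _ /=.
by rewrite cadjZ conjCK cadjM Da cadjK -tens_adj cadjK (adje eU).
Qed.

(* Van Daele: an h with om * h = h = h * om is invariant under every rho <= om *)
Lemma van_daele om h rho (c : R) : state e om -> state e h -> state e rho ->
  (forall x, h (Rc om x) = h x) -> (forall x, h (Lc om x) = h x) ->
  (forall x, rho (cadj x ** x) <= c%:C * om (cadj x ** x)) ->
  forall x, h (Rc rho x) = h x.
Proof.
move=> so sh sr hR hL dom.
have [vo vh vr] := And3 (state_vecf eU so) (state_vecf eU sh) (state_vecf eU sr).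
have [po ph pr] := And3 (state_pvec eU so) (state_pvec eU sh) (state_pvec eU sr).
pose h' x := h (Rc rho x).
have sh' : state e h' by exact: state_Rc.
have vh' := state_vecf eU sh'.
have main a b' : h (slice h' (tens b' e ** D a : T)) = h (slice h (tens b' e ** D a : T)).
  set b := Lc h a.
  have Lb : Lc om b = b by apply: Lc_comp => // y; rewrite hR.
  have Lrb : Lc rho b = Lc h' a by exact: Lc_comp.
  (* (h ⊗ om)(X^* X) = 0 by the two invariances, hence (h ⊗ rho)(X^* X) = 0 by domination.
     Cauchy-Schwarz then shows that h ⊗ rho vanishes on (b' ⊗ e) X, which is the claim. *)
  set X := D b - tens b e.
  have X0 : om (slice2 h (cadj X ** X)) = 0.
    rewrite -slice_slice2 // /X cadjB cmulBl !cmulBr -Da -DM -!tens_adj (adje eU).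
    rewrite -!tensM (mule eU).
    have sB (t t' : T) : slice om (t - t') = slice om t - slice om t' :> K.
      by rewrite -scaleN1r sliceD // sliceZ // scaleN1r.
    have L1 : slice om (D (cadj b)) = cadj b by rewrite -/(Lc om (cadj b)) Lc_adj // Lb.
    rewrite !sB slice_tr // slice_tl // slice_tens // L1 -/(Lc om (cadj b ** b)) -/(Lc om b) Lb.
    case: (so) => _ _ ->; rewrite scale1r !vecfB // hL; ring.
  have posX : 0 <= rho (slice2 h (cadj X ** X)).
    rewrite -slice_slice2 //.
    by apply: (@prodf_pos _ _ _ T (fun t => h (slice rho t))); exists h, rho.
  have leX : rho (slice2 h (cadj X ** X)) <= c%:C * om (slice2 h (cadj X ** X)).
    rewrite -subr_ge0.
    pose chi y := c%:C * om y - rho y.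
    have pchi : pvec chi.
      apply: (pos_pvec eU); first by move=> k x y; rewrite /chi !(vecfD _ _ vo) !(vecfD _ _ vr) !(vecfZ _ _ vo) !(vecfZ _ _ vr) /GRing.scale /=; ring.
      by move=> x; rewrite /chi subr_ge0.
    rewrite -/(chi _) -slice_slice2 //; last exact: pvec_vecf.
    by apply: (@prodf_pos _ _ _ T (fun t => h (slice chi t))); exists h, chi.
  have rX0 : rho (slice2 h (cadj X ** X)) = 0.
    by apply/eqP; rewrite eq_le posX andbT; move: leX; rewrite X0 mulr0.
  pose Ph (t : T) := h (slice rho t).
  have Pprod : prodf (T := T) Ph by exists h, rho.
  have [Pl _] := prodf_lin Pprod.
  have Pc Y : Ph (cadj Y ** X) = 0.
    have := @cauchy_schwarz _ (gns_pre Pl (fun t => prodf_pos t Pprod)) X Y.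
    rewrite /= {1}/q /q2 /= {2}/Ph slice_slice2 // rX0 /= sqrtr0 mul0r => l.
    by apply/nc_eq0/eqP; rewrite eq_le nc_ge0 andbT.
  have := Pc (tens (cadj b') e); rewrite -tens_adj cadjK (adje eU) /X /Ph slice_tl //.
  rewrite -scaleN1r sliceD // sliceZ // slice_tens // scaleN1r cmulBr vecfB // -/(Lc rho b) Lrb.
  case: (sr) => _ _ ->; rewrite scale1r => /eqP; rewrite subr_eq0 => /eqP.
  by rewrite !slice_tl.
have [l1 [c1 b1]] := vecf_lin_bnd vh (@slice_lin _ _ _ T _ vh') (slice_bnd T vh').
have [l2 [c2 b2]] := vecf_lin_bnd vh (@slice_lin _ _ _ T _ vh) (slice_bnd T vh).
(* The elements (b' ⊗ e) D a are dense, so h ⊗ h' and h ⊗ h agree at e ⊗ x as well. *)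
move=> x; have := @dense_eqC _ T _ _ _ _ _ _ dense_adj l1 l2 b1 b2 (fun p => main p.1 p.2) (tens e x).
rewrite !slice_tens // !vecfZ //; case: (sh) => _ _ ->; rewrite !mulr1.
exact.
Qed.

(** For a finite list S of states, the mean of S and om0 dominates each member up to the factor |S|
    + 1, so a state invariant under the mean is invariant under S by [van_daele]. A limit along an
    ultrafilter refining the directed system of lists is invariant under every state and, after
    scaling, under every positive functional. *)
Lemma haar : exists h, state e h /\ forall x, Lc h x = h x *: e.
Proof.
have [om0 so0] := state_ex eU e0.
pose St := {chi | state e chi}.
pose st (r : St) := sval r.
have sst (r : St) : state e (st r) by exact: (svalP r).
(* om0 makes the mean a state also when S is empty. *)
pose av (S : seq St) x := ((size S).+1%:R^-1)%:C * (om0 x + \sum_(r <- S) st r x).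
have sav S : state e (av S).
  split.
  - move=> k a b; rewrite /av (vecf_lin (state_vecf eU so0)).
    rewrite (eq_bigr (fun r : St => k * st r a + st r b)); last first.
      by move=> r _; rewrite (vecf_lin (state_vecf eU (sst r))).
    rewrite big_split -mulr_sumr /= /GRing.scale /=; ring.
  - move=> x; apply: mulr_ge0; first by rewrite lecR invr_ge0.
    apply: addr_ge0; first by case: so0.
    by apply: sumr_ge0 => r _; case: (sst r).
  rewrite /av (eq_bigr (fun=> 1)); last by move=> r _; case: (sst r).
  case: (so0) => _ _ ->.
  rewrite big_const_seq count_predT iter_addr_0 -mulrS.
  by rewrite -(rmorph_nat (real_complex R)) -rmorphM /= mulVf.
have /choice[hS hhS] : forall S, exists h, [/\ state e h,
    (forall x, h (Rc (av S) x) = h x) & (forall x, h (Lc (av S) x) = h x)].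
  by move=> S; exact: cesaro.
have inv S (r : St) : List.In r S -> forall x, hS S (Rc (st r) x) = hS S x.
  move=> rS; have [sh hR hL] := hhS S.
  apply: (van_daele (om := av S) (c := (size S).+1%:R)) => // x.
  rewrite /av mulrA -rmorphM /= mulfV // mul1r.
  have p0 : 0 <= om0 (cadj x ** x) by case: so0.
  have pr (r' : St) : 0 <= st r' (cadj x ** x) by case: (sst r').
  apply: le_trans (_ : \sum_(r' <- S) st r' (cadj x ** x) <= _); last by rewrite lerDr.
  elim: (S) rS => //= r' S' IH [->|/IH h]; rewrite big_cons.
    by rewrite lerDl sumr_ge0.
  by apply: le_trans h _; rewrite lerDr.
(* The filter of sections of the lists, ordered by inclusion of their members. *)
pose F : set_system (seq St) := [set A | exists S0, forall S, (forall r, List.In r S0 -> List.In r S) -> A S].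
have PF : ProperFilter F.
  split; first by move=> [S0 h]; exact: (h S0).
  split; first by exists [::].
  - move=> A B [S0 hA] [S1 hB]; exists (S0 ++ S1) => S h; split.
      by apply: hA => r rS; apply/h/List.in_or_app; left.
    by apply: hB => r rS; apply/h/List.in_or_app; right.
  by move=> A B AB [S0 hA]; exists S0 => S /hA/AB.
have [U [hU FU]] := ultraFilterLemma PF.
have [h [sh hh]] := ulim_state hU (fun S => let: And3 s _ _ := hhS S in s).
have hinv r x : state e r -> h (Rc r x) = h x.
  move=> sr; pose r' : St := exist _ r sr.
  apply: (uconv_uniq hU (hh _)); apply: uconv_eq (hh x) => //.
  by apply: FU; exists [:: r'] => S hS'; rewrite /= -(inv _ r') //; apply: hS'; left.
have vh := state_vecf eU sh.
exists h; split=> // x; apply/eqP; rewrite -subr_eq0; apply/eqP; apply: pos_sep => psi pp.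
have vp := pvec_vecf pp; rewrite vecfB // vecfZ // LR //.
have pe0 : 0 <= psi e by have := pvec_pos e pp; rewrite (adje eU) (mule eU).
(* If psi e = 0 then psi vanishes by Cauchy-Schwarz; otherwise psi / psi e is a state. *)
have [pe|pe] := eqVneq (psi e) 0.
  have z y : psi y = 0.
    have := @cauchy_schwarz _ (gns_pre (vecf_lin vp) (fun x => pvec_pos x pp)) y e.
    rewrite /= {2}/q /q2 /= (adje eU) !(mule eU) pe /= sqrtr0 mulr0 => l.
    by apply/nc_eq0/eqP; rewrite eq_le nc_ge0 andbT.
  have vz : Rc psi x = 0.
    apply: pos_sep => chi pc; rewrite -LR //; exact: pvec_vecf.
  by rewrite vz (vecf0 vh) pe mulr0 subr0.
pose r y := (psi e)^-1 * psi y.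
have sr : state e r.
  split.
  - by move=> k a b; rewrite /r (vecf_lin vp) /GRing.scale /=; ring.
  - by move=> y; rewrite mulr_ge0 ?invr_ge0 //; exact: pvec_pos.
  by rewrite /r mulVf.
have vr := state_vecf eU sr.
have -> : Rc psi x = psi e *: Rc r x.
  apply/eqP; rewrite -subr_eq0; apply/eqP; apply: pos_sep => chi pc.
  have vc := pvec_vecf pc; rewrite vecfB // vecfZ // -!LR // /r mulrA mulfV // mul1r subrr //.
by rewrite vecfZ // hinv // mulrC subrr.
Qed.

End Haar.

Lemma nc_sum (R : realType) (I : Type) (s : seq I) (P : pred I) (f : I -> R[i]) :
  nc (\sum_(i <- s | P i) f i) <= \sum_(i <- s | P i) nc (f i).
Proof.
apply: (big_ind2 (fun x y => nc x <= y)) => //; first by rewrite nc0.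
by move=> x y x' y' h h'; apply: le_trans (ncD _ _) (lerD h h').
Qed.

Lemma le0_near (R : realType) (x C : R) :
  (forall e, 0 < e -> e <= 1 -> x <= C * e) -> x <= 0.
Proof.
move=> h; rewrite leNgt; apply/negP => x0.
have D0 : 0 < 2 * `|C| + x by rewrite ltr_wpDl ?mulr_ge0.
have := h (x / (2 * `|C| + x)) (divr_gt0 x0 D0).
rewrite ler_pdivrMr // mul1r lerDr mulr_ge0 // => /(_ isT).
rewrite mulrA ler_pdivlMr //; have := ler_norm C; nra.
Qed.

(** * Null vectors of coefficient spaces *)

Section NullCorep.
Variables (R : realType) (K : cstar R) (e : K) (T : min_tensor K K) (D : K -> T).
Hypotheses (eU : is_unit e) (e0 : e != 0) (hD : comult e D).
Variable h : K -> R[i].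
Hypotheses (sh : state e h) (hR : forall x, Rc D h x = h x *: e).

Let Dl : linear D. Proof. by case: hD. Qed.
Let DM a b : D (a ** b) = D a ** D b. Proof. by case: hD. Qed.
Let Da a : D (cadj a) = cadj (D a). Proof. by case: hD. Qed.
Let De : D e = tens e e. Proof. by case: hD. Qed.
Let Dcomm chi om x : vecf chi -> vecf om -> Lc D chi (Rc D om x) = Rc D om (Lc D chi x).
Proof. by case: hD => _ _ _ _; exact. Qed.
Let vh : vecf h := state_vecf eU sh.
Let ph : pvec h := state_pvec eU sh.
Let he : h e = 1. Proof. by case: sh. Qed.

Definition Ph (t : T) := h (slice h t).
Let PhP : prodf Ph. Proof. by exists h, h. Qed.
Let Phl : linear (Ph : T -> R[i]^o). Proof. by case: (prodf_lin PhP). Qed.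

Lemma unit_tens : is_unit (tens e e : T).
Proof.
have i1 : incl e = 1 by apply: mult_eqL => v; rewrite mL_incl (mule eU).
have E : incl (tens e e) = 1 :> multiplier T by rewrite -leg_tens i1 leg1_1 leg2_1 mul1r.
move=> t; split; first by rewrite -mL_incl E.
by apply: incl_inj; rewrite inclM E mulr1.
Qed.

Lemma Ph_state : state (tens e e) Ph.
Proof.
split; [exact: Phl|by move=> x; exact: prodf_pos|].
by rewrite /Ph slice_tens // he scale1r he.
Qed.

Let P1 := gns_pre (let: And3 l _ _ := sh in l) (let: And3 _ p _ := sh in p).
Let P2 := gns_pre Phl (fun t => prodf_pos t PhP).
(** The length in L^2(h), and for [l2T] in L^2(h ⊗ h); these are only seminorms, since h may have
    null vectors. *)
Definition l2 (x : K) : R := @q _ P1 x.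
Definition l2T (t : T) : R := @q _ P2 t.

Lemma l2_cs x y : nc (h (cadj y ** x)) <= l2 x * l2 y.
Proof. exact: (@cauchy_schwarz _ P1). Qed.
Lemma l2T_cs x y : nc (Ph (cadj y ** x)) <= l2T x * l2T y.
Proof. exact: (@cauchy_schwarz _ P2). Qed.
Lemma l2_ge0 x : 0 <= l2 x. Proof. exact: q_ge0. Qed.
Lemma l2T_ge0 x : 0 <= l2T x. Proof. exact: q_ge0. Qed.
Lemma l2_sqr x : h (cadj x ** x) = (l2 x ^+ 2)%:C.
Proof. by rewrite q_sqr -q2E. Qed.
Lemma l2T_sqr x : Ph (cadj x ** x) = (l2T x ^+ 2)%:C.
Proof. by rewrite q_sqr -q2E. Qed.

Lemma l2_le x : l2 x <= nr x.
Proof.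
rewrite -(@ler_pXn2r _ 2) ?nnegrE ?l2_ge0 ?nr_ge0 // -nr_cs -lecR -l2_sqr.
have := state_le eU (cadj x ** x) sh; rewrite l2_sqr nc_real ger0_norm ?sqr_ge0 //.
by rewrite lecR.
Qed.
Lemma l2T_le x : l2T x <= nr x.
Proof.
rewrite -(@ler_pXn2r _ 2) ?nnegrE ?l2T_ge0 ?nr_ge0 // -nr_cs -lecR -l2T_sqr.
have := state_le unit_tens (cadj x ** x) Ph_state; rewrite l2T_sqr nc_real ger0_norm ?sqr_ge0 //.
by rewrite lecR.
Qed.

Definition hl (b z : K) := h (cadj b ** z).
Lemma hl_vecf b : vecf (hl b). Proof. exact: vecf_mull. Qed.
Lemma hl2_vecf b c : vecf (fun z => hl b (z ** c)). Proof. exact: vecf_mulr (hl_vecf b). Qed.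

Lemma PhA a b t : Ph (tens (cadj a) (cadj b) ** t) = h (cadj a ** slice (hl b) t).
Proof.
have [l1 [c1 b1]] := vecf_lin_bnd (hl_vecf a) (@slice_lin _ _ _ T _ (hl_vecf b)) (slice_bnd T (hl_vecf b)).
have [C [C0 PC]] : exists C, 0 <= C /\ forall t, nc (Ph t) <= C * nr t.
  by have [_ [C ? ?]] := prodf_lin PhP; exists C.
apply: (@dense_eqC _ T _ _ (fun t => Ph (tens (cadj a) (cadj b) ** t)) _
  (C * nr (tens (cadj a) (cadj b) : T)) c1 (@tens_dense_by _ _ _ T) _ l1 _ b1).
- by move=> k x y; rewrite cmulDr cmulZr Phl.
- by move=> v; apply: le_trans (PC _) _; rewrite -mulrA ler_wpM2l // nrM.
move=> [x y] /=; rewrite -tensM /Ph !slice_tens //; last exact: hl_vecf.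
by rewrite /hl cmulZr.
Qed.

Lemma PhB a b t : Ph (tens (cadj a) (cadj b) ** t) = h (cadj b ** slice2 (hl a) t).
Proof. by rewrite PhA; exact: (slice_slice2 (psi := hl a) (chi := hl b) t (hl_vecf a) (hl_vecf b)). Qed.

Let hle : hl e = h. Proof. by apply/funext => z; rewrite /hl (adje eU) (mule eU). Qed.

(** Invariance: slicing the first leg of D z by h leaves h z times e. It is what makes D isometric
    from L^2(h) to L^2(h ⊗ h), see [l2TD]. *)
Lemma PhD z c : Ph (tens e (cadj c) ** D z) = ((h c)^*)%R * h z.
Proof.
have := PhB e c (D z); rewrite (adje eU) => ->; rewrite hle.
have := hR z; rewrite /Rc => ->; rewrite cmulZr (emul eU) vecfZ // pvec_adj // mulrC //.
Qed.

Lemma Ph_adj t : Ph (cadj t) = ((Ph t)^*)%R.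
Proof. exact: (state_conj unit_tens t Ph_state). Qed.

Lemma PhD' z c : Ph (D z ** tens e c) = h z * h c.
Proof.
rewrite -[LHS]conjCK -Ph_adj cadjM -Da -tens_adj (adje eU) PhD pvec_adj // -cjM.
by rewrite conjCK mulrC.
Qed.

Lemma slice_te chi (c : K) (t : T) : vecf chi ->
  slice chi (t ** tens e c) = slice (fun z => chi (z ** c)) t.
Proof.
move=> vc; have v2 := vecf_mulr c vc.
have [d hd] := slice_bnd T vc; have [d2 hd2] := slice_bnd T v2.
apply: (slice_uniq (f := fun t => slice chi (t ** tens e c)) (c := `|d| * nr (tens e c : T)) (c' := d2)) => //.
- by move=> k a b; rewrite cmulDl cmulZl slice_lin.
- exact: slice_lin.
- move=> v; apply: le_trans (hd _) _; apply: le_trans (ler_wpM2r (nr_ge0 _) (ler_norm d)) _.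
  by rewrite -mulrA ler_wpM2l // mulrC nrM.
by move=> x y; rewrite -tensM !slice_tens // (emul eU).
Qed.

(* Elements \sum D(x)(1 (x) c) and their images \sum h(c) x under the
   adjoint of x |-> D(x) on L^2 *)
Definition dz (l : seq (R[i] * (K * K))) : T := comb (fun p : K * K => D p.1 ** tens e p.2) l.
Definition dr (l : seq (R[i] * (K * K))) : K := comb (fun p : K * K => h p.2 *: p.1) l.

Let hsum (I : Type) (r : seq I) (f : I -> K) : h (\sum_(i <- r) f i) = \sum_(i <- r) h (f i).
Proof. exact: vecf_sum. Qed.
Let PhD2 x y : Ph (x + y) = Ph x + Ph y.
Proof. by have := Phl 1 x y; rewrite !scale1r. Qed.
Let Ph0 : Ph 0 = 0. Proof. by apply: (addrI (Ph 0)); rewrite -PhD2 !addr0. Qed.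
Let PhZ k x : Ph (k *: x) = k * Ph x.
Proof. by have := Phl k x 0; rewrite Ph0 !addr0. Qed.
Let PhN x : Ph (- x) = - Ph x.
Proof. by rewrite -scaleN1r PhZ mulN1r. Qed.
Let Phsum (I : Type) (r : seq I) (f : I -> T) : Ph (\sum_(i <- r) f i) = \sum_(i <- r) Ph (f i).
Proof. exact: (big_morph Ph PhD2 Ph0). Qed.

Lemma dr_adj l x : h (cadj (dr l) ** x) = Ph (cadj (dz l) ** D x).
Proof.
rewrite /dr /dz /comb !cadj_sum !cmul_suml hsum Phsum; apply: eq_bigr => p _.
rewrite !cadjZ !cmulZl !(vecfZ _ _ vh) PhZ cadjM -tens_adj (adje eU).
by rewrite -cmulA -Da -DM PhD.
Qed.

Lemma dr_le l : l2 (dr l) <= nr (dz l).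
Proof.
have [->|n0] := eqVneq (l2 (dr l)) 0; first exact: nr_ge0.
have p0 : 0 < l2 (dr l) by rewrite lt_def n0 l2_ge0.
rewrite -(ler_pM2r p0) -expr2.
have lD : l2T (D (dr l)) = l2 (dr l).
  apply/eqP; rewrite -(@eqrXn2 _ 2) ?l2_ge0 ?l2T_ge0 //; apply/eqP/complexI.
  rewrite -l2T_sqr -l2_sqr -Da -DM -[D _](emul unit_tens) PhD' he mulr1 //.
have := l2T_cs (D (dr l)) (dz l); rewrite -dr_adj l2_sqr nc_real ger0_norm ?sqr_ge0 // lD.
move=> le; apply: le_trans le _; rewrite mulrC ler_wpM2r ?l2_ge0 //.
exact: l2T_le.
Qed.

Lemma l2TD x : l2T (D x) = l2 x.
Proof.
apply/eqP; rewrite -(@eqrXn2 _ 2) ?l2_ge0 ?l2T_ge0 //; apply/eqP/complexI.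
by rewrite -l2T_sqr -l2_sqr -Da -DM -[D _](emul unit_tens) PhD' he mulr1.
Qed.

Definition Rk k x := Rc D (hl k) x.

Lemma Rk_ip k y x : h (cadj y ** Rk k x) = Ph (cadj (tens k y) ** D x).
Proof. by rewrite -tens_adj PhB. Qed.

(** The adjoint of D on L^2 sends k ⊗ y to a vector of the completion. When [dz l] is near k ⊗ y,
    [dr l] is an element of K close to that vector, as seen by pairing with any x. *)
Lemma dr_near l k y x :
  nc (h (cadj (dr l) ** x) - h (cadj y ** Rk k x)) <= nr (tens k y - dz l : T) * l2 x.
Proof.
rewrite dr_adj Rk_ip -PhN -PhD2 -cmulNl -cmulDl -cadjB.
apply: le_trans (l2T_cs _ _) _; rewrite l2TD mulrC ler_wpM2r ?l2_ge0 //.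
by rewrite nrC; exact: l2T_le.
Qed.

Lemma Rk_comm k w l : Rk k (slice (hl w) (dz l)) =
  comb (fun p : K * K => slice (hl w) (D (Rk k p.1) ** tens e p.2)) l.
Proof.
have vw := hl_vecf w; rewrite /dz (linear_comb _ _ (slice_lin vw)).
rewrite /Rk (linear_comb _ _ (Rc_lin hD (hl_vecf k))); apply: eq_bigr => p _ /=.
by rewrite !slice_te // -Dcomm //; [exact: hl2_vecf|exact: hl_vecf].
Qed.

Lemma l2T_tens a b : l2T (tens a b) = l2 a * l2 b.
Proof.
apply/eqP; rewrite -(@eqrXn2 _ 2) ?mulr_ge0 ?l2_ge0 ?l2T_ge0 //; apply/eqP/complexI.
by rewrite -l2T_sqr -tens_adj -tensM /Ph slice_tens // vecfZ // !l2_sqr -rmorphM exprMn mulrC.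
Qed.

Hypotheses (dl : dense_by (fun p : K * K => D p.1 ** tens p.2 e))
  (dr' : dense_by (fun p : K * K => D p.1 ** tens e p.2)).

Section Core.
Variables (n : nat) (y : 'I_n -> K) (w : 'I_n -> 'I_n -> K).
Hypotheses (Dy : forall a t, Ph (cadj t ** D (y a)) = \sum_c Ph (cadj t ** tens (y c) (w c a)))
  (wy : forall c, \sum_a cadj (w c a) ** y a = 0).

(** By invariance each h(c) h(y_a^* Rk k x) equals the value of h ⊗ h at D(y_a^* Rk k x)(e ⊗ c).
    There the relation for D (y a) applies, and [Rk_comm] recombines the sum over l. *)
Lemma core_step2 k a l : h (cadj (y a) ** Rk k (dr l)) =
  \sum_c h (cadj (y c) ** Rk k (slice (hl (w c a)) (dz l))).
Proof.
pose f x := h (cadj (y a) ** x).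
have vf : vecf f by exact: hl_vecf.
have -> : h (cadj (y a) ** Rk k (dr l)) = \sum_(p <- l) p.1 * (h p.2.2 * f (Rk k p.2.1)).
  rewrite /Rk /dr (linear_comb _ _ (Rc_lin hD (hl_vecf k))) -/(f _) /comb (vecf_sum _ _ _ vf).
  apply: eq_bigr => p _ /=; rewrite vecfZ //; congr (_ * _).
  rewrite -vecfZ //; congr f.
  have R0 : Rc D (hl k) 0 = 0.
    by have := Rc_lin hD (hl_vecf k) (-1) 0 0; rewrite scaler0 addr0 scaleN1r addNr.
  by have := Rc_lin hD (hl_vecf k) (h p.2.2) p.2.1 0; rewrite !addr0 R0 addr0.
under [RHS]eq_bigr => c _.
  rewrite Rk_comm -/(hl (y c) _) /comb (vecf_sum _ _ _ (hl_vecf _)).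
  under eq_bigr do rewrite (vecfZ _ _ (hl_vecf _)).
  over.
rewrite exchange_big /=; apply: eq_bigr => p _; rewrite -mulr_sumr; congr (_ * _).
rewrite mulrC -PhD' DM Da -cmulA -[LHS]conjCK -Ph_adj cadjM cadjK Dy.
rewrite rmorph_sum; apply: eq_bigr => c _ /=.
by rewrite -Ph_adj cadjM cadjK -tens_adj PhA.
Qed.

(** Let eta_a be the image of k ⊗ y_a under the adjoint of D on L^2, approximated by [dr (l a)]. By
    [core_step2] the sum of the |eta_a|^2 is the sum over a and c of h(eta_c^* k) h(w_ca^* y_a),
    which is 0 by [wy]. With approximations of quality eps the error is at most C eps. *)
Lemma core_bound k : exists C, forall eps : R, 0 < eps -> eps <= 1 ->
  exists l : 'I_n -> seq (R[i] * (K * K)),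
    (forall a, nr (tens k (y a) - dz (l a) : T) <= eps) /\
    (forall a, l2 (dr (l a)) ^+ 2 <= C * eps).
Proof.
(* M bounds all [dz (l a)] once eps <= 1, and hence all [dr (l a)]; this keeps C independent of
   eps. *)
pose M := \sum_a (nr (tens k (y a) : T) + 1).
have M1 a : nr (tens k (y a) : T) + 1 <= M.
  by rewrite /M (bigD1 a) //= lerDl sumr_ge0 // => i _; rewrite addr_ge0 ?nr_ge0.
have hX (ca : 'I_n * 'I_n) : exists c : R, 0 <= c /\ forall t : T, nr (slice (hl (w ca.1 ca.2)) t) <= c * nr t.
  have [c hc] := slice_bnd T (hl_vecf (w ca.1 ca.2)); exists `|c|; split=> // t.
  by apply: le_trans (hc t) _; rewrite ler_wpM2r ?nr_ge0 // ler_norm.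
have [X hX'] := choice hX.
pose C := \sum_(a < n) (M + \sum_(c < n) (X (c, a) * M + M * l2 (w c a))).
exists C => eps e0' e1.
have hl a : exists l, nr (tens k (y a) - dz l : T) < eps.
  exact: dr' e0'.
have [l hl'] := choice hl; exists l; split=> [a|]; first exact: ltW.
have zM a : nr (dz (l a)) <= M.
  apply: le_trans (M1 a); rewrite (_ : dz (l a) = tens k (y a) - (tens k (y a) - dz (l a))); last by zm.
  by apply: le_trans (nrB _ _) _; rewrite lerD2l; apply: le_trans e1; exact: ltW.
have rM a : l2 (dr (l a)) <= M by apply: le_trans (dr_le _) _.
have M0 (a : 'I_n) : 0 <= M by move: (zM a); apply: le_trans; exact: nr_ge0.
suff S : \sum_a l2 (dr (l a)) ^+ 2 <= C * eps.
  move=> a; apply: le_trans S; rewrite (bigD1 a) //= lerDl sumr_ge0 // => i _.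
  exact: sqr_ge0.
pose Q (c a : 'I_n) := Ph (cadj (tens (dr (l c)) (w c a)) ** tens k (y a)).
have Q0 : \sum_a \sum_c Q c a = 0.
  rewrite exchange_big big1 // => c _.
  under eq_bigr => a _ do rewrite /Q -tens_adj -tensM /Ph slice_tens // vecfZ // mulrC.
  by rewrite -mulr_sumr -(vecf_sum _ _ _ vh) wy vecf0 // mulr0.
have near a : nc (h (cadj (dr (l a)) ** dr (l a)) - \sum_c Q c a) <=
   (M + \sum_c (X (c, a) * M + M * l2 (w c a))) * eps.
  set u := h (cadj (y a) ** Rk k (dr (l a))).
  rewrite (_ : _ - _ = (h (cadj (dr (l a)) ** dr (l a)) - u) + (u - \sum_c Q c a)); last by ring.
  apply: le_trans (ncD _ _) _; rewrite mulrDl lerD //.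
    apply: le_trans (dr_near _ _ _ _) _; rewrite mulrC; apply: ler_pM => //; [exact: l2_ge0|exact: nr_ge0|exact: ltW].
  rewrite /u core_step2 -sumrB mulr_suml; apply: le_trans (nc_sum _ _ _) _; apply: ler_sum => c _.
  set x := slice _ _; rewrite (_ : _ - _ = - (h (cadj (dr (l c)) ** x) - h (cadj (y c) ** Rk k x)) +
    (h (cadj (dr (l c)) ** x) - Q c a)); last by ring.
  apply: le_trans (ncD _ _) _; rewrite mulrDl lerD // ?ncN.
    apply: le_trans (dr_near _ _ _ _) _; rewrite mulrC; apply: ler_pM; rewrite ?l2_ge0 ?nr_ge0 //; last exact: ltW.
    apply: le_trans (l2_le _) _; apply: le_trans (proj2 (hX' (c, a)) _) _.
    by rewrite ler_wpM2l //; case: (hX' (c, a)).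
  rewrite /Q /x -PhA tens_adj -PhN -PhD2 -cmulNr -cmulDr.
  apply: le_trans (l2T_cs _ _) _; rewrite mulrC l2T_tens.
  apply: ler_pM; rewrite ?mulr_ge0 ?l2_ge0 ?l2T_ge0 //.
    by rewrite ler_wpM2r ?l2_ge0.
  by apply: le_trans (l2T_le _) _; rewrite -nrN opprB ltW.
have E : \sum_a h (cadj (dr (l a)) ** dr (l a)) = (\sum_a l2 (dr (l a)) ^+ 2)%:C.
  by rewrite rmorph_sum; apply: eq_bigr => a _; rewrite l2_sqr.
have := nc_real (\sum_a l2 (dr (l a)) ^+ 2); rewrite -E ger0_norm; last first.
  by apply: sumr_ge0 => a _; exact: sqr_ge0.
have -> : \sum_a h (cadj (dr (l a)) ** dr (l a)) =
    \sum_a (h (cadj (dr (l a)) ** dr (l a)) - \sum_c Q c a) by rewrite sumrB Q0 subr0.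
move=> <-; rewrite /C mulr_suml.
by apply: le_trans (nc_sum _ _ _) _; apply: ler_sum => a _; exact: near.
Qed.

(** By [core_bound] the adjoint of D annihilates k ⊗ y_a, so every D x is orthogonal to it. As the
    elements (k^* ⊗ e) D x are dense, e ⊗ y_a is orthogonal to everything, itself included. *)
Lemma core_null a : h (cadj (y a) ** y a) = 0.
Proof.
have Z k x : h (cadj (y a) ** Rk k x) = 0.
  have [C hC] := core_bound k; apply: nc_eq0; set N := nc _; have N0 : 0 <= N by exact: nc_ge0.
  apply/eqP; rewrite -sqrf_eq0; apply/eqP/le_anti; rewrite sqr_ge0 andbT.
  (* The constant comes from (r + eps)^2 <= 2 r^2 + 2 eps^2 with r^2 <= C eps and eps <= 1. *)
  apply: (@le0_near _ _ (2 * (C + 1) * l2 x ^+ 2)) => eps e0' e1.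
  have [l [h1 h2]] := hC _ e0' e1.
  have NL : N <= (l2 (dr (l a)) + eps) * l2 x.
    rewrite /N (_ : h _ = h (cadj (dr (l a)) ** x) - (h (cadj (dr (l a)) ** x) - h (cadj (y a) ** Rk k x))); last by ring.
    apply: le_trans (ncD _ _) _; rewrite ncN mulrDl lerD //; first by rewrite mulrC l2_cs.
    by apply: le_trans (dr_near _ _ _ _) _; rewrite ler_wpM2r ?l2_ge0.
  have := l2_ge0 x; have := l2_ge0 (dr (l a)); have := h2 a; move: NL.
  move: (l2 (dr (l a))) (l2 x) => r L NL hr r0 L0.
  apply: (@le_trans _ _ (((r + eps) * L) ^+ 2)).
    by rewrite ler_pXn2r ?nnegrE // mulr_ge0 ?addr_ge0 // ltW.
  rewrite exprMn [leRHS]mulrAC; apply: ler_wpM2r; first exact: sqr_ge0.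
  have : eps ^+ 2 <= eps by rewrite expr2 -[leRHS]mulr1 ler_wpM2l // ltW.
  by have := sqr_ge0 (r - eps); move: hr; nra.
have PZ : forall t, Ph (tens e (cadj (y a)) ** t) = 0.
  have [C [C0 PC]] : exists C, 0 <= C /\ forall t, nc (Ph t) <= C * nr t.
    by have [_ [C ? ?]] := prodf_lin PhP; exists C.
  move=> t.
  apply: (@dense_eqC _ T _ _ (fun t => Ph (tens e (cadj (y a)) ** t)) (fun=> 0)
    (C * nr (tens e (cadj (y a)) : T)) 0 (dense_adj eU hD dl)).
  - by move=> k u v; rewrite cmulDr cmulZr Phl.
  - by move=> k u v; rewrite scaler0 addr0.
  - by move=> v; apply: le_trans (PC _) _; rewrite -mulrA ler_wpM2l // nrM.
  - by move=> v; rewrite nc0 mul0r.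
  move=> [x k] /=; rewrite cmulA -tensM (emul eU) (mule eU) -[k]cadjK tens_adj -Rk_ip.
  exact: Z.
have := PZ (tens e (y a)); rewrite -tensM (mule eU) /Ph slice_tens // vecfZ // he mulr1.
by [].
Qed.
End Core.

Section Corep.
Variables (n : nat) (v : 'I_n -> 'I_n -> K) (xi : 'I_n -> R[i]).
Hypotheses (Dv : forall i j, D (v i j) = \sum_k tens (v i k) (v k j))
  (vv : forall c j, \sum_a cadj (v c a) ** v j a = if c == j then e else 0)
  (xi1 : \sum_j ((xi j)^*)%R * xi j = 1)
  (null : forall i, let x := \sum_l xi l *: v i l in h (cadj x ** x) = 0).

(* With y_a = \sum_j conj(xi_j) v_ja, the last hypothesis gives
   D y_a = \sum_c y_c (x) (v_ca - xi_c y_a) up to a null vector, while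
   \sum_a (v_ca - xi_c y_a)^* y_a = 0; hence h(y_a^* y_a) = 0, contradicting
   \sum_a y_a^* y_a = 1. *)
Lemma corep_null : False.
Proof.
pose y a := \sum_j ((xi j)^*)%R *: v j a.
have vy c : \sum_a cadj (v c a) ** y a = ((xi c)^*)%R *: e.
  under eq_bigr => a _ do rewrite cmul_sumr.
  rewrite exchange_big (bigD1 c) //= [X in _ + X]big1 ?addr0 => [|j jc].
    by under eq_bigr => a _ do rewrite cmulZr; rewrite -scaler_sumr vv eqxx.
  under eq_bigr => a _ do rewrite cmulZr.
  by rewrite -scaler_sumr vv eq_sym (negbTE jc) scaler0.
have yy : \sum_a cadj (y a) ** y a = e.
  under eq_bigr => a _ do rewrite {1}/y cadj_sum cmul_suml.
  rewrite exchange_big /=.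
  under eq_bigr => j _.
    under eq_bigr => a _ do rewrite cadjZ conjCK cmulZl.
    rewrite -scaler_sumr vy scalerA mulrC; over.
  by rewrite -scaler_suml xi1 scale1r.
(* N is a combination of the null vectors of [null], and D (y a) differs from the sum of the y_c ⊗
   (v_ca - xi_c y_a) by N ⊗ y_a. *)
pose N := \sum_c xi c *: y c.
have NE : N = \sum_j ((xi j)^*)%R *: \sum_l xi l *: v j l.
  rewrite /N /y; under eq_bigr do rewrite scaler_sumr.
  rewrite exchange_big; apply: eq_bigr => j _; rewrite scaler_sumr.
  by apply: eq_bigr => c _; rewrite !scalerA mulrC.
have N0 : h (cadj N ** N) = 0.
  rewrite {2}NE cmul_sumr vecf_sum // big1 // => j _.
  by rewrite cmulZr vecfZ // (state_cs _ sh (null j)) mulr0.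
have lN : l2 N = 0.
  by apply/eqP; rewrite -sqrf_eq0 -(inj_eq (@complexI R)) -l2_sqr N0.
have := @core_null n y (fun c a => v c a - xi c *: y a).
move=> H; suff hy a : h (cadj (y a) ** y a) = 0.
  have := he; rewrite -yy vecf_sum // big1 // => /eqP.
  by rewrite eq_sym oner_eq0.
apply: H => [{}a t|c].
  have -> : D (y a) = \sum_c tens (y c) (v c a - xi c *: y a) + tens N (y a).
    have lD : \sum_c tens (y c) (v c a) = D (y a) :> T.
      rewrite {2}/y (_ : D _ = comb (fun j => D (v j a)) [seq (((xi j)^*)%R, j) | j <- index_enum _]).
        rewrite /comb big_map /=; under [RHS]eq_bigr => j _ do rewrite Dv scaler_sumr.
        rewrite exchange_big; apply: eq_bigr => c _; rewrite tens_suml; apply: eq_bigr => j _.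
        by rewrite tensZl.
      by rewrite -linear_comb // /comb big_map.
    rewrite -lD /N tens_suml -big_split; apply: eq_bigr => c _ /=.
    by rewrite tensZl -tensZr -tensDr subrK.
  rewrite cmulDr PhD2 cmul_sumr Phsum.
  suff -> : Ph (cadj t ** tens N (y a)) = 0 by rewrite addr0.
  apply: nc_eq0; apply: le_anti; rewrite nc_ge0 andbT; apply: le_trans (l2T_cs _ _) _.
  by rewrite l2T_tens lN !mul0r.
under eq_bigr do rewrite cadjB cmulDl cmulNl cadjZ cmulZl.
by rewrite sumrB vy -scaler_sumr yy subrr.
Qed.
End Corep.

End NullCorep.

(** * Bounded linear maps *)

Section Blin.
Variable R : realType.
Implicit Types V W Z : completeNormedModType R[i].

Lemma linZ (V W : lmodType R[i]) (f : V -> W) k x : linear f -> f (k *: x) = k *: f x.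
Proof.
move=> l; have f0 : f 0 = 0.
  by have := l (-1) 0 0; rewrite scaler0 addr0 scaleN1r addNr.
by have := l k x 0; rewrite f0 !addr0.
Qed.

Definition blin V W (f : V -> W) :=
  linear f /\ exists c : R, 0 <= c /\ forall v, nr (f v) <= c * nr v.

Lemma blinI V W (f : V -> W) : linear f -> (exists c : R, forall v, nr (f v) <= c * nr v) -> blin f.
Proof.
move=> l [c hc]; split=> //; exists `|c|; split=> // v.
by apply: le_trans (hc v) _; rewrite ler_wpM2r ?nr_ge0 // ler_norm.
Qed.

Lemma blin_comp V W Z (f : V -> W) (g : W -> Z) : blin f -> blin g -> blin (fun v => g (f v)).
Proof.
move=> [lf [c [c0 hc]]] [lg [d [d0 hd]]]; split; first by move=> k a b; rewrite lf lg.
exists (d * c); split=> [|v]; first exact: mulr_ge0.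
by apply: le_trans (hd _) _; rewrite -mulrA ler_wpM2l.
Qed.

Lemma blin_eq V W (I : Type) (s : I -> V) (f g : V -> W) : dense_by s -> blin f -> blin g ->
  (forall i, f (s i) = g (s i)) -> f =1 g.
Proof. by move=> ds [lf [c [_ hc]]] [lg [d [_ hd]]]; exact: (dense_eq ds lf lg hc hd). Qed.

Lemma blinZ V W (f : V -> W) k : blin f -> blin (fun v => k *: f v).
Proof.
move=> [lf [c [c0 hc]]]; split; first by move=> l a b; rewrite lf scalerDr !scalerA mulrC.
exists (nc k * c); split=> [|v]; first by rewrite mulr_ge0 ?nc_ge0.
by rewrite nrZ -mulrA ler_wpM2l ?nc_ge0.
Qed.

Lemma blinD V W (f g : V -> W) : blin f -> blin g -> blin (fun v => f v + g v).
Proof.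
move=> [lf [c [c0 hc]]] [lg [d [d0 hd]]]; split; first by move=> l a b; rewrite lf lg scalerDr addrACA.
exists (c + d); split=> [|v]; first exact: addr_ge0.
by apply: le_trans (nrD _ _) _; rewrite mulrDl lerD.
Qed.

Lemma blin0 V W : blin (fun _ : V => 0 : W).
Proof.
split; first by move=> k a b; rewrite scaler0 addr0.
by exists 0; split=> // v; rewrite nr0 mul0r.
Qed.

Lemma blin_sum V W (I : Type) (r : seq I) (P : pred I) (f : I -> V -> W) : (forall i, blin (f i)) ->
  blin (fun v => \sum_(i <- r | P i) f i v).
Proof.
move=> h; elim: r => [|i r IH].
  by under eq_fun do rewrite big_nil; exact: blin0.
under eq_fun do rewrite big_cons.
by case: (P i) => //; exact: blinD.
Qed.

Section Alg.
Variables X Y : cstar R.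

Lemma blin_mL (m : multiplier X) : blin (mL m).
Proof.
have [b [b0 hb]] := mult_bounded m; apply: blinI; first exact: mL_linear.
by exists b.
Qed.

Lemma blin_mull (a : X) : blin (fun x => a ** x).
Proof. exact: (blin_mL (incl a)). Qed.

Lemma blin_mulr (a : X) : blin (fun x => x ** a).
Proof.
apply: blinI => [k x y|]; first by rewrite cmulDl cmulZl.
by exists (nr a) => x; rewrite mulrC nrM.
Qed.

Lemma blin_hom (f : X -> multiplier Y) v : starhom f -> blin (fun x => mL (f x) v).
Proof.
move=> hf; apply: blinI => [k x y|].
  by case: (hf) => -> _ _.
by exists (nr v) => x; rewrite mulrC; case: (starhom_bnd x hf) => _; exact.
Qed.

Variable T : min_tensor X Y.
Lemma blin_slice chi : vecf chi -> blin (slice chi : T -> X).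
Proof. by move=> v; apply: blinI; [exact: slice_lin|exact: slice_bnd]. Qed.
Lemma blin_slice2 chi : vecf chi -> blin (slice2 chi : T -> Y).
Proof. by move=> v; apply: blinI; [exact: slice2_lin|exact: slice2_bnd]. Qed.
Lemma blin_tensl y : blin (fun x => tens x y : T).
Proof.
apply: blinI => [k a b|]; first exact: tens_linl.
by exists (nr y) => x; rewrite mulrC nr_tens.
Qed.
Lemma blin_tensr x : blin (fun y => tens x y : T).
Proof.
apply: blinI => [k a b|]; first exact: tens_linr.
by exists (nr x) => y; rewrite nr_tens.
Qed.
Lemma blin_eq_tens W (f g : T -> W) t : blin f -> blin g ->
  (forall x y, f (tens x y) = g (tens x y)) -> f t = g t.
Proof.
by move=> bf bg h; apply: (blin_eq (@tens_dense_by _ _ _ T)) => // -[x y]; exact: h.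
Qed.
End Alg.
End Blin.

(** * Haar states of a compact quantum group *)

Section CompactQG.
Variables (R : realType) (mt : tensor_choice R) (K : compact_qg mt).
Local Notation "X ⊗ Y" := (tensor_alg (mt X Y)) (at level 40, left associativity).
Local Notation e := (cqg_unit K).
Local Notation D := (@cqg_comul R mt K).
Let eU : is_unit e. Proof. exact: cqg_unitP. Qed.
Let hD : starhom D. Proof. by case: (cqg_bialg K). Qed.
Let nD : nondegenerate D. Proof. by case: (cqg_bialg K). Qed.

Lemma unit_incl (X : cstar R) (o : X) : is_unit o -> incl o = 1.
Proof. by move=> h; apply: mult_eqL => v; rewrite mL_incl; case: (h v). Qed.

Lemma incl_ee : incl (tens e e) = 1 :> multiplier (K ⊗ K).
Proof. exact/unit_incl/unit_tens. Qed.

(** K ⊗ K is unital, so the multiplier D k is an element of it, recovered as its value at the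
    unit. *)
Definition D0 (k : K) : K ⊗ K := mL (D k) (tens e e).

Lemma incl_D0 k : incl (D0 k) = D k.
Proof. by rewrite /D0 -mul_incl incl_ee mulr1. Qed.

Lemma D0_lin : linear D0. Proof. exact: (proj1 (blin_hom _ hD)). Qed.

(** The commuting convolutions are coassociativity evaluated at the unit of K ⊗ K ⊗ K and sliced by
    om in the first and by chi in the third leg. *)
Lemma D0_comult : comult (T := mt K K) e D0.
Proof.
case: (hD) => Dl DM Da; split.
- by move=> k a b; apply: incl_inj; rewrite inclD inclZ !incl_D0 Dl.
- by move=> a b; apply: incl_inj; rewrite inclM !incl_D0 DM.
- by move=> a; apply: incl_inj; rewrite incl_adj !incl_D0 Da.
- apply: incl_inj; rewrite incl_D0 incl_ee; apply: (nondeg_eq nD) => a.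
  by rewrite mul1r -DM; case: (eU a) => ->.
move=> chi om x vc vo.
pose v : K ⊗ K ⊗ K := tens (tens e e) e.
pose A1 t := mL (tens_id D t) v; pose A2 t := mL (id_tens D t) v.
have bA1 : blin A1 by apply: blin_hom; exact: tens_id_hom.
have bA2 : blin A2 by apply: blin_hom; exact: id_tens_hom.
pose S (t : K ⊗ K ⊗ K) := slice2 (T := mt K K) om (slice chi t).
have bS : blin S by apply: (blin_comp (blin_slice _ vc) (blin_slice2 _ vo)).
have AE : A1 (D0 x) = A2 (D0 x).
  have [_ _ /(_ x)] := cqg_bialg K.
  rewrite -(incl_D0 x) !ext_incl; [by rewrite /A1 /A2 => ->|exact: id_tens_hom|exact: id_tens_nondeg|exact: tens_id_hom|exact: tens_id_nondeg].
have L : S (A1 (D0 x)) = Rc D0 om (Lc D0 chi x).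
  rewrite /Lc; move: (D0 x) => t.
  apply: (blin_eq_tens (f := fun t => S (A1 t)) (g := fun t => Rc D0 om (slice chi t))) => [||a b].
  - exact: blin_comp.
  - apply: (blin_comp (blin_slice _ vc)); apply: (blin_comp (f := D0)); last exact: blin_slice2.
    exact: blin_hom.
  rewrite /S /A1 tens_idE // mL_mul leg2P leg1P mL_incl; case: (eU b) => _ ->.
  rewrite !slice_tens // (linZ _ _ (slice2_lin vo)) -/(D0 a) /Rc (linZ _ _ D0_lin).
  by rewrite (linZ _ _ (slice2_lin vo)).
rewrite -L AE /Rc; move: (D0 x) => t.
apply: (blin_eq_tens (f := fun t => Lc D0 chi (slice2 om t)) (g := fun t => S (A2 t))) => [||a b].
- apply: (blin_comp (blin_slice2 _ vo)); apply: (blin_comp (f := D0)); last exact: blin_slice.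
  exact: blin_hom.
- exact: blin_comp.
rewrite /S /A2 id_tensE // -incl_D0 ext_incl; [|exact: emb23_hom|exact: emb23_nondeg].
rewrite slice2_tens // /Lc (linZ _ _ D0_lin) -/(D0 b) (linZ _ _ (slice_lin vc)).
move: (D0 b) => u; rewrite mL_mul -/(S _).
apply: (blin_eq_tens (f := fun u => om a *: slice chi u)
  (g := fun u => S (mL (leg1 (leg1 (incl a))) (mL (emb23 K u) v)))) => [||p q].
- exact/blinZ/blin_slice.
- apply: blin_comp => //; apply: blin_comp; last exact: blin_mL.
  by apply: blin_hom; exact: emb23_hom.
rewrite emb23E mL_mul leg2P !leg1P leg2P leg1P !mL_incl /S !slice_tens //.
rewrite (linZ _ _ (slice2_lin vo)) slice2_tens // scalerA mulrC -scalerA.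
by case: (eU p) (eU q) (eU a) => _ -> [_ ->] [_ ->].
Qed.

Lemma D0_dense1 : dense_by (fun p : K * K => D0 p.1 ** tens p.2 e).
Proof.
apply: dense_by_img (dense_spanP (cqg_cancel1 K)) _ => -[s [a [b h]]] /=.
exists (a, b); apply: incl_inj; rewrite h inclM incl_D0 -leg_tens.
by rewrite (unit_incl eU) leg2_1 mulr1.
Qed.

Lemma D0_dense2 : dense_by (fun p : K * K => D0 p.1 ** tens e p.2).
Proof.
apply: dense_by_img (dense_spanP (cqg_cancel2 K)) _ => -[s [a [b h]]] /=.
exists (a, b); apply: incl_inj; rewrite h inclM incl_D0 -leg_tens.
by rewrite (unit_incl eU) leg1_1 mul1r.
Qed.

Lemma corep_D0 n (u : 'M[K]_n) : unitary_corep u ->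
  forall i j, D0 (u i j) = \sum_k tens (u i k) (u k j).
Proof. by move=> [h _ _] i j; apply: incl_inj; rewrite incl_D0 h. Qed.

Lemma haar_left : exists h, state e h /\ forall x, Lc D0 h x = h x *: e.
Proof. exact: (haar eU (cqg_unit_neq0 K) D0_comult D0_dense1). Qed.

(** Flipping the tensor square interchanges the two convolutions, and [haar] applies to the flipped
    comultiplication. *)
Lemma haar_right : exists h, state e h /\ forall x, Rc D0 h x = h x *: e.
Proof.
have cf : comult (T := flip (mt K K)) e D0.
  case: D0_comult => h1 h2 h3 h4 h5; split=> // chi om x vc vo.
  by have := h5 om chi x vo vc.
exact: (haar eU (cqg_unit_neq0 K) cf D0_dense2).
Qed.

End CompactQG.

(** * Matrices over multiplier algebras, and conjugate corepresentations *)

Section KMat.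
Variable R : realType.

Definition sc (X : cstar R) m n (P : 'M[R[i]]_(m, n)) : 'M[multiplier X]_(m, n) :=
  map_mx (fun c => c *: (1 : multiplier X)) P.
Definition ct m n (P : 'M[R[i]]_(m, n)) : 'M[R[i]]_(n, m) := map_mx Num.conj P^T.
Definition ma (X : cstar R) m n (A : 'M[multiplier X]_(m, n)) := map_mx (@madj R X) A^T.

Lemma scM (X : cstar R) m n p (P : 'M[R[i]]_(m, n)) (Q : 'M[R[i]]_(n, p)) :
  sc X (P *m Q) = sc X P *m sc X Q.
Proof.
apply/matrixP => i j; rewrite !mxE scaler_suml; apply: eq_bigr => k _.
by rewrite !mxE mscaleAl mul1r scalerA.
Qed.

Lemma sc1 (X : cstar R) n : sc X (1%:M : 'M[R[i]]_n) = 1%:M.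
Proof. by apply/matrixP => i j; rewrite !mxE; case: eqP; rewrite ?scale1r ?scale0r. Qed.

Lemma maM (X : cstar R) m n p (A : 'M[multiplier X]_(m, n)) (B : 'M[multiplier X]_(n, p)) :
  ma (A *m B) = ma B *m ma A.
Proof.
apply/matrixP => i j; rewrite !mxE (big_morph _ (@madjD _ X) (@madj0 _ X)).
by apply: eq_bigr => k _; rewrite !mxE madjM.
Qed.

Lemma ma_sc (X : cstar R) m n (P : 'M[R[i]]_(m, n)) : ma (sc X P) = sc X (ct P).
Proof. by apply/matrixP => i j; rewrite !mxE madjZ madj1. Qed.

Lemma map_mulmx (X Y : cstar R) (phi : multiplier X -> multiplier Y) m n p
  (A : 'M[multiplier X]_(m, n)) (B : 'M[multiplier X]_(n, p)) :
  {morph phi : a b / a + b} -> phi 0 = 0 -> {morph phi : a b / a * b} ->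
  map_mx phi (A *m B) = map_mx phi A *m map_mx phi B.
Proof.
move=> fD f0 fM; apply/matrixP => i j; rewrite !mxE (big_morph phi fD f0).
by apply: eq_bigr => k _; rewrite !mxE fM.
Qed.

Lemma lin0 (V W : lmodType R[i]) (f : V -> W) : linear f -> f 0 = 0.
Proof. by move=> l; have := l (-1) 0 0; rewrite scaler0 addr0 scaleN1r addNr. Qed.

(** S is the square root of the diagonal of eigenvalues times the diagonalizing unitary. *)
Lemma posdef_factor n (F : 'M[R[i]]_n) : ct F = F ->
  (forall x : 'rV_n, x *m ct x = 1%:M -> 0 < (x *m F *m ct x) 0 0) ->
  exists S S' : 'M[R[i]]_n, [/\ S *m S' = 1%:M, S' *m S = 1%:M & F = ct S *m S].
Proof.
move=> Fh Fp.
have /hermitian_normalmx/orthomx_spectralP : F \is hermsymmx.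
  by apply/is_hermitianmxP; rewrite expr0 scale1r -[LHS]Fh.
set P := spectralmx F; set d := spectral_diag F => FE.
have Pu : P *m ct P = 1%:M by exact/unitarymxP/spectral_unitarymx.
have Pu' : ct P *m P = 1%:M by exact: mulmx1C.
have PiE : invmx P = ct P by rewrite invmx_unitary ?spectral_unitarymx.
have d0 i : 0 < d 0 i.
  have := Fp (row i P); rewrite FE PiE => H.
  have rowE (M : 'M[R[i]]_n) : (row i P *m M *m ct (row i P)) 0 0 = (P *m M *m ct P) i i.
    by rewrite -row_mul !mxE; apply: eq_bigr => k _; rewrite !mxE.
  move: H; rewrite rowE !mulmxA Pu mul1mx -mulmxA Pu mulmx1 mxE eqxx mulr1n; apply.
  apply/matrixP => a b; have := rowE 1%:M; rewrite !mulmx1 !ord1 => ->; rewrite Pu !mxE !eqxx //.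
pose r := map_mx sqrtC d; pose r' := map_mx (fun x => (sqrtC x)^-1) d.
have rr : diag_mx r *m diag_mx r' = 1%:M.
  rewrite mulmx_diag -diag_const_mx; congr diag_mx; apply/matrixP => a b.
  by rewrite !ord1 !mxE mulfV // sqrtC_eq0 gt_eqF.
have r2 : ct (diag_mx r) *m diag_mx r = diag_mx d.
  rewrite /ct tr_diag_mx map_diag_mx mulmx_diag; congr diag_mx; apply/matrixP => a b.
  by rewrite !ord1 !mxE /= geC0_conj ?sqrtC_ge0 ?ltW // -expr2 sqrtCK.
have h1 : (diag_mx r *m P) *m (ct P *m diag_mx r') = 1%:M.
  by rewrite mulmxA -(mulmxA _ P) Pu mulmx1.
exists (diag_mx r *m P), (ct P *m diag_mx r'); split; [exact: h1|exact: mulmx1C h1|].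
have -> : ct (diag_mx r *m P) = ct P *m ct (diag_mx r).
  by rewrite /ct trmx_mul map_mxM.
by rewrite mulmxA -(mulmxA (ct P)) r2 FE PiE.
Qed.
End KMat.

Section Conjugate.
Variables (R : realType) (mt : tensor_choice R) (K : compact_qg mt).
Local Notation "X ⊗ Y" := (tensor_alg (mt X Y)) (at level 40, left associativity).
Local Notation e := (cqg_unit K).
Local Notation D := (@cqg_comul R mt K).
Local Notation D0 := (@D0 R mt K).
Let eU : is_unit e. Proof. exact: cqg_unitP. Qed.
Let hD : starhom D. Proof. by case: (cqg_bialg K). Qed.
Let nD : nondegenerate D. Proof. by case: (cqg_bialg K). Qed.
Let ie : incl e = 1. Proof. exact: unit_incl. Qed.
Let hC : comult (T := mt K K) e D0. Proof. exact: D0_comult. Qed.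

(* The three conditions defining a unitary corepresentation as equations
   between matrices over multiplier algebras. *)
Definition crep n (U : 'M[multiplier K]_n) :=
  [/\ map_mx (ext D) U = map_mx (@leg1 R K K (mt K K)) U *m map_mx (@leg2 R K K (mt K K)) U,
      ma U *m U = 1%:M & U *m ma U = 1%:M].

Definition lift n (W : 'M[multiplier K]_n) : 'M[K]_n := map_mx (fun m => mL m e) W.

Lemma liftK n (W : 'M[multiplier K]_n) : map_mx (@incl R K) (lift W) = W.
Proof. by apply/matrixP => i j; rewrite !mxE -mul_incl ie mulr1. Qed.

Lemma if_incl b : incl (if b then e else 0) = (b%:R : multiplier K).
Proof. by case: b; rewrite ?ie ?incl0. Qed.

Lemma crepP n (u : 'M[K]_n) : unitary_corep u <-> crep (map_mx (@incl R K) u).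
Proof.
split=> [[h1 h2 h3]|[h1 h2 h3]]; split.
- apply/matrixP => i j; rewrite !mxE ext_incl // h1 incl_sum; apply: eq_bigr => k _.
  by rewrite !mxE leg_tens.
- apply/matrixP => i j; rewrite !mxE -if_incl -h2 incl_sum; apply: eq_bigr => k _.
  by rewrite !mxE inclM incl_adj.
- apply/matrixP => i j; rewrite !mxE -if_incl -h3 incl_sum; apply: eq_bigr => k _.
  by rewrite !mxE inclM incl_adj.
- move=> i j; have /matrixP/(_ i j) := h1; rewrite !mxE ext_incl // incl_sum => ->.
  by apply: eq_bigr => k _; rewrite !mxE leg_tens.
- move=> i j; apply: incl_inj; have /matrixP/(_ i j) := h2; rewrite !mxE if_incl incl_sum => <-.
  by apply: eq_bigr => k _; rewrite !mxE inclM incl_adj.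
- move=> i j; apply: incl_inj; have /matrixP/(_ i j) := h3; rewrite !mxE if_incl incl_sum => <-.
  by apply: eq_bigr => k _; rewrite !mxE inclM incl_adj.
Qed.

Lemma interP n m (u : 'M[K]_n) (v : 'M[K]_m) T : intertwiner u v T <->
  sc K T *m map_mx (@incl R K) u = map_mx (@incl R K) v *m sc K T.
Proof.
have E1 i j : (sc K T *m map_mx (@incl R K) u) i j = incl (\sum_k T i k *: u k j).
  by rewrite mxE incl_sum; apply: eq_bigr => k _; rewrite !mxE inclZ mscaleAl mul1r.
have E2 i j : (map_mx (@incl R K) v *m sc K T) i j = incl (\sum_k T k j *: v i k).
  by rewrite mxE incl_sum; apply: eq_bigr => k _; rewrite !mxE inclZ mscaleAr mulr1.
split=> [h|/matrixP h i j].
  by apply/matrixP => i j; rewrite E1 E2 h.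
by apply: incl_inj; rewrite -E1 -E2 h.
Qed.

(** Invariance of h is applied to the Gram entry sum_i v_ia^* v_ib. In matrix form, with F the
    averaged Gram matrix, the identity is v^* F v = F. *)
Lemma haar_right_corep h n (v : 'M[K]_n) : state e h -> (forall x, Rc D0 h x = h x *: e) ->
  (forall i j, D0 (v i j) = \sum_k tens (v i k) (v k j)) -> forall a b,
  \sum_k \sum_l h (\sum_i cadj (v i k) ** v i l) *: (cadj (v k a) ** v l b) =
  h (\sum_i cadj (v i a) ** v i b) *: e.
Proof.
move=> sh hR Dv a b; have vh := state_vecf eU sh; case: (hC) => Dl DM Da _ _.
rewrite -hR /Rc.
have -> : D0 (\sum_i cadj (v i a) ** v i b) = \sum_k \sum_l
    tens (\sum_i cadj (v i k) ** v i l) (cadj (v k a) ** v l b).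
  under [RHS]eq_bigr => k _ do under eq_bigr => l _ do rewrite tens_suml.
  under [RHS]eq_bigr => k _ do rewrite exchange_big.
  rewrite exchange_big /=.
  have D0s (f : 'I_n -> K) : D0 (\sum_i f i) = \sum_i D0 (f i).
    have D0D x y : D0 (x + y) = D0 x + D0 y by have := Dl 1 x y; rewrite !scale1r.
    have D00 : D0 0 = 0 by apply: (addrI (D0 0)); rewrite -D0D !addr0.
    exact: (big_morph _ D0D D00).
  rewrite D0s; apply: eq_bigr => i _; rewrite DM Da !Dv cadj_sum cmul_suml.
  apply: eq_bigr => k _; rewrite cmul_sumr; apply: eq_bigr => l _.
  by rewrite -tens_adj tensM.
rewrite /slice2 slice_sum //; apply: eq_bigr => k _; rewrite slice_sum //.
by apply: eq_bigr => l _; rewrite -/(slice2 _ _) slice2_tens.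
Qed.

(** In matrix form v F v^* = F, where F averages the entries of v v^*. *)
Lemma haar_left_corep h n (v : 'M[K]_n) : state e h -> (forall x, Lc D0 h x = h x *: e) ->
  (forall i j, D0 (v i j) = \sum_k tens (v i k) (v k j)) -> forall a b,
  \sum_k \sum_l h (\sum_i v k i ** cadj (v l i)) *: (v a k ** cadj (v b l)) =
  h (\sum_i v a i ** cadj (v b i)) *: e.
Proof.
move=> sh hL Dv a b; have vh := state_vecf eU sh; case: (hC) => Dl DM Da _ _.
rewrite -hL /Lc.
have -> : D0 (\sum_i v a i ** cadj (v b i)) = \sum_k \sum_l
    tens (v a k ** cadj (v b l)) (\sum_i v k i ** cadj (v l i)).
  under [RHS]eq_bigr => k _ do under eq_bigr => l _ do rewrite tens_sumr.
  under [RHS]eq_bigr => k _ do rewrite exchange_big.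
  rewrite exchange_big /=.
  have D0s (f : 'I_n -> K) : D0 (\sum_i f i) = \sum_i D0 (f i).
    have D0D x y : D0 (x + y) = D0 x + D0 y by have := Dl 1 x y; rewrite !scale1r.
    have D00 : D0 0 = 0 by apply: (addrI (D0 0)); rewrite -D0D !addr0.
    exact: (big_morph _ D0D D00).
  rewrite D0s; apply: eq_bigr => i _; rewrite DM Da !Dv cadj_sum cmul_suml.
  apply: eq_bigr => k _; rewrite cmul_sumr; apply: eq_bigr => l _.
  by rewrite -tens_adj tensM.
rewrite slice_sum //; apply: eq_bigr => k _; rewrite slice_sum //.
by apply: eq_bigr => l _; rewrite slice_tens.
Qed.

(** The product of the adjoint of S with S is the matrix F of [haar_right_corep] for the conjugate v
    of u, so S v S^-1 is an isometry. A unit vector on which the form of F vanishes would be, up to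
    conjugation, the xi that [corep_null] excludes. *)
Lemma conj_posdef n (u : 'M[K]_n) : unitary_corep u ->
  exists S S' : 'M[R[i]]_n, let ub := map_mx (fun x => incl (cadj x)) u in
  [/\ S *m S' = 1%:M, S' *m S = 1%:M & ma ub *m sc K (ct S *m S) *m ub = sc K (ct S *m S)].
Proof.
move=> uc; have [h [sh hR]] := haar_right K; have vh := state_vecf eU sh.
pose v := map_mx cadj u.
have Dv i j : D0 (v i j) = \sum_k tens (v i k) (v k j).
  case: hC => _ _ Da _ _; rewrite mxE Da (corep_D0 uc) cadj_sum.
  by apply: eq_bigr => k _; rewrite -tens_adj !mxE.
have HF := haar_right_corep sh hR Dv.
pose F := \matrix_(k, l) h (\sum_i cadj (v i k) ** v i l).
have [||S [S' [s1 s2 FE]]] := @posdef_factor _ n F.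
- apply/matrixP => k l; rewrite !mxE -(state_conj eU _ sh) cadj_sum; congr h.
  by apply: eq_bigr => i _; rewrite cadjM cadjK.
- move=> x x1.
  pose xi l := ((x 0 l)^*)%R.
  have E : (x *m F *m ct x) 0 0 = \sum_i h (cadj (\sum_l xi l *: v i l) ** (\sum_l xi l *: v i l)).
    rewrite mxE; under eq_bigr => l _ do rewrite mxE mulr_suml.
    under [RHS]eq_bigr => i _.
      rewrite cmul_sumr vecf_sum //.
      under eq_bigr => l _.
        rewrite cmulZr vecfZ // cadj_sum cmul_suml vecf_sum // mulr_sumr.
        under eq_bigr => k _ do rewrite cadjZ conjCK cmulZl vecfZ //.
      over.
    over.
    rewrite [RHS]exchange_big; apply: eq_bigr => l _; rewrite [RHS]exchange_big /=.
    apply: eq_bigr => k _; rewrite [F _ _]mxE [ct _ _ _]mxE [x^T _ _]mxE vecf_sum // mulr_sumr mulr_suml.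
    by apply: eq_bigr => i _; rewrite mulrC.
  rewrite E lt_def sumr_ge0 ?andbT => [|i _]; last by case: sh => _ + _; apply.
  apply/negP => /eqP z.
  refine (@corep_null _ K e (mt K K) D0 eU hC h sh hR (@D0_dense1 _ _ K) (@D0_dense2 _ _ K) n (fun i j => v i j) xi Dv _ _ _).
  + by move=> c j; have [_ _ /(_ c j)<-] := uc; apply: eq_bigr => a _; rewrite !mxE cadjK.
  + transitivity ((x *m ct x) 0 0); last by rewrite x1 mxE eqxx.
    by rewrite mxE; apply: eq_bigr => j _; rewrite !mxE /xi conjCK.
  move=> i; have /psumr_eq0P/(_ i) := z; apply=> // k _; by case: sh => _ + _; apply.
exists S, S'; split=> //; rewrite -FE; apply/matrixP => a b.
rewrite mxE; under eq_bigr => l _ do rewrite mxE mulr_suml.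
rewrite exchange_big /= [RHS]mxE [F a b]mxE -ie -inclZ -HF incl_sum; apply: eq_bigr => k _.
rewrite incl_sum; apply: eq_bigr => l _; rewrite !mxE inclZ inclM !incl_adj !madjK.
by rewrite mscaleAr mulr1 mscaleAl.
Qed.
Let extD_morph : [/\ {morph ext D : a b / a + b}, ext D 0 = 0, {morph ext D : a b / a * b} &
  forall k : R[i], ext D (k *: (1 : multiplier K)) = k *: (1 : multiplier (K ⊗ K))].
Proof.
have e0 : ext D 0 = 0 by rewrite -incl0 ext_incl //; case: hD => l _ _; rewrite (lin0 l).
split=> //; [by move=> a b; rewrite extD|by move=> a b; rewrite extM|].
by move=> k; rewrite extZ // ext1.
Qed.

Lemma map_sc (X : cstar R) (phi : multiplier K -> multiplier X) m n (P : 'M[R[i]]_(m, n)) :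
  (forall k : R[i], phi (k *: (1 : multiplier K)) = k *: (1 : multiplier X)) -> map_mx phi (sc K P) = sc X P.
Proof. by move=> h; apply/matrixP => i j; rewrite !mxE h. Qed.

Let leg1_morph : [/\ {morph @leg1 R K K (mt K K) : a b / a + b}, @leg1 R K K (mt K K) 0 = 0,
  {morph @leg1 R K K (mt K K) : a b / a * b} & forall k : R[i], leg1 (k *: (1 : multiplier K)) = k *: (1 : multiplier (K ⊗ K))].
Proof.
split; [exact: leg1D|exact: leg1_0|exact: leg1M|].
by move=> k; rewrite leg1Z leg1_1.
Qed.
Let leg2_morph : [/\ {morph @leg2 R K K (mt K K) : a b / a + b}, @leg2 R K K (mt K K) 0 = 0,
  {morph @leg2 R K K (mt K K) : a b / a * b} & forall k : R[i], leg2 (k *: (1 : multiplier K)) = k *: (1 : multiplier (K ⊗ K))].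
Proof.
split; [exact: leg2D|exact: leg2_0|exact: leg2M|].
by move=> k; rewrite leg2Z leg2_1.
Qed.

Lemma corep_conj n (u : 'M[K]_n) (S S' : 'M[R[i]]_n) : unitary_corep u -> S *m S' = 1%:M ->
  S' *m S = 1%:M -> let W := sc K S *m map_mx (fun x => incl (cadj x)) u *m sc K S' in
  map_mx (ext D) W = map_mx (@leg1 R K K (mt K K)) W *m map_mx (@leg2 R K K (mt K K)) W.
Proof.
move=> uc s1 s2; set ub := map_mx _ u => W.
have ubE : map_mx (ext D) ub = map_mx (@leg1 R K K (mt K K)) ub *m map_mx (@leg2 R K K (mt K K)) ub.
  apply/matrixP => i j; rewrite !mxE ext_incl //; case: (hD) => _ _ ->.
  case: uc => -> _ _; rewrite -incl_adj cadj_sum incl_sum; apply: eq_bigr => k _.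
  by rewrite -tens_adj !mxE leg_tens.
have [d1 d2 d3 d4] := extD_morph; have [l1 l2 l3 l4] := leg1_morph; have [r1 r2 r3 r4] := leg2_morph.
rewrite /W !map_mulmx // !map_sc // ubE !mulmxA; congr (_ *m _ *m _).
by rewrite -(mulmxA _ _ (sc _ S)) -scM s2 sc1 mulmx1.
Qed.

(** Taking adjoints of all entries turns the relation into one for u with the complex conjugate of
    T. *)
Lemma inter_conj n (u : 'M[K]_n) T : irreducible u ->
  sc K T *m map_mx (fun x => incl (cadj x)) u = map_mx (fun x => incl (cadj x)) u *m sc K T ->
  is_scalar_mx T.
Proof.
move=> [_ ui] h; suff : is_scalar_mx (map_mx Num.conj T).
  move=> /is_scalar_mxP[c hc]; apply/is_scalar_mxP; exists ((c^*)%R).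
  apply/matrixP => i j; have /matrixP/(_ i j) := hc; rewrite !mxE => /(congr1 Num.conj).
  by rewrite /= conjCK => ->; rewrite rmorphMn.
apply: ui; apply/interP.
have /(congr1 (map_mx (@madj R K))) := h => {}h.
apply/matrixP => i j; have /matrixP/(_ i j) := h.
rewrite !mxE !(big_morph _ (@madjD _ K) (@madj0 _ K)) => h'.
under eq_bigr => k _ do rewrite !mxE mscaleAl mul1r.
under [RHS]eq_bigr => k _ do rewrite !mxE mscaleAr mulr1.
transitivity (\sum_i0 madj (sc K T i i0 * (map_mx (fun x => incl (cadj x)) u) i0 j)).
  by apply: eq_bigr => k _; rewrite !mxE mscaleAl mul1r madjZ incl_adj madjK.
rewrite h'; apply: eq_bigr => k _.
by rewrite !mxE mscaleAr mulr1 madjZ incl_adj madjK.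
Qed.

(** W = S v S^-1 is an isometry by [conj_posdef]; the other half of unitarity comes from the left
    invariant state. Its matrix satisfies W [Gm] W^* = [Gm], so [Gm] commutes with W and is a scalar
    g, and g W W^* = g. If g were 0, h would annihilate all x u_ik, against sum_k u_ki^* u_ki =
    1. *)
Theorem conjugate_unitary n (u : 'M[K]_n) : unitary_corep u -> irreducible u ->
  exists w (S S' : 'M[R[i]]_n), [/\ unitary_corep w, irreducible w, S *m S' = 1%:M, S' *m S = 1%:M &
   intertwiner (map_mx cadj u) w S].
Proof.
move=> uc ui; have [S [S' [s1 s2]]] := conj_posdef uc; set ub := map_mx _ u => FE.
pose W := sc K S *m ub *m sc K S'; pose w := lift W.
have wW : map_mx (@incl R K) w = W by exact: liftK.
have WD := corep_conj uc s1 s2; rewrite -/ub -/W in WD.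
have t1 : sc K S *m sc K S' = 1%:M by rewrite -scM s1 sc1.
have t2 : sc K S' *m sc K S = 1%:M by rewrite -scM s2 sc1.
have SW : sc K S *m ub = W *m sc K S by rewrite /W -!mulmxA t2 mulmx1.
have ubE : ub = sc K S' *m W *m sc K S by rewrite /W !mulmxA t2 mul1mx -mulmxA t2 mulmx1.
have ubik i k : ub i k = incl (cadj (u i k)) by rewrite mxE.
move: WD => /= WD; clearbody w; clearbody W; clearbody ub.
have W1 : ma W *m W = 1%:M.
  have : ma (sc K S) *m (ma W *m W) *m sc K S = ma (sc K S) *m sc K S.
    rewrite mulmxA -maM -mulmxA -SW maM mulmxA -(mulmxA (ma ub)) ma_sc -scM.
    by rewrite FE scM.
  move=> /(congr1 (fun X => X *m sc K S')); rewrite -!mulmxA t1 !mulmx1.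
  move=> /(congr1 (fun X => ma (sc K S') *m X)); rewrite !mulmxA -maM t1.
  have -> : ma (1%:M : 'M[multiplier K]_n) = 1%:M.
    by apply/matrixP => i j; rewrite !mxE eq_sym; case: eqP; rewrite ?madj1 ?madj0.
  by rewrite mul1mx.
have WI T : sc K T *m W = W *m sc K T -> is_scalar_mx T.
  move=> h; have : is_scalar_mx (S' *m T *m S).
    apply: (inter_conj ui); have -> : map_mx (fun x => incl (cadj x)) u = ub.
      by apply/matrixP => i k; rewrite ubik mxE.
    rewrite ubE !scM -!mulmxA; congr (_ *m _).
    by rewrite !(mulmxA (sc K S)) t1 !mul1mx !mulmxA h.
  move=> /is_scalar_mxP[c hc]; apply/is_scalar_mxP; exists c.
  have /(congr1 (fun X => S *m X *m S')) := hc.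
  by rewrite !mulmxA s1 mul1mx -mulmxA s1 mulmx1 mul_mx_scalar -scalemxAl s1 scalemx1.
have Dw i j : D0 (w i j) = \sum_k tens (w i k) (w k j).
  apply: incl_inj; rewrite incl_D0; have /matrixP/(_ i j) := WD; rewrite -wW !mxE ext_incl // => ->.
  by rewrite incl_sum; apply: eq_bigr => k _; rewrite !mxE leg_tens.
have [h [sh hL]] := haar_left K; have vh := state_vecf eU sh.
pose Gm := \matrix_(k, l) h (\sum_i w k i ** cadj (w l i)).
have WG : W *m sc K Gm *m ma W = sc K Gm.
  apply/matrixP => a b; rewrite mxE; under eq_bigr => l _ do rewrite mxE mulr_suml.
  rewrite exchange_big /= [RHS]mxE [Gm a b]mxE -ie -inclZ -(haar_left_corep sh hL Dw) incl_sum.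
  apply: eq_bigr => k _; rewrite incl_sum; apply: eq_bigr => l _.
  by rewrite -wW !mxE inclZ inclM !incl_adj mscaleAr mulr1 mscaleAl.
have /WI/is_scalar_mxP[g gE] : sc K Gm *m W = W *m sc K Gm.
  by rewrite -[in LHS]WG -mulmxA W1 mulmx1.
have gW : sc K (g%:M : 'M[R[i]]_n) *m (W *m ma W) = sc K g%:M.
  rewrite -gE -[RHS]WG !mulmxA; congr (_ *m _).
  by rewrite -[in LHS]WG -mulmxA W1 mulmx1.
have g0 : g != 0.
  apply/eqP => g0.
  have hw i k : h (w i k ** cadj (w i k)) = 0.
    have : Gm i i = 0 by rewrite gE g0 mxE mul0rn.
    rewrite mxE vecf_sum // => /psumr_eq0P; apply=> // j _.
    by case: sh => _ + _ => /(_ (cadj (w i j))); rewrite cadjK.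
  have hw' x i k : h (x ** cadj (w i k)) = 0.
    by have := @state_cs _ _ _ _ (cadj (w i k)) (cadj x) sh; rewrite !cadjK; apply.
  have hu x i k : h (x ** u i k) = 0.
    have uE : u i k = \sum_b \sum_a ((S' i a)^*)%R * ((S b k)^*)%R *: cadj (w a b).
      apply: incl_inj; apply: (can_inj (@madjK _ K)); rewrite -incl_adj.
      rewrite -ubik ubE mxE incl_sum (big_morph _ (@madjD _ K) (@madj0 _ K)).
      apply: eq_bigr => b _; rewrite mxE mulr_suml incl_sum (big_morph _ (@madjD _ K) (@madj0 _ K)).
      apply: eq_bigr => a _; rewrite -wW !mxE inclZ incl_adj madjZ madjK cjM !conjCK.
      by rewrite mscaleAl mul1r mscaleAr mulr1 scalerA mulrC.
    rewrite uE cmul_sumr vecf_sum // big1 // => b _; rewrite cmul_sumr vecf_sum // big1 // => a _.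
    by rewrite cmulZr vecfZ // hw' mulr0.
  have [n0 _] := ui; pose i0 := Ordinal n0.
  have [_ /(_ i0 i0) + _] := uc; rewrite eqxx => /(congr1 h); rewrite vecf_sum // big1; last by move=> k _; exact: hu.
  by case: sh => _ _ -> /eqP; rewrite eq_sym oner_eq0.
have W2 : W *m ma W = 1%:M.
  have : sc K (g^-1%:M : 'M[R[i]]_n) *m sc K (g%:M) = 1%:M.
    by rewrite -scM -scalar_mxM mulVf // sc1.
  by move=> E; rewrite -[LHS]mul1mx -E -mulmxA gW.
exists w, S, S'; split=> //.
- by apply/crepP; rewrite wW; split.
- by case: (ui) => n0 _; split=> // T /interP; rewrite wW; exact: WI.
- apply/interP; rewrite wW -SW; congr (_ *m _); apply/matrixP => i j.
  by rewrite ubik !mxE.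
Qed.

End Conjugate.

(** * The counit and the cup vectors *)

Section Schur.
Variables (R : realType) (mt : tensor_choice R) (K : compact_qg mt).

Lemma schur n m (u : 'M[K]_n) (v : 'M[K]_m) T : unitary_corep u -> unitary_corep v ->
  irreducible u -> irreducible v -> intertwiner u v T -> T != 0 -> corep_equiv u v.
Proof.
move=> /crepP[_ u1 u2] /crepP[_ v1 v2] [n0 ui] [m0 vi] iT T0.
have hT := proj1 (interP u v T) iT; set U := map_mx _ u in u1 u2 hT; set V := map_mx _ v in v1 v2 hT.
have hT' : sc K (ct T) *m V = U *m sc K (ct T).
  have := congr1 (@ma _ _ _ _) hT; rewrite !maM ma_sc => h.
  have := congr1 (fun X => U *m X *m V) h; rewrite /= !mulmxA u2 mul1mx.
  by rewrite -(mulmxA (U *m _)) v1 mulmx1.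
have /is_scalar_mxP[a aE] : is_scalar_mx (ct T *m T).
  by apply: ui; apply/interP; rewrite -/U scM -mulmxA hT mulmxA hT' mulmxA.
have /is_scalar_mxP[b bE] : is_scalar_mx (T *m ct T).
  by apply: vi; apply/interP; rewrite -/V scM -mulmxA hT' mulmxA hT mulmxA.
have a0 : a != 0.
  apply: contra T0 => /eqP a0; apply/eqP/matrixP => i j; rewrite mxE.
  have : (ct T *m T) j j = 0 by rewrite aE a0 mxE mul0rn.
  rewrite mxE => /psumr_eq0P z; have : ct T j i * T i j = 0.
    by apply: z => // k _; rewrite !mxE /= mulrC mul_conjC_ge0.
  by rewrite !mxE /= mulrC => /eqP; rewrite mul_conjC_eq0 => /eqP.
have ab : b = a.
  have : a *: T = b *: T by rewrite -!mul_scalar_mx -bE -mulmxA aE mul_mx_scalar mul_scalar_mx.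
  move=> /eqP; rewrite -subr_eq0 -scalerBl scaler_eq0 (negbTE T0) orbF subr_eq0 => /eqP ->//.
exists T, (a^-1 *: ct T); split=> //.
  by rewrite -scalemxAr bE ab scale_scalar_mx mulVf.
by rewrite -scalemxAl aE scale_scalar_mx mulVf.
Qed.
End Schur.

Section Discrete.
Variables (R : realType) (mt : tensor_choice R) (G : discrete_qg mt).
Local Notation "X ⊗ Y" := (tensor_alg (mt X Y)) (at level 40, left associativity).
Local Notation K := (qg_dual G).
Local Notation e := (cqg_unit K).
Local Notation A := (C0 G).
Local Notation Delta := (@comul R mt G).
Local Notation W := (Wdual G).
Let eU : is_unit e. Proof. exact: cqg_unitP. Qed.
Let ie : incl e = 1. Proof. exact: unit_incl. Qed.
Let hD : starhom Delta. Proof. by case: (comul_bialg G). Qed.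
Let nD : nondegenerate Delta. Proof. by case: (comul_bialg G). Qed.

Definition mus (p : {a : irr G & ('I_(dimi a) * 'I_(dimi a))%type}) : A :=
  mu (tagged p).1 (tagged p).2.
Definition mi (a : irr G) (i j : 'I_(dimi a)) : {a : irr G & ('I_(dimi a) * 'I_(dimi a))%type} :=
  Tagged (fun a => ('I_(dimi a) * 'I_(dimi a))%type) (i, j).

Lemma mus_dense : dense_by mus.
Proof.
apply: dense_by_img (dense_spanP (@mu_dense _ _ G)) _ => -[x [a [i [j h]]]].
by exists (mi i j); rewrite /= h.
Qed.

Lemma blin_mu (W' : completeNormedModType R[i]) (f g : A -> W') x : blin f -> blin g ->
  (forall a i j, f (mu (a := a) i j) = g (mu i j)) -> f x = g x.
Proof. by move=> bf bg h; apply: (blin_eq mus_dense) => // -[a [i j]]; exact: h. Qed.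

Lemma vecf_neq0 (X : cstar R) (x : X) : x != 0 -> exists2 chi, vecf chi & chi x != 0.
Proof.
move=> x0; apply: contrapT => h; move/eqP: x0; apply.
apply: pos_sep => chi pc; apply: contrapT => /eqP c0; apply: h.
by exists chi => //; exact: pvec_vecf.
Qed.

(** A scaled vector functional reads off the factor; f maps the matrix units, hence by density all
    of A, into the line of z. *)
Lemma scalar_functional (f : A -> A) z : blin f -> z != 0 ->
  (forall a i j, exists c, f (mu (a := a) i j) = c *: z) ->
  exists2 tau : A -> R[i], linear (tau : A -> R[i]^o) & forall x, f x = tau x *: z.
Proof.
move=> bf z0 h; have [chi vc c0] := vecf_neq0 z0; have [lf _] := bf.
exists (fun x => chi (f x) / chi z) => [k x y|x].
  by rewrite lf (vecf_lin vc) mulrDl /GRing.scale /= mulrA.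
apply: (blin_mu (f := f) (g := fun x => (chi (f x) / chi z) *: z)) => // [|a i j].
  split=> [k u v|].
    by rewrite lf (vecf_lin vc) mulrDl scalerDl scalerA mulrA.
  have [b b0 hb] := vecf_bnd vc; have [_ [c [cc hc]]] := bf.
  exists (b * c * nc ((chi z)^-1) * nr z); split=> [|v].
    by rewrite !mulr_ge0 ?nc_ge0 ?nr_ge0.
  have le : nc (chi (f v)) <= b * c * nr v.
    by apply: le_trans (hb _) _; rewrite -mulrA ler_wpM2l.
  rewrite (nrZ (chi (f v) / chi z) z) ncM.
  rewrite (_ : b * c * _ * _ * _ = b * c * nr v * nc ((chi z)^-1) * nr z); last by ring.
  by rewrite !ler_wpM2r ?nr_ge0 ?nc_ge0.
by have [c ->] := h a i j; rewrite (vecfZ _ _ vc) mulfK.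
Qed.

Lemma mu_cross (a b : irr G) (i j : 'I_(dimi a)) (k l : 'I_(dimi b)) x :
  a <> b -> mu i j ** x ** mu k l = 0.
Proof.
move=> ab; apply: (blin_mu (f := fun x => mu i j ** x ** mu k l) (g := fun=> 0)) => [||c r s].
- exact: (blin_comp (blin_mull _) (blin_mulr _)).
- exact: blin0.
have [ac|ac] := pselect (a = c).
  by subst c; rewrite mu_mul; case: eqP => _; rewrite ?cmul0l // mu_orth.
by rewrite mu_orth // cmul0l.
Qed.

(** e_ss z e_xx is a multiple of e_sx: this holds for matrix units z and passes to limits. The
    factor is the (s, x) coefficient of z in the block of a. *)
Lemma mu_block (a : irr G) (s x : 'I_(dimi a)) : exists2 tau : A -> R[i],
  linear (tau : A -> R[i]^o) & forall z r y, mu r s ** z ** mu x y = tau z *: mu r y.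
Proof.
have [|c i j|tau tl tP] := @scalar_functional (fun z => mu s s ** z ** mu x x) (mu s x) _ (mu_neq0 s x).
- exact: (blin_comp (blin_mull _) (blin_mulr _)).
- have [ac|ac] := pselect (a = c); last by exists 0; rewrite mu_orth // cmul0l scale0r.
  subst c; rewrite mu_mul; case: eqP => _; last by exists 0; rewrite cmul0l scale0r.
  by rewrite mu_mul; case: eqP => _; [exists 1; rewrite scale1r|exists 0; rewrite scale0r].
exists tau => // z r y.
have -> : mu r s ** z ** mu x y = mu r s ** (mu s s ** z ** mu x x) ** mu x y.
  have e1 : mu r s = mu r s ** mu s s by rewrite mu_mul eqxx.
  have e2 : mu x y = mu x x ** mu x y by rewrite mu_mul eqxx.
  by rewrite {1}e1 {1}e2 !cmulA.
by rewrite tP cmulZr cmulZl !mu_mul eqxx mu_mul eqxx.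
Qed.

Lemma mu_eq0 (z : A) : (forall a i j, mu (a := a) i j ** z = 0) -> z = 0.
Proof.
move=> h; apply: cmul_faithl => c; rewrite cmul0r.
by apply: (blin_mu (f := fun c => c ** z) (g := fun=> 0)); [exact: blin_mulr|exact: blin0|].
Qed.

Lemma mult_mu_eq (m n : multiplier A) : (forall a i j b k l,
   mu (a := a) i j ** mL m (mu (a := b) k l) = mu i j ** mL n (mu k l)) -> m = n.
Proof.
move=> h; apply: mult_eqL => v.
apply: (blin_mu (f := mL m) (g := mL n)) => [||b k l]; try exact: blin_mL.
by apply/eqP; rewrite -subr_eq0; apply/eqP/mu_eq0 => a i j; rewrite cmulBr h subrr.
Qed.

Lemma Wmul (a : irr G) (k l : 'I_(dimi a)) :
  W * leg1 (incl (mu k l)) = \sum_i leg1 (incl (mu i l)) * leg2 (incl (irrep a i k)).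
Proof.
rewrite Wdual_irrep incl_sum; apply: eq_bigr => i _; by rewrite leg_tens.
Qed.

(** [Wdual_irrep] describes W times a matrix unit; multiplying both sides here by mu r s on the
    right reduces the claim to it. *)
Lemma mulW (a : irr G) (k l : 'I_(dimi a)) :
  leg1 (incl (mu k l)) * W = \sum_j leg1 (incl (mu k j)) * leg2 (incl (irrep a l j)).
Proof.
apply: (nondeg_eq (@nondeg_l1 _ A K (mt A K))) => x.
apply: mult_eqL => v.
apply: (blin_mu (f := fun x => mL (leg1 (incl (mu k l)) * W * leg1 (incl x)) v)
 (g := fun x => mL ((\sum_j leg1 (incl (mu k j)) * leg2 (incl (irrep a l j))) * leg1 (incl x)) v)) => [||b r s].
- exact: (blin_comp (blin_hom _ (@starhom_l1 _ A K (mt A K))) (blin_mL _)).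
- exact: (blin_comp (blin_hom _ (@starhom_l1 _ A K (mt A K))) (blin_mL _)).
congr (mL _ v); rewrite -mulrA Wmul mulr_sumr mulr_suml.
have [ab|ab] := pselect (a = b); last first.
  rewrite !big1 // => i _.
    by rewrite -mulrA -legC mulrA -leg1M -inclM mu_orth // incl0 leg1_0 mul0r.
  by rewrite mulrA -leg1M -inclM mu_orth // incl0 leg1_0 mul0r.
subst b; rewrite (bigD1 l) //= [in RHS](bigD1 r) //= !big1 ?addr0 => [|j jl|j jl].
- by rewrite mulrA -leg1M -inclM -mulrA -legC mulrA -leg1M -inclM !mu_mul !eqxx.
- by rewrite -mulrA -legC mulrA -leg1M -inclM mu_mul (negbTE jl) incl0 leg1_0 mul0r.
by rewrite mulrA -leg1M -inclM mu_mul eq_sym (negbTE jl) incl0 leg1_0 mul0r.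
Qed.
(* Schur's lemma on the coefficients of E(mu k l) in the blocks of A. *)
Lemma mL_suml (X : cstar R) (I : Type) (r : seq I) (P : pred I) (f : I -> multiplier X) v :
  mL (\sum_(i <- r | P i) f i) v = \sum_(i <- r | P i) mL (f i) v.
Proof. exact: (big_morph (fun m : multiplier X => mL m v)). Qed.

Lemma ext_sum (X Y : cstar R) (phi : X -> multiplier Y) (hp : starhom phi) (nd : nondegenerate phi)
  (I : Type) (r : seq I) (P : pred I) (f : I -> multiplier X) :
  ext phi (\sum_(i <- r | P i) f i) = \sum_(i <- r | P i) ext phi (f i).
Proof.
apply: (big_morph (ext phi) (extD hp nd)).
by rewrite -incl0 ext_incl //; case: hp => l _ _; rewrite (lin0 l).
Qed.

Section FixW.
Variable E : A -> multiplier A.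
Hypotheses (hE : starhom E) (nE : nondegenerate E) (EW : ext (@tens_id R mt A A K E) W = W).

Let tE := @tens_id_hom R mt A A K E hE.
Let nt := @tens_id_nondeg R mt A A K E hE nE.

Lemma EW_mul (a : irr G) (k l : 'I_(dimi a)) :
  W * leg1 (E (mu k l)) = \sum_i leg1 (E (mu i l)) * leg2 (incl (irrep a i k)).
Proof.
rewrite -{1}EW -(ext_incl hE nE) -(ext_tens_id_leg1 mt K hE nE) -(extM tE nt) Wmul.
rewrite (ext_sum tE nt); apply: eq_bigr => i _.
by rewrite (extM tE nt) (ext_tens_id_leg1 mt K hE nE) (ext_tens_id_leg2 mt hE nE) ext_incl.
Qed.

Lemma EW_mulr (a : irr G) (k l : 'I_(dimi a)) :
  leg1 (E (mu k l)) * W = \sum_j leg1 (E (mu k j)) * leg2 (incl (irrep a l j)).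
Proof.
rewrite -{1}EW -(ext_incl hE nE) -(ext_tens_id_leg1 mt K hE nE) -(extM tE nt) mulW.
rewrite (ext_sum tE nt); apply: eq_bigr => i _.
by rewrite (extM tE nt) (ext_tens_id_leg1 mt K hE nE) (ext_tens_id_leg2 mt hE nE) ext_incl.
Qed.

Lemma tens_mu_inj (a : irr G) (i j : 'I_(dimi a)) (x y : K) :
  tens (mu i j) x = tens (mu i j) y :> A ⊗ K -> x = y.
Proof.
move=> h; have [chi vc c0] := vecf_neq0 (mu_neq0 i j).
have := congr1 (slice2 (T := mt A K) chi) h; rewrite !slice2_tens // => /(congr1 (fun v => (chi (mu i j))^-1 *: v)).
by rewrite !scalerA mulVf // !scale1r.
Qed.

Lemma E_inter (a b : irr G) (s x : 'I_(dimi b)) : exists2 t : 'I_(dimi a) -> 'I_(dimi a) -> R[i],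
  (forall k l r y, mu r s ** mL (E (mu k l)) (mu x y) = t k l *: mu r y) & True.
Proof.
have [tau _ h] := mu_block s x; exists (fun k l => tau (mL (E (mu k l)) (mu x x))) => // k l r y.
rewrite -h -cmulA; congr (_ ** _).
by have e2 : mu x y = mu x x ** mu x y; rewrite ?mu_mul ?eqxx // [in LHS]e2 mLM.
Qed.

(** t records the coefficients of E (mu k l) in each block. Comparing [EW_mul] with [mulW] makes
    them intertwine irrep a with irrep b in one pair of indices; comparing [EW_mulr] with [Wmul]
    makes them intertwine irrep a with itself in the other. Schur's lemma leaves one scalar and only
    the block of a. *)
Lemma E_mu (a : irr G) : exists c : R[i], forall k l : 'I_(dimi a), E (mu k l) = c *: incl (mu k l).
Proof.
have /choice[t ht] : forall sx : {b : irr G & ('I_(dimi b) * 'I_(dimi b))%type},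
   exists t : 'I_(dimi a) -> 'I_(dimi a) -> R[i],
  (forall k l r y, mu r (tagged sx).1 ** mL (E (mu k l)) (mu (tagged sx).2 y) = t k l *: mu r y).
  by move=> [b [s x]]; have [t h _] := E_inter a s x; exists t.
have {}ht (b : irr G) (s x : 'I_(dimi b)) k l r y :
  mu r s ** mL (E (mu k l)) (mu x y) = t (mi s x) k l *: mu r y by exact: (ht (mi s x)).
have I1 (b : irr G) (l : 'I_(dimi a)) (x : 'I_(dimi b)) :
    intertwiner (irrep a) (irrep b) (\matrix_(s, i) t (mi s x) i l).
  move=> s k; apply: (@tens_mu_inj b s x); rewrite !tens_sumr.
  transitivity (mL (leg1 (incl (mu s s)) * (\sum_i leg1 (E (mu i l)) * leg2 (incl (irrep a i k))))
     (tens (mu x x) e : A ⊗ K)).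
    rewrite mulr_sumr mL_suml; apply: eq_bigr => i _.
    rewrite !mL_mul leg2P !leg1P !mL_incl; have [_ ->] := eU (irrep a i k).
    by rewrite ht mxE tensZr tensZl.
  rewrite -EW_mul mulrA mulW mulr_suml mL_suml; apply: eq_bigr => j _.
  rewrite -mulrA -legC !mL_mul leg2P !leg1P !mL_incl; have [_ ->] := eU (irrep b s j).
  by rewrite ht mxE tensZr tensZl.
have [n0 ua] := @irrep_irr _ _ G a; pose i0 := Ordinal n0.
pose tau l x := t (mi i0 x) i0 l.
have tE1 s x i l : t (mi s x) i l = if s == i then tau l x else 0.
  have /is_scalar_mxP[c /matrixP hc] := ua _ (I1 a l x).
  have := hc i0 i0; have := hc s i; rewrite !mxE eqxx -/(tau l x) => -> ->.
  by case: eqP.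
have I2 : intertwiner (irrep a) (irrep a) (\matrix_(l, i) tau l i).
  move=> l x; apply: (@tens_mu_inj a i0 i0); rewrite !tens_sumr.
  transitivity (mL (leg1 (incl (mu i0 i0)) * leg1 (E (mu i0 l)) * W * leg1 (incl (mu x i0)))
     (tens (mu i0 i0) e : A ⊗ K)).
    rewrite -mulrA Wmul mulr_sumr mL_suml; apply: eq_bigr => i _.
    rewrite !mL_mul leg2P !leg1P !mL_incl; have [_ ->] := eU (irrep a i x).
    by rewrite mu_mul eqxx ht mxE tE1 eqxx tensZr tensZl.
  rewrite -(mulrA (leg1 (incl (mu i0 i0)))) EW_mulr mulr_sumr mulr_suml mL_suml; apply: eq_bigr => j _.
  rewrite !mL_mul leg1P leg2P !leg1P !mL_incl; have [_ ->] := eU (irrep a l j).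
  by rewrite mu_mul eqxx ht mxE tE1 eqxx tensZr tensZl.
have /is_scalar_mxP[c /matrixP hc] := ua _ I2.
exists c => k l; apply: mult_mu_eq => b r s b' x y.
rewrite [mL (c *: _) _]/= cmulZr.
have [bb|bb] := pselect (b = b'); last first.
  have e2 : mu x y = mu x x ** mu x y by rewrite mu_mul eqxx.
  by rewrite [in LHS]e2 mLM !cmulA mu_cross // mu_cross // scaler0.
subst b'; have [ab|ab] := pselect (a = b); last first.
  rewrite (mu_orth _ _ _ _ ab).
  rewrite cmul0r scaler0 ht.
  have /matrixP/(_ s k) : \matrix_(s, i) t (mi s x) i l = 0.
    apply/eqP; apply: contrapT => /negP ne; apply: ab; apply: irrep_inj.
    by apply: schur (I1 b l x) ne; [exact: irrep_unitary|exact: irrep_unitary|exact: irrep_irr|exact: irrep_irr].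
  by rewrite !mxE => ->; rewrite scale0r.
subst b; rewrite ht tE1.
have := hc l x; rewrite !mxE => ->; rewrite !mu_mul.
by case: (l == x); rewrite ?cmul0r ?mu_mul; case: (s == k); rewrite ?scaler0 ?scale0r ?mulr1n ?mulr0n ?scale0r.
Qed.

(** The scalar c of a block satisfies c = c^2 by multiplicativity; c = 0 would make mu k k
    annihilate the range of E, against nondegeneracy. *)
Lemma E_incl : E = incl.
Proof.
apply: (starhom_eq_dense mus_dense hE (@starhom_incl _ A)) => -[a [k l]] /=.
have [c hc] := E_mu a; rewrite /mus /= hc.
suff -> : c = 1 by rewrite scale1r.
have [_ EM _] := hE.
have cc : c = c * c.
  have h := EM (mu k k) (mu k k); rewrite mu_mul eqxx !hc mscaleAl mscaleAr -inclM mu_mul eqxx scalerA in h.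
  move/eqP: h; rewrite -subr_eq0 -scalerBl -inclZ -incl0 => /eqP/incl_inj/eqP.
  by rewrite scaler_eq0 (negbTE (mu_neq0 k k)) orbF subr_eq0 => /eqP.
have [c0|c0] := eqVneq c 0; last by apply: (mulfI c0); rewrite -cc mulr1.
have /incl_inj/eqP : incl (mu k k) = incl 0; last by rewrite (negbTE (mu_neq0 k k)).
rewrite incl0; apply: (nondeg_eq nE) => x; apply: mult_eqL => v.
apply: (blin_mu (f := fun x => mL (incl (mu k k) * E x) v) (g := fun x => mL (0 * E x) v)) => [||b r s].
- exact: (blin_comp (blin_hom _ hE) (blin_mL _)).
- exact: (blin_comp (blin_hom _ hE) (blin_mL _)).
congr (mL _ v); rewrite mul0r; have [ab|ab] := pselect (a = b).
  by subst b; rewrite hc c0 scale0r mulr0.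
by have [c' ->] := E_mu b; rewrite mscaleAr -inclM mu_orth // incl0 scaler0.
Qed.
End FixW.

(** The one-dimensional corepresentation e is equivalent to some irrep a0, which is then an identity
    matrix. The diagonal matrix unit at i0 intertwines it with itself, so by irreducibility i0 is
    the only index. *)
Lemma trivial_irr : exists a0 : irr G, exists i0 : 'I_(dimi a0),
  (forall i : 'I_(dimi a0), i = i0) /\ irrep a0 i0 i0 = e.
Proof.
pose u0 : 'M[K]_1 := const_mx e.
have e1 : e ** e = e by case: (eU e).
have uu : unitary_corep u0.
  split=> i j; rewrite ?big_ord1 !mxE ?(adje eU) ?e1 ?ord1 ?eqxx //.
  rewrite -(incl_D0 e); congr incl; case: (D0_comult K) => _ _ _ -> _.
  by [].
have ui : irreducible u0.
  split=> // T _; apply/is_scalar_mxP; exists (T 0 0); apply/matrixP => i j.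
  by rewrite !ord1 mxE eqxx.
have [a0 [T [S [iT TS ST]]]] := irrep_all uu ui.
have [n0 ua] := @irrep_irr _ _ G a0; pose i0 := Ordinal n0.
have uE i j : irrep a0 i j = if i == j then e else 0.
  transitivity (\sum_k (\sum_l T k l * S l j) *: irrep a0 i k).
    rewrite (bigD1 j) //= [X in _ + X]big1 ?addr0 => [|k kj].
      by have /matrixP/(_ j j) := TS; rewrite !mxE eqxx => ->; rewrite scale1r.
    by have /matrixP/(_ k j) := TS; rewrite !mxE (negbTE kj) => ->; rewrite scale0r.
  under eq_bigr do rewrite big_ord1.
  have := iT i 0; rewrite big_ord1 mxE => h.
  under eq_bigr do rewrite mulrC -scalerA.
  rewrite -scaler_sumr -h scalerA mulrC.
  have /matrixP/(_ i j) := TS; rewrite !mxE big_ord1 => ->.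
  by case: eqP; rewrite ?scale1r ?scale0r.
exists a0, i0; split; last by rewrite uE eqxx.
move=> i; apply: contrapT => /eqP ii.
have /ua/is_scalar_mxP[c /matrixP hc] : intertwiner (irrep a0) (irrep a0) (delta_mx i0 i0).
  move=> k l; rewrite (bigD1 l) //= big1 ?addr0 => [|m ml].
    rewrite [RHS](bigD1 k) //= [in RHS]big1 ?addr0 => [|m mk].
      by rewrite !uE !eqxx.
    by rewrite uE eq_sym (negbTE mk) scaler0.
  by rewrite uE (negbTE ml) scaler0.
have := hc i0 i0; have := hc i i; rewrite !mxE !eqxx (negbTE ii) /= => <- /eqP.
by rewrite oner_eq0.
Qed.

(* The support projection of the counit is the matrix unit of the trivial
   corepresentation. *)
Lemma counit_ex : exists (a0 : irr G) (i0 : 'I_(dimi a0)) (eps : A -> R[i]),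
  [/\ counit Delta eps, (forall i : 'I_(dimi a0), i = i0), irrep a0 i0 i0 = e &
      forall x, x ** mu i0 i0 = eps x *: mu i0 i0].
Proof.
have [a0 [i0 [ii u0]]] := trivial_irr; set m0 := mu i0 i0.
have hmu a (k l : 'I_(dimi a)) : exists c : R[i], m0 ** mu k l = c *: m0 /\ mu k l ** m0 = c *: m0.
  have [ab|ab] := pselect (a = a0).
    by subst a0; exists 1; rewrite scale1r (ii k) (ii l) mu_mul eqxx.
  by exists 0; rewrite scale0r !mu_orth //; move=> /esym.
have [|eps el eP] := @scalar_functional (fun x => m0 ** x) m0 (blin_mull _) (mu_neq0 i0 i0).
  by move=> a k l; have [c [h _]] := hmu a k l; exists c.
have eP' x : x ** m0 = eps x *: m0.
  have [eps' el' eP'] : exists2 eps' : A -> R[i], linear (eps' : A -> R[i]^o) & forall x, x ** m0 = eps' x *: m0.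
    apply: (@scalar_functional (fun x => x ** m0) m0 (blin_mulr _) (mu_neq0 i0 i0)).
    by move=> a k l; have [c [_ h]] := hmu a k l; exists c.
  have mm : m0 ** m0 = m0 by rewrite mu_mul eqxx.
  have : m0 ** x ** m0 = m0 ** (x ** m0) by rewrite cmulA.
  by rewrite (eP x) (eP' x) cmulZl cmulZr mm => ->.
have m0n : m0 != 0 := mu_neq0 i0 i0.
have inj c c' : c *: m0 = c' *: m0 -> c = c'.
  by move=> /eqP; rewrite -subr_eq0 -scalerBl scaler_eq0 (negbTE m0n) orbF subr_eq0 => /eqP.
have ce : character eps.
  split=> // [a b|a|].
  - by apply: inj; rewrite -eP cmulA eP cmulZl eP scalerA.
  - apply: inj; rewrite -eP; have := congr1 cadj (eP' a); rewrite cadjM cadjZ mu_adj.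
    by [].
  exists m0; apply/eqP => z; have := eP m0; rewrite z scale0r mu_mul eqxx => /eqP.
  by rewrite (negbTE m0n).
pose F0 (x : A) : multiplier A := eps x *: (1 : multiplier A).
have hF0 : starhom F0 by exact: starhom_char.
have e0 : eps m0 = 1 by apply: inj; rewrite -eP mu_mul eqxx scale1r.
have nF0 : nondegenerate F0.
  apply: (dense_by_span (@id_dense _ A)) => x; exists m0, x.
  by rewrite /F0 e0 scale1r.
have tF := @tens_id_hom R mt A A K F0 hF0; have nt := @tens_id_nondeg R mt A A K F0 hF0 nF0.
(* (eps ⊗ id)(W) = 1, since the block of a0 in W is m0 ⊗ e. *)
have W1 : ext (@tens_id R mt A A K F0) W = 1.
  apply: (nondeg_eq (@nondeg_l2 _ A K (mt A K))) => k; rewrite mul1r.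
  have E : leg2 (incl k) = @tens_id R mt A A K F0 (tens m0 k).
    by rewrite tens_idE // /F0 e0 scale1r leg1_1 mul1r.
  rewrite E -(ext_incl tF nt) -extM // -leg_tens mulrA Wmul; congr ext; congr (_ * _).
  rewrite (bigD1 i0) //= big1 ?addr0 => [|j /eqP]; last by rewrite (ii j).
  by rewrite u0 ie leg2_1 mulr1.
have [hi ni] := eps_idP mt ce; have hi2 := id_eps_hom mt ce A; have ni2 := id_eps_nondeg mt ce A.
have h13 := @tens_id_hom R mt A (A ⊗ A) K _ (@starhom_l1 _ A A (mt A A)).
have n13 := @tens_id_nondeg R mt A (A ⊗ A) K _ (@starhom_l1 _ A A (mt A A)) (@nondeg_l1 _ A A (mt A A)).
have h23 := @tens_id_hom R mt A (A ⊗ A) K _ (@starhom_l2 _ A A (mt A A)).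
have n23 := @tens_id_nondeg R mt A (A ⊗ A) K _ (@starhom_l2 _ A A (mt A A)) (@nondeg_l2 _ A A (mt A A)).
have tD := @tens_id_hom R mt A (A ⊗ A) K _ hD; have ntD := @tens_id_nondeg R mt A (A ⊗ A) K _ hD nD.
(* For E = psi Delta the relation for (Delta ⊗ id)(W) gives (E ⊗ id)(W) as a product of the images
   of W under f ⊗ id and g ⊗ id. In both uses one factor is 1 and the other W, so [E_incl]
   applies. *)
have key (psi : A ⊗ A -> multiplier A) (hp : starhom psi) (np : nondegenerate psi) f g :
    (fun x => ext psi (leg1 (incl x))) = f -> (fun x => ext psi (leg2 (incl x))) = g ->
    ext (@tens_id R mt A A K f) W * ext (@tens_id R mt A A K g) W = W ->
    (fun x => ext psi (Delta x)) = incl.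
  move=> ef eg h.
  have tp := @tens_id_hom R mt (A ⊗ A) A K _ hp; have ntp := @tens_id_nondeg R mt (A ⊗ A) A K _ hp np.
  apply: E_incl; [exact: starhom_ext|exact: nondeg_comp|].
  rewrite tens_id_comp // ext_comp // Wdual_comul extM // -[RHS]h -ef -eg.
  rewrite !tens_id_comp //; try exact: starhom_l1; try exact: starhom_l2.
  by rewrite !ext_comp.
have tiW : ext (@tens_id R mt A A K incl) W = W.
  have -> : @tens_id R mt A A K incl = incl; last exact: ext_id.
  apply: starhom_eq_tens; [exact/tens_id_hom/starhom_incl|exact: starhom_incl|].
  by move=> x y; rewrite tens_idE ?leg_tens //; exact: starhom_incl.
exists a0, i0, eps; split=> //.
split=> [//|a|a].
- have := @key (@eps_id R mt A eps) hi ni F0 incl.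
  move=> /(_ _ _ _)/(congr1 (fun f => f a)); apply.
  + by apply/funext => x; exact: (ext_char_leg1 (mt A A) ce).
  + by apply/funext => x; exact: (ext_char_leg2 (mt A A) ce).
  + by rewrite W1 mul1r.
- have := @key (@id_eps R mt A A eps) hi2 ni2 incl F0.
  move=> /(_ _ _ _)/(congr1 (fun f => f a)); apply.
  + by apply/funext => x; rewrite (ext_id_eps_leg1 mt ce).
  + by apply/funext => x; rewrite (ext_id_eps_leg2 mt ce).
  + by rewrite W1 mulr1.
Qed.
Section Cup.
Variables (a b : irr G) (Q : 'M[R[i]]_(dimi b, dimi a)).
Hypothesis iQ : intertwiner (map_mx cadj (irrep a)) (irrep b) Q.

(* The element of I_a (x) I_b given by the invariant vector Q of
   irrep a (x) irrep b. *)
Definition cup x y : A ⊗ A := \sum_k \sum_l Q l k *: tens (mu k x) (mu l y).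

Let h23 := emb23_hom mt A A K.
Let n23 := emb23_nondeg mt A A K.
Let h13 := @tens_id_hom R mt A (A ⊗ A) K _ (@starhom_l1 _ A A (mt A A)).
Let n13 := @tens_id_nondeg R mt A (A ⊗ A) K _ (@starhom_l1 _ A A (mt A A)) (@nondeg_l1 _ A A (mt A A)).
Local Notation W13 := (ext (@emb13 R mt A A K) W).
Local Notation W23 := (ext (@emb23 R mt A A K) W).

Lemma W13_mul (k x : 'I_(dimi a)) : W13 * leg1 (leg1 (incl (mu k x))) =
  \sum_i leg1 (leg1 (incl (mu i x))) * leg2 (incl (irrep a i k)).
Proof.
have E m : leg1 (leg1 m) = ext (@emb13 R mt A A K) (leg1 m).
  rewrite -(ext_l1 (mt A A) m); symmetry.
  exact: (ext_tens_id_leg1 mt K (@starhom_l1 _ A A (mt A A)) (@nondeg_l1 _ A A (mt A A)) m).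
have E2 m : leg2 m = ext (@emb13 R mt A A K) (leg2 m).
  symmetry; exact: (ext_tens_id_leg2 mt (@starhom_l1 _ A A (mt A A)) (@nondeg_l1 _ A A (mt A A)) m).
rewrite E -(extM h13 n13) Wmul (ext_sum h13 n13); apply: eq_bigr => i _.
by rewrite (extM h13 n13) -E -E2.
Qed.

Lemma W23_mul (l y : 'I_(dimi b)) : W23 * leg1 (leg2 (incl (mu l y))) =
  \sum_j leg1 (leg2 (incl (mu j y))) * leg2 (incl (irrep b j l)).
Proof.
rewrite -(ext_emb23_leg1 mt A) -(extM h23 n23) Wmul (ext_sum h23 n23); apply: eq_bigr => i _.
by rewrite (extM h23 n23) ext_emb23_leg1 ext_emb23_leg2.
Qed.

(** The new coefficient at mu i x ⊗ mu j y is sum_kl Q_lk u_ik v_jl. As Q intertwines the conjugate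
    of u with v, this is the sum over l of Q_jl times the (i, l) entry of u u^*, that is Q_ji. *)
Lemma cup_fixed x y : W13 * W23 * leg1 (incl (cup x y)) = leg1 (incl (cup x y)).
Proof.
have comm (z : A) : leg1 (leg1 (incl z)) * W23 = W23 * leg1 (leg1 (incl z)).
  have cm u : leg1 (leg1 (incl z)) * @emb23 R mt A A K u = emb23 A u * leg1 (leg1 (incl z)).
    exact: e23_comm.
  apply: (nondeg_eq n23) => t.
  by rewrite -mulrA extP // -[RHS]mulrA !cm mulrA extP.
have cupE : leg1 (incl (cup x y)) = \sum_k \sum_l Q l k *: (leg1 (leg1 (incl (mu k x))) * leg1 (leg2 (incl (mu l y)))) :> multiplier (A ⊗ A ⊗ K).
  rewrite /cup incl_sum (big_morph _ (@leg1D _ _ _ _) (@leg1_0 _ _ _ _)); apply: eq_bigr => k _.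
  rewrite incl_sum (big_morph _ (@leg1D _ _ _ _) (@leg1_0 _ _ _ _)); apply: eq_bigr => l _.
  by rewrite inclZ leg1Z -leg_tens leg1M.
rewrite cupE mulr_sumr.
transitivity (\sum_k \sum_l \sum_i \sum_j Q l k *: (leg1 (leg1 (incl (mu i x))) * leg1 (leg2 (incl (mu j y))) *
    leg2 (incl (irrep a i k ** irrep b j l))) : multiplier (A ⊗ A ⊗ K)).
  apply: eq_bigr => k _; rewrite mulr_sumr; apply: eq_bigr => l _.
  rewrite mscaleAr; under [RHS]eq_bigr do rewrite -scaler_sumr.
  rewrite -scaler_sumr; congr (_ *: _).
  rewrite -mulrA [W23 * _]mulrA -comm -mulrA W23_mul mulrA W13_mul mulr_suml.
  apply: eq_bigr => i _; rewrite mulr_sumr; apply: eq_bigr => j _.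
  rewrite -!mulrA inclM leg2M; congr (_ * _); rewrite !mulrA; congr (_ * _).
  by rewrite legC.
have uQ i j : \sum_k \sum_l Q l k *: (irrep a i k ** irrep b j l) = Q j i *: e.
  have [_ _ /(_ i) uu] := irrep_unitary a.
  transitivity (\sum_k \sum_l Q j l *: (irrep a i k ** cadj (irrep a l k))).
    apply: eq_bigr => k _; have /(congr1 (fun z => irrep a i k ** z)) := iQ j k.
    rewrite !cmul_sumr => h; transitivity (\sum_l irrep a i k ** (Q l k *: irrep b j l)).
      by apply: eq_bigr => l _; rewrite cmulZr.
    by rewrite -h; apply: eq_bigr => l _; rewrite cmulZr mxE.
  rewrite exchange_big (bigD1 i) //= [X in _ + X]big1 ?addr0 => [|l li].
    by rewrite -scaler_sumr uu eqxx.
  by rewrite -scaler_sumr uu eq_sym (negbTE li) scaler0.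
under eq_bigr => k _ do rewrite exchange_big.
rewrite exchange_big; apply: eq_bigr => i _.
under eq_bigr => k _ do rewrite exchange_big.
rewrite exchange_big; apply: eq_bigr => j _ /=.
transitivity (leg1 (leg1 (incl (mu i x))) * leg1 (leg2 (incl (mu j y))) *
  leg2 (incl (\sum_k \sum_l Q l k *: (irrep a i k ** irrep b j l))) : multiplier (A ⊗ A ⊗ K)).
  rewrite incl_sum (big_morph _ (@leg2D _ _ _ _) (@leg2_0 _ _ _ _)) mulr_sumr; apply: eq_bigr => k _.
  rewrite incl_sum (big_morph _ (@leg2D _ _ _ _) (@leg2_0 _ _ _ _)) mulr_sumr; apply: eq_bigr => l _.
  by rewrite inclZ leg2Z mscaleAr.
by rewrite uQ inclZ ie leg2Z leg2_1 mscaleAr mulr1.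
Qed.

(** (Delta ⊗ id)(W) = W13 W23 fixes the cup vector, while [mulW] expands its product with Delta (mu
    k l). The family z thus transforms by irrep c and trivially at the same time. *)
Lemma cup_comul c (k l : 'I_(dimi c)) x y : let z j := mL (Delta (mu k j)) (cup x y) in
  tens (z l) e = \sum_j tens (z j) (irrep c l j) :> A ⊗ A ⊗ K.
Proof.
move=> z; have tD := @tens_id_hom R mt A (A ⊗ A) K _ hD; have ntD := @tens_id_nondeg R mt A (A ⊗ A) K _ hD nD.
apply: incl_inj; rewrite incl_sum.
transitivity (leg1 (Delta (mu k l)) * (W13 * W23) * leg1 (incl (cup x y)) : multiplier (A ⊗ A ⊗ K)).
  by rewrite -mulrA cup_fixed -leg1M mul_incl -leg_tens ie leg2_1 mulr1.
rewrite -Wdual_comul -(ext_incl hD nD) -(ext_tens_id_leg1 mt K hD nD) -(extM tD ntD) mulW.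
rewrite (ext_sum tD ntD) mulr_suml; apply: eq_bigr => j _.
rewrite (extM tD ntD) (ext_tens_id_leg1 mt K hD nD) (ext_tens_id_leg2 mt hD nD) ext_incl //.
by rewrite -mulrA -legC mulrA -leg1M mul_incl leg_tens.
Qed.

Variables (a0 : irr G) (i0 : 'I_(dimi a0)) (eps : A -> R[i]).
Hypotheses (ii : forall i, i = i0) (u0 : irrep a0 i0 i0 = e)
  (eP : forall x, x ** mu i0 i0 = eps x *: mu i0 i0).

(** By [cup_comul] the scalars chi (z j) intertwine the trivial corepresentation with irrep c, so
    they vanish by Schur's lemma. *)
Lemma cup_other c (k l : 'I_(dimi c)) x y : c <> a0 -> mL (Delta (mu k l)) (cup x y) = 0.
Proof.
move=> ca; apply: pos_sep => chi /pvec_vecf vc.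
pose t j := chi (mL (Delta (mu k j)) (cup x y)).
pose T : 'M[R[i]]_(dimi c, dimi a0) := \matrix_(j, i) t j.
have iT : intertwiner (irrep a0) (irrep c) T.
  move=> j i; rewrite (bigD1 i) //= big1 ?addr0 => [|i' /eqP]; last by rewrite (ii i) (ii i').
  rewrite (ii i) u0 mxE.
  have := congr1 (slice2 (T := mt (A ⊗ A) K) chi) (cup_comul k j x y).
  rewrite /slice2 slice_sum // -/(slice2 _ _) slice2_tens // => ->.
  by apply: eq_bigr => m _; rewrite -/(slice2 _ _) slice2_tens // mxE.
have /matrixP/(_ l i0) : T = 0; last by rewrite !mxE.
apply/eqP; apply: contrapT => /negP ne; apply: ca; apply/esym/irrep_inj.
by apply: schur iT ne; [exact: irrep_unitary|exact: irrep_unitary|exact: irrep_irr|exact: irrep_irr].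
Qed.

(** r = s - Delta(m0) s is annihilated by every Delta(w): on the trivial block because m0 is
    idempotent, on the others by [cup_other]. Nondegeneracy of Delta gives r = 0, and z m0 = eps(z)
    m0 concludes. *)
Lemma cup_counit x y z : mL (Delta z) (cup x y) = eps z *: cup x y.
Proof.
have [Dl DM Da] := hD; set s := cup x y; set m0 := mu i0 i0.
suff sE : mL (Delta m0) s = s.
  by rewrite -{1}sE -mL_mul -DM eP (linZ _ _ Dl) /= sE.
pose r := s - mL (Delta m0) s.
have r0 w : mL (Delta w) r = 0.
  apply: (blin_mu (f := fun w => mL (Delta w) r) (g := fun=> 0)) => [||c k l].
  - exact: blin_hom.
  - exact: blin0.
  rewrite /r mLB -mL_mul -DM; have [ca|ca] := pselect (c = a0).
    by subst c; rewrite (ii k) (ii l) mu_mul eqxx subrr.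
  by rewrite mu_orth // cup_other // (lin0 Dl) [mL 0 _]/= subrr.
suff : r = 0 by move=> /eqP; rewrite subr_eq0 => /eqP.
apply: (can_inj (@cadjK _ (A ⊗ A))); apply: incl_inj; rewrite cadj0 incl0.
apply: (nondeg_eq nD) => w; rewrite mul0r incl_adj -[w]cadjK Da -madjM.
by rewrite mul_incl r0 incl0 madj0.
Qed.

End Cup.

(** The left inverse Q' serves to recover matrix units from slices of cup vectors. *)
Lemma cup_exists (a : irr G) : exists (b : irr G) (Q : 'M[R[i]]_(dimi b, dimi a)) (Q' : 'M[R[i]]_(dimi a, dimi b)),
  intertwiner (map_mx cadj (irrep a)) (irrep b) Q /\ Q' *m Q = 1%:M.
Proof.
have [w [S [S' [wu wi s1 s2 iS]]]] := conjugate_unitary (irrep_unitary a) (@irrep_irr _ _ G a).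
have [b [T [T' [iT t1 t2]]]] := irrep_all wu wi.
exists b, (T *m S), (S' *m T'); split.
  apply/interP; rewrite scM -mulmxA (proj1 (interP _ _ _) iS) mulmxA.
  by rewrite (proj1 (interP _ _ _) iT) mulmxA.
by rewrite mulmxA -(mulmxA S') t2 mulmx1.
Qed.

End Discrete.

(** * Closed spans and injective homomorphisms *)

Section Closure.
Variable R : realType.
Implicit Types V W : completeNormedModType R[i].

Definition clspan V (I : Type) (s : I -> V) v := forall e : R, 0 < e -> exists l, nr (v - comb s l) < e.

Lemma clspan_gen V (I : Type) (s : I -> V) i : clspan s (s i).
Proof. by move=> e e0; exists [:: (1, i)]; rewrite comb1 subrr nr0. Qed.

Lemma clspanD V (I : Type) (s : I -> V) k v w : clspan s v -> clspan s w -> clspan s (k *: v + w).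
Proof.
move=> hv hw e e0; have k0 : 0 < nc k + 1 by rewrite ltr_wpDl ?nc_ge0.
have e2 : 0 < e / 2 by rewrite divr_gt0.
have [l hl] := hv _ (divr_gt0 e2 k0); have [l' hl'] := hw _ e2.
exists ([seq (k * p.1, p.2) | p <- l] ++ l'); rewrite comb_cat comb_scale lin_sub.
apply: le_lt_trans (nrD _ _) _; rewrite [ltRHS]splitr; apply: ler_ltD => //.
rewrite nrZ; apply: (@le_trans _ _ ((nc k + 1) * nr (v - comb s l))).
  by rewrite ler_wpM2r ?nr_ge0 // lerDl.
by rewrite mulrC -ler_pdivlMr // ltW.
Qed.

Lemma clspan_closed V (I : Type) (s : I -> V) v :
  (forall e : R, 0 < e -> exists w, clspan s w /\ nr (v - w) < e) -> clspan s v.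
Proof.
move=> h e e0; have e2 : 0 < e / 2 by rewrite divr_gt0.
have [w [cw vw]] := h _ e2; have [l hl] := cw _ e2; exists l.
rewrite (_ : v - _ = (v - w) + (w - comb s l)); last by zm.
by apply: le_lt_trans (nrD _ _) _; rewrite [ltRHS]splitr ltrD.
Qed.

(** P stands for a closed linear subspace, given by its membership predicate. *)
Lemma blin_closed V W (I : Type) (t : I -> V) (f : V -> W) (P : W -> Prop) : blin f -> dense_by t ->
  P 0 -> (forall k v w, P v -> P w -> P (k *: v + w)) ->
  (forall v, (forall e : R, 0 < e -> exists w, P w /\ nr (v - w) < e) -> P v) ->
  (forall i, P (f (t i))) -> forall x, P (f x).
Proof.
move=> [lf [c [c0 hc]]] dt P0 PD Pc h x; apply: Pc => e e0.
have c1 : 0 < c + 1 by rewrite ltr_wpDl.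
have [l hl] := dt x _ (divr_gt0 e0 c1); exists (f (comb t l)); split.
  rewrite (linear_comb _ _ lf); elim: {hl} l => [|p l IH]; first by rewrite /comb big_nil.
  by rewrite comb_cons; apply: PD => //; exact: h.
have -> : f x - f (comb t l) = f (x - comb t l).
  by have := lf (-1) (comb t l) x; rewrite !scaleN1r addrC => <-; rewrite addrC.
apply: le_lt_trans (hc _) _; apply: (@le_lt_trans _ _ ((c + 1) * nr (x - comb t l))).
  by rewrite ler_wpM2r ?nr_ge0 // lerDl.
by rewrite mulrC -ltr_pdivlMr.
Qed.

Lemma clspan0 V (I : Type) (s : I -> V) : clspan s 0.
Proof. by move=> e e0; exists [::]; rewrite /comb big_nil subrr nr0. Qed.

Lemma clspan_blin V W (I J : Type) (s : J -> W) (t : I -> V) (f : V -> W) : blin f -> dense_by t ->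
  (forall i, clspan s (f (t i))) -> forall x, clspan s (f x).
Proof.
move=> bf dt h; apply: (blin_closed (P := clspan s) bf dt) => //.
- exact: clspan0.
- exact: clspanD.
- exact: clspan_closed.
Qed.

(** Y is norm closed in M(Y), and Phi is contractive, so values in Y on a dense family spread to all
    of X. *)
Lemma hom_incl (X Y : cstar R) (I : Type) (s : I -> X) (Phi : X -> multiplier Y) : starhom Phi ->
  dense_by s -> (forall i, exists y, Phi (s i) = incl y) ->
  exists f : X -> Y, (forall x, Phi x = incl (f x)) /\ blin f.
Proof.
move=> hP ds h; have hPl : linear Phi by case: hP.
have E x : exists y, Phi x = incl y.
  apply: incl_closed => e e0; have [l hl] := ds x _ e0.
  have [y hy] : exists y, Phi (comb s l) = incl y.
    rewrite (linear_comb _ _ hPl); elim: {hl} l => [|[k i] l [y IH]].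
      by exists 0; rewrite /comb big_nil incl0.
    have [z hz] := h i; exists (k *: z + y).
    by rewrite comb_cons IH /= hz inclD inclZ.
  exists y; rewrite -hy (_ : Phi x - Phi (comb s l) = Phi (x - comb s l)); last first.
    by have := hPl (-1) (comb s l) x; rewrite !scaleN1r addrC => <-; rewrite addrC.
  by have [b0 hb] := starhom_bnd (x - comb s l) hP; split=> [|v]; [exact: ltW|apply: le_trans (hb v) _; rewrite ler_wpM2r ?nr_ge0 // ltW].
have [f fP] := choice E; exists f; split=> //; apply: blinI.
  by move=> k a b; apply: incl_inj; rewrite -fP hPl inclD inclZ -!fP.
by exists 1 => v; rewrite mul1r; apply: bnd_incl_le; rewrite -fP; exact: starhom_bnd.
Qed.

(* An injective homomorphism is isometric: the states pulled back along it
   separate points. *)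
Lemma hom_isometric (X Y : cstar R) (f : X -> Y) : starhom (fun x => incl (f x)) -> injective f ->
  forall x, nr x <= nr (f x).
Proof.
move=> hf fi x; have [fl fM fa] : [/\ linear f, forall a b, f (a ** b) = f a ** f b & forall a, f (cadj a) = cadj (f a)].
  case: hf => l M a; split=> [k u v|u v|u]; apply: incl_inj.
  - by rewrite l inclD inclZ.
  - by rewrite M inclM.
  - by rewrite a incl_adj.
apply: bnd_incl_le; apply: (@norm_by_states _ X [set phi | exists2 chi, pvec chi & phi = fun y => chi (f y)]).
- by move=> _ [chi pc ->] k u v; rewrite fl (vecf_lin (pvec_vecf pc)).
- by move=> _ [chi pc ->] z; rewrite fM fa; exact: pvec_pos.
- move=> y h; apply: cs_eq0; apply: fi; rewrite (lin0 fl); apply: pos_sep => chi pc.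
  by apply: (h (fun y => chi (f y))); exists chi.
- exact: nr_ge0.
move=> _ [chi [H [rho [xi [r ->]]]] ->] y; have [_ _ rM ra] := r.
have E z : ip (rho (cadj z ** z) xi) xi = (nr (rho z xi) ^+ 2)%:C by rewrite rM ra cadjK ip_nr.
rewrite mL_incl !(fM (cadj _)) !fa !E fM rM -rmorphM lecR -exprMn.
rewrite ler_pXn2r ?nnegrE ?mulr_ge0 ?nr_ge0 //; exact: rep_bnd.
Qed.
End Closure.

(** * The coaction *)

Section Main.
Variables (R : realType) (mt : tensor_choice R) (G : discrete_qg mt).
Local Notation "X ⊗ Y" := (tensor_alg (mt X Y)) (at level 40, left associativity).
Local Notation A := (C0 G).
Local Notation Delta := (@comul R mt G).
Let bA : cstar_bialgebra Delta. Proof. exact: comul_bialg. Qed.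
Let hD : starhom Delta. Proof. by case: bA. Qed.
Let nD : nondegenerate Delta. Proof. by case: bA. Qed.

Lemma tens_id_incl (X Y : cstar R) : @tens_id R mt X X Y incl = incl.
Proof.
apply: starhom_eq_tens; [exact/tens_id_hom/starhom_incl|exact: starhom_incl|].
by move=> x y; rewrite tens_idE ?leg_tens //; exact: starhom_incl.
Qed.

Lemma proj_ext (X Y : cstar R) (f : X -> multiplier Y) q : starhom f -> nondegenerate f ->
  projection q -> projection (ext f q).
Proof. by move=> hf nf [q1 q2]; split; rewrite -?extM // -?ext_adj ?q1 ?q2. Qed.

Lemma admissible_comul (C : cstar R) (q : multiplier (C ⊗ A)) : admissible q ->
  admissible (ext (id_tens Delta) q : multiplier (C ⊗ A ⊗ A)).
Proof.
move=> [pq cq]; have hT := @id_tens_hom R mt A C Delta hD; have nT := @id_tens_nondeg R mt A C Delta hD nD.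
have hT' := @id_tens_hom R mt A (C ⊗ A) Delta hD; have nT' := @id_tens_nondeg R mt A (C ⊗ A) Delta hD nD.
have hP := @tens_id_hom R mt _ _ A _ hT; have nP := @tens_id_nondeg R mt _ _ A _ hT nT.
split; first exact: proj_ext.
have E : ext (@tens_id R mt (C ⊗ A) (C ⊗ A ⊗ A) A (id_tens Delta)) (ext (id_tens Delta) q) =
   ext (@id_tens R mt (C ⊗ A) A Delta) (ext (id_tens Delta) q).
  rewrite -!ext_comp //; congr ext; apply/funext => t; exact: id_tens_coassoc.
have := congr1 (ext (@tens_id R mt (C ⊗ A) (C ⊗ A ⊗ A) A (id_tens Delta))) cq.
by rewrite !(extM hP nP) (ext_tens_id_leg1 mt A hT nT) E.
Qed.

Variables (B : cstar R) (oneB : B) (p : multiplier (B ⊗ A)).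
Hypothesis hp : universal_admissible oneB p.
Let oU : is_unit oneB. Proof. by case: hp. Qed.
Let io : incl oneB = 1. Proof. exact: unit_incl. Qed.
Let ap : admissible p. Proof. by case: hp. Qed.

Lemma unital_nondeg (C : cstar R) (f : B -> multiplier C) : f oneB = 1 -> nondegenerate f.
Proof.
by move=> f1; apply: (dense_by_span (@id_dense _ C)) => x; exists oneB, x; rewrite f1.
Qed.

Lemma nondeg_unital (C : cstar R) (f : B -> multiplier C) : starhom f -> nondegenerate f -> f oneB = 1.
Proof.
move=> hf nf; apply: (nondeg_eq nf) => a; case: (hf) => _ fM _.
by rewrite mul1r -fM; case: (oU a) => ->.
Qed.

Lemma universal_eq (C : cstar R) (f g : B -> multiplier C) (q : multiplier (C ⊗ A)) : admissible q ->
  starhom f -> starhom g -> nondegenerate f -> nondegenerate g ->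
  ext (tens_id f) p = q -> ext (tens_id g) p = q -> f = g.
Proof.
move=> aq hf hg nf ng ef eg; case: hp => _ _ /(_ _ q aq)[d [_ hd]].
by rewrite -(hd f) ?(hd g) //; split=> //; exact: nondeg_unital.
Qed.

Local Notation q := (ext (@id_tens R mt B A Delta) p).

Section Coaction.
Variable delta : B -> multiplier (B ⊗ A).
Hypotheses (hd : starhom delta) (d1 : delta oneB = 1) (dp : ext (tens_id delta) p = q).
Let nd : nondegenerate delta. Proof. exact: unital_nondeg. Qed.

Let hI := @id_tens_hom R mt A B Delta hD. Let nI := @id_tens_nondeg R mt A B Delta hD nD.
Let hI2 := @id_tens_hom R mt A (B ⊗ A) Delta hD. Let nI2 := @id_tens_nondeg R mt A (B ⊗ A) Delta hD nD.
Let hT := @tens_id_hom R mt _ _ A _ hd. Let nT := @tens_id_nondeg R mt _ _ A _ hd nd.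

(** Both sides send p to (id ⊗ id ⊗ Delta)(id ⊗ Delta)(p), which is admissible by two applications
    of [admissible_comul]; [id_tens_swap] and [id_tens_coassoc] bring the left and the right side to
    this form. *)
Lemma delta_coassoc b : ext (tens_id delta) (delta b) = ext (id_tens Delta) (delta b).
Proof.
pose f b := ext (tens_id delta) (delta b); pose g b := ext (id_tens Delta) (delta b).
suff : f = g by move=> /(congr1 (fun f => f b)).
have hTT := @tens_id_hom R mt _ _ A _ hT; have nTT := @tens_id_nondeg R mt _ _ A _ hT nT.
have hTI := @tens_id_hom R mt _ _ A _ hI; have nTI := @tens_id_nondeg R mt _ _ A _ hI nI.
apply: (@universal_eq _ f g (ext (@id_tens R mt (B ⊗ A) A Delta) q)).
- exact/admissible_comul/admissible_comul.
- exact: starhom_ext.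
- exact: starhom_ext.
- exact: nondeg_comp.
- exact: nondeg_comp.
- rewrite /f tens_id_comp // ext_comp // dp -ext_comp // -dp -ext_comp //.
  by congr ext; apply/funext => t; rewrite id_tens_swap.
- rewrite /g tens_id_comp // ext_comp // dp -!ext_comp //.
  by congr ext; apply/funext => t; rewrite id_tens_coassoc.
Qed.

Lemma delta_counital eps : counit Delta eps -> forall b, ext (id_eps eps) (delta b) = incl b.
Proof.
move=> [ce c1 c2] b; pose f b := ext (@id_eps R mt B A eps) (delta b).
suff : f = incl by move=> /(congr1 (fun f => f b)).
have he := id_eps_hom mt ce B; have ne := id_eps_nondeg mt ce B.
have hTe := @tens_id_hom R mt _ _ A _ he; have nTe := @tens_id_nondeg R mt _ _ A _ he ne.
apply: (@universal_eq _ f incl p ap).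
- exact: starhom_ext.
- exact: starhom_incl.
- exact: nondeg_comp.
- exact: nondeg_incl.
- rewrite /f tens_id_comp // ext_comp // dp -ext_comp //.
  rewrite -[RHS]ext_id; congr ext; apply/funext => t.
  by rewrite (eps_id_tens bA ce t c1).
- by rewrite tens_id_incl ext_id.
Qed.

Lemma delta_inj : injective delta.
Proof.
move=> b b' h; have [a0 [i0 [eps [ce _ _ _]]]] := counit_ex G.
by apply: incl_inj; rewrite -!(delta_counital ce) h.
Qed.

(** The unit of B makes delta b (1 ⊗ a) an element of B ⊗ A rather than a mere multiplier; this is
    how that condition on coactions is met. *)
Definition act1 b a : B ⊗ A := mL (delta b) (tens oneB a).

Lemma act1E b a : delta b * leg2 (incl a) = incl (act1 b a).
Proof. by rewrite /act1 -mul_incl -leg_tens io leg1_1 mul1r. Qed.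

Lemma delta_coaction : coaction Delta delta.
Proof.
split=> //; first exact: delta_inj.
  by move=> b a; exists (act1 b a); exact: act1E.
exact: delta_coassoc.
Qed.

End Coaction.
End Main.

Lemma linB (R : realType) (V W : lmodType R[i]) (f : V -> W) x y : linear f -> f (x - y) = f x - f y.
Proof. by move=> l; rewrite addrC -scaleN1r l scaleN1r addrC. Qed.

(** * Inclusions tensored with the identity *)

Section TensIncl.
Variables (R : realType) (mt : tensor_choice R) (X Y C : cstar R) (g : X -> Y).
Local Notation "X ⊗ Y" := (tensor_alg (mt X Y)) (at level 40, left associativity).
Hypotheses (hg : starhom (fun x => incl (g x))) (gi : injective g).

Lemma incl_hom : [/\ linear g, (forall a b, g (a ** b) = g a ** g b) & (forall a, g (cadj a) = cadj (g a))].
Proof.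
case: hg => l M a; split=> [k u v|u v|u]; apply: incl_inj.
- by rewrite l inclD inclZ.
- by rewrite M inclM.
- by rewrite a incl_adj.
Qed.

Lemma incl_blin : blin g.
Proof.
apply: blinI; first by case: incl_hom.
by exists 1 => v; rewrite mul1r; apply: bnd_incl_le; exact: (starhom_bnd v hg).
Qed.

(** g is isometric by [hom_isometric] and contractivity, so preimages of a convergent sequence form
    a Cauchy sequence. *)
Lemma incl_range_closed v : (forall e : R, 0 < e -> exists w, (exists x, g x = w) /\ nr (v - w) < e) ->
  exists x, g x = v.
Proof.
have iso := hom_isometric hg gi; have [gl _ _] := incl_hom.
have gB x y : g (x - y) = g x - g y by exact: linB.
move=> h; have /choice[u hu] : forall n : nat, exists x, nr (v - g x) < n.+1%:R^-1.
  move=> n; have [|w [[x <-] hx]] := h (n.+1%:R^-1); first by rewrite invr_gt0 ltr0Sn.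
  by exists x.
have gv : clim (fun n => g (u n)) v.
  move=> e e0; have [N hN] := @inv_small _ _ e0; exists N => n Nn.
  by rewrite nrC; apply: lt_trans (hu n) (hN _ Nn).
have [x hx] : exists x, clim u x.
  apply: cau_lim => e e0; have [N hN] := clim_cau gv e0; exists N => m n Nm Nn.
  by apply: le_lt_trans (iso _) _; rewrite gB; exact: hN.
exists x; apply: (clim_uniq _ gv).
apply: (@clim_lip _ _ _ g 1) hx => a b.
by rewrite mul1r -gB; apply: bnd_incl_le; exact: (starhom_bnd (a - b) hg).
Qed.

(** Slices commute with the inclusions and separate points, so injectivity passes from g to f. *)
Lemma tens_incl : exists f : X ⊗ C -> Y ⊗ C,
  [/\ forall s, tens_id (fun x => incl (g x)) s = incl (f s),
      forall x c, f (tens x c) = tens (g x) c,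
      starhom (fun s => incl (f s)),
      injective f &
      forall chi s, vecf chi -> slice chi (f s) = g (slice chi s)].
Proof.
have hT := @tens_id_hom R mt _ _ C _ hg.
have [|f [fE bf]] := hom_incl hT (@tens_dense_by _ _ _ (mt X C)).
  by move=> [x c]; exists (tens (g x) c); rewrite tens_idE // leg_tens.
have fT x c : f (tens x c) = tens (g x) c by apply: incl_inj; rewrite -fE tens_idE // leg_tens.
have hf : starhom (fun s => incl (f s)) by rewrite (_ : (fun _ => _) = @tens_id R mt X Y C (fun x => incl (g x))) //; apply/funext.
have fS chi s : vecf chi -> slice chi (f s) = g (slice chi s).
  move=> vc; apply: (blin_eq_tens (f := fun s => slice chi (f s)) (g := fun s => g (slice chi s))) => [||x c].
  - exact: (blin_comp bf (blin_slice _ vc)).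
  - exact: (blin_comp (blin_slice _ vc) incl_blin).
  by rewrite fT !slice_tens //; case: incl_hom => gl _ _; rewrite (linZ _ _ gl).
exists f; split=> // s s' h; apply/eqP; rewrite -subr_eq0; apply/eqP.
apply: slice_sep => chi /pvec_vecf vc; apply: gi.
have [gl _ _] := incl_hom; rewrite (lin0 gl).
by rewrite (linB _ _ (slice_lin vc)) (linB _ _ gl) -!fS // h subrr.
Qed.
End TensIncl.

(** * Matrix coefficients of the universal projection *)

Section Coefs.
Variables (R : realType) (mt : tensor_choice R) (G : discrete_qg mt).
Local Notation "X ⊗ Y" := (tensor_alg (mt X Y)) (at level 40, left associativity).
Local Notation A := (C0 G).

Lemma vecf_scale (X : cstar R) (chi : X -> R[i]) k : vecf chi -> vecf (fun x => k * chi x).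
Proof.
move=> [H [rho [xi [eta [r ->]]]]]; exists H, rho, (k *: xi), eta; split=> //.
by apply/funext => x; rewrite (repZ r) ipZ.
Qed.

Lemma coef_ex (a : irr G) (i l : 'I_(dimi a)) : exists chi : A -> R[i],
  vecf chi /\ forall z r y, mu r i ** z ** mu l y = chi z *: mu r y.
Proof.
have [tau _ h] := mu_block i l; have [chi vc c0] := vecf_neq0 (mu_neq0 i l).
exists tau; split=> //.
rewrite (_ : tau = fun z => (chi (mu i l))^-1 * chi (mu i i ** (z ** mu l l))).
  exact: (vecf_scale _ (vecf_mulr (mu l l) (vecf_mull (mu i i) vc))).
apply/funext => z; rewrite cmulA h vecfZ // mulrCA mulVf // mulr1 //.
Qed.

(** The (i, l) coefficient of the block of a, realized as a vector functional so that it can be used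
    in slices. *)
Definition coef a i l := projT1 (cid (@coef_ex a i l)).
Lemma coef_vecf (a : irr G) (i l : 'I_(dimi a)) : vecf (coef i l).
Proof. by rewrite /coef; case: cid => chi []. Qed.
Lemma coefP (a : irr G) (i l : 'I_(dimi a)) z r y : mu r i ** z ** mu l y = coef i l z *: mu r y.
Proof. by rewrite /coef; case: cid => chi []. Qed.

Lemma coef_mu (a : irr G) (i l k m : 'I_(dimi a)) : coef i l (mu k m) = ((i == k) && (m == l))%:R.
Proof.
have := coefP i l (mu k m) i l; rewrite mu_mul.
case: eqP => _; rewrite ?cmul0l; last first.
  by move=> /esym/eqP; rewrite scaler_eq0 (negbTE (mu_neq0 i l)) orbF => /eqP.
rewrite mu_mul; case: eqP => _ /=.
  by rewrite -[LHS]scale1r => /eqP; rewrite -subr_eq0 -scalerBl scaler_eq0 (negbTE (mu_neq0 i l)) orbF subr_eq0 => /eqP.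
by move=> /esym/eqP; rewrite scaler_eq0 (negbTE (mu_neq0 i l)) orbF => /eqP.
Qed.

Lemma mul_mu_expand (a : irr G) (l m : 'I_(dimi a)) z : z ** mu l m = \sum_i coef i l z *: mu i m.
Proof.
under eq_bigr => i _ do rewrite -coefP.
apply: (blin_mu (f := fun z => z ** mu l m) (g := fun z => \sum_i mu i i ** z ** mu l m)) => [||c r s].
- exact: blin_mulr.
- by apply: blin_sum => i; exact: (blin_comp (blin_mull _) (blin_mulr _)).
have [ca|ca] := pselect (c = a); last first.
  by rewrite mu_orth // big1 // => i _; rewrite -cmulA mu_orth // cmul0r.
subst c; rewrite [RHS](bigD1 r) //= [in RHS]mu_mul eqxx [X in _ + X]big1 ?addr0 // => i ir.
by rewrite mu_mul (negbTE ir) cmul0l.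
Qed.

Variables (B : cstar R) (oneB : B) (p : multiplier (B ⊗ A)).
Hypotheses (oU : is_unit oneB) (pp : projection p).
Let io : incl oneB = 1. Proof. exact: unit_incl. Qed.

(** The p^a_ik of the universal projection. Multiplying by 1 ⊗ e_kk first brings p from multipliers
    into B ⊗ A, where slices are defined. *)
Definition pcoef a : 'M[B]_(dimi a) :=
  \matrix_(i, k) slice (coef i k) (mL p (tens oneB (mu (a := a) k k))).

Lemma pcoefP a k l : p * leg2 (incl (mu (a := a) k l)) = incl (\sum_i tens (pcoef a i k) (mu i l)).
Proof.
have tE (t : B ⊗ A) : t ** tens oneB (mu k l) = \sum_i tens (slice (coef i k) t) (mu i l).
  apply: (blin_eq_tens (f := fun t => t ** tens oneB (mu k l)) (g := fun t => \sum_i tens (slice (coef i k) t) (mu i l))) => [||b z].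
  - exact: blin_mulr.
  - by apply: blin_sum => i; exact: (blin_comp (blin_slice _ (coef_vecf _ _)) (blin_tensl _ _)).
  rewrite -tensM mul_mu_expand tens_sumr; case: (oU b) => _ ->; apply: eq_bigr => i _.
  by rewrite slice_tens ?tensZl ?tensZr //; exact: coef_vecf.
have -> : leg2 (incl (mu k l)) = incl (tens oneB (mu k k)) * incl (tens oneB (mu k l)) :> multiplier (B ⊗ A).
  by rewrite -!leg_tens io leg1_1 !mul1r -leg2M -inclM mu_mul eqxx.
by rewrite mulrA (mul_incl p) -inclM tE; congr incl; apply: eq_bigr => i _; rewrite mxE.
Qed.

(** The relation in [matrix_coefs] determines its family, as slicing by [coef] shows. *)
Lemma pcoef_uniq b : matrix_coefs p b -> exists a i k, b = pcoef a i k.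
Proof.
move=> [pc [h [a [i [k ->]]]]]; exists a, i, k.
have := pcoefP k k; rewrite h => /incl_inj/(congr1 (slice (coef i k))).
have vc := coef_vecf i k.
have E (x : 'I_(dimi a) -> B) : slice (coef i k) (\sum_i tens (x i) (mu i k) : B ⊗ A) = x i.
  rewrite slice_sum // (bigD1 i) //= big1 ?addr0 => [|m mi]; rewrite slice_tens // coef_mu.
    by rewrite !eqxx scale1r.
  by rewrite eq_sym (negbTE mi) scale0r.
by rewrite !E.
Qed.

Lemma pcoef_coefs a i k : matrix_coefs p (pcoef a i k).
Proof. by exists pcoef; split; [exact: pcoefP|exists a, i, k]. Qed.

(** Follows from p^* = p after compressing with matrix units on both sides. *)
Lemma pcoef_adj a i k : cadj (pcoef a i k) = pcoef a k i.
Proof.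
have E r s (k' l : 'I_(dimi a)) : leg2 (incl (mu r s)) * p * leg2 (incl (mu k' l)) =
    incl (tens (pcoef a s k') (mu r l)).
  rewrite -mulrA pcoefP incl_sum mulr_sumr (bigD1 s) //= big1 ?addr0 => [|m ms].
    by rewrite -leg_tens mulrA -legC -mulrA -leg2M -inclM mu_mul eqxx leg_tens.
  by rewrite -leg_tens mulrA -legC -mulrA -leg2M -inclM mu_mul eq_sym (negbTE ms) incl0 leg2_0 mulr0.
have := congr1 (@madj _ _) (E i i k k); rewrite !madjM -!leg2_adj -!incl_adj !mu_adj (proj2 pp) mulrA E.
move=> /incl_inj; rewrite -tens_adj mu_adj => /(congr1 (slice (coef k i))).
by rewrite !slice_tens ?coef_mu ?eqxx ?scale1r //; exact: coef_vecf.
Qed.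

End Coefs.

Lemma lin_sum (R : realType) (V W : lmodType R[i]) (f : V -> W) (I : Type) (r : seq I) (P : pred I)
  (F : I -> V) : linear f -> f (\sum_(i <- r | P i) F i) = \sum_(i <- r | P i) f (F i).
Proof.
by move=> l; apply: (big_morph f) => [x y|]; [have := l 1 x y; rewrite !scale1r|exact: lin0].
Qed.

(** * The coaction on the pointed part *)

Section Pointed.
Variables (R : realType) (mt : tensor_choice R) (G : discrete_qg mt).
Local Notation "X ⊗ Y" := (tensor_alg (mt X Y)) (at level 40, left associativity).
Local Notation A := (C0 G).
Local Notation Delta := (@comul R mt G).
Let bA : cstar_bialgebra Delta. Proof. exact: comul_bialg. Qed.
Let hD : starhom Delta. Proof. by case: bA. Qed.
Let nD : nondegenerate Delta. Proof. by case: bA. Qed.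

Variables (B : cstar R) (oneB : B) (p : multiplier (B ⊗ A)).
Hypothesis hp : universal_admissible oneB p.
Let oU : is_unit oneB. Proof. by case: hp. Qed.
Let io : incl oneB = 1. Proof. exact: unit_incl. Qed.
Let pp : projection p. Proof. by case: hp => _ [h _] _. Qed.
Let ob b : oneB ** b = b. Proof. by case: (oU b). Qed.
Let bo b : b ** oneB = b. Proof. by case: (oU b). Qed.

Variable delta : B -> multiplier (B ⊗ A).
Hypotheses (hd : starhom delta) (d1 : delta oneB = 1)
  (dp : ext (tens_id delta) p = ext (id_tens Delta) p).
Local Notation q := (ext (@id_tens R mt B A Delta) p).
Let nd : nondegenerate delta. Proof. exact: (unital_nondeg d1). Qed.
Let dl : linear delta. Proof. by case: hd. Qed.
Let dM a b : delta (a ** b) = delta a * delta b. Proof. by case: hd. Qed.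
Let da a : delta (cadj a) = madj (delta a). Proof. by case: hd. Qed.
Let hI := @id_tens_hom R mt A B Delta hD. Let nI := @id_tens_nondeg R mt A B Delta hD nD.
Let hT := @tens_id_hom R mt _ _ A _ hd. Let nT := @tens_id_nondeg R mt _ _ A _ hd nd.
Local Notation d1a := (act1 oneB delta).

Let emb23_ex : exists g : A ⊗ A -> B ⊗ A ⊗ A, (forall z, emb23 B z = incl (g z)) /\ blin g.
Proof.
apply: (hom_incl (emb23_hom mt B A A) (@tens_dense_by _ _ _ (mt A A))) => -[a b].
by exists (tens (tens oneB a) b); rewrite emb23E -!leg_tens io leg1_1 mul1r.
Qed.
(* z |-> 1 (x) z *)
Let f23 : A ⊗ A -> B ⊗ A ⊗ A := projT1 (cid emb23_ex).
Let f23E z : emb23 B z = incl (f23 z).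
Proof. by rewrite /f23; case: cid => g []. Qed.
Let f23_blin : blin f23.
Proof. by rewrite /f23; case: cid => g []. Qed.
Let f23_tens a b : f23 (tens a b) = tens (tens oneB a) b.
Proof. by apply: incl_inj; rewrite -f23E emb23E -!leg_tens io leg1_1 mul1r. Qed.
Let f23_mul m z : mL (ext (@emb23 R mt B A A) m) (f23 z) = f23 (mL m z).
Proof.
apply: incl_inj; rewrite -mul_incl -!f23E extP //; [exact: emb23_hom|exact: emb23_nondeg].
Qed.
Let f23_slice chi (m : multiplier B) z : vecf chi ->
  slice chi (mL (leg1 (leg1 m)) (f23 z)) = tens (mL m oneB) (slice chi z) :> B ⊗ A.
Proof.
move=> vc; rewrite slice_leg1 //.
apply: (blin_eq_tens (f := fun z => mL (leg1 m) (slice chi (f23 z))) (g := fun z => tens (mL m oneB) (slice chi z))) => [||a b].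
- exact: (blin_comp (blin_comp f23_blin (blin_slice _ vc)) (blin_mL _)).
- exact: (blin_comp (blin_slice _ vc) (blin_tensr _ _)).
by rewrite f23_tens !slice_tens // mLZ leg1P tensZr.
Qed.

(** q is read as (delta ⊗ id)(p) here; [ran_gen] plays this against its reading as (id ⊗
    Delta)(p). *)
Lemma q_mul (a : irr G) (k l : 'I_(dimi a)) :
  q * leg2 (incl (mu k l)) = \sum_i leg1 (delta (pcoef oneB p a i k)) * leg2 (incl (mu i l)).
Proof.
rewrite -dp -(ext_tens_id_leg2 mt hd nd) -(extM hT nT) (pcoefP p oU) ext_incl //.
by rewrite (starhom_sum _ _ _ hT); apply: eq_bigr => i _; rewrite tens_idE.
Qed.

Variables (J : cstar R) (j : J -> B).
Hypotheses (hj : starhom (fun x => incl (j x))) (ji : injective j)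
  (jr : range j = cstar_generated (matrix_coefs p)).
Variable f : J ⊗ A -> B ⊗ A.
Hypotheses (fE : forall s, tens_id (fun x => incl (j x)) s = incl (f s))
  (fT : forall x a, f (tens x a) = tens (j x) a)
  (hf : starhom (fun s => incl (f s))) (fi : injective f)
  (fS : forall chi s, vecf chi -> slice chi (f s) = j (slice chi s)).
Let jl : linear j. Proof. by case: (incl_hom hj). Qed.
Let jM x y : j (x ** y) = j x ** j y. Proof. by case: (incl_hom hj). Qed.
Let ja x : j (cadj x) = cadj (j x). Proof. by case: (incl_hom hj). Qed.
Let fl : linear f. Proof. by case: (incl_hom hf). Qed.
Let fM x y : f (x ** y) = f x ** f y. Proof. by case: (incl_hom hf). Qed.
Let fa x : f (cadj x) = cadj (f x). Proof. by case: (incl_hom hf). Qed.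
Let f_blin : blin f. Proof. exact: incl_blin. Qed.

(** J ⊗ A as a subspace of B ⊗ A; the next three facts are what [blin_closed] asks for. *)
Let ran (v : B ⊗ A) := exists s, f s = v.
Let ran0 : ran 0. Proof. by exists 0; rewrite (lin0 fl). Qed.
Let ranD k v w : ran v -> ran w -> ran (k *: v + w).
Proof. by move=> [s <-] [t <-]; exists (k *: s + t); rewrite fl. Qed.
Let ran_closed v : (forall e : R, 0 < e -> exists w, ran w /\ nr (v - w) < e) -> ran v.
Proof. exact: (incl_range_closed hf fi). Qed.

Lemma pcoef_range a i k : exists y, j y = pcoef oneB p a i k.
Proof.
have : range j (pcoef oneB p a i k) by rewrite jr => S' _; apply; exact: (pcoef_coefs p oU).
by case=> y _ <-; exists y.
Qed.

(** The slice of q (1 ⊗ z) is computed twice. As (id ⊗ Delta)(p), on the vectors z = Delta(c') w,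
    dense by nondegeneracy, it gives tensors whose first factors are coefficients of p, hence
    elements of J ⊗ A. As (delta ⊗ id)(p), at z = c ⊗ e_kk, it gives delta(p_ik)(1 ⊗ c). *)
Lemma ran_gen a i k c : ran (d1a (pcoef oneB p a i k) c).
Proof.
have vc := coef_vecf i k; set chi := coef i k in vc.
pose F z := slice chi (mL q (f23 z)).
have bF : blin F by exact: (blin_comp (blin_comp f23_blin (blin_mL _)) (blin_slice _ vc)).
have RF z : ran (F z).
  apply: (blin_closed bF (nondeg_dense nD)) => // -[c' w] /=.
  apply: (blin_closed (f := fun c' => F (mL (Delta c') w)) (t := @mus R mt G)) => //.
  - by apply: (blin_comp _ bF); exact: blin_hom.
  - exact: mus_dense.
  move=> [b [r s]]; rewrite /mus /= /F -f23_mul -mL_mul.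
  have -> : q * ext (@emb23 R mt B A A) (Delta (mu r s)) =
      \sum_i' leg1 (leg1 (incl (pcoef oneB p b i' r))) * ext (@emb23 R mt B A A) (Delta (mu i' s)).
    rewrite -(ext_incl hD nD) -(ext_id_tens_leg2 B hD nD) -(extM hI nI) (pcoefP p oU) ext_incl //.
    by rewrite (starhom_sum _ _ _ hI); apply: eq_bigr => i' _; rewrite id_tensE.
  have [y hy] := choice (fun i' => pcoef_range i' r).
  exists (\sum_i' tens (y i') (slice chi (mL (Delta (mu i' s)) w))).
  rewrite mL_suml slice_sum // (lin_sum _ _ _ fl); apply: eq_bigr => i' _.
  by rewrite fT hy mL_mul f23_mul f23_slice // mL_incl bo.
have [s hs] := RF (tens c (mu k k)); exists s; rewrite hs /F f23_tens.
have -> : mL q (tens (tens oneB c) (mu k k)) = \sum_i' tens (d1a (pcoef oneB p a i' k) c) (mu i' k).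
  have e1 : tens (tens oneB c) (mu k k) = mL (leg2 (incl (mu k k))) (tens (tens oneB c) (mu k k)) :> B ⊗ A ⊗ A.
    by rewrite leg2P mL_incl mu_mul eqxx.
  rewrite e1 -mL_mul q_mul mL_suml; apply: eq_bigr => i' _.
  by rewrite mL_mul leg2P leg1P mL_incl mu_mul eqxx.
rewrite slice_sum // (bigD1 i) //= big1 ?addr0 => [|m mi]; rewrite slice_tens // /chi coef_mu.
  by rewrite !eqxx scale1r.
by rewrite eq_sym (negbTE mi) scale0r.
Qed.

Let T2 b := forall a, ran (d1a b a).

(** y ⊗ a a' is the product of 1 ⊗ a with y ⊗ a', and such elements span a dense subspace. *)
Lemma T2_ran b s : T2 b -> ran (mL (delta b) (f s)).
Proof.
move=> h; move: s.
apply: (blin_closed (t := fun p : J * (A * A) => tens p.1 (p.2.1 ** p.2.2) : J ⊗ A) (f := fun s => mL (delta b) (f s))) => //.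
- exact: (blin_comp f_blin (blin_mL _)).
- exact: (tens_dense2 _ (@id_dense _ J) (@prod_dense _ A)).
move=> [y [a a']]; have [s hs] := h a; exists (s ** tens y a').
rewrite fM hs !fT /= /act1 -mLM -tensM ob //.
Qed.

(** The b for which b and b^* both satisfy [T2] form a C*-subalgebra, and it contains the p_ik,
    whose adjoints are the p_ki. [T2] alone is stable under products and limits but not visibly
    under adjoints. *)
Lemma range_T2 x : T2 (j x) /\ T2 (cadj (j x)).
Proof.
pose S' : set B := [set b | T2 b /\ T2 (cadj b)].

have Tlin k b b' : T2 b -> T2 b' -> T2 (k *: b + b').
  move=> h h' a; rewrite /act1 dl; exact: (ranD k (h a) (h' a)).
have TM b b' : T2 b -> T2 b' -> T2 (b ** b').
  move=> h h' a; have [s hs] := h' a; rewrite /act1 dM mL_mul -/(d1a b' a) -hs.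
  exact: T2_ran.
have Tlim b : (forall e : R, 0 < e -> exists b', T2 b' /\ nr (b - b') < e) -> T2 b.
  move=> h a; apply: ran_closed => e e0.
  have n0 : 0 < nr (tens oneB a : B ⊗ A) + 1 by rewrite ltr_wpDl ?nr_ge0.
  have [b' [Tb' hb]] := h _ (divr_gt0 e0 n0); exists (d1a b' a); split=> //.
  have /= := linB b b' (proj1 (blin_hom (tens oneB a) hd)); rewrite /act1 => <-.
  apply: le_lt_trans (proj2 (starhom_bnd (b - b') hd) _) _.
  apply: (@le_lt_trans _ _ (nr (b - b') * (nr (tens oneB a : B ⊗ A) + 1))).
    by rewrite ler_wpM2l ?nr_ge0 // lerDl.
  by rewrite -ltr_pdivlMr.
suff : S' (j x) by [].
have : range j (j x) by exists x.
rewrite jr; apply.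
  split.
  - apply/closure_id/seteqP; split; first exact: subset_closure.
    move=> b /closure_nrP h; split; apply: Tlim => e /h[b' [[t t'] hb]].
      by exists b'.
    by exists (cadj b'); rewrite -cadjB nr_adj.
  - split=> a; [rewrite /act1 (lin0 dl)|rewrite /act1 cadj0 (lin0 dl)]; exact: ran0.
  - move=> k a b [a1 a2] [b1 b2]; split; first exact: Tlin.
    by rewrite cadjD cadjZ; exact: Tlin.
  - move=> a b [a1 a2] [b1 b2]; split; first exact: TM.
    by rewrite cadjM; exact: TM.
  - by move=> a [a1 a2]; split; rewrite ?cadjK.
move=> b /(pcoef_uniq oU)[a [i [k ->]]]; split=> c; first exact: ran_gen.
by rewrite (pcoef_adj oU pp); exact: ran_gen.
Qed.

(** delta (j x) maps f(J ⊗ A) into itself from the left by [T2] for j x, and from the right by [T2]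
    for its adjoint; injectivity of f pulls both actions back to a double centralizer of J ⊗ A. *)
Lemma deltaJ_ex : exists dJ : J -> multiplier (J ⊗ A), forall x,
  (forall s, f (mL (dJ x) s) = mL (delta (j x)) (f s)) /\
  (forall s, f (mR (dJ x) s) = mR (delta (j x)) (f s)).
Proof.
suff /choice[dJ h] : forall x, exists m : multiplier (J ⊗ A),
  (forall s, f (mL m s) = mL (delta (j x)) (f s)) /\
  (forall s, f (mR m s) = mR (delta (j x)) (f s)) by exists dJ.
move=> x; have [t1 t2] := range_T2 x.
have [L hL] := choice (fun s => T2_ran s t1).
have hR' s : ran (mR (delta (j x)) (f s)).
  have [s' hs] := T2_ran (cadj s) t2; exists (cadj s').
  by rewrite fa hs da fa /= !cadjK.
have [Rm hRm] := choice hR'.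
have LR s s' : s ** L s' = Rm s ** s' by apply: fi; rewrite !fM hL hRm mLR.
by exists (Multiplier LR).
Qed.

Variable dJ : J -> multiplier (J ⊗ A).
Hypotheses (dJL : forall x s, f (mL (dJ x) s) = mL (delta (j x)) (f s))
  (dJR : forall x s, f (mR (dJ x) s) = mR (delta (j x)) (f s)).

Lemma dJ_hom : starhom dJ.
Proof.
split=> [k x y|x y|x]; apply: mult_eqL => s; apply: fi; rewrite dJL.
- by rewrite jl dl /= fl !dJL.
- by rewrite jM dM mL_mul /= !dJL.
- by rewrite ja da /= fa dJR fa.
Qed.

Lemma dJ_leg2 x a : exists2 s, f s = d1a (j x) a & dJ x * leg2 (incl a) = incl s.
Proof.
have [t1 _] := range_T2 x; have [s hs] := t1 a; exists s => //.
apply: tens_eq => y a'; apply: fi; rewrite mL_mul leg2P dJL mL_incl fM hs !fT.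
by rewrite /act1 -mLM -tensM ob.
Qed.

Variable eps : A -> R[i].
Hypotheses (ce : counit Delta eps).
Let he : character eps. Proof. by case: ce. Qed.

(** Equality of dJ x and dJ x' is known only on J ⊗ A, so delta b with b = j (x - x') is tested on
    b^* ⊗ a, eps a = 1; id ⊗ eps turns delta(b)(b^* ⊗ a) = 0 into b b^* = 0. *)
Lemma dJ_inj : injective dJ.
Proof.
move=> x x' h; apply/eqP; rewrite -subr_eq0; apply/eqP.
apply: (can_inj (@cadjK _ J)); rewrite cadj0; apply: cs_eq0; rewrite cadjK; apply: ji; rewrite jM (lin0 jl).
pose b := j (x - x'); have [a a1] := char_norm1 he.
have z : delta b * incl (f (tens (cadj (x - x')) a)) = 0.
  rewrite mul_incl -dJL; have [l _ _] := dJ_hom.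
  by rewrite (linB _ _ l) h subrr /= (lin0 fl) incl0.
have hi := id_eps_hom mt he B; have ni := id_eps_nondeg mt he B.
have := congr1 (ext (@id_eps R mt B A eps)) z.
rewrite extM // (delta_counital hp hd d1 dp ce) ext_incl // fT id_epsE // a1 scale1r -inclM.
have -> : ext (@id_eps R mt B A eps) 0 = incl 0 by rewrite -incl0 ext_incl // (starhom0 hi) incl0.
exact: incl_inj.
Qed.

Variable f3 : J ⊗ A ⊗ A -> B ⊗ A ⊗ A.
Hypotheses (f3T : forall s a, f3 (tens s a) = tens (f s) a)
  (f3h : starhom (fun v => incl (f3 v))) (f3i : injective f3)
  (f3S : forall chi v, vecf chi -> slice chi (f3 v) = f (slice chi v)).
Let f3_blin : blin f3. Proof. exact: incl_blin. Qed.
Let f3l : linear f3. Proof. by case: (incl_hom f3h). Qed.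

(** Correspondence of multipliers through f. It replaces an extension of f to multiplier algebras,
    which a degenerate inclusion need not have; [rel3] is the threefold analogue. *)
Let rel (m : multiplier (J ⊗ A)) (n : multiplier (B ⊗ A)) := forall s, f (mL m s) = mL n (f s).
Let rel3 (m : multiplier (J ⊗ A ⊗ A)) (n : multiplier (B ⊗ A ⊗ A)) := forall v, f3 (mL m v) = mL n (f3 v).

Let rel3_leg1 m n : rel m n -> rel3 (leg1 m) (leg1 n).
Proof.
move=> h v; apply: (blin_eq_tens (f := fun v => f3 (mL (leg1 m) v)) (g := fun v => mL (leg1 n) (f3 v))) => [||s a].
- exact: (blin_comp (blin_mL _) f3_blin).
- exact: (blin_comp f3_blin (blin_mL _)).
by rewrite leg1P !f3T leg1P h.
Qed.
Let rel3_leg2 m : rel3 (leg2 m) (leg2 m).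
Proof.
move=> v; apply: (blin_eq_tens (f := fun v => f3 (mL (leg2 m) v)) (g := fun v => mL (leg2 m) (f3 v))) => [||s a].
- exact: (blin_comp (blin_mL _) f3_blin).
- exact: (blin_comp f3_blin (blin_mL _)).
by rewrite leg2P !f3T leg2P.
Qed.
Let rel_leg1 y : rel (leg1 (incl y)) (leg1 (incl (j y))).
Proof.
move=> v; apply: (blin_eq_tens (f := fun v => f (mL (leg1 (incl y)) v)) (g := fun v => mL (leg1 (incl (j y))) (f v))) => [||s a].
- exact: (blin_comp (blin_mL _) f_blin).
- exact: (blin_comp f_blin (blin_mL _)).
by rewrite leg1P !fT leg1P !mL_incl jM.
Qed.
Let rel_leg2 m : rel (leg2 m) (leg2 m).
Proof.
move=> v; apply: (blin_eq_tens (f := fun v => f (mL (leg2 m) v)) (g := fun v => mL (leg2 m) (f v))) => [||s a].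
- exact: (blin_comp (blin_mL _) f_blin).
- exact: (blin_comp f_blin (blin_mL _)).
by rewrite leg2P !fT leg2P.
Qed.
Let rel3M m n m' n' : rel3 m n -> rel3 m' n' -> rel3 (m * m') (n * n').
Proof. by move=> h h' v; rewrite !mL_mul h h'. Qed.

Let rel3_emb m : rel3 (ext (@emb23 R mt J A A) m) (ext (@emb23 R mt B A A) m).
Proof.
have hJ := emb23_hom mt J A A; have nJ := emb23_nondeg mt J A A.
have hB := emb23_hom mt B A A; have nB := emb23_nondeg mt B A A.
have E z : rel3 (emb23 J z) (emb23 B z).
  move=> v; apply: (blin_eq_tens (f := fun z => f3 (mL (emb23 J z) v)) (g := fun z => mL (emb23 B z) (f3 v))) => [||a b].
  - exact: (blin_comp (blin_hom _ hJ) f3_blin).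
  - exact: blin_hom.
  by rewrite !emb23E; apply: rel3M; [exact/rel3_leg1/rel_leg2|exact: rel3_leg2].
move=> v; apply: (blin_eq (f := fun v => f3 (mL (ext (@emb23 R mt J A A) m) v)) (g := fun v => mL (ext (@emb23 R mt B A A) m) (f3 v)) (nondeg_dense nJ)) => [||[z w]] /=.
- exact: (blin_comp (blin_mL _) f3_blin).
- exact: (blin_comp f3_blin (blin_mL _)).
by rewrite -mL_mul extP // !E -mL_mul extP.
Qed.

Let rel3_dJ t : rel3 (tens_id dJ t) (tens_id delta (f t)).
Proof.
move=> v; apply: (blin_eq_tens (f := fun t => f3 (mL (tens_id dJ t) v)) (g := fun t => mL (tens_id delta (f t)) (f3 v))) => [||y a].
- apply: (blin_comp _ f3_blin); apply: blin_hom; exact/tens_id_hom/dJ_hom.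
- exact: (blin_comp (g := fun t => mL (tens_id delta t) (f3 v)) f_blin (blin_hom _ hT)).
rewrite fT !tens_idE //; last exact: dJ_hom.
by apply: rel3M; [apply: rel3_leg1; exact: dJL|exact: rel3_leg2].
Qed.

Let hIJ := @id_tens_hom R mt A J Delta hD. Let nIJ := @id_tens_nondeg R mt A J Delta hD nD.

Let rel3_comul t : rel3 (id_tens Delta t) (id_tens Delta (f t)).
Proof.
move=> v; apply: (blin_eq_tens (f := fun t => f3 (mL (id_tens Delta t) v)) (g := fun t => mL (id_tens Delta (f t)) (f3 v))) => [||y a].
- by apply: (blin_comp _ f3_blin); apply: blin_hom.
- exact: (blin_comp (g := fun t => mL (id_tens Delta t) (f3 v)) f_blin (blin_hom _ hI)).
rewrite fT !id_tensE //.
by apply: rel3M; [exact/rel3_leg1/rel_leg1|exact: rel3_emb].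
Qed.

(** On 1 ⊗ s the multiplier (id ⊗ Delta)(t) acts as (id ⊗ eps)(t) ⊗ 1, because Delta acts on s
    through eps; for delta b, counitality leaves b. *)
Lemma slice_absorb b x s : (forall z, mL (Delta z) s = eps z *: s) ->
  mL (ext (id_tens Delta) (delta b)) (mL (leg1 (leg1 (incl x))) (f23 s)) =
  mL (leg1 (leg1 (incl (b ** x)))) (f23 s).
Proof.
move=> hs; have hi := id_eps_hom mt he B; have ni := id_eps_nondeg mt he B.
have f23l : linear f23 by case: f23_blin.
have E t : mL (id_tens Delta t) (f23 s) = mL (leg1 (leg1 (id_eps eps t))) (f23 s).
  apply: (blin_eq_tens (f := fun t => mL (id_tens Delta t) (f23 s)) (g := fun t => mL (leg1 (leg1 (id_eps eps t))) (f23 s))) => [||y a].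
  - exact: blin_hom.
  - by apply: blin_hom; exact/starhom_leg1/starhom_leg1.
  by rewrite id_tensE // id_epsE // mL_mul f23_mul hs (linZ _ _ f23l) mLZ !leg1Z.
have [c c1] := char_norm1 he.
have -> : mL (leg1 (leg1 (incl x))) (f23 s) = mL (id_tens Delta (tens x c)) (f23 s).
  by rewrite E id_epsE // c1 scale1r.
rewrite -mL_mul extP // E.
have -> : id_eps eps (mL (delta b) (tens x c)) = incl (b ** x); last by [].
by rewrite -extP // (delta_counital hp hd d1 dp ce) id_epsE // c1 scale1r inclM.
Qed.

Hypothesis cupP : forall (a b : irr G) (Q : 'M[R[i]]_(dimi b, dimi a)),
  intertwiner (map_mx cadj (irrep a)) (irrep b) Q -> forall x y z,
  mL (Delta z) (cup Q x y) = eps z *: cup Q x y.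

Let gen (pr : J * (J ⊗ A)) := mL (dJ pr.1) pr.2.

Section OneCup.
Variables (a b : irr G) (Q : 'M[R[i]]_(dimi b, dimi a)).
Hypothesis iQ : intertwiner (map_mx cadj (irrep a)) (irrep b) Q.

(** [Th t] is a slice of (dJ ⊗ id)(t) applied to v = x' ⊗ s. On elementary tensors t it is a value
    of [gen]; at t = dJ(y')(1 ⊗ u), coassociativity and [slice_absorb] give the tensor of the
    statement. *)
Lemma cup_clspan x y (x' y' : J) chi : vecf chi -> clspan gen (tens (y' ** x') (slice chi (cup Q x y))).
Proof.
move=> vc; set s := cup Q x y.
pose v : J ⊗ A ⊗ A := \sum_k \sum_l Q l k *: tens (tens x' (mu k x)) (mu l y).
have vE : f3 v = mL (leg1 (leg1 (incl (j x')))) (f23 s).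
  rewrite (lin_sum _ _ _ f3l) (lin_sum _ _ _ (proj1 f23_blin)) mL_sum; apply: eq_bigr => k _.
  rewrite (lin_sum _ _ _ f3l) (lin_sum _ _ _ (proj1 f23_blin)) mL_sum; apply: eq_bigr => l _.
  by rewrite (linZ _ _ f3l) (linZ _ _ (proj1 f23_blin)) mLZ f3T fT f23_tens !leg1P mL_incl bo.
(* The unit of the block of b: 1 ⊗ 1 ⊗ u fixes v, and multiplying dJ y' by 1 ⊗ u gives an element of
   J ⊗ A, to which dJ ⊗ id applies. *)
pose u : A := \sum_l mu (a := b) l l.
have uv : mL (leg2 (incl u)) v = v.
  rewrite mL_sum; apply: eq_bigr => k _; rewrite mL_sum; apply: eq_bigr => l _.
  rewrite mLZ leg2P mL_incl /u cmul_suml (bigD1 l) //= big1 ?addr0 => [|m ml].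
    by rewrite mu_mul eqxx.
  by rewrite mu_mul (negbTE ml).
pose Th t := slice chi (mL (tens_id dJ t) v).
have [t ht _] := dJ_leg2 y' u.
have <- : Th t = tens (y' ** x') (slice chi s).
  apply: fi; rewrite -f3S // rel3_dJ ht fT jM /act1 -(extP hT nT) mL_mul tens_idE // d1 leg1_1 mul1r.
  rewrite -rel3_leg2 uv vE (delta_coassoc hp hd d1 dp) slice_absorb; last exact: cupP.
  by rewrite f23_slice // mL_incl bo.
apply: (clspan_blin (f := Th) _ (@tens_dense_by _ _ _ (mt J A))).
- apply: (blin_comp _ (blin_slice _ vc)); apply: blin_hom; exact/tens_id_hom/dJ_hom.
move=> [y0 a0]; rewrite /Th tens_idE /=; last exact: dJ_hom.
by rewrite slice_leg1 //; exact: (clspan_gen gen (y0, slice chi (mL (leg2 (incl a0)) v))).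
Qed.
End OneCup.

Lemma dJ_nondeg : nondegenerate dJ.
Proof.
apply: (dense_by_span (s := gen)); last by move=> [x s]; exists x, s.
apply: dense_by_trans (tens_dense2 _ (@prod_dense _ J) (@mus_dense R mt G)) _.
move=> [[y' x'] [a [k x]]]; rewrite /mus /=.
have [b [Q [Q' [iQ QQ]]]] := cup_exists a.
have [b0 _] := @irrep_irr _ _ G b; pose y := Ordinal b0.
(* Slicing the second leg of the cup vector by [coef m y] leaves sum_i Q_mi mu i x, and the left
   inverse Q' isolates the term i = k. *)
have -> : mu k x = \sum_m Q' k m *: slice (coef m y) (cup Q x y) :> A.
  transitivity (\sum_m \sum_i (Q' k m * Q m i) *: mu i x : A).
    rewrite exchange_big (bigD1 k) //= [X in _ + X]big1 ?addr0 => [|i ik].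
      rewrite -scaler_suml; have /matrixP/(_ k k) := QQ; rewrite !mxE eqxx => ->.
      by rewrite scale1r.
    rewrite -scaler_suml; have /matrixP/(_ k i) := QQ; rewrite !mxE eq_sym (negbTE ik) => ->.
    by rewrite scale0r.
  apply: eq_bigr => m _; have vc := coef_vecf m y.
  rewrite /cup slice_sum // scaler_sumr; apply: eq_bigr => i _.
  rewrite slice_sum // (bigD1 m) //= big1 ?addr0 => [|l lm]; rewrite sliceZ // slice_tens // coef_mu.
    by rewrite !eqxx scale1r scalerA.
  by rewrite eq_sym (negbTE lm) scale0r scaler0.
rewrite tens_sumr; apply: (big_ind (clspan gen)).
- exact: clspan0.
- by move=> v w hv hw; rewrite -[v]scale1r; exact: clspanD.
move=> m _; rewrite tensZr -[_ *: _]addr0; apply: clspanD; last exact: clspan0.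
by apply: cup_clspan => //; exact: coef_vecf.
Qed.

(** Both sides correspond through f3 to the two sides for delta (j x), which agree; f3 is
    injective. *)
Lemma dJ_coassoc x : ext (tens_id dJ) (dJ x) = ext (id_tens Delta) (dJ x).
Proof.
have hTJ := @tens_id_hom R mt _ _ A _ dJ_hom; have nTJ := @tens_id_nondeg R mt _ _ A _ dJ_hom dJ_nondeg.
have E1 : rel3 (ext (tens_id dJ) (dJ x)) (ext (tens_id delta) (delta (j x))).
  move=> v; apply: (blin_eq (f := fun v => f3 (mL (ext (tens_id dJ) (dJ x)) v))
    (g := fun v => mL (ext (tens_id delta) (delta (j x))) (f3 v)) (nondeg_dense nTJ)) => [||[t w]] /=.
  - exact: (blin_comp (blin_mL _) f3_blin).
  - exact: (blin_comp f3_blin (blin_mL _)).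
  by rewrite -mL_mul extP // !rel3_dJ dJL -extP // mL_mul.
have E2 : rel3 (ext (id_tens Delta) (dJ x)) (ext (id_tens Delta) (delta (j x))).
  move=> v; apply: (blin_eq (f := fun v => f3 (mL (ext (id_tens Delta) (dJ x)) v))
    (g := fun v => mL (ext (id_tens Delta) (delta (j x))) (f3 v)) (nondeg_dense nIJ)) => [||[t w]] /=.
  - exact: (blin_comp (blin_mL _) f3_blin).
  - exact: (blin_comp f3_blin (blin_mL _)).
  by rewrite -mL_mul extP // !rel3_comul dJL -extP // mL_mul.
apply: mult_eqL => v; apply: f3i; rewrite E1 E2.
by rewrite (delta_coassoc hp hd d1 dp).
Qed.

Lemma dJ_restricts : restricts Delta delta j.
Proof.
exists dJ.
  split; [exact: dJ_hom|exact: dJ_inj|exact: dJ_nondeg| |exact: dJ_coassoc].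
  by move=> x a; have [s _ h] := dJ_leg2 x a; exists s.
move=> x a s h; have [s' hs' h'] := dJ_leg2 x a.
have -> : s = s' by apply: incl_inj; rewrite -h.
by rewrite fE hs' (act1E hp).
Qed.

End Pointed.

Theorem proposition7p5 (R : realType) (mt : tensor_choice R)
    (G : discrete_qg mt)
    (B : cstar R) (oneB : B) (p : multiplier (mt B (C0 G)))
    (hp : universal_admissible oneB p)
    (J : cstar R) (j : J -> B) (hj : is_pointed_part p j) :
  exists delta : B -> multiplier (mt B (C0 G)),
    [/\ unique (fun d : B -> multiplier (mt B (C0 G)) =>
          coaction (@comul R mt G) d /\
          ext (tens_id d) p = ext (id_tens (@comul R mt G)) p) delta,
        counital (@comul R mt G) delta &
        restricts (@comul R mt G) delta j].

Proof.
have [oU ap univ] := hp; have [hj1 ji jr] := hj.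
have hD : starhom (@comul R mt G) by case: (comul_bialg G).
have [d [[hd d1 dp] du]] := univ _ _ (admissible_comul ap).
have dp' := esym dp; have nd := unital_nondeg d1.
have [a0 [i0 [eps [ce ii u0 eP]]]] := counit_ex G.
exists d; split.
- split; first by split=> //; exact: (delta_coaction hp hd d1 dp').
  move=> d' [[hd' _ nd' _ _] dp2]; apply: du; split=> //.
  exact: (nondeg_unital hp hd' nd').
- by exists eps => //; exact: (delta_counital hp hd d1 dp').
have [f [fE fT hf fi fS]] := tens_incl mt (C0 G) hj1 ji.
(* The inclusion f is tensored with C_0(G) once more, since coassociativity takes place in threefold
   products. *)
have [f3 [f3E f3T hf3 f3i f3S]] := tens_incl mt (C0 G) hf fi.
have [dJ hdJ] := deltaJ_ex hp hd d1 dp' jr fT hf fi.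
have dJL x := proj1 (hdJ x); have dJR x := proj2 (hdJ x).
refine (dJ_restricts hp hd d1 dp' hj1 ji jr fE fT hf fi dJL dJR ce f3T hf3 f3i f3S _).
move=> a b Q iQ x y z; exact: (cup_counit iQ ii u0 eP).
Qed.
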